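(* Let $T>0$ and $q\in(1,p_-)$, assume that $A$ satisfies $(A_0)$, $(A_1)$, $(A_2)$ and that $f$ satisfies $(f_0)$, $(f_1)$ (conditions listed in the context). Let $v,w$ be two weak solutions (in the sense defined in the context) of $$\begin{cases} v^{q-1}\partial_t(v^q)-\nabla\cdot a(x,\nabla v)=h(t,x)v^{q-1}+f(x,v) & \text{in } Q_T,\\ v\ge 0 & \text{in } Q_T,\\ v=0 & \text{on } (0,T)\times\partial\Omega,\\ v(0,\cdot)=v_0 & \text{in }\Omega,\end{cases}\qquad (E)$$ with respect to the initial data $v_0,w_0\in L^{2q}(\Omega)$, $v_0,w_0\ge0$, and the potentials $h,\tilde h\in L^2(Q_T)$, respectively. Then, for any $t\in[0,T]$, $$\|v^q(t)-w^q(t)\|_{L^2(\Omega)}\le\|v_0^q-w_0^q\|_{L^2(\Omega)}+\int_0^t\|h(s)-\tilde h(s)\|_{L^2(\Omega)}\,ds.$$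
   Context: Setting. $N\ge1$, $\Omega\subset\mathbb R^N$ is a smooth bounded domain, $Q_T=(0,T)\times\Omega$, $\mathbb R^+=[0,\infty)$. The exponent $p\in C^1(\overline\Omega)$ satisfies $1<p_-:=\min_{\overline\Omega}p\le p_+:=\max_{\overline\Omega}p<\infty$. $\mathcal W=W^{1,p(x)}_0(\Omega)$ is the variable exponent Sobolev space. Operator. $A:\Omega\times\mathbb R^N\to\mathbb R^+$ is continuous and differentiable with respect to $\xi$, and $a(x,\xi)=(a_j(x,\xi))_{j}=\frac1{p(x)}\nabla_\xi A(x,\xi)$. Conditions: $(A_0)$ $A(x,t\xi)=t^{p(x)}A(x,\xi)$ for all $t\in\mathbb R^+$, $\xi\in\mathbb R^N$ and a.e. $x\in\Omega$. $(A_1)$ For $j=1,\dots,N$: $a_j(x,0)=0$, $a_j\in C^1(\Omega\times\mathbb R^N\setminus\{0\})\cap C(\Omega\times\mathbb R^N)$, and there are constants $\gamma,\Gamma>0$ such that for all $x\in\Omega$, $\xi\in\mathbb R^N\setminus\{0\}$, $\eta\in\mathbb R^N$: $\sum_{i,j}\frac{\partial a_j}{\partial\xi_i}(x,\xi)\eta_i\eta_j\ge\gamma|\xi|^{p(x)-2}|\eta|^2$ and $\sum_{i,j}\big|\frac{\partial a_j}{\partial\xi_i}(x,\xi)\big|\le\Gamma|\xi|^{p(x)-2}$. $(A_2)$ There is $C>0$ such that for all $(x,\xi)\in\Omega\times\mathbb R^N\setminus\{0\}$: $\sum_{i,j}\big|\frac{\partial a_i}{\partial x_j}(x,\xi)\big|\le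 C|\xi|^{p(x)-1}(1+|\ln|\xi||)$. Source term. $(f_0)$ $f:\overline\Omega\times\mathbb R^+\to\mathbb R^+$ is continuous, $f(x,0)\equiv0$, and $f>0$ on $\Omega\times(\mathbb R^+\setminus\{0\})$. $(f_1)$ For any $x\in\Omega$, $s\mapsto f(x,s)/s^{q-1}$ is nonincreasing on $\mathbb R^+\setminus\{0\}$. Weak solution. A weak solution of $(E)$ is any positive function $v\in L^\infty(0,T;\mathcal W)\cap L^\infty(Q_T)$ such that $\partial_t(v^q)\in L^2(Q_T)$, $v(0,\cdot)=v_0$ a.e. in $\Omega$ and, for any $\phi\in L^2(Q_T)\cap L^1(0,T;\mathcal W)$ and any $t\in(0,T]$, $$\int_0^t\!\!\int_\Omega\partial_t(v^q)v^{q-1}\phi\,dx\,ds+\int_0^t\!\!\int_\Omega a(x,\nabla v)\cdot\nabla\phi\,dx\,ds=\int_0^t\!\!\int_\Omega(h(s,x)v^{q-1}+f(x,v))\phi\,dx\,ds.$$ *)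

(* Defs.v *)
From HB Require Import structures.
From mathcomp Require Import all_boot all_order all_algebra.
From mathcomp Require Import all_classical all_reals all_analysis.

Set Implicit Arguments.
Unset Strict Implicit.
Unset Printing Implicit Defensive.
Import Order.TTheory GRing.Theory Num.Theory.
Import numFieldNormedType.Exports.
Local Open Scope classical_set_scope.
Local Open Scope ring_scope.

Definition rV_display : measure_display. Proof. exact. Qed.

(* The sigma-algebra on R^n generated by the coordinates (i.e. the Borel one;
   the library has it on n-tuples only). *)
Section rV_measurable.
Variables (R : realType) (n : nat).

Let coord (i : 'I_n) (x : 'rV[R]_n) : R := x ord0 i.

Let rV_set0 : g_sigma_preimage coord set0.
Proof. exact: sigma_algebra0. Qed.

Let rV_setC A : g_sigma_preimage coord A -> g_sigma_preimage coord (~` A).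
Proof. exact: sigma_algebraC. Qed.

Let rV_bigcup (F : _^nat) : (forall i, g_sigma_preimage coord (F i)) ->
  g_sigma_preimage coord (\bigcup_i (F i)).
Proof. exact: sigma_algebra_bigcup. Qed.

HB.instance Definition _ := @isMeasurable.Build rV_display
  'rV[R]_n (g_sigma_preimage coord) rV_set0 rV_setC rV_bigcup.

Lemma measurable_coord (i : 'I_n) :
  measurable_fun [set: 'rV[R]_n] (fun x : 'rV[R]_n => x ord0 i).
Proof.
move=> _ Y mY; rewrite setTI; apply: sub_sigma_algebra => /=.
rewrite -bigcup_seq/=; exists i => /=; first by rewrite mem_index_enum.
by exists Y => //; rewrite setTI.
Qed.

Lemma measurable_fun_rV d (T : measurableType d) (D : set T)
    (f : T -> 'rV[R]_n) :
  (forall i, measurable_fun D (fun t => f t ord0 i)) -> measurable_fun D f.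
Proof.
move=> mf mD.
pose G := [set A | measurable (D `&` f @^-1` A)].
suff : g_sigma_preimage coord `<=` G by move=> sG Y /sG.
apply: smallest_sub.
  split=> [|A GA|F GF]; rewrite /G /=.
  - by rewrite preimage_set0 setI0.
  - rewrite setTD preimage_setC.
    have -> : D `&` ~` (f @^-1` A) = D `\` (D `&` f @^-1` A).
      by rewrite setDE setCI setIUr setICr set0U.
    exact: measurableD.
  - by rewrite preimage_bigcup setI_bigcupr; exact: bigcupT_measurable.
move=> A; rewrite -bigcup_seq => -[i _ [B mB <-]].
by rewrite /G/= setTI; exact: mf.
Qed.

End rV_measurable.

Definition rV_cons (R : realType) (n : nat) (z : R * 'rV[R]_n) : 'rV[R]_n.+1 :=
  row_mx (z.1%:M : 'rV[R]_1) z.2.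

Lemma rV_cons0 (R : realType) (n : nat) (z : R * 'rV[R]_n) :
  rV_cons z ord0 ord0 = z.1.
Proof.
rewrite /rV_cons (_ : ord0 = lshift n (ord0 : 'I_1)); last exact/val_inj.
by apply: (etrans (row_mxEl _ _ _ _)); rewrite mxE eqxx mulr1n.
Qed.

Lemma rV_consS (R : realType) (n : nat) (z : R * 'rV[R]_n) (i : 'I_n) :
  rV_cons z ord0 (lift ord0 i) = z.2 ord0 i.
Proof.
rewrite /rV_cons (_ : lift ord0 i = rshift 1 i); last exact/val_inj.
exact: row_mxEr.
Qed.

Lemma measurable_rV_cons (R : realType) (n : nat) :
  measurable_fun [set: R * 'rV[R]_n] (@rV_cons R n).
Proof.
apply: measurable_fun_rV => i; have [j ->|->] := unliftP ord0 i.
- rewrite (_ : (fun _ => _) =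
      (fun x : 'rV[R]_n => x ord0 j) \o snd); last first.
    by apply/funext => z; rewrite rV_consS.
  by apply: measurableT_comp; [exact: measurable_coord|exact: measurable_snd].
- rewrite (_ : (fun _ => _) = fst); first exact: measurable_fst.
  by apply/funext => z; rewrite rV_cons0.
Qed.

Definition rV_uncons (R : realType) (n : nat) (x : 'rV[R]_n.+1) :
  R * 'rV[R]_n := (x ord0 ord0, \row_i x ord0 (lift ord0 i)).

Lemma measurable_rV_uncons (R : realType) (n : nat) :
  measurable_fun [set: 'rV[R]_n.+1] (@rV_uncons R n).
Proof.
apply: measurable_fun_pair; first exact: measurable_coord.
apply: measurable_fun_rV => i.
rewrite (_ : (fun _ => _) =
  (fun x : 'rV[R]_n.+1 => x ord0 (lift ord0 i))); first exact: measurable_coord.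
by apply/funext => x; rewrite mxE.
Qed.

Lemma rV_consK (R : realType) (n : nat) :
  cancel (@rV_cons R n) (@rV_uncons R n).
Proof.
move=> [t x]; rewrite /rV_uncons rV_cons0; congr pair.
by apply/rowP => i; rewrite mxE rV_consS.
Qed.

Section lebesgue_rV.
Variables (R : realType).

Section step.
Variables (n : nat) (mu : {sigma_finite_measure set 'rV[R]_n -> \bar R}).

Let prod : {measure set (measurableTypeR R * 'rV[R]_n)%type -> \bar R} :=
  (@lebesgue_measure R \x mu)%E.

Definition leb_step : set 'rV[R]_n.+1 -> \bar R :=
  pushforward prod (@rV_cons R n).

Let leb_step0 : leb_step set0 = 0%E.
Proof. by rewrite /leb_step /pushforward preimage_set0 measure0. Qed.

Let leb_step_ge0 A : (0 <= leb_step A)%E.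
Proof. exact: (measure_ge0 prod). Qed.

Let measurable_pre A : measurable A -> measurable (@rV_cons R n @^-1` A).
Proof.
by move=> mA; rewrite -[X in measurable X]setTI; exact: measurable_rV_cons.
Qed.

Let leb_step_sigma_additive : semi_sigma_additive leb_step.
Proof.
move=> F mF tF mUF; rewrite /leb_step /pushforward preimage_bigcup.
apply: measure_semi_sigma_additive.
- by move=> k; exact: measurable_pre.
- apply/trivIsetP => /= i j _ _ ij; rewrite -preimage_setI.
  by move/trivIsetP : tF => /(_ _ _ _ _ ij) ->//; rewrite preimage_set0.
- by rewrite -preimage_bigcup; exact: measurable_pre.
Qed.

HB.instance Definition _ := isMeasure.Build _ _ _ leb_step
  leb_step0 leb_step_ge0 leb_step_sigma_additive.

Let leb_step_sigma_finite : sigma_finite setT leb_step.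
Proof.
have /sigma_finiteP[F [UF ndF Foo]] := sigma_finiteT (@lebesgue_measure R).
have /sigma_finiteP[G [UG ndG Goo]] := sigma_finiteT mu.
exists (fun k => @rV_uncons R n @^-1` (F k `*` G k)).
  apply/esym; rewrite -subTset => x _.
  have : (\bigcup_k F k) (rV_uncons x).1 by rewrite -UF.
  have : (\bigcup_k G k) (rV_uncons x).2 by rewrite -UG.
  move=> [j _ Gj] [i _ Fi]; exists (maxn i j) => //; split.
  - by move: Fi; exact/subsetPset/ndF/leq_maxl.
  - by move: Gj; exact/subsetPset/ndG/leq_maxr.
move=> k; have [mF Fk] := Foo k; have [mG Gk] := Goo k; split.
  rewrite -[X in measurable X]setTI; apply: measurable_rV_uncons => //.
  exact: measurableX.
rewrite /leb_step /pushforward -comp_preimage.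
rewrite (_ : _ \o _ = id); last by apply/funext => z; exact: rV_consK.
rewrite preimage_id [ltLHS]product_measure1E//.
by rewrite lte_mul_pinfty// ge0_fin_numE.
Qed.

HB.instance Definition _ := Measure_isSigmaFinite.Build _ _ _
  leb_step leb_step_sigma_finite.
End step.

(* Lebesgue measure on R^n, as an iterated product; leb_box characterizes it. *)
Fixpoint leb (n : nat) : {sigma_finite_measure set 'rV[R]_n -> \bar R} :=
  match n with
  | 0 => \d_(0 : 'rV[R]_0)
  | n.+1 => leb_step (leb n)
  end.

Lemma leb_box n (A : 'I_n -> set R) : (forall i, measurable (A i)) ->
  leb n [set x | forall i, A i (x ord0 i)] =
  (\prod_(i < n) lebesgue_measure (A i))%E.
Proof.
elim: n A => [|n IHn] A mA /=.
  by rewrite big_ord0 diracE mem_set// => -[].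
have mB : measurable [set x : 'rV[R]_n | forall i, A (lift ord0 i) (x ord0 i)].
  rewrite (_ : [set x | _] = \bigcap_(i in [set: 'I_n])
      ((fun x : 'rV[R]_n => x ord0 i) @^-1` A (lift ord0 i))).
    apply: fin_bigcap_measurable => // i _.
    by rewrite -[X in measurable X]setTI; exact: measurable_coord.
  by apply/seteqP; split=> [x Ax i _|x Ax i]; [exact: Ax|exact: (Ax i I)].
rewrite big_ord_recl -(IHn (fun i => A (lift ord0 i)))//.
rewrite -(product_measure1E lebesgue_measure (leb n) (mA ord0) mB).
rewrite /leb_step /pushforward; congr ((_ \x _)%E _); apply/seteqP; split => -[t x] /=.
- move=> Ax; split=> [|i]; first by have := Ax ord0; rewrite rV_cons0.
  by have := Ax (lift ord0 i); rewrite rV_consS.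
- move=> [At Ax] i; have [j ->|->] := unliftP ord0 i.
    by rewrite rV_consS; exact: Ax.
  by rewrite rV_cons0.
Qed.

End lebesgue_rV.

Section euclidean.
Variables (R : realType) (N : nat).
Local Notation E := 'rV[R]_N.

Definition dotp (x y : E) : R := \sum_(i < N) x ord0 i * y ord0 i.

(* The library norm `|x| on 'rV is the sup norm. *)
Definition enorm (x : E) : R := Num.sqrt (dotp x x).

Definition basis_vec (i : 'I_N) : E := delta_mx ord0 i.

Definition partial (i : 'I_N) (u : E -> R) (x : E) : R := 'D_(basis_vec i) u x.

Definition gradient (u : E -> R) (x : E) : E := \row_i partial i u x.

End euclidean.

(* Meant for open U and finite-dimensional V. *)
Fixpoint Ck_on (R : realType) (V : normedModType R) (U : set V) (k : nat)
    (u : V -> R) : Prop :=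
  match k with
  | 0 => forall x, U x -> {for x, continuous u}
  | k.+1 => (forall x, U x -> differentiable u x) /\
            (forall h : V, Ck_on U k (fun x => 'D_h u x))
  end.

Definition smooth_on (R : realType) (V : normedModType R) (U : set V)
  (u : V -> R) : Prop := forall k, Ck_on U k u.

Definition test_function (R : realType) (V : normedModType R) (U : set V)
    (psi : V -> R) : Prop :=
  smooth_on setT psi /\
  exists K : set V, [/\ compact K, K `<=` U & forall x, ~ K x -> psi x = 0].

Section domain.
Variables (R : realType) (N : nat).
Local Notation E := 'rV[R]_N.

(* Near each boundary point, Omega is a strict sublevel set of a smooth
   function without critical points. *)
Definition smooth_boundary (Omega : set E) : Prop :=
  forall x, (closure Omega `\` interior Omega) x ->
  exists (U : set E) (rho : E -> R),
    [/\ open U, U x, smooth_on U rho,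
        forall y, U y -> gradient rho y != 0 &
        Omega `&` U = [set y | U y /\ rho y < 0]].

Definition smooth_bounded_domain (Omega : set E) : Prop :=
  [/\ open Omega, connected Omega, Omega !=set0, bounded_set Omega &
      smooth_boundary Omega].

Definition C1_closure (Omega : set E) (u : E -> R) : Prop :=
  [/\ Ck_on Omega 1 u, {within closure Omega, continuous u} &
      forall i : 'I_N, exists g : E -> R,
        {within closure Omega, continuous g} /\
        forall x, Omega x -> g x = partial i u x].

(* For p continuous on the compact set closure Omega, the infimum is the
   minimum, and the supremum of p is automatically finite. *)
Definition p_minus (Omega : set E) (p : E -> R) : R := inf (p @` closure Omega).

Definition variable_exponent (Omega : set E) (p : E -> R) : Prop :=
  C1_closure Omega p /\ 1 < p_minus Omega p.

End domain.

Section operator.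
Variables (R : realType) (N : nat).
Local Notation E := 'rV[R]_N.
Variables (Omega : set E) (p : E -> R) (A : E -> E -> R).

Definition flux (x xi : E) : E := (p x)^-1 *: gradient (A x) xi.

(* The i-th partial derivatives of a_j in xi and in x. *)
Definition dflux_xi (i j : 'I_N) (x xi : E) : R :=
  partial i (fun xi' => flux x xi' ord0 j) xi.
Definition dflux_x (i j : 'I_N) (x xi : E) : R :=
  partial i (fun x' => flux x' xi ord0 j) x.

Definition operator_potential : Prop :=
  [/\ forall x xi, Omega x -> 0 <= A x xi,
      {within Omega `*` setT, continuous (fun z : E * E => A z.1 z.2)} &
      forall x xi, Omega x -> differentiable (A x) xi].

Definition condA0 : Prop :=
  forall (t : R) (xi : E), 0 <= t ->
  {ae leb R N, forall x, Omega x -> A x (t *: xi) = t `^ p x * A x xi}.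

Definition condA1 : Prop :=
  [/\ forall j x, Omega x -> flux x 0 ord0 j = 0,
      forall j, Ck_on (Omega `*` [set xi : E | xi != 0]) 1
                  (fun z : E * E => flux z.1 z.2 ord0 j),
      forall j, {within Omega `*` setT,
                  continuous (fun z : E * E => flux z.1 z.2 ord0 j)} &
      exists gamma Gamma : R, [/\ 0 < gamma, 0 < Gamma &
        forall x xi, Omega x -> xi != 0 ->
        (forall eta : E,
          gamma * enorm xi `^ (p x - 2) * enorm eta ^+ 2 <=
          \sum_(i < N) \sum_(j < N)
             dflux_xi i j x xi * eta ord0 i * eta ord0 j) /\
        \sum_(i < N) \sum_(j < N) `|dflux_xi i j x xi| <=
          Gamma * enorm xi `^ (p x - 2)]].

Definition condA2 : Prop :=
  exists C : R, 0 < C /\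
  forall x xi, Omega x -> xi != 0 ->
  \sum_(i < N) \sum_(j < N) `|dflux_x j i x xi| <=
    C * enorm xi `^ (p x - 1) * (1 + `|ln (enorm xi)|).

End operator.

Section source.
Variables (R : realType) (N : nat).
Local Notation E := 'rV[R]_N.
Variables (Omega : set E) (f : E -> R -> R).

Definition condf0 : Prop :=
  [/\ forall x s, closure Omega x -> 0 <= s -> 0 <= f x s,
      {within closure Omega `*` [set s : R | 0 <= s],
        continuous (fun z : E * R => f z.1 z.2)},
      forall x, closure Omega x -> f x 0 = 0 &
      forall x s, Omega x -> 0 < s -> 0 < f x s].

Definition condf1 (q : R) : Prop :=
  forall x s s', Omega x -> 0 < s -> s <= s' ->
  f x s' / s' `^ (q - 1) <= f x s / s `^ (q - 1).

End source.

(* L^r norms over D and membership in L^r(D), 1 <= r <= +oo. *)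
Definition Lnorm_on d (T : measurableType d) (R : realType)
    (mu : {measure set T -> \bar R}) (D : set T) (r : \bar R) (u : T -> \bar R) :
  \bar R := 'N[mu]_r[u \_ D]%E.

Definition in_Lp d (T : measurableType d) (R : realType)
    (mu : {measure set T -> \bar R}) (D : set T) (r : \bar R) (u : T -> R) :
  Prop := measurable_fun D u /\ (Lnorm_on mu D r (EFin \o u) < +oo)%E.

Section sobolev.
Variables (R : realType) (N : nat).
Local Notation E := 'rV[R]_N.
Variables (Omega : set E) (p : E -> R).

(* g is the (locally integrable) distributional gradient of u in Omega *)
Definition weak_gradient (u : E -> R) (g : E -> E) : Prop :=
  [/\ measurable_fun Omega u, measurable_fun Omega g,
      forall K, compact K -> K `<=` Omega ->
        (leb R N).-integrable K (EFin \o u) /\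
        forall i, (leb R N).-integrable K (fun x => (g x ord0 i)%:E) &
      forall (i : 'I_N) (psi : E -> R), test_function Omega psi ->
        \int[leb R N]_(x in Omega) (u x * partial i psi x) =
        - \int[leb R N]_(x in Omega) (g x ord0 i * psi x)].

(* Luxemburg norm of L^p(x)(Omega) *)
Definition luxemburg (u : E -> R) : \bar R :=
  ereal_inf [set l%:E | l in [set l : R | 0 < l /\
    (\int[leb R N]_(x in Omega) ((`|u x| / l) `^ p x)%:E <= 1)%E]].

(* Norm of W^{1,p(x)}(Omega); it is +oo outside this space, and otherwise the
   infimum is over the a.e. unique weak gradient. *)
Definition sobolev_norm (u : E -> R) : \bar R :=
  ereal_inf [set (luxemburg u + luxemburg (fun x => enorm (g x)))%E
            | g in weak_gradient u].

(* W^{1,p(x)}_0(Omega), the closure of the test functions *)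
Definition W0 (u : E -> R) : Prop :=
  (sobolev_norm u < +oo)%E /\
  exists psi : nat -> E -> R, (forall n, test_function Omega (psi n)) /\
    (fun n => sobolev_norm (u \- psi n)) @ \oo --> 0%E.

(* W-valued simple functions of time *)
Definition simple_W0 (s : R -> E -> R) : Prop :=
  exists (k : nat) (B : 'I_k -> set R) (u : 'I_k -> E -> R),
    [/\ forall i, measurable (B i), forall i, W0 (u i) &
        s = fun t x => \sum_(i < k) \1_(B i) t * u i x].

(* The Bochner space L^r(0,T;W) *)
Definition in_LrW (T : R) (r : \bar R) (u : R -> E -> R) : Prop :=
  [/\ {ae @lebesgue_measure R, forall t : R, 0 < t < T -> W0 (u t)},
      exists s : nat -> R -> E -> R, (forall n, simple_W0 (s n)) /\
        {ae @lebesgue_measure R, forall t : R, 0 < t < T ->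
          (fun n => sobolev_norm (u t \- s n t)) @ \oo --> 0%E} &
      (Lnorm_on (@lebesgue_measure R) `]0%R, T[%classic r
         (fun t => sobolev_norm (u t)) < +oo)%E].

End sobolev.

Section evolution.
Variables (R : realType) (N : nat).
Local Notation E := 'rV[R]_N.

Definition tleb : {measure set (measurableTypeR R * E)%type -> \bar R} :=
  (@lebesgue_measure R \x leb R N)%E.

Variables (Omega : set E) (T : R).

Definition QT (t : R) : set (measurableTypeR R * E)%type := `]0, t[ `*` Omega.

(* Functions of (t, x) are curried. *)
Definition joint (Y : Type) (u : R -> E -> Y) : measurableTypeR R * E -> Y :=
  fun z => u z.1 z.2.

Definition in_LpQ (r : \bar R) (u : R -> E -> R) : Prop :=
  in_Lp tleb (QT T) r (joint u).

(* v = d/dt u in the sense of distributions in Q_T *)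
Definition weak_dt (u v : R -> E -> R) : Prop :=
  (forall K : set (R * E)%type, compact K -> K `<=` QT T ->
     tleb.-integrable K (EFin \o joint u) /\
     tleb.-integrable K (EFin \o joint v)) /\
  forall psi : R * E -> R, test_function (QT T : set (R * E)%type) psi ->
    \int[tleb]_(z in QT T) (joint u z * 'D_((1, 0) : R * E) psi z) =
    - \int[tleb]_(z in QT T) (joint v z * psi z).

(* G is the spatial gradient of u as a measurable function on Q_T *)
Definition spatial_gradient (u : R -> E -> R) (G : R -> E -> E) : Prop :=
  measurable_fun (QT T) (joint G) /\
  {ae @lebesgue_measure R, forall t : R, 0 < t < T ->
     weak_gradient Omega (u t) (G t)}.

Definition L2norm (u : E -> R) : \bar R := Lnorm_on (leb R N) Omega 2%:E (EFin \o u).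

(* U is the representative of u in C([0,T];L^2(Omega)) *)
Definition C_L2_representative (u U : R -> E -> R) : Prop :=
  [/\ forall t, 0 <= t <= T -> in_Lp (leb R N) Omega 2%:E (U t),
      forall t, 0 <= t <= T ->
        L2norm (U s \- U t) @[s --> within `[0, T]%classic (nbhs t)] --> 0%E &
      {ae @lebesgue_measure R, forall t : R, 0 < t < T ->
        {ae leb R N, forall x, Omega x -> U t x = u t x}}].

Definition pow_q (q : R) (v : R -> E -> R) : R -> E -> R :=
  fun t x => v t x `^ q.

Variables (p : E -> R) (A : E -> E -> R) (f : E -> R -> R) (q : R).

(* v(0) = v0 is understood through the continuous representative of v^q. *)
Definition weak_solution (h : R -> E -> R) (v0 : E -> R) (v : R -> E -> R) :
    Prop :=
  [/\ {ae tleb, forall z, QT T z -> 0 < joint v z},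
      in_LrW Omega p T +oo%E v,
      in_LpQ +oo%E v,
      exists V, C_L2_representative (pow_q q v) V /\
        {ae leb R N, forall x, Omega x -> V 0 x = v0 x `^ q} &
      exists (dvq : R -> E -> R) (Dv : R -> E -> E),
      [/\ weak_dt (pow_q q v) dvq, in_LpQ 2%:E dvq, spatial_gradient v Dv &
        forall (phi : R -> E -> R) (Dphi : R -> E -> E),
        in_LpQ 2%:E phi -> in_LrW Omega p T 1%E phi ->
        spatial_gradient phi Dphi ->
        forall t, 0 < t <= T ->
        \int[tleb]_(z in QT t)
          (joint dvq z * joint v z `^ (q - 1) * joint phi z) +
        \int[tleb]_(z in QT t)
          dotp (flux p A z.2 (joint Dv z)) (joint Dphi z) =
        \int[tleb]_(z in QT t)
          ((joint h z * joint v z `^ (q - 1) + f z.2 (joint v z)) *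
           joint phi z)]].

End evolution.

(* Main.v *)
Require Import Defs.
From HB Require Import structures.
From mathcomp Require Import all_boot all_order all_algebra.
From mathcomp Require Import all_classical all_reals all_analysis.
From mathcomp Require Import ess_sup_inf measurable_realfun ring lra.
Set Implicit Arguments.
Unset Strict Implicit.
Unset Printing Implicit Defensive.
Import Order.TTheory GRing.Theory Num.Theory.
Import numFieldNormedType.Exports.
Local Open Scope classical_set_scope.
Local Open Scope ring_scope.

(** Let [P t = v^q(t) - w^q(t)], let [Z] be the time derivative of [P], and let
    [H = h - ht].  The estimate expresses that the nonlinear operator, divided
    by [v^(q-1)], is accretive in [L^2] in the variable [v^q].

    Formally, the equation of [v] is tested with [(v^q - w^q) / v^(q-1)] and
    that of [w] with [(w^q - v^q) / w^(q-1)], and the two are added.  The time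
    derivatives give the integral of [Z P] and the potentials that of [H P].
    The operator terms add up to a nonnegative integrand: this is the Picone
    inequality [picone], which follows from the homogeneity and the convexity of
    [A] and from [q < p].  The source terms add up to
    [(v^q - w^q) (f(x,v) / v^(q-1) - f(x,w) / w^(q-1))], which is nonpositive by
    the monotonicity of [f(x,s) / s^(q-1)].  Hence, on each cylinder, the
    integral of [Z P] is at most that of [H P].

    The formal test functions are neither bounded nor known to belong to the
    energy space, because [v] and [w] are positive without a lower bound.  They
    are replaced by [quot], in which [v] and [w] are increased by [2 c] and cut
    off smoothly above their range.  Belonging to [L^1(0,T;W)] is a chain rule for
    the variable exponent space, proved by density of the test functions
    ([W0_with_chain], [in_L1W_chain]).  As [c] tends to [0], dominated convergence
    handles all terms but the source; of the latter only the positive part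
    matters, and this part is dominated ([comparison_limit]).

    It remains to pass from this inequality to the norms.  The weak time
    derivative makes [P t] the primitive [P 0 + \int_0^t Z] for every [t] and
    almost every [x] ([weak_dt_primitive]), and exchanging the order of
    integration over a triangle ([half_square]) turns the integral of [Z P] into
    [(|P t|^2 - |P 0|^2) / 2] ([energy_identity]).  With the Cauchy-Schwarz
    inequality, [y t = |P t|] satisfies [y(t)^2 <= y(0)^2 + 2 \int_0^t |H| y],
    and the Gronwall argument [gronwall_sqr] gives [y(t) <= y(0) + \int_0^t |H|]. *)

(** * Integrals up to null sets and Fubini on rectangles *)

Section integral_ae.
Local Open Scope ereal_scope.
Context d (T : measurableType d) (R : realType).
Variable mu : {measure set T -> \bar R}.
Implicit Types (D : set T) (f g : T -> \bar R).

Import HBNNSimple.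

(** The integral is the supremum over simple functions below [f], and such a
    simple function lies below [g] once it is set to zero on the exceptional
    null set, which does not change its integral. *)
Lemma ge0_le_integral_ae D f g :
  (forall x, D x -> 0 <= f x) -> (forall x, D x -> 0 <= g x) ->
  {ae mu, forall x, D x -> f x <= g x} ->
  \int[mu]_(x in D) f x <= \int[mu]_(x in D) g x.
Proof.
move=> f0 g0 [N [mN muN0 fgN]].
rewrite (ge0_integralE _ f0) (ge0_integralE _ g0).
apply: ge_ereal_sup => _ [s /= sf <-].
pose s' := proj_nnsfun s (measurableC mN).
have s'E x : s' x = (s \_ (~` N)) x by rewrite (mrestrict s (measurableC mN)).
apply: le_ereal_sup_tmp; exists (sintegral mu s').
  exists s' => // x; rewrite s'E /patch.
  have gx0 : 0 <= (if x \in D then g x else point).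
    by case: ifPn => // /set_mem; exact: g0.
  have [xN|xN] := boolP (x \in ~` N); last by [].
  apply: (le_trans (sf x)); rewrite /patch.
  case: ifPn => // xD; have Dx := set_mem xD; move: (set_mem xN) => /= nNx.
  by apply: contrapT => h; apply: nNx; apply: fgN => /= /(_ Dx).
rewrite -!integralT_nnsfun.
rewrite (@ae_eq_integral _ _ _ mu setT (EFin \o s') (EFin \o s))//.
- exact/measurable_EFinP.
- exact/measurable_EFinP.
- exists N; split => // x h; apply: contrapT => nNx; apply: h => _.
  by apply/esym; congr EFin; apply: (etrans (s'E x)); rewrite /patch mem_set.
Qed.

Lemma ge0_ae_eq_integral_nomeas D f g :
  (forall x, D x -> 0 <= f x) -> (forall x, D x -> 0 <= g x) ->
  {ae mu, forall x, D x -> f x = g x} ->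
  \int[mu]_(x in D) f x = \int[mu]_(x in D) g x.
Proof.
move=> f0 g0 fg; apply/eqP; rewrite eq_le; apply/andP; split;
  apply: ge0_le_integral_ae => //; apply: filterS fg => x h Dx; by rewrite h.
Qed.

Lemma ae_eq_integral_nomeas D f g :
  {ae mu, forall x, D x -> f x = g x} ->
  \int[mu]_(x in D) f x = \int[mu]_(x in D) g x.
Proof.
move=> fg; rewrite integralE [RHS]integralE.
congr (_ - _); apply: ge0_ae_eq_integral_nomeas => // ;
  by apply: filterS fg => x h Dx; rewrite ?funeposE ?funenegE h.
Qed.

Lemma ae_eq_Rintegral D (f g : T -> R) :
  {ae mu, forall x, D x -> f x = g x} ->
  (\int[mu]_(x in D) f x = \int[mu]_(x in D) g x)%R.
Proof.
move=> fg; rewrite /Rintegral; congr fine; apply: ae_eq_integral_nomeas.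
by apply: filterS fg => x h Dx; rewrite h.
Qed.

Lemma dominated_cvg_Rintegral D (u : nat -> T -> R) (v g : T -> R) :
  measurable D -> (forall n, measurable_fun D (u n)) -> measurable_fun D v ->
  mu.-integrable D (EFin \o g) ->
  {ae mu, forall x, D x -> forall n, (`|u n x| <= g x)%R} ->
  {ae mu, forall x, D x -> (fun n => u n x) @ \oo --> v x} ->
  mu.-integrable D (EFin \o v) /\
  (fun n => \int[mu]_(x in D) u n x)%R @ \oo --> (\int[mu]_(x in D) v x)%R.
Proof.
move=> mD mu_ mv ig ug uv.
have := @dominated_convergence _ _ _ mu D mD (fun n => EFin \o u n)
  (EFin \o v) (EFin \o g).
case.
- by move=> n; exact/measurable_EFinP.
- exact/measurable_EFinP.
- apply: filterS uv => x h Dx; apply: cvg_EFin; last exact: h.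
  by near=> n.
- exact: ig.
- by apply: filterS ug => x h n Dx; rewrite lee_fin; exact: h.
move=> iv _ cv; split => //.
rewrite /Rintegral; apply: fine_cvg.
by rewrite fineK; [exact: cv|exact: integrable_fin_num].
Unshelve. all: by end_near. Qed.

End integral_ae.

Section fubini_on_rectangles.
Local Open Scope ereal_scope.
Context d1 d2 (T1 : measurableType d1) (T2 : measurableType d2) (R : realType).
Variable m1 : {sigma_finite_measure set T1 -> \bar R}.
Variable m2 : {sigma_finite_measure set T2 -> \bar R}.
Variables (D1 : set T1) (D2 : set T2).
Hypotheses (mD1 : measurable D1) (mD2 : measurable D2).
Let mD : measurable (D1 `*` D2) := measurableX mD1 mD2.

Let patchX (f : T1 * T2 -> \bar R) x y :
  (f \_ (D1 `*` D2)) (x, y) = ((fun x => (fun y => f (x, y)) \_ D2 y) \_ D1) x.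
Proof.
rewrite /patch in_setX /=; case: (x \in D1) => //=.
Qed.

Let patch_int (f : T1 * T2 -> \bar R) x :
  \int[m2]_y (f \_ (D1 `*` D2)) (x, y) =
  ((fun x => \int[m2]_(y in D2) f (x, y)) \_ D1) x.
Proof.
rewrite {2}/patch; case: ifPn => xD.
  rewrite [RHS]integral_mkcond; apply: eq_integral => y _.
  by rewrite patchX /patch xD.
rewrite integral0_eq// => y _; rewrite patchX /patch (negbTE xD)//.
Qed.

Lemma ge0_fubini_rect (f : T1 * T2 -> \bar R) :
  measurable_fun (D1 `*` D2) f -> (forall z, (D1 `*` D2) z -> 0 <= f z) ->
  measurable_fun D1 (fun x => \int[m2]_(y in D2) f (x, y)) /\
  \int[m1 \x m2]_(z in D1 `*` D2) f z =
  \int[m1]_(x in D1) \int[m2]_(y in D2) f (x, y).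
Proof.
move=> mf f0.
have mg : measurable_fun setT (f \_ (D1 `*` D2)).
  by apply/(measurable_restrictT _ mD).
have g0 z : 0 <= (f \_ (D1 `*` D2)) z.
  by rewrite /patch; case: ifPn => // /set_mem; exact: f0.
have mF := measurable_fun_fubini_tonelli_F (m2 := m2) _ mg g0.
split.
  apply/(measurable_restrictT _ mD1).
  rewrite (_ : _ \_ _ = fubini_F m2 (f \_ (D1 `*` D2)))//.
  by apply/funext => x; rewrite -patch_int.
rewrite integral_mkcond fubini_tonelli1// [RHS]integral_mkcond.
by apply: eq_integral => x _; rewrite -patch_int.
Qed.

Lemma fubini_rect (f : T1 * T2 -> \bar R) :
  (m1 \x m2).-integrable (D1 `*` D2) f ->
  [/\ {ae m1, forall x, D1 x -> m2.-integrable D2 (fun y => f (x, y))},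
   m1.-integrable D1 (fun x => \int[m2]_(y in D2) f (x, y)) &
  \int[m1 \x m2]_(z in D1 `*` D2) f z =
  \int[m1]_(x in D1) \int[m2]_(y in D2) f (x, y)].
Proof.
move=> /(integrable_mkcond _ mD) ig; split.
- have := ae_integrable1 ig; apply: filterS => x h D1x.
  apply/(integrable_mkcond _ mD2).
  apply: eq_integrable h => // y _; rewrite patchX /patch mem_set//.
- apply/(integrable_mkcond _ mD1).
  apply: eq_integrable (integrable_fubini_F ig) => // x _.
  by rewrite -patch_int.
- rewrite integral_mkcond -(integral12_prod_meas1 ig) [RHS]integral_mkcond.
  by apply: eq_integral => x _; rewrite -patch_int.
Qed.

Let patch_int' (f : T1 * T2 -> \bar R) y :
  \int[m1]_x (f \_ (D1 `*` D2)) (x, y) =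
  ((fun y => \int[m1]_(x in D1) f (x, y)) \_ D2) y.
Proof.
rewrite {2}/patch; case: ifPn => yD.
  rewrite [RHS]integral_mkcond; apply: eq_integral => x _.
  by rewrite patchX /patch yD.
rewrite integral0_eq// => x _; rewrite patchX /patch (negbTE yD)//.
by case: ifPn.
Qed.

Lemma integrable_fubini_G (f : T1 * T2 -> \bar R) :
  (m1 \x m2).-integrable setT f -> m2.-integrable setT (fubini_G m1 f).
Proof.
move=> ig; have mf := measurable_int _ ig.
have maf : measurable_fun setT (abse \o f) by exact: measurableT_comp.
apply/integrableP; split; first exact: measurable_fubini_G ig.
apply: le_lt_trans ((integrable21ltyP m1 m2 mf).1 ig).
apply: ge0_le_integral => //.
- by apply: measurableT_comp => //; exact: measurable_fubini_G ig.
- exact: (measurable_fun_fubini_tonelli_G (m1 := m1) _ maf (fun=> abse_ge0 _)).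
- move=> y _; apply: le_abse_integral => //.
  exact: measurableT_comp mf _.
Qed.

Lemma fubini_rect' (f : T1 * T2 -> \bar R) :
  (m1 \x m2).-integrable (D1 `*` D2) f ->
  [/\ {ae m2, forall y, D2 y -> m1.-integrable D1 (fun x => f (x, y))},
   m2.-integrable D2 (fun y => \int[m1]_(x in D1) f (x, y)) &
  \int[m1 \x m2]_(z in D1 `*` D2) f z =
  \int[m2]_(y in D2) \int[m1]_(x in D1) f (x, y)].
Proof.
move=> /(integrable_mkcond _ mD) ig; split.
- have := ae_integrable2 ig; apply: filterS => y h D2y.
  apply/(integrable_mkcond _ mD1).
  apply: eq_integrable h => // x _; rewrite patchX /patch (mem_set D2y)//.
- apply/(integrable_mkcond _ mD2).
  apply: eq_integrable (integrable_fubini_G ig) => // x _.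
  by rewrite -patch_int'.
- rewrite integral_mkcond -(integral21_prod_meas1 ig) [RHS]integral_mkcond.
  by apply: eq_integral => x _; rewrite -patch_int'.
Qed.

End fubini_on_rectangles.

(** * Borel sets and Lebesgue measure of R^n *)

Section countable_bases.
Variable R : realType.

Lemma countType_bigcup_measurable d (M : measurableType d) (I : countType)
    (P : set I) (F : I -> set M) :
  (forall i, P i -> measurable (F i)) -> measurable (\bigcup_(i in P) F i).
Proof.
move=> mF; rewrite bigcup_mkcond; apply: countable_bigcupT_measurable.
  exact: countableP.
by move=> i; case: ifPn => [/set_mem/mF//|_]; exact: measurable0.
Qed.

Definition countable_base (T : topologicalType) (I : countType)
    (B : I -> set T) :=
  forall x U, nbhs x U -> exists i, B i x /\ B i `<=` U.

(** The continuity of [f] is only required at the points [g x] with [x] in [D],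
    which allows functions that are regular only on an open set. *)
Lemma measurable_comp_continuous d (M : measurableType d) (T : topologicalType)
    (I : countType) (B : I -> set T) (D : set M) (g : M -> T) (f : T -> R) :
  countable_base B -> measurable D ->
  (forall i, measurable (D `&` g @^-1` B i)) ->
  (forall x, D x -> {for g x, continuous f}) ->
  measurable_fun D (fun x => f (g x)).
Proof.
move=> baseB mD mB cf.
apply: (measurability _ (RGenOInfty.measurableE R)).
move=> _ [_ [y ->] <-].
rewrite (_ : D `&` _ = \bigcup_(i in [set i | B i `<=` [set z | y < f z]])
    (D `&` g @^-1` B i)).
  by apply: countType_bigcup_measurable => // i _; exact: mB.
apply/seteqP; split=> [x [Dx /=]|x [i /= Bi [Dx gx]]].
  rewrite in_itv/= andbT => yfx.
  have /baseB[i [Bix Bi]] : nbhs (g x) [set z | y < f z].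
    exact: (cf x Dx _ (lt_nbhsr yfx)).
  by exists i => //=; split.
by split => //=; rewrite in_itv/= andbT; exact: Bi.
Qed.

Lemma exists_natSinv_lt (e : R) : 0 < e -> exists k : nat, (k.+1)%:R^-1 < e.
Proof.
move=> e0; exists (Num.truncn e^-1).
by rewrite invf_plt ?posrE// truncnS_gt.
Qed.

Definition rat_itv (z : rat * nat) : set R :=
  [set x | `|ratr z.1 - x| < (z.2.+1%:R)^-1].

Lemma measurable_rat_itv z : measurable (rat_itv z).
Proof. exact: measurable_ball. Qed.

Definition rat_box n (z : 'rV[rat]_n * nat) : set 'rV[R]_n :=
  [set x | forall i, `|ratr (z.1 ord0 i) - x ord0 i| < (z.2.+1%:R)^-1].

Definition rat_cube n (z : 'rV[rat]_n * nat) : set 'rV[R]_n :=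
  [set x | forall i, `|ratr (z.1 ord0 i) - x ord0 i| <= (z.2.+1%:R)^-1].

Lemma rat_cube_nbhs n (x : 'rV[R]_n) U : nbhs x U ->
  exists z, rat_box z x /\ rat_cube z `<=` U.
Proof.
move=> /nbhs_ballP[e /= e0 eU].
have [k ke] := exists_natSinv_lt (divr_gt0 e0 (ltr0n R 2)).
have /choice[q qx] (i : 'I_n) : exists q : rat, `|ratr q - x ord0 i| < (k.+1)%:R^-1.
  have /rat_in_itvoo[q] : x ord0 i - (k.+1)%:R^-1 < x ord0 i + (k.+1)%:R^-1.
    by rewrite ltrD2l gtrN// invr_gt0.
  rewrite in_itv/= => /andP[h1 h2]; exists q.
  by rewrite ltr_norml ltrBrDl h1 ltrBlDl h2.
exists ((\row_i q i), k); split; first by move=> i /=; rewrite mxE; exact: qx.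
move=> y /= ky; apply: eU; split=> // a b; rewrite /ball/= ord1.
have := ky b; rewrite mxE /= => h1; have h2 := qx b.
rewrite (_ : x ord0 b - y ord0 b = (x ord0 b - ratr (q b)) + (ratr (q b) - y ord0 b)); last by ring.
rewrite (le_lt_trans (ler_normD _ _))// (splitr e) ltrD//.
  by rewrite distrC (lt_trans h2).
by rewrite (le_lt_trans h1).
Qed.

Lemma rat_box_base n : countable_base (@rat_box n).
Proof.
move=> x U /rat_cube_nbhs[z [zx zU]]; exists z; split => //.
by apply: subset_trans zU => y yz i; exact/ltW/yz.
Qed.

Lemma measurable_rat_box n z : measurable (@rat_box n z).
Proof.
rewrite (_ : rat_box z = \bigcap_(i in [set: 'I_n])
   ((fun x : 'rV[R]_n => x ord0 i) @^-1` rat_itv (z.1 ord0 i, z.2))).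
  apply: fin_bigcap_measurable => // i _.
  rewrite -[X in measurable X]setTI; apply: measurable_coord => //.
  exact: measurable_rat_itv.
by apply/seteqP; split => [x h i _|x h i]; [exact: h|exact: (h i I)].
Qed.

Lemma rat_itv_base : countable_base rat_itv.
Proof.
move=> x U /nbhs_ballP[e /= e0 eU].
have [k ke] := exists_natSinv_lt (divr_gt0 e0 (ltr0n R 2)).
have /rat_in_itvoo[q] : x - (k.+1)%:R^-1 < x + (k.+1)%:R^-1.
  by rewrite ltrD2l gtrN// invr_gt0.
rewrite in_itv/= => /andP[h1 h2]; exists (q, k); split.
  by rewrite /rat_itv/= ltr_norml ltrBrDl h1 ltrBlDl h2.
move=> y /=; rewrite /rat_itv/= ltr_norml => /andP[h3 h4]; apply: eU.
by move: h1 h2 h3 h4 ke; set r := (_^-1); move=> *; rewrite /ball/= ltr_norml; apply/andP; split; lra.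
Qed.

Lemma prod_base (T1 T2 : topologicalType) (I1 I2 : countType)
    (B1 : I1 -> set T1) (B2 : I2 -> set T2) :
  countable_base B1 -> countable_base B2 ->
  countable_base (fun i : I1 * I2 => B1 i.1 `*` B2 i.2).
Proof.
move=> b1 b2 [x y] U [[U1 U2] /= [/b1[i [ix iU]] /b2[j [jy jU]]] sU].
by exists (i, j); split => //= -[a b] /= [ha hb]; apply: sU; split; [exact: iU|exact: jU].
Qed.

Lemma open_measurable_base d (M : measurableType d) (T : topologicalType)
    (I : countType) (B : I -> set T) (g : M -> T) (U : set T) :
  countable_base B -> (forall i, measurable (g @^-1` B i)) -> open U ->
  measurable (g @^-1` U).
Proof.
move=> baseB mB oU.
rewrite (_ : _ @^-1` _ = \bigcup_(i in [set i | B i `<=` U]) (g @^-1` B i)).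
  by apply: countType_bigcup_measurable => // i _; exact: mB.
apply/seteqP; split=> [x /= Ux|x [i /= Bi gx]]; last exact: Bi.
have /baseB[i [Bix Bi]] : nbhs (g x) U by exact: open_nbhs_nbhs.
by exists i.
Qed.

Lemma open_measurable_rV n (U : set 'rV[R]_n) : open U -> measurable U.
Proof.
exact: (@open_measurable_base _ 'rV[R]_n 'rV[R]_n _ _ id U (@rat_box_base n)
  (@measurable_rat_box n)).
Qed.

Lemma measurable_continuous_rV n (D : set 'rV[R]_n) (f : 'rV[R]_n -> R) :
  measurable D -> (forall x, D x -> {for x, continuous f}) -> measurable_fun D f.
Proof.
move=> mD cf; apply: (@measurable_comp_continuous _ 'rV[R]_n 'rV[R]_n _ _ D id f (@rat_box_base n)) => //.
by move=> i; apply: measurableI => //; exact: measurable_rat_box.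
Qed.

End countable_bases.

Section leb_sets.
Variables (R : realType) (n : nat).

Lemma leb_cube (c : 'rV[R]_n) (r : R) : 0 <= r ->
  measurable [set x : 'rV[R]_n | forall i, `[c ord0 i - r, c ord0 i + r]%classic (x ord0 i)] /\
  leb R n [set x : 'rV[R]_n | forall i, `[c ord0 i - r, c ord0 i + r]%classic (x ord0 i)]
  = ((2 * r) ^+ n)%:E.
Proof.
move=> r0; split.
  rewrite (_ : [set x | _] = \bigcap_(i in [set: 'I_n])
   ((fun x : 'rV[R]_n => x ord0 i) @^-1` `[c ord0 i - r, c ord0 i + r])).
    apply: fin_bigcap_measurable => // i _.
    by rewrite -[X in measurable X]setTI; exact: measurable_coord.
  by apply/seteqP; split => [x h i _|x h i]; [exact: h|exact: (h i I)].
rewrite (@leb_box _ n (fun i => `[c ord0 i - r, c ord0 i + r]%classic))//.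
have lr (i : 'I_n) : c ord0 i - r <= c ord0 i + r by lra.
under eq_bigr => i _.
  rewrite lebesgue_measure_itv/= lte_fin.
  rewrite (_ : (if _ then _ else _) = (2 * r)%:E); last first.
    case: ifPn => [_|]; first by congr EFin; ring.
    rewrite -leNgt => h; congr EFin; lra.
  over.
by rewrite prodEFin prodr_const card_ord.
Qed.

Lemma bounded_leb_lty (A : set 'rV[R]_n) :
  measurable A -> bounded_set A -> (leb R n A < +oo)%E.
Proof.
move=> mA [M [_ /(_ (`|M| + 1))]] AM.
have M1 : M < `|M| + 1 by rewrite (le_lt_trans (ler_norm _))// ltrDl.
have M0 : 0 <= `|M| + 1 by [].
have [mC leC] := leb_cube (0 : 'rV[R]_n) M0.
apply: (@le_lt_trans _ _ (((2 * (`|M| + 1)) ^+ n)%:E)); last exact: ltry.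
rewrite -leC le_measure ?inE//; move=> x /(AM M1) xM i /=.
rewrite in_itv/= mxE sub0r add0r -ler_norml (le_trans _ xM)//.
have -> : `|x| = mx_norm x by [].
rewrite mx_normrE.
exact: (le_bigmax _ (fun ij : 'I_1 * 'I_n => `|x ij.1 ij.2|) (ord0, i)).
Qed.

Lemma open_leb_gt0 (U : set 'rV[R]_n) x : open U -> U x -> (0 < leb R n U)%E.
Proof.
move=> oU Ux; have /nbhs_ballP[e /= e0 eU] : nbhs x U by exact: open_nbhs_nbhs.
have e20 : 0 <= e / 2 by rewrite divr_ge0// ltW.
have [mC leC] := leb_cube x e20.
apply: (@lt_le_trans _ _ (((2 * (e / 2)) ^+ n)%:E)).
  by rewrite lte_fin exprn_gt0// mulr_gt0// divr_gt0.
rewrite -leC le_measure ?inE//; first exact: open_measurable_rV.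
move=> y /= h; apply: eU; split=> // a b; rewrite ord1 /ball/=.
have := h b; rewrite in_itv/= => /andP[h1 h2].
by rewrite ltr_norml; apply/andP; split; lra.
Qed.

(** A property that holds almost everywhere in an open set holds on a dense
    subset, hence an equality of continuous functions holds everywhere. *)
Lemma ae_eq_continuous (U : set 'rV[R]_n) (f g : 'rV[R]_n -> R) :
  open U -> {in U, continuous f} -> {in U, continuous g} ->
  {ae leb R n, forall x, U x -> f x = g x} -> forall x, U x -> f x = g x.
Proof.
move=> oU cf cg [N [mN N0 fgN]] x Ux; apply: contrapT => /eqP fg.
pose V := U `&` [set y | f y - g y != 0].
have oV : open V.
  rewrite openE => y [Uy /= fgy].
  apply: filterI; first exact: open_nbhs_nbhs.
  have cy : {for y, continuous (fun y => f y - g y)}.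
    by apply: continuousB; [exact/cf/mem_set|exact/cg/mem_set].
  have nz : nbhs (f y - g y) [set z | z != 0].
    by apply: open_nbhs_nbhs; split => //; exact: open_neq.
  exact: (cy _ nz).
have Vx : V x by split => //=; rewrite subr_eq0.
have := open_leb_gt0 oV Vx; apply/negP; rewrite -leNgt -N0.
rewrite le_measure ?inE//; first exact: open_measurable_rV.
move=> y [Uy /= fgy]; apply: fgN => /= /(_ Uy) h.
by move: fgy; rewrite h subrr eqxx.
Qed.

End leb_sets.

(** * Smooth functions of class C^k *)

Section Ck_algebra.
Variables (R : realType).
Implicit Types (V W : normedModType R).

Lemma derive_cst_fun V (a : R) (h : V) : (fun x => 'D_h (fun _ : V => a) x) = fun=> 0.
Proof. by apply/funext => x; rewrite derive_cst. Qed.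

Lemma Ck_cst V k (a : R) : Ck_on [set: V] k (fun=> a).
Proof.
elim: k a => [a x _|k IH a /=]; first exact: cst_continuous.
split=> [x _|h]; first exact: differentiable_cst.
by rewrite derive_cst_fun; exact: IH.
Qed.

Lemma Ck_onS V k (u : V -> R) : Ck_on [set: V] k.+1 u -> Ck_on [set: V] k u.
Proof.
elim: k u => [u [du _] x _|k IH u [du Du]].
  exact/differentiable_continuous/du.
by split => // h; apply: IH; exact: Du.
Qed.

Lemma CkD V k (u v : V -> R) :
  Ck_on [set: V] k u -> Ck_on [set: V] k v -> Ck_on [set: V] k (fun x => u x + v x).
Proof.
elim: k u v => [u v cu cv x _|k IH u v [du Du] [dv Dv]].
  by apply: continuousD; [exact: cu|exact: cv].
split=> [x _|h]; first by apply: differentiableD; [exact: du|exact: dv].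
rewrite (_ : (fun x => 'D_h _ x) = fun x => 'D_h u x + 'D_h v x).
  by apply: IH; [exact: Du|exact: Dv].
apply/funext => x; rewrite deriveD//; apply: diff_derivable; [exact: du|exact: dv].
Qed.

Lemma CkM V k (u v : V -> R) :
  Ck_on [set: V] k u -> Ck_on [set: V] k v -> Ck_on [set: V] k (fun x => u x * v x).
Proof.
elim: k u v => [u v cu cv x _|k IH u v ku kv].
  by apply: continuousM; [exact: cu|exact: cv].
have u' := Ck_onS ku; have v' := Ck_onS kv.
case: ku => du Du; case: kv => dv Dv.
split=> [x _|h]; first by apply: differentiableM; [exact: du|exact: dv].
rewrite (_ : (fun x => 'D_h _ x) = fun x => u x * 'D_h v x + v x * 'D_h u x).
  by apply: CkD; apply: IH => //; [exact: Dv|exact: Du].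
apply/funext => x; rewrite deriveM//; apply: diff_derivable; [exact: du|exact: dv].
Qed.

Lemma CkZ V k a (u : V -> R) : Ck_on [set: V] k u -> Ck_on [set: V] k (fun x => a * u x).
Proof. by move=> ku; apply: CkM => //; exact: Ck_cst. Qed.

Lemma CkN V k (u : V -> R) : Ck_on [set: V] k u -> Ck_on [set: V] k (fun x => - u x).
Proof.
move=> ku; rewrite (_ : (fun x => - u x) = fun x => (-1) * u x); first exact: CkZ.
by apply/funext => x; rewrite mulN1r.
Qed.

Lemma derive_comp_linear V W (g : {linear W -> V}) (u : V -> R) (x h : W) :
  continuous g -> differentiable u (g x) ->
  differentiable (u \o g) x /\ 'D_h (u \o g) x = 'D_(g h) u (g x).
Proof.
move=> cg du.
have dg : differentiable g x by apply: linear_differentiable; exact: cg.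
have dug : differentiable (u \o g) x by exact: differentiable_comp.
split => //; rewrite deriveE// diff_comp//= diff_lin//.
by rewrite deriveE.
Qed.

Lemma Ck_comp_linear V W k (g : {linear W -> V}) (u : V -> R) :
  continuous g -> Ck_on [set: V] k u -> Ck_on [set: W] k (fun x => u (g x)).
Proof.
move=> cg; elim: k u => [u cu x _|k IH u [du Du]].
  by apply: continuous_comp; [exact: cg|exact: cu].
split=> [x _|h].
  by have [] := derive_comp_linear 0 cg (du (g x) I).
rewrite (_ : (fun x => 'D_h _ x) = fun x => 'D_(g h) u (g x)); first exact: IH (Du _).
by apply/funext => x; have [] := derive_comp_linear h cg (du (g x) I).
Qed.

Lemma derive_comp_real V (kap : R -> R) (u : V -> R) (x h : V) :
  differentiable kap (u x) -> differentiable u x ->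
  differentiable (kap \o u) x /\ 'D_h (kap \o u) x = 'D_1 kap (u x) * 'D_h u x.
Proof.
move=> dk du; have dku : differentiable (kap \o u) x by exact: differentiable_comp.
split => //; rewrite deriveE// diff_comp//= !deriveE//.
rewrite -[in LHS](mulr1 ('d u x h)) -[_ * 1]/(_ *: (1 : R^o)) linearZ/=.
by rewrite mulrC.
Qed.

Lemma Ck_comp_real V k (kap : R -> R) (u : V -> R) :
  Ck_on [set: R] k kap -> Ck_on [set: V] k u -> Ck_on [set: V] k (fun x => kap (u x)).
Proof.
elim: k kap u => [kap u ck cu x _|k IH kap u [dk Dk] ku].
  by apply: continuous_comp; [exact: cu|exact: ck].
have ku' := Ck_onS ku; case: ku => du Du.
split=> [x _|h].
  by have [] := derive_comp_real 0 (dk (u x) I) (du x I).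
rewrite (_ : (fun x => 'D_h _ x) = fun x => 'D_1 kap (u x) * 'D_h u x).
  by apply: CkM; [exact: (IH _ _ (Dk _) ku')|exact: Du].
by apply/funext => x; have [] := derive_comp_real h (dk (u x) I) (du x I).
Qed.

Lemma derive_powR_gt0 (s a : R) : 0 < a ->
  differentiable (fun y : R => y `^ s) a /\
  'D_1 (fun y : R => y `^ s) a = s * a `^ (s - 1).
Proof.
move=> a0; have h := is_derive1_powR s a0.
by split; [apply/derivable1_diffP; exact: ex_derive|rewrite derive_val].
Qed.

Lemma Ck_powR V k (s : R) (u : V -> R) : (forall x, 0 < u x) ->
  Ck_on [set: V] k u -> Ck_on [set: V] k (fun x => u x `^ s).
Proof.
move=> u0; elim: k s => [s cu x _|k IH s ku].
  apply: (@continuous_comp _ _ _ u (fun y => y `^ s)); first exact: cu.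
  by apply: differentiable_continuous; have [] := derive_powR_gt0 s (u0 x).
have ku' := Ck_onS ku; have pk := fun s => IH s ku'.
case: ku => du Du.
have dp x h := derive_comp_real h (derive_powR_gt0 s (u0 x)).1 (du x I).
split=> [x _|h]; first by have [] := dp x 0.
rewrite (_ : (fun x => 'D_h _ x) = fun x => (s * u x `^ (s - 1)) * 'D_h u x).
  by apply: CkM; [apply: CkZ; exact: pk|exact: Du].
apply/funext => x; have [_ ->] := dp x h; congr (_ * _).
by have [] := derive_powR_gt0 s (u0 x).
Qed.

End Ck_algebra.

Section smooth_step.
Variable R : realType.

(** The parameter [n] makes the family closed under differentiation, see
    [is_derive_expinv]. *)
Definition expinv (n : nat) (x : R) : R :=
  if 0 < x then x ^- n * expR (- x^-1) else 0.

Lemma expinv_ge0 n x : 0 <= expinv n x.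
Proof.
rewrite /expinv; case: ifPn => // x0.
by rewrite mulr_ge0// ?expR_ge0// invr_ge0 exprn_ge0// ltW.
Qed.

Lemma expinv_gt0 n x : 0 < x -> 0 < expinv n x.
Proof.
by move=> x0; rewrite /expinv x0 mulr_gt0// ?expR_gt0// invr_gt0 exprn_gt0.
Qed.

Lemma expinv_le0 n x : x <= 0 -> expinv n x = 0.
Proof. by rewrite /expinv leNgt => /negbTE ->. Qed.

(** A term of the exponential series bounds the flat function by a quadratic
    one, which makes its derivative at [0] vanish. *)
Lemma expinv_bound n x : 0 < x -> expinv n x <= (n.+2)`!%:R * x ^+ 2.
Proof.
move=> x0; rewrite /expinv x0 expRN.
have y0 : 0 <= x^-1 by rewrite invr_ge0 ltW.
have := @expR_ge1Dxn R _ n.+1 y0.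
set e := expR _ => h; have e0 : 0 < e by exact: expR_gt0.
have f0 : 0 < (n.+2)`!%:R :> R by rewrite ltr0n fact_gt0.
have {h} : x^-1 ^+ n.+2 / (n.+2)`!%:R <= e by rewrite (le_trans _ h)// lerDr.
rewrite ler_pdivrMr// => h.
have x20 : 0 < x ^+ 2 by rewrite exprn_gt0.
rewrite ler_pdivrMr// -exprVn.
have -> : x^-1 ^+ n = x^-1 ^+ n.+2 * x ^+ 2.
  by rewrite -[n.+2]addn2 exprD -mulrA -exprMn mulVf ?gt_eqF// expr1n mulr1.
by rewrite [leRHS]mulrAC ler_pM2r// mulrC.
Qed.

Lemma is_derive_expinv n (x : R) :
  is_derive x 1 (expinv n) (- n%:R * expinv n.+1 x + expinv n.+2 x).
Proof.
have [x0|x0|->] := ltgtP x 0.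
- rewrite !expinv_le0 ?ltW// mulr0 addr0.
  apply: (@near_eq_is_derive _ _ _ (fun=> 0)).
    near=> y; rewrite expinv_le0// ltW//.
    near: y; exact: lt_nbhsl.
- have i1 : is_derive x 1 (fun y : R => y^-1) (- x ^- 2 *: 1).
    by apply: is_deriveV; rewrite gt_eqF.
  have i2 : is_derive x 1 (fun y : R => y ^- n) ((n%:R * x^-1 ^+ n.-1) *: (- x ^- 2 *: 1)).
    have := is_deriveX n i1.
    by rewrite (_ : (fun y : R => y^-1) ^+ n = (fun y : R => y ^- n))//;
      apply/funext => y; rewrite fctE exprVn.
  have i3 : is_derive x 1 (fun y : R => expR (- y^-1)) (expR (- x^-1) * (- (- x ^- 2 *: 1))).
    have i4 : is_derive x 1 (fun y : R => - y^-1) (- (- x ^- 2 *: 1)).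
      exact: is_deriveN.
    exact: (@is_derive1_comp _ expR (fun y : R => - y^-1) _ _ _ (is_derive_expR (- x^-1)) i4).
  apply: (@near_eq_is_derive _ _ _ (fun y : R => y ^- n * expR (- y^-1))).
    near=> y; rewrite /expinv ifT//.
    near: y; exact: lt_nbhsr.
  have i5 : is_derive x 1 (fun y : R => y ^- n * expR (- y^-1))
      (x ^- n *: (expR (- x^-1) * (- (- x ^- 2 *: 1))) +
       expR (- x^-1) *: ((n%:R * x^-1 ^+ n.-1) *: (- x ^- 2 *: 1))).
    exact: is_deriveM.
  apply: (is_derive_eq i5).
  rewrite /expinv x0 /=.
  have xn0 : x != 0 by rewrite gt_eqF.
  rewrite /GRing.scale /=.
  rewrite -!exprVn; move: (expR (- x^-1)) => E; move: (x^-1) => y.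
  by case: (n) => [|m] /=; rewrite ?exprS; ring.
- rewrite !expinv_le0 // mulr0 addr0.
  have lim : (fun h : R => h^-1 *: (expinv n (h *: 1 + 0) - expinv n 0)) @ 0^' --> (0 : R).
    have f0 : 0 < (n.+2)`!%:R :> R by rewrite ltr0n fact_gt0.
    apply/cvgrPdist_le => e e0; near=> h.
    rewrite sub0r normrN [expinv n 0]expinv_le0// subr0 addr0 [_ *: 1]mulr1.
    have h0 : h != 0 by near: h; exact: nbhs_dnbhs_neq.
    have hle : `|h| <= e / (n.+2)`!%:R.
      near: h; apply: nbhs_dnbhs; apply/nbhs_ballP.
      exists (e / (n.+2)`!%:R); first exact: divr_gt0.
      by move=> y; rewrite /ball/= sub0r normrN => /ltW.
    rewrite normrZ normfV ler_pdivrMl ?normr_gt0//.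
    rewrite ger0_norm ?expinv_ge0//.
    have [hneg|hpos] := leP h 0.
      by rewrite expinv_le0// mulr_ge0// ltW.
    apply: (le_trans (expinv_bound n hpos)).
    rewrite [leRHS]mulrC (ger0_norm (ltW hpos)) expr2 mulrA ler_pM2r//.
    by rewrite mulrC -ler_pdivlMr// (le_trans _ hle)// ler_norm.
  by apply: DeriveDef; [apply/cvg_ex; exists 0|exact/cvg_lim].
Unshelve. all: by end_near. Qed.

Lemma derive_is_derive (f : R -> R) (x h d : R) :
  is_derive x 1 f d -> differentiable f x /\ 'D_h f x = d * h.
Proof.
move=> fd; have df : differentiable f x by apply/derivable1_diffP; exact: ex_derive.
split => //; rewrite deriveE// -{1}(mulr1 h) -[h * 1]/(h *: (1 : R^o)) linearZ/=.
by rewrite -deriveE// derive_val [RHS]mulrC.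
Qed.

Lemma Ck_expinv k n : Ck_on [set: R] k (expinv n).
Proof.
elim: k n => [n x _|k IH n].
  by apply: differentiable_continuous; have [] := derive_is_derive 0 (is_derive_expinv n x).
split=> [x _|h]; first by have [] := derive_is_derive 0 (is_derive_expinv n x).
rewrite (_ : (fun x => 'D_h _ x) =
  fun x => h * (- n%:R * expinv n.+1 x + expinv n.+2 x)).
  by apply: CkZ; apply: CkD; [apply: CkZ|]; exact: IH.
by apply/funext => x; have [_ ->] := derive_is_derive h (is_derive_expinv n x); rewrite mulrC.
Qed.

Lemma Ck_id k : Ck_on [set: R] k (fun x => x).
Proof.
elim: k => [x _|k IH /=]; first by exact: cvg_id.
have did x h := derive_is_derive h (is_derive_id (x : R) (1 : R)).
split=> [x _|h]; first by have [] := did x 0.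
rewrite (_ : (fun x => 'D_h _ x) = fun=> h); first exact: Ck_cst.
by apply/funext => x; have [_ ->] := did x h; rewrite mul1r.
Qed.

(** The two terms of the denominator never vanish together. The inverse is
    written as a real power so that [Ck_powR] applies. *)
Definition step (x : R) : R := expinv 0 x * (expinv 0 x + expinv 0 (1 - x)) `^ (-1).

Lemma step_den_gt0 x : 0 < expinv 0 x + expinv 0 (1 - x).
Proof.
have [x0|x0] := ltP 0 x; first by rewrite ltr_pwDl ?expinv_gt0 ?expinv_ge0.
by rewrite ltr_wpDl ?expinv_ge0 ?expinv_gt0//; lra.
Qed.

Lemma Ck_step k : Ck_on [set: R] k step.
Proof.
have k1 : Ck_on [set: R] k (fun x => 1 - x).
  by apply: CkD; [exact: Ck_cst|apply: CkN; exact: Ck_id].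
apply: CkM; first exact: Ck_expinv.
apply: (@Ck_powR _ _ _ _ (fun x => expinv 0 x + expinv 0 (1 - x))).
  exact: step_den_gt0.
by apply: CkD; [exact: Ck_expinv|apply: Ck_comp_real => //; exact: Ck_expinv].
Qed.

Lemma step_le0 x : x <= 0 -> step x = 0.
Proof. by move=> x0; rewrite /step expinv_le0// mul0r. Qed.

Lemma step_ge1 x : 1 <= x -> step x = 1.
Proof.
move=> x1; rewrite /step [expinv 0 (1 - x)]expinv_le0; last by lra.
have x0 : 0 < x by lra.
by rewrite addr0 powR_inv1 ?expinv_ge0// mulfV// gt_eqF// expinv_gt0.
Qed.

Lemma step_ge0 x : 0 <= step x.
Proof. by rewrite mulr_ge0// ?expinv_ge0// powR_ge0. Qed.

Lemma step_le1 x : step x <= 1.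
Proof.
have d0 := step_den_gt0 x.
rewrite /step (powR_inv1 (ltW d0)) ler_pdivrMr ?step_den_gt0// mul1r.
by rewrite lerDl expinv_ge0.
Qed.

(** On [[0, M]] this is the translation by [2 c]. It stays above [c], so that
    its real powers are smooth, and it is constant outside of a compact set, so
    that their derivatives are bounded. *)
Definition cutoff (c M x : R) : R := c + c + x * (step ((x + c) / c) * step (M + 1 - x)).

Lemma Ck_cutoff k c M : Ck_on [set: R] k (cutoff c M).
Proof.
apply: CkD; first exact: Ck_cst.
apply: CkM; first exact: Ck_id.
apply: CkM.
  apply: (@Ck_comp_real _ _ _ step (fun x => (x + c) / c)); first exact: Ck_step.
  by apply: CkM; [apply: CkD; [exact: Ck_id|exact: Ck_cst]|exact: Ck_cst].
apply: (@Ck_comp_real _ _ _ step (fun x => M + 1 - x)); first exact: Ck_step.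
by apply: CkD; [exact: Ck_cst|apply: CkN; exact: Ck_id].
Qed.

Lemma cutoffE c M x : 0 < c -> 0 <= x <= M -> cutoff c M x = x + (c + c).
Proof.
move=> c0 /andP[x0 xM].
have h1 : 1 <= (x + c) / c by rewrite ler_pdivlMr// mul1r lerDr.
have h2 : 1 <= M + 1 - x by lra.
by rewrite /cutoff (step_ge1 h1) (step_ge1 h2) !mulr1 addrC.
Qed.

Lemma cutoff_out c M x : 0 < c -> 0 <= M -> (x <= - c) || (M + 1 <= x) -> cutoff c M x = c + c.
Proof.
move=> c0 M0 /orP[h|h]; rewrite /cutoff.
  by rewrite [step (_ / _)]step_le0 ?mul0r ?mulr0 ?addr0// pmulr_lle0 ?invr_gt0//; lra.
by rewrite [step (_ - x)]step_le0 ?mulr0 ?addr0//; lra.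
Qed.

Lemma cutoff_bounds c M x : 0 < c -> 0 <= M -> c <= cutoff c M x <= c + c + M + 1.
Proof.
move=> c0 M0; have [h|h] := boolP ((x <= - c) || (M + 1 <= x)).
  by rewrite cutoff_out//; apply/andP; split; lra.
move: h; rewrite negb_or -!ltNge => /andP[h1 h2]; rewrite /cutoff.
set t := (_ * step _).
have t0 : 0 <= t by rewrite mulr_ge0 ?step_ge0.
have t1 : t <= 1 by rewrite mulr_ile1 ?step_ge0 ?step_le1.
by apply/andP; split; nra.
Qed.

End smooth_step.

(** * Integrals of partial derivatives *)

Section integration_by_parts.
Variable R : realType.

(** Along an affine map the difference quotients of [f] and of the composition
    are the same function. *)
Lemma derive_affine (V W : normedModType R) (g : W -> V) (f : V -> R) (v a : W) (v' : V) :
  (forall h : R, g (h *: v + a) = h *: v' + g a) ->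
  (derivable f (g a) v' -> derivable (f \o g) a v) /\
  'D_v (f \o g) a = 'D_v' f (g a).
Proof.
move=> ga.
have E : (fun h : R => h^-1 *: (((f \o g) \o shift a) (h *: v) - (f \o g) a)) =
         (fun h : R => h^-1 *: ((f \o shift (g a)) (h *: v') - f (g a))).
  by apply/funext => h /=; rewrite /shift/= ga.
by rewrite /derivable /derive E.
Qed.

Lemma rV_cons_affine n (h : R) (z w : R * 'rV[R]_n) :
  rV_cons (h *: z + w) = h *: rV_cons z + rV_cons w.
Proof.
apply/rowP => i.
rewrite (_ : (h *: rV_cons z + rV_cons w) ord0 i =
  h * rV_cons z ord0 i + rV_cons w ord0 i); last by rewrite [LHS]mxE; congr (_ + _); exact: mxE.
by have [j ->|->] := unliftP ord0 i; rewrite ?rV_consS ?rV_cons0//= !mxE.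
Qed.

Lemma rV_cons_basis0 n : rV_cons (1, 0) = basis_vec R (ord0 : 'I_n.+1).
Proof.
apply/rowP => i; rewrite [RHS]mxE eqxx/=.
by have [j ->|->] := unliftP ord0 i; rewrite ?rV_consS ?rV_cons0//= mxE.
Qed.

Lemma rV_cons_basisS n (j : 'I_n) :
  rV_cons (0, basis_vec R j) = basis_vec R (lift ord0 j).
Proof.
apply/rowP => i; rewrite [RHS]mxE eqxx/=.
have [k ->|->] := unliftP ord0 i; rewrite ?rV_consS ?rV_cons0//= mxE eqxx/=.
by rewrite (inj_eq lift_inj).
Qed.

Lemma rV_cons_continuous n : continuous (fun z : R * 'rV[R]_n => rV_cons z).
Proof.
move=> z; apply/cvgrPdist_lt => e e0.
have : \forall w \near z, ball z e w by exact: nbhsx_ballx.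
apply: filterS => w; rewrite /ball/= => -[h1 [_ h2]].
have : ball (rV_cons z) e (rV_cons w).
  split=> // a i; rewrite ord1.
  have [k ->|->] := unliftP ord0 i; rewrite ?rV_consS ?rV_cons0//.
by rewrite -ball_normE.
Qed.

Definition cube n (M : R) : set 'rV[R]_n := [set x | forall i, `|x ord0 i| <= M].
Arguments cube : clear implicits.

Lemma cube_measurable n M : 0 <= M -> measurable (cube n M) /\ (leb R n (cube n M) < +oo)%E.
Proof.
move=> M0; have [mC leC] := leb_cube (0 : 'rV[R]_n) M0.
rewrite (_ : cube n M = [set x : 'rV[R]_n | forall i : 'I_n, `[(0 : 'rV[R]_n) ord0 i - M, (0 : 'rV[R]_n) ord0 i + M]%classic (x ord0 i)]).
  by rewrite leC ltry.
by apply/seteqP; split => x h i; have := h i;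
  rewrite /= in_itv/= mxE sub0r add0r ler_norml.
Qed.

Lemma integrable_in_cube n (M C : R) (g : 'rV[R]_n -> R) : 0 <= M ->
  measurable_fun setT g -> (forall x, `|g x| <= C) ->
  (forall x, ~ cube n M x -> g x = 0) -> (leb R n).-integrable setT (EFin \o g).
Proof.
move=> M0 mg gC g0; have [mcu lcu] := cube_measurable n M0.
have ig : (leb R n).-integrable (cube n M) (EFin \o g).
  apply: measurable_bounded_integrable => //; first exact: measurable_funTS.
  exists C; split; first exact: num_real.
  by move=> y Cy x _; exact: le_trans (gC x) (ltW Cy).
apply: (@eq_integrable _ _ _ _ _ _ ((EFin \o g) \_ (cube n M))) => //.
  move=> x _; rewrite /patch; case: ifPn => //= /negP nx.
  by rewrite g0// => h; apply: nx; exact/mem_set.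
by apply/(integrable_mkcond _ mcu).
Qed.

(** The class in which the induction on the dimension is carried out: it is
    stable under restriction to the slices. *)
Definition C1_in_cube n (M C : R) (psi : 'rV[R]_n -> R) : Prop :=
  [/\ forall x i, derivable psi x (basis_vec R i),
      forall i, continuous (partial i psi),
      forall x i, `|partial i psi x| <= C &
      forall x, ~ cube n M x -> psi x = 0 /\ forall i, partial i psi x = 0].

Lemma FTC_compact_support (M : R) (f f' : R -> R) : 0 < M ->
  (forall x, derivable f x 1) -> (forall x, 'D_1 f x = f' x) -> continuous f' ->
  (forall x, M < `|x| -> f x = 0 /\ f' x = 0) ->
  (\int[lebesgue_measure]_x (f' x)%:E = 0)%E.
Proof.
move=> M0 df f'E cf' f0.
have ab : - (M + 1) < M + 1 :> R by lra.
have ft := @continuous_FTC2 R f' f _ _ ab.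
have cf : continuous f.
  by move=> x; apply: differentiable_continuous; exact/derivable1_diffP/df.
have -> : (\int[lebesgue_measure]_x (f' x)%:E =
   \int[lebesgue_measure]_(x in `[(- (M + 1))%R, (M + 1)%R]) (f' x)%:E)%E.
  rewrite [RHS]integral_mkcond; apply: eq_integral => x _.
  rewrite /patch; case: ifPn => // /negP xM.
  suff /f0[_ ->//] : M < `|x|.
  rewrite ltNge; apply/negP => h; apply: xM.
  by apply/mem_set; rewrite /= in_itv/= -ler_norml (le_trans h)// lerDl.
rewrite ft.
- have /f0[-> _] : M < `|M + 1| by rewrite gtr0_norm; lra.
  have /f0[-> _] : M < `|- (M + 1)| by rewrite normrN gtr0_norm; lra.
  by rewrite subee.
- exact: continuous_subspaceT.
- split; first by move=> x _; exact: df.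
  + by apply: cvg_at_right_filter; exact: cf.
  + by apply: cvg_at_left_filter; exact: cf.
- by move=> x _; rewrite derive1E f'E.
Qed.

(** Induction on the dimension: the derivative in the first coordinate is
    integrated along that coordinate, the others slice by slice. *)
Lemma integral_partial_eq0 n (M C : R) (psi : 'rV[R]_n -> R) (i : 'I_n) : 0 < M ->
  C1_in_cube M C psi -> (\int[leb R n]_x (partial i psi x)%:E = 0)%E.
Proof.
move=> M0; elim: n psi i => [psi [] //|n IH psi i [dpsi cpsi bpsi spsi]].
have mp : measurable_fun setT (partial i psi).
  by apply: measurable_continuous_rV => // x _; exact: cpsi.
have ip : (leb R n.+1).-integrable setT (EFin \o partial i psi).
  apply: (@integrable_in_cube _ M C) => //; first exact: ltW.
  by move=> x /spsi[].
pose prod : {measure set (measurableTypeR R * 'rV[R]_n)%type -> \bar R} :=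
  (@lebesgue_measure R \x leb R n)%E.
have mc : measurable_fun [set: (measurableTypeR R * 'rV[R]_n)%type]
    (@rV_cons R n : (measurableTypeR R * 'rV[R]_n)%type -> 'rV[R]_n.+1) :=
  @measurable_rV_cons R n.
have ip' : prod.-integrable setT (EFin \o (fun z => partial i psi (rV_cons z))).
  have /integrableP[_ hfin] := ip.
  apply/integrableP; split.
    apply/measurable_EFinP.
    exact: (measurableT_comp mp mc).
  move: hfin; rewrite [ltLHS](_ : _ = \int[prod]_x `|(EFin \o (fun z => partial i psi (rV_cons z))) x|)%E//.
  have := @ge0_integral_pushforward _ _ _ _ R _ mc prod setT (fun x => `|partial i psi x|%:E).
  rewrite preimage_setT => ->//.
  by apply/measurable_EFinP; exact: measurableT_comp.
have -> : (\int[leb R n.+1]_x (partial i psi x)%:E =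
    \int[prod]_z (partial i psi (rV_cons z))%:E)%E.
  have := @integral_pushforward _ _ _ _ R _ mc prod setT (EFin \o partial i psi).
  by rewrite preimage_setT => ->//; exact/measurable_EFinP.
have notcube t x : (exists j, M < `|rV_cons (t, x) ord0 j|) -> ~ cube n.+1 M (rV_cons (t, x)).
  by move=> [j h] /(_ j); rewrite leNgt h.
have slice_affine t x v :
    (derivable psi (rV_cons (t, x)) (rV_cons (0, v)) ->
     derivable (psi \o (fun x => rV_cons (t, x))) x v) /\
    'D_v (psi \o (fun x => rV_cons (t, x))) x =
    'D_(rV_cons (0, v)) psi (rV_cons (t, x)).
  apply: (@derive_affine _ _ (fun x => rV_cons (t, x)) psi v x (rV_cons (0, v))).
  move=> h; rewrite -rV_cons_affine; congr rV_cons.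
  by congr pair; rewrite /= scaler0 add0r.
have sliceE t k : partial k (psi \o (fun x => rV_cons (t, x))) =
    partial (lift ord0 k) psi \o (fun x => rV_cons (t, x)).
  apply/funext => x; rewrite /partial -rV_cons_basisS.
  by have [_ ->] := slice_affine t x (basis_vec R k).
have slice0_affine t x :
    (derivable psi (rV_cons (t, x)) (rV_cons (1, 0)) ->
     derivable (psi \o (fun t => rV_cons (t, x))) t 1) /\
    'D_1 (psi \o (fun t => rV_cons (t, x))) t =
    'D_(rV_cons (1, 0)) psi (rV_cons (t, x)).
  apply: (@derive_affine _ _ (fun t => rV_cons (t, x)) psi 1 t (rV_cons (1, 0))).
  move=> h; rewrite -rV_cons_affine; congr rV_cons.
  by congr pair; rewrite /= scaler0 add0r.
have cslice (t : R) : continuous (fun x : 'rV[R]_n => rV_cons (t, x)).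
  move=> x; change {for x, continuous (@rV_cons R n \o (fun x => (t, x)))}.
  apply: continuous_comp.
    move=> U [[U1 U2] /= [h1 h2] sU]; apply: (filterS _ h2) => y U2y.
    by apply: sU; split => //=; exact: nbhs_singleton.
  exact: rV_cons_continuous.
have cslice0 (x : 'rV[R]_n) : continuous (fun t : R => rV_cons (t, x)).
  move=> t; change {for t, continuous (@rV_cons R n \o (fun t => (t, x)))}.
  apply: continuous_comp.
    move=> U [[U1 U2] /= [h1 h2] sU]; apply: (filterS _ h1) => y U1y.
    by apply: sU; split => //=; exact: nbhs_singleton.
  exact: rV_cons_continuous.
have [j ij|i0] := unliftP ord0 i.
- rewrite -(integral12_prod_meas1 ip') /fubini_F integral0_eq// => t _ /=.
  rewrite (eq_integral (fun x => (partial j (psi \o (fun x => rV_cons (t, x))) x)%:E)); last first.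
    by move=> x _; rewrite sliceE ij.
  apply: IH; split.
  + move=> x k.
    have [+ _] := slice_affine t x (basis_vec R k).
    by apply; rewrite rV_cons_basisS; exact: dpsi.
  + move=> k; rewrite sliceE => x; apply: continuous_comp; first exact: cslice.
    exact: cpsi.
  + by move=> x k; rewrite sliceE; exact: bpsi.
  + move=> x xM; have /spsi[h1 h2] : ~ cube n.+1 M (rV_cons (t, x)).
      by move=> h; apply: xM => k; have := h (lift ord0 k); rewrite rV_consS.
    by split => // k; rewrite sliceE; exact: h2.
- rewrite -(integral21_prod_meas1 ip') /fubini_G integral0_eq// => x _ /=.
  rewrite i0 /partial -rV_cons_basis0.
  apply: (@FTC_compact_support M (psi \o (fun t => rV_cons (t, x)))) => //.
  + move=> t; have [+ _] := slice0_affine t x; apply.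
    by rewrite rV_cons_basis0; exact: dpsi.
  + by move=> t; have [_ ->] := slice0_affine t x.
  + rewrite rV_cons_basis0 => t; apply: (@continuous_comp _ _ _ (fun t => rV_cons (t, x)) (partial ord0 psi)).
      exact: cslice0.
    exact: cpsi.
  + move=> t tM; have /spsi[h1 h2] : ~ cube n.+1 M (rV_cons (t, x)).
      by move=> /(_ ord0); rewrite rV_cons0/= leNgt tM.
    by split => //; rewrite rV_cons_basis0; exact: h2.
Qed.

End integration_by_parts.
Arguments cube {R} n M.

(** * Test functions *)

Section test_functions.
Variables (R : realType).

Lemma smooth_derive (V : normedModType R) (u : V -> R) (h : V) :
  smooth_on setT u -> smooth_on setT (fun x => 'D_h u x).
Proof. by move=> su k; have [_] := su k.+1; apply. Qed.

Lemma smooth_differentiable (V : normedModType R) (u : V -> R) x :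
  smooth_on setT u -> differentiable u x.
Proof. by move=> /(_ 1%N)[+ _]; apply. Qed.

Lemma smooth_continuous (V : normedModType R) (u : V -> R) :
  smooth_on setT u -> continuous u.
Proof. by move=> su x; apply: (su 0%N x). Qed.

Lemma smooth_derivable (V : normedModType R) (u : V -> R) x h :
  smooth_on setT u -> derivable u x h.
Proof. by move=> su; apply: diff_derivable; exact: smooth_differentiable. Qed.

Lemma test_function_derive (V : normedModType R) (U : set V) (u : V -> R) (h : V) :
  test_function U u -> test_function U (fun x => 'D_h u x).
Proof.
move=> [su [K [cK KU u0]]]; split; first exact: smooth_derive.
exists K; split => // x nKx.
have oK : open (~` K) by apply: closed_openC; exact: compact_closed.
have -> : 'D_h u x = 'D_h (fun=> 0 : R) x.
  apply: near_eq_derive; apply: filterS (open_nbhs_nbhs (conj oK nKx)) => y; exact: u0.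
exact: derive_cst.
Qed.

Lemma continuous_bounded_compact (V : normedModType R) (K : set V) (u : V -> R) :
  compact K -> continuous u -> exists2 C, 0 <= C & forall x, K x -> `|u x| <= C.
Proof.
move=> cK cu.
have cuK : compact (u @` K).
  by apply: continuous_compact => //; exact: continuous_subspaceT.
have [M [_ uM]] := @compact_bounded R R _ cuK.
exists (`|M| + 1); first by rewrite addr_ge0.
move=> x Kx.
apply: (uM (`|M| + 1)); first by rewrite (le_lt_trans (ler_norm _))// ltrDl.
by exists x.
Qed.

Lemma test_function_bounded (V : normedModType R) (U : set V) (u : V -> R) :
  test_function U u -> exists2 C, 0 <= C & forall x, `|u x| <= C.
Proof.
move=> [su [K [cK KU u0]]].
have [C C0 KC] := continuous_bounded_compact cK (smooth_continuous su).
exists C => // x; have [/KC//|/u0->] := pselect (K x).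
by rewrite normr0.
Qed.

Lemma test_functionD (V : normedModType R) (U : set V) (u v : V -> R) :
  test_function U u -> test_function U v -> test_function U (fun x => u x + v x).
Proof.
move=> [su [K [cK KU u0]]] [sv [L [cL LU v0]]]; split.
  by move=> k; apply: CkD; [exact: su|exact: sv].
exists (K `|` L); split => //; first exact: compactU.
  by move=> x [/KU|/LU].
by move=> x /not_orP[/u0-> /v0->]; rewrite addr0.
Qed.

Lemma test_functionM (V : normedModType R) (U : set V) (u v : V -> R) :
  test_function U u -> smooth_on setT v -> test_function U (fun x => u x * v x).
Proof.
move=> [su [K [cK KU u0]]] sv; split.
  by move=> k; apply: CkM; [exact: su|exact: sv].
by exists K; split => // x /u0 ->; rewrite mul0r.
Qed.

Lemma test_function_cst0 (V : normedModType R) (U : set V) : test_function U (fun=> 0 : R).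
Proof.
split; first by move=> k; exact: Ck_cst.
by exists set0; split => //; exact: compact0.
Qed.

End test_functions.

Section test_functions_rV.
Variables (R : realType) (n : nat).
Local Notation E := 'rV[R]_n.

Lemma compact_in_cube (K : set E) : compact K -> exists2 M, 0 < M & K `<=` cube n M.
Proof.
move=> /compact_bounded[M [_ KM]]; exists (`|M| + 1).
  by rewrite ltr_wpDl.
move=> x Kx i.
have M1 : M < `|M| + 1 by rewrite (le_lt_trans (ler_norm _))// ltrDl.
apply: le_trans (KM (`|M| + 1) M1 x Kx).
have -> : `|x| = mx_norm x by [].
rewrite mx_normrE.
exact: (le_bigmax _ (fun ij : 'I_1 * 'I_n => `|x ij.1 ij.2|) (ord0, i)).
Qed.

Lemma test_function_measurable U (u : E -> R) :
  test_function U u -> measurable_fun setT u.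
Proof.
move=> [su _]; apply: measurable_continuous_rV => // x _.
exact: smooth_continuous.
Qed.

Lemma test_function_integrable U (u : E -> R) :
  test_function U u -> (leb R n).-integrable setT (EFin \o u).
Proof.
move=> tu; have [C C0 uC] := test_function_bounded tu.
have mu := test_function_measurable tu.
move: tu => [su [K [/compact_in_cube[M M0 KM] KU u0]]].
apply: (@integrable_in_cube _ _ M C) => //; first exact: ltW.
by move=> x xM; apply: u0 => /KM.
Qed.

Lemma test_function_C1_in_cube U (u : E -> R) : test_function U u ->
  exists M C, 0 < M /\ C1_in_cube M C u.
Proof.
move=> tu.
have /choice[C HC] (i : 'I_n) : exists C, 0 <= C /\ forall x, `|partial i u x| <= C.
  by have [C C0 h] := test_function_bounded (test_function_derive (basis_vec R i) tu); exists C.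
have sD i := (test_function_derive (basis_vec R i) tu).1.
move: tu => [su [K [cK KU u0]]].
have [M M0 KM] := compact_in_cube cK.
have oK : open (~` K) by apply: closed_openC; exact: compact_closed.
exists M, (\sum_i C i); split => //; split.
- by move=> x i; exact: smooth_derivable.
- by move=> i; exact: (smooth_continuous (sD i)).
- move=> x i; rewrite (le_trans ((HC i).2 x))// (bigD1 i)//= lerDl.
  by apply: sumr_ge0 => j _; exact: (HC j).1.
- move=> x xM; have nK : ~ K x by move=> /KM.
  split; first exact: u0.
  move=> i; rewrite /partial.
  have -> : 'D_(basis_vec R i) u x = 'D_(basis_vec R i) (fun=> 0 : R) x.
    by apply: near_eq_derive; apply: filterS (open_nbhs_nbhs (conj oK nK)) => y; exact: u0.
  exact: derive_cst.
Qed.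

Lemma partialM (u v : E -> R) i x : derivable u x (basis_vec R i) ->
  derivable v x (basis_vec R i) ->
  partial i (fun x => u x * v x) x = u x * partial i v x + partial i u x * v x.
Proof.
by move=> du dv; rewrite /partial deriveM//; congr (_ + _); rewrite mulrC.
Qed.

Variable Omega : set E.
Hypotheses (oO : open Omega).

Let mO : measurable Omega := open_measurable_rV oO.

Lemma test_function_int_setT (u : E -> R) : test_function Omega u ->
  \int[leb R n]_(x in Omega) u x = \int[leb R n]_x u x.
Proof.
move=> [_ [K [_ KU u0]]]; rewrite Rintegral_mkcond; apply: eq_Rintegral => x _.
rewrite /patch; case: ifPn => // /negP xO; rewrite u0// => /KU Ox.
by apply: xO; exact/mem_set.
Qed.

(** The partial derivatives of the product, which has compact support, have
    integral zero. *)
Lemma integration_by_parts (u v : E -> R) (i : 'I_n) :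
  test_function Omega u -> test_function Omega v ->
  \int[leb R n]_(x in Omega) (u x * partial i v x) =
  - \int[leb R n]_(x in Omega) (partial i u x * v x).
Proof.
move=> tu tv.
have tuv := test_functionM tu tv.1.
have t1 : test_function Omega (fun x => u x * partial i v x).
  by apply: test_functionM => //; exact: smooth_derive tv.1.
have t2 : test_function Omega (fun x => partial i u x * v x).
  by apply: test_functionM; [exact: test_function_derive|exact: tv.1].
have i1 := test_function_integrable t1.
have i2 := test_function_integrable t2.
apply/eqP; rewrite -addr_eq0 (test_function_int_setT t1) (test_function_int_setT t2).
rewrite -RintegralD//.
have [M [C [M0 h]]] := test_function_C1_in_cube tuv.
rewrite /Rintegral -[X in _ == X]/(fine 0%E) -(integral_partial_eq0 i M0 h).
apply/eqP; congr fine; apply: eq_integral => x _; rewrite partialM//.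
  exact: smooth_derivable tu.1.
exact: smooth_derivable tv.1.
Qed.

Lemma bounded_integrable (D : set E) (u : E -> R) C :
  measurable D -> (leb R n D < +oo)%E -> measurable_fun D u ->
  (forall x, D x -> `|u x| <= C) -> (leb R n).-integrable D (EFin \o u).
Proof.
move=> mD fD mu uC; apply: measurable_bounded_integrable => //.
exists C; split; first exact: num_real.
by move=> y Cy x Dx; exact: le_trans (uC _ Dx) (ltW Cy).
Qed.

Lemma compact_leb (K : set E) : compact K -> measurable K /\ (leb R n K < +oo)%E.
Proof.
move=> cK; have mK : measurable K.
  rewrite -[K]setCK; apply: measurableC; apply: open_measurable_rV.
  by apply: closed_openC; exact: compact_closed.
by split => //; apply: bounded_leb_lty => //; exact: compact_bounded.
Qed.

Lemma test_function_weak_gradient (u : E -> R) :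
  test_function Omega u -> weak_gradient Omega u (gradient u).
Proof.
move=> tu; split.
- by apply: measurable_funTS; exact: test_function_measurable tu.
- apply: measurable_fun_rV => i.
  rewrite (_ : (fun _ => _) = partial i u); last by apply/funext => x; rewrite mxE.
  apply: measurable_funTS; exact: test_function_measurable (test_function_derive (basis_vec R i) tu).
- move=> K cK KO; have [mK fK] := compact_leb cK.
  split=> [|i].
    apply: (integrableS measurableT) => //; exact: test_function_integrable tu.
  rewrite (_ : (fun _ => _) = EFin \o partial i u); last by apply/funext => x; rewrite mxE.
  apply: (integrableS measurableT) => //.
  exact: test_function_integrable (test_function_derive (basis_vec R i) tu).
- move=> i psi tpsi; rewrite integration_by_parts//; congr (- _).
  by apply: eq_Rintegral => x _; rewrite mxE.
Qed.

End test_functions_rV.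

(** * The fundamental lemma of the calculus of variations *)

Section fundamental_lemma.
Variables (R : realType) (n : nat).
Local Notation E := 'rV[R]_n.

(** A name for the coordinates that can carry their linear structure. *)
Definition entry (i : 'I_n) (x : E) : R := x ord0 i.

Lemma entry_is_linear i : linear (entry i : E -> R^o).
Proof. by move=> a x y; rewrite /entry !mxE. Qed.

HB.instance Definition _ i := GRing.isLinear.Build R E R^o *:%R (entry i) (entry_is_linear i).

Lemma Ck_entry k i (kap : R -> R) : Ck_on [set: R] k kap ->
  Ck_on [set: E] k (fun x => kap (x ord0 i)).
Proof.
move=> kk; apply: (@Ck_comp_linear R R E k (entry i : {linear E -> R^o}) kap) => //.
exact: coord_continuous.
Qed.

Lemma Ck_prod (V : normedModType R) k (I : Type) (s : seq I) (u : I -> V -> R) :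
  (forall i, Ck_on [set: V] k (u i)) -> Ck_on [set: V] k (fun x => \prod_(i <- s) u i x).
Proof.
move=> ku; elim: s => [|i s IH].
  rewrite (_ : (fun x => _) = fun=> 1); first exact: Ck_cst.
  by apply/funext => x; rewrite big_nil.
rewrite (_ : (fun x => _) = fun x => u i x * \prod_(j <- s) u j x).
  exact: CkM.
by apply/funext => x; rewrite big_cons.
Qed.

Definition obox (a b : E) : set E := [set x | forall i, a ord0 i < x ord0 i < b ord0 i].
Definition cbox (a b : E) : set E := [set x | forall i, a ord0 i <= x ord0 i <= b ord0 i].

Lemma cbox_compact a b : compact (cbox a b).
Proof.
have := @rV_compact R n (fun i => `[a ord0 i, b ord0 i]%classic) (fun i => @segment_compact _ _ _).
congr compact; apply/seteqP; split => x /= h i; have := h i; by rewrite in_itv.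
Qed.

Lemma obox_measurable a b : measurable (obox a b).
Proof.
rewrite (_ : obox a b = \bigcap_(i in [set: 'I_n])
   ((fun x : 'rV[R]_n => x ord0 i) @^-1` `]a ord0 i, b ord0 i[)).
  apply: fin_bigcap_measurable => // i _.
  by rewrite -[X in measurable X]setTI; exact: measurable_coord.
by apply/seteqP; split => [x h i _ /=|x h i];
  [rewrite in_itv/=; exact: h|have := h i I; rewrite /= in_itv].
Qed.

(** As [k] grows these functions converge to the indicator of an open interval,
    outside of which they vanish. *)
Definition bump1 (k : nat) (a b y : R) : R := step (k%:R * (y - a)) * step (k%:R * (b - y)).

Lemma Ck_bump1 m k a b : Ck_on [set: R] m (bump1 k a b).
Proof.
apply: CkM.
  apply: (@Ck_comp_real _ _ _ (@step R) (fun x => k%:R * (x - a))); first exact: Ck_step.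
  by apply: CkZ; apply: CkD; [exact: Ck_id|exact: Ck_cst].
apply: (@Ck_comp_real _ _ _ (@step R) (fun x => k%:R * (b - x))); first exact: Ck_step.
by apply: CkZ; apply: CkD; [exact: Ck_cst|apply: CkN; exact: Ck_id].
Qed.

Lemma bump1_ge0 k a b y : 0 <= bump1 k a b y.
Proof. by rewrite mulr_ge0// step_ge0. Qed.

Lemma bump1_le1 k a b y : bump1 k a b y <= 1.
Proof. by rewrite mulr_ile1// ?step_ge0// step_le1. Qed.

Lemma bump1_out k a b y : ~~ (a < y < b) -> bump1 k a b y = 0.
Proof.
rewrite negb_and -!leNgt /bump1 => /orP[h|h].
  by rewrite step_le0 ?mul0r// mulr_ge0_le0// subr_le0.
by rewrite [step (_ * (b - _))]step_le0 ?mulr0// mulr_ge0_le0// subr_le0.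
Qed.

Lemma step_scaled_cvg (y : R) : 0 < y -> \forall k \near \oo, step (k%:R * y) = 1.
Proof.
move=> y0; near=> k; apply: step_ge1.
rewrite -ler_pdivrMr// mul1r.
by near: k; exact: nbhs_infty_ger.
Unshelve. all: by end_near. Qed.

Lemma bump1_in a b y : a < y < b -> \forall k \near \oo, bump1 k a b y = 1.
Proof.
move=> /andP[ay yb].
have h1 : \forall k \near \oo, step (k%:R * (y - a)) = 1.
  by apply: step_scaled_cvg; rewrite subr_gt0.
have h2 : \forall k \near \oo, step (k%:R * (b - y)) = 1.
  by apply: step_scaled_cvg; rewrite subr_gt0.
by apply: filterS2 h1 h2 => k e1 e2; rewrite /bump1 e1 e2 mulr1.
Qed.

Definition bump k (a b x : E) : R := \prod_i bump1 k (a ord0 i) (b ord0 i) (x ord0 i).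

Lemma bump_ge0 k a b x : 0 <= bump k a b x.
Proof. by apply: prodr_ge0 => i _; exact: bump1_ge0. Qed.

Lemma bump_le1 k a b x : bump k a b x <= 1.
Proof. by apply: prodr_ile1 => i _; rewrite bump1_ge0 bump1_le1. Qed.

Lemma bump_out k a b x : ~ obox a b x -> bump k a b x = 0.
Proof.
move=> /existsNP[i /negP h]; rewrite /bump (bigD1 i)//= bump1_out ?mul0r//.
Qed.

Lemma bump_cvg a b x : (fun k => bump k a b x) @ \oo --> (\1_(obox a b) x : R).
Proof.
rewrite indicE; case: (boolP (x \in obox a b)) => [/set_mem h|/negP h]; last first.
  rewrite (_ : (fun _ => _) = fun=> 0); first exact: cvg_cst.
  by apply/funext => k; rewrite bump_out// => ?; apply: h; exact/mem_set.
apply: cvg_near_cst.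
have : \forall k \near \oo, forall i, bump1 k (a ord0 i) (b ord0 i) (x ord0 i) = 1.
  by apply: filter_forall => i; exact: bump1_in.
by apply: filterS => k hk; rewrite /bump big1.
Qed.

Lemma bump_test_function k a b (U : set E) : cbox a b `<=` U -> test_function U (bump k a b).
Proof.
move=> abU; split.
  by move=> m; apply: Ck_prod => i; apply: Ck_entry; exact: Ck_bump1.
exists (cbox a b); split => //; first exact: cbox_compact.
move=> x nx; apply: bump_out => h; apply: nx => i.
by have /andP[/ltW -> /ltW ->] := h i.
Qed.

Lemma obox_generate (A : set E) : measurable A ->
  <<s [set B | exists a b, B = obox a b] >> A.
Proof.
set G := [set B | _].
have sG : sigma_algebra setT <<s G >> by exact: smallest_sigma_algebra.
have gbox z : <<s G >> (rat_box z : set E).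
  apply: sub_sigma_algebra; rewrite /G /=.
  exists (\row_i (ratr (z.1 ord0 i) - (z.2.+1%:R)^-1)), (\row_i (ratr (z.1 ord0 i) + (z.2.+1%:R)^-1)).
  by apply/seteqP; split => x h i; have := h i; rewrite !mxE distrC ltr_distl.
have gopen (U : set E) : open U -> <<s G >> U.
  move=> oU.
  rewrite (_ : U = \bigcup_(i in [set z | rat_box z `<=` U]) rat_box i); last first.
    apply/seteqP; split => [x Ux|x [z /= zU]]; last exact: zU.
    have /rat_box_base[z [zx zU]] : nbhs x U by exact: open_nbhs_nbhs.
    by exists z.
  have := @countType_bigcup_measurable _ (g_sigma_algebraType G) _ [set z | rat_box z `<=` U] (fun z => rat_box z : set E).
  by apply => i _; exact: gbox.
apply: smallest_sub => // B; rewrite -bigcup_seq => -[i _ [C mC <-]].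
rewrite setTI.
have mi : measurable_fun [set: g_sigma_algebraType G] (entry i : g_sigma_algebraType G -> R).
  apply: (measurability _ (RGenOInfty.measurableE R)) => _ [_ [y ->] <-].
  rewrite setTI; apply: gopen.
  have -> : entry i @^-1` `]y, +oo[ = entry i @^-1` [set z | y < z].
    by apply/seteqP; split => x /=; rewrite in_itv/= andbT.
  apply: open_comp; last exact: open_gt.
  by move=> x _; exact: coord_continuous.
by have := mi measurableT C mC; rewrite setTI.
Qed.

Variables (Omega : set E) (oO : open Omega) (u : E -> R).
Hypothesis mu : measurable_fun Omega u.
Hypothesis iu : forall K, compact K -> K `<=` Omega -> (leb R n).-integrable K (EFin \o u).
Hypothesis u0 : forall psi, test_function Omega psi ->
  \int[leb R n]_(x in Omega) (u x * psi x) = 0.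

Let mO : measurable Omega := open_measurable_rV oO.

Let int_box a b : cbox a b `<=` Omega ->
  (\int[leb R n]_(x in obox a b) (u x)%:E = 0)%E.
Proof.
move=> abO; have cab := @cbox_compact a b.
have [mab fab] := compact_leb cab.
have iab := iu cab abO.
have mab' := @obox_measurable a b.
have sub : obox a b `<=` cbox a b.
  by move=> x h i; have /andP[/ltW -> /ltW ->] := h i.
have muc : measurable_fun (cbox a b) u by apply: (measurable_funS mO abO).
have mbump k : measurable_fun (cbox a b) (bump k a b).
  by apply: measurable_funTS; exact: test_function_measurable (bump_test_function k abO).
have [|||||i1 c1] := @dominated_cvg_Rintegral _ _ _ (leb R n) (cbox a b)
  (fun k x => u x * bump k a b x) (fun x => u x * \1_(obox a b) x) (fun x => `|u x|) mab.
- by move=> k; exact: measurable_funM.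
- by apply: measurable_funM => //; exact: measurable_indic.
- exact: integrable_norm.
- apply: aeW => x _ k; rewrite normrM ler_piMr//.
  by rewrite ger0_norm ?bump_ge0 ?bump_le1.
- by apply: aeW => x _; apply: cvgM; [exact: cvg_cst|exact: bump_cvg].
have e1 : \int[leb R n]_(x in cbox a b) (u x * \1_(obox a b) x) = 0.
  apply: (cvg_unique (@Rhausdorff R) c1).
  rewrite (_ : (fun k => _) = fun=> 0); first exact: cvg_cst.
  apply/funext => k; rewrite -[RHS](u0 (bump_test_function k abO)).
  rewrite Rintegral_mkcond [RHS]Rintegral_mkcond; apply: eq_Rintegral => x _.
  rewrite /patch; case: ifPn => [/set_mem/abO/mem_set->//|/negP nx].
  rewrite bump_out ?mulr0; first by case: ifP.
  by move=> /sub h; apply: nx; exact/mem_set.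
have e2 : (\int[leb R n]_(x in cbox a b) (u x * \1_(obox a b) x)%:E =
           \int[leb R n]_(x in obox a b) (u x)%:E)%E.
  rewrite integral_mkcond [RHS]integral_mkcond; apply: eq_integral => x _.
  rewrite /patch indicE; case: (boolP (x \in obox a b)) => [/set_mem/sub/mem_set->|_].
    by rewrite mulr1.
  by rewrite mulr0; case: ifP.
rewrite -e2 -[LHS]fineK; last exact: integrable_fin_num.
by congr EFin.
Qed.

Let ae0_box z : rat_cube z `<=` Omega ->
  {ae leb R n, forall x, rat_box z x -> u x = 0}.
Proof.
move=> zO; set r := (z.2.+1%:R)^-1 : R.
pose a : E := \row_i (ratr (z.1 ord0 i) - r).
pose b : E := \row_i (ratr (z.1 ord0 i) + r).
have zE : rat_box z = obox a b.
  by apply/seteqP; split => x h i; have := h i; rewrite !mxE distrC ltr_distl.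
have cO : cbox a b `<=` Omega.
  apply: subset_trans zO => x h i; have := h i.
  by rewrite !mxE distrC ler_distl.
rewrite zE {zE}; clearbody a b.
have sub : obox a b `<=` cbox a b.
  by move=> x h i; have /andP[/ltW -> /ltW ->] := h i.
have mB := @obox_measurable a b.
have [mC _] := compact_leb (@cbox_compact a b).
have iB : (leb R n).-integrable (obox a b) (EFin \o u).
  by apply: (integrableS mC) => //; apply: iu => //; exact: cbox_compact.
have iBA A : measurable A -> (leb R n).-integrable (A `&` obox a b) (EFin \o u).
  by move=> mA; apply: (integrableS mB) => //; exact: measurableI.
have key A : measurable A -> (\int[leb R n]_(x in A `&` obox a b) (u x)%:E = 0)%E.
  move=> mA; have gA := obox_generate mA; move: mA gA => _.
  apply: (@dynkin_induction _ _ [set B | exists a b, B = obox a b]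
    (fun A => (\int[leb R n]_(x in A `&` obox a b) (u x)%:E = 0)%E)).
  - apply/seteqP; split; first exact: obox_generate.
    apply: smallest_sub; first exact: sigma_algebra_measurable.
    by move=> _ [c [d ->]]; exact: obox_measurable.
  - move=> _ _ [c [d ->]] [c' [d' ->]].
    exists (\row_i Num.max (c ord0 i) (c' ord0 i)), (\row_i Num.min (d ord0 i) (d' ord0 i)).
    apply/seteqP; split => x.
      move=> [h1 h2] i; have /andP[h3 h4] := h1 i; have /andP[h5 h6] := h2 i.
      by rewrite !mxE gt_max lt_min h3 h4 h5.
    move=> h; split => i; have := h i; rewrite !mxE gt_max lt_min;
      by move=> /andP[/andP[a1 a2] /andP[a3 a4]]; rewrite ?a1 ?a2 ?a3 ?a4.
  - by rewrite setTI; exact: int_box.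
  - move=> _ [c [d ->]].
    rewrite (_ : obox c d `&` obox a b = obox (\row_i Num.max (c ord0 i) (a ord0 i)) (\row_i Num.min (d ord0 i) (b ord0 i))).
      apply: int_box; apply: subset_trans cO => x h i; have := h i.
      by rewrite !mxE ge_max le_min => /andP[/andP[_ ->] /andP[_ ->]].
    apply/seteqP; split => x.
      move=> [h1 h2] i; have /andP[h3 h4] := h1 i; have /andP[h5 h6] := h2 i.
      by rewrite !mxE gt_max lt_min h3 h4 h5.
    move=> h; split => i; have := h i; rewrite !mxE gt_max lt_min;
      by move=> /andP[/andP[a1 a2] /andP[a3 a4]]; rewrite ?a1 ?a2 ?a3 ?a4.
  - move=> S mS hS.
    have := int_box cO.
    have e : obox a b = (S `&` obox a b) `|` (~` S `&` obox a b).
      by rewrite -setIUl setUv setTI.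
    rewrite {1}e integral_setU.
    + by rewrite hS add0e.
    + exact: measurableI.
    + by apply: measurableI => //; exact: measurableC.
    + by rewrite -e; exact: measurable_int iB.
    + by rewrite disj_set2E; apply/eqP; rewrite setIACA setICr set0I.
  - move=> F mF tF hF.
    rewrite setI_bigcupl integral_bigcup.
    + by apply: eseries0 => i _ _; exact: hF.
    + exact: trivIset_setIr.
    + by move=> k; exact: measurableI.
    + by rewrite -setI_bigcupl; apply: iBA; exact: bigcup_measurable.
have := @integral_ae_eq _ _ _ (leb R n) (obox a b) mB (cst 0%E) (EFin \o u) iB (measurable_cst _).
have h A : A `<=` obox a b -> measurable A ->
    (\int[leb R n]_(x in A) (EFin \o u) x = \int[leb R n]_(x in A) cst 0 x)%E.
  move=> sA mA; rewrite integral0 -[RHS](key A mA); congr (integral _ _ _).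
  by apply/esym/setIidPl.
move=> /(_ h); apply: filterS => x /= hx /hx [].
by move=> ->.
Qed.

(** Products of one-dimensional bumps converge to the indicators of open boxes,
    over which [u] therefore has integral zero. Boxes generate the Borel sets,
    so that [u] vanishes almost everywhere in each compact cube contained in
    [Omega], and countably many such cubes cover [Omega]. *)
Lemma ae_eq0_of_test_functions : {ae leb R n, forall x, Omega x -> u x = 0}.
Proof.
pose I := ('rV[rat]_n * nat)%type.
pose P (i : nat) x := if unpickle i is Some z then
   (rat_cube (z : I) `<=` Omega -> rat_box z x -> u x = 0) else True.
have : forall i, {ae leb R n, forall x, P i x}.
  move=> i; rewrite /P; case: (unpickle i) => [z|]; last exact: aeW.
  have [zO|nzO] := pselect (rat_cube z `<=` Omega).
    by apply: filterS (ae0_box zO) => x h _.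
  exact: aeW.
move=> /ae_foralln; apply: filterS => x h Ox.
have /rat_cube_nbhs[z [zx zO]] : nbhs x Omega by exact: open_nbhs_nbhs.
by have := h (pickle z); rewrite /P pickleK; apply.
Qed.

End fundamental_lemma.

(** * Euclidean norm and modulars with variable exponent *)

Section cvg0.
Variable R : realType.

Lemma ge0_cvg0P (T : Type) (F : set_system T) {FF : Filter F} (f : T -> \bar R) :
  (forall x, 0 <= f x)%E ->
  f @ F --> 0%E <-> forall e : R, 0 < e -> \forall x \near F, (f x <= e%:E)%E.
Proof.
move=> f0; split=> [/fine_cvgP[fin /cvgrPdist_le cv] e e0|h].
  have := cv e e0; apply: filterS2 fin => x fx.
  rewrite sub0r normrN ger0_norm ?fine_ge0//= => h.
  by rewrite -(fineK fx) lee_fin.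
apply/fine_cvgP; split.
  apply: filterS (h 1 ltr01) => x h1; rewrite ge0_fin_numE//.
  by rewrite (le_lt_trans h1)// ltry.
apply/cvgrPdist_le => e e0; apply: filterS (h e e0) => x hx.
have fx : f x \is a fin_num by rewrite ge0_fin_numE// (le_lt_trans hx)// ltry.
by rewrite sub0r normrN ger0_norm ?fine_ge0//= -lee_fin fineK.
Qed.

End cvg0.

Section powR_bounds.
Variable R : realType.

Lemma powR_bound (a c p P : R) : 0 <= a -> a <= c -> 1 <= c -> 0 <= p -> p <= P ->
  a `^ p <= c `^ P.
Proof.
move=> a0 ac c1 p0 pP; apply: (@le_trans _ _ (c `^ p)).
  by apply: ge0_ler_powR => //; rewrite nnegrE (le_trans a0).
exact: ler_powR.
Qed.

Lemma measurable_powR2 d (T : measurableType d) (D : set T) (f p : T -> R) :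
  measurable D ->
  measurable_fun D f -> measurable_fun D p -> (forall x, D x -> 0 < p x) ->
  (forall x, D x -> 0 <= f x) ->
  measurable_fun D (fun x => f x `^ p x).
Proof.
move=> mD mf mp p0 f0.
apply: (@eq_measurable_fun _ _ _ _ _ (fun x => \1_(`]0, +oo[%classic) (f x) * expR (p x * ln (f x)))).
  move=> x /set_mem Dx; rewrite /powR indicE.
  have := f0 x Dx; rewrite le_eqVlt => /predU1P[<-|fx0].
    by rewrite eqxx gt_eqF ?p0// memNset ?mul0r//= in_itv/= ltxx.
  by rewrite gt_eqF// mem_set ?mul1r//= in_itv/= fx0.
apply: measurable_funM.
  exact: (measurableT_comp (measurable_indic _) mf).
apply: (measurableT_comp (@measurable_expR R)).
apply: measurable_funM => //.
exact: (measurableT_comp (@measurable_ln R)).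
Qed.

End powR_bounds.

Section euclidean_norm.
Variables (R : realType) (n : nat).
Local Notation E := 'rV[R]_n.

Lemma dotp_ge0 (x : E) : 0 <= dotp x x.
Proof. by apply: sumr_ge0 => i _; rewrite -expr2 sqr_ge0. Qed.

Lemma enorm_ge0 (x : E) : 0 <= enorm x.
Proof. exact: sqrtr_ge0. Qed.

Lemma sqr_enorm (x : E) : enorm x ^+ 2 = dotp x x.
Proof. by rewrite sqr_sqrtr// dotp_ge0. Qed.

Lemma dotpC (x y : E) : dotp x y = dotp y x.
Proof. by apply: eq_bigr => i _; rewrite mulrC. Qed.

Lemma dotpDl (x y z : E) : dotp (x + y) z = dotp x z + dotp y z.
Proof. by rewrite /dotp -big_split; apply: eq_bigr => i _; rewrite mxE mulrDl. Qed.

Lemma dotpDr (x y z : E) : dotp z (x + y) = dotp z x + dotp z y.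
Proof. by rewrite dotpC dotpDl !(dotpC z). Qed.

Lemma dotpZl a (x y : E) : dotp (a *: x) y = a * dotp x y.
Proof. by rewrite /dotp mulr_sumr; apply: eq_bigr => i _; rewrite mxE mulrA. Qed.

Lemma dotpZr a (x y : E) : dotp x (a *: y) = a * dotp x y.
Proof. by rewrite dotpC dotpZl dotpC. Qed.

Lemma enormZ a (x : E) : enorm (a *: x) = `|a| * enorm x.
Proof.
by rewrite /enorm dotpZl dotpZr mulrA -expr2 sqrtrM ?sqr_ge0// sqrtr_sqr.
Qed.

Lemma enorm0_eq0 (x : E) : enorm x = 0 -> x = 0.
Proof.
move=> x0; have : dotp x x = 0 by rewrite -sqr_enorm x0 expr0n.
move/psumr_eq0P => h; apply/rowP => i; rewrite mxE; apply/eqP.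
rewrite -sqrf_eq0 expr2; apply/eqP; apply: h => // j _.
by rewrite -expr2 sqr_ge0.
Qed.

Lemma cauchy_schwarz_dotp (x y : E) : dotp x y <= enorm x * enorm y.
Proof.
have [x0|xn0] := eqVneq (enorm x) 0.
  rewrite x0 mul0r (enorm0_eq0 x0) /dotp big1// => i _.
  by rewrite mxE mul0r.
have [y0|yn0] := eqVneq (enorm y) 0.
  rewrite y0 mulr0 (enorm0_eq0 y0) /dotp big1// => i _.
  by rewrite mxE mulr0.
have xp : 0 < enorm x by rewrite lt_def xn0 enorm_ge0.
have yp : 0 < enorm y by rewrite lt_def yn0 enorm_ge0.
have := dotp_ge0 (enorm y *: x - enorm x *: y).
rewrite -scaleNr dotpDl !dotpDr !dotpZl !dotpZr (dotpC y x) -!sqr_enorm => h.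
have : 0 <= (2 * (enorm x * enorm y)) * (enorm x * enorm y - dotp x y).
  by apply: le_trans h _; rewrite le_eqVlt; apply/orP; left; apply/eqP; ring.
by rewrite pmulr_rge0 ?subr_ge0// !mulr_gt0.
Qed.

Lemma enorm_triangle (x y : E) : enorm (x + y) <= enorm x + enorm y.
Proof.
rewrite -(@ler_pXn2r _ 2)// ?nnegrE ?addr_ge0 ?enorm_ge0//.
rewrite sqr_enorm dotpDl !dotpDr -!sqr_enorm (dotpC y x).
have := cauchy_schwarz_dotp x y; nra.
Qed.

Lemma entry_le_enorm (x : E) i : `|x ord0 i| <= enorm x.
Proof.
rewrite -(@ler_pXn2r _ 2)// ?nnegrE ?enorm_ge0// sqr_enorm real_normK ?num_real//.
rewrite /dotp (bigD1 i)//= expr2 lerDl; apply: sumr_ge0 => j _.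
by rewrite -expr2 sqr_ge0.
Qed.

Lemma norm_dotp_le (x y : E) : `|dotp x y| <= enorm x * enorm y.
Proof.
rewrite ler_norml cauchy_schwarz_dotp andbT.
have := cauchy_schwarz_dotp (- x) y.
by rewrite -scaleN1r dotpZl enormZ normrN normr1 mul1r mulN1r lerNl.
Qed.

Lemma measurable_enorm d (T : measurableType d) (D : set T) (g : T -> E) :
  measurable_fun D g -> measurable_fun D (fun x => enorm (g x)).
Proof.
move=> mg; apply: (@measurableT_comp _ _ _ _ _ _ (@Num.sqrt R)).
  by apply: continuous_measurable_fun; exact: sqrt_continuous.
apply: measurable_sum => i; apply: measurable_funM;
  exact: (measurableT_comp (@measurable_coord R n i) mg).
Qed.

Lemma measurable_dotp d (T : measurableType d) (D : set T) (f g : T -> E) :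
  measurable_fun D f -> measurable_fun D g -> measurable_fun D (fun x => dotp (f x) (g x)).
Proof.
move=> mf mg; apply: measurable_sum => i; apply: measurable_funM.
  exact: (measurableT_comp (@measurable_coord R n i) mf).
exact: (measurableT_comp (@measurable_coord R n i) mg).
Qed.

End euclidean_norm.

(** The modular of [u / l] in [L^p(x)]; the Luxemburg norm of [u] is at most [l]
    when it is at most one.  All estimates are carried out on the modular. *)
HB.lock Definition modular (R : realType) (N : nat) (Omega : set 'rV[R]_N)
    (p : 'rV[R]_N -> R) (l : R) (u : 'rV[R]_N -> R) : \bar R :=
  (\int[leb R N]_(x in Omega) ((`|u x| / l) `^ p x)%:E)%E.

Lemma modularE (R : realType) (N : nat) (Omega : set 'rV[R]_N) p l u :
  modular Omega p l u =
  (\int[leb R N]_(x in Omega) ((`|u x| / l) `^ p x)%:E)%E.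
Proof. by rewrite modular.unlock. Qed.

Section modular.
Variables (R : realType) (N : nat).
Local Notation E := 'rV[R]_N.
Variables (Omega : set E) (p : E -> R) (P : R).
Hypotheses (mO : measurable Omega) (fO : (leb R N Omega < +oo)%E).
Hypotheses (mp : measurable_fun Omega p) (p1 : forall x, Omega x -> 1 <= p x <= P).
Implicit Types (u v w : E -> R) (l : R).

Local Notation modular := (modular Omega p).

Let p0 x : Omega x -> 0 < p x.
Proof. by move=> /p1 /andP[h _]; exact: lt_le_trans h. Qed.

Lemma measurable_modular l u : measurable_fun Omega u -> 0 < l ->
  measurable_fun Omega (fun x => (`|u x| / l) `^ p x).
Proof.
move=> mu l0; apply: measurable_powR2 => //.
  apply: measurable_funM => //; exact: (measurableT_comp (@normr_measurable R setT) mu).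
by move=> x _; rewrite divr_ge0// ltW.
Qed.

Lemma modular_le l l' u v : 0 < l -> 0 < l' ->
  {ae leb R N, forall x, Omega x -> `|u x| / l <= `|v x| / l'} ->
  (modular l u <= modular l' v)%E.
Proof.
move=> l0 l0' uv; rewrite !modularE; apply: ge0_le_integral_ae.
- by move=> x _; rewrite lee_fin powR_ge0.
- by move=> x _; rewrite lee_fin powR_ge0.
apply: filterS uv => x h Ox; rewrite lee_fin.
apply: ge0_ler_powR; first exact/ltW/p0.
- by rewrite nnegrE divr_ge0// ltW.
- by rewrite nnegrE divr_ge0// ltW.
- exact: h.
Qed.

Lemma luxemburg_lt l u : (luxemburg Omega p u < l%:E)%E -> 0 < l /\ (modular l u <= 1)%E.
Proof.
move=> /ereal_inf_lt[_ [k [k0 uk] <-]]; rewrite lte_fin => kl.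
have l0 := lt_trans k0 kl; split; first exact: l0.
rewrite -modularE in uk; apply: (le_trans _ uk).
apply: modular_le => //; apply: aeW => x _.
by rewrite ler_wpM2l// lef_pV2 ?posrE// ltW.
Qed.

Lemma luxemburg_le l u : 0 < l -> (modular l u <= 1)%E -> (luxemburg Omega p u <= l%:E)%E.
Proof. by move=> l0 ul; apply: ge_ereal_inf; exists l%:E => //; exists l => //; split; rewrite -?modularE. Qed.

Lemma luxemburg_ge0 u : (0 <= luxemburg Omega p u)%E.
Proof. by apply: le_ereal_inf_tmp => _ [l [l0 _] <-]; rewrite lee_fin ltW. Qed.

(** The sum is at most twice its larger term, and another factor [2] halves the
    two modulars, since [1 <= p]. *)
Lemma modular_add l u v w : 0 < l -> measurable_fun Omega u -> measurable_fun Omega v ->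
  {ae leb R N, forall x, Omega x -> `|w x| <= `|u x| + `|v x|} ->
  (modular l u <= 1)%E -> (modular l v <= 1)%E -> (modular (4 * l) w <= 1)%E.
Proof.
rewrite !modularE => l0 mu mv wuv ul vl.
have half (k : E -> R) x : Omega x -> ((`|k x| / (2 * l)) `^ p x <= 2^-1 * (`|k x| / l) `^ p x).
  move=> Ox; have -> : `|k x| / (2 * l) = 2^-1 * (`|k x| / l).
    by rewrite invfM mulrCA.
  rewrite powRM ?divr_ge0//; last exact: ltW.
  rewrite ler_wpM2r ?powR_ge0//.
  rewrite -[leRHS]powRr1//; apply: ger_powR; last by have /andP[] := p1 Ox.
  by rewrite invr_gt0 ltr0n/= invf_le1// ler1n.
have l40 : 0 < 4 * l by rewrite mulr_gt0.
pose h x := ((2^-1)%:E * ((`|u x| / l) `^ p x)%:E + (2^-1)%:E * ((`|v x| / l) `^ p x)%:E)%E.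
have mh (k : E -> R) : measurable_fun Omega k ->
    measurable_fun Omega (fun x => ((`|k x| / l) `^ p x)%:E).
  by move=> mk; apply/measurable_EFinP; exact: measurable_modular.
apply: (@le_trans _ _ (\int[leb R N]_(x in Omega) h x)%E).
  apply: ge0_le_integral_ae.
  - by move=> x _; rewrite lee_fin powR_ge0.
  - by move=> x _; rewrite adde_ge0// lee_fin mulr_ge0// powR_ge0.
  apply: filterS wuv => x hw Ox; rewrite /h -!EFinM -EFinD lee_fin.
  have hu := half u _ Ox; have hv := half v _ Ox.
  apply: (le_trans _ (lerD hu hv)).
  have wmax : `|w x| / (4 * l) <= Num.max (`|u x| / (2 * l)) (`|v x| / (2 * l)).
    have e k : k / (2 * l) = (2 * k) / (4 * l).
      by field; rewrite gt_eqF.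
    have i0 : 0 <= (4 * l)^-1 by rewrite invr_ge0 ltW.
    have hwx := hw Ox; rewrite !e le_max.
    have [uv|uv] := leP `|u x| `|v x|; apply/orP; [right|left];
      apply: ler_wpM2r => //; lra.
  have pp := ltW (p0 Ox).
  apply: (@le_trans _ _ ((Num.max (`|u x| / (2 * l)) (`|v x| / (2 * l))) `^ p x)).
    have a0 : 0 <= `|u x| / (2 * l) by rewrite divr_ge0// mulr_ge0// ltW.
    have w0 : 0 <= `|w x| / (4 * l) by rewrite divr_ge0// ltW.
    by apply: ge0_ler_powR => //; rewrite nnegrE// le_max a0.
  have [uv|uv] := leP (`|u x| / (2 * l)) (`|v x| / (2 * l)).
    by rewrite lerDr powR_ge0.
  by rewrite lerDl powR_ge0.
rewrite ge0_integralD//; first last.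
- by apply: measurable_funeM; exact: mh.
- by move=> x _; rewrite mule_ge0// lee_fin powR_ge0.
- by apply: measurable_funeM; exact: mh.
- by move=> x _; rewrite mule_ge0// lee_fin powR_ge0.
rewrite !ge0_integralZl_EFin//; first last.
- exact: mh.
- by move=> x _; rewrite lee_fin powR_ge0.
- exact: mh.
- by move=> x _; rewrite lee_fin powR_ge0.
have e : (1%:E = (2^-1)%:E * 1%:E + (2^-1)%:E * 1%:E :> \bar R)%E.
  by rewrite -!EFinM -EFinD; congr EFin; lra.
have h2 : (0 <= (2^-1)%:E :> \bar R)%E by rewrite lee_fin.
rewrite [leRHS]e; apply: leeD; [exact: (lee_wpmul2l h2 ul)|exact: (lee_wpmul2l h2 vl)].
Qed.

Lemma modular_scale l u w C : 0 < l -> 0 < C ->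
  {ae leb R N, forall x, Omega x -> `|w x| <= C * `|u x|} ->
  (modular l u <= 1)%E -> (modular (C * l) w <= 1)%E.
Proof.
move=> l0 C0 wu; apply: le_trans; apply: modular_le => //; first exact: mulr_gt0.
apply: filterS wu => x h Ox; rewrite ler_pdivrMr ?mulr_gt0//.
have -> : `|u x| / l * (C * l) = C * `|u x| by field; rewrite gt_eqF.
exact: h.
Qed.

(** This embedding of [L^p(x)] in [L^1] rests on [t <= 1 + t ^ p]. *)
Lemma modular_integral l u : 0 < l -> measurable_fun Omega u -> (modular l u <= 1)%E ->
  (\int[leb R N]_(x in Omega) (`|u x|)%:E <= l%:E * (leb R N Omega + 1))%E.
Proof.
rewrite modularE => l0 mu ul.
have mm := measurable_modular mu l0.
apply: (@le_trans _ _ (\int[leb R N]_(x in Omega) (l%:E * (1 + ((`|u x| / l) `^ p x)%:E)))%E).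
  apply: ge0_le_integral_ae.
  - by move=> x _; rewrite lee_fin.
  - move=> x _; apply: mule_ge0; first by rewrite lee_fin ltW.
    by apply: adde_ge0 => //; rewrite lee_fin powR_ge0.
  apply: aeW => x Ox; rewrite -EFinD -EFinM lee_fin -ler_pdivrMl// mulrC.
  set t := _ / l; have t0 : 0 <= t by rewrite divr_ge0// ltW.
  have [t1|t1] := leP t 1; first by rewrite (le_trans t1)// lerDl powR_ge0.
  rewrite ler_wpDl// -[leLHS]powRr1//; apply: ler_powR; first exact: ltW.
  by have /andP[] := p1 Ox.
rewrite ge0_integralZl_EFin//; first last.
- exact: ltW.
- apply: emeasurable_funD; first exact: measurable_cst.
  exact/measurable_EFinP.
- by move=> x _; rewrite adde_ge0// lee_fin powR_ge0.
apply: lee_wpmul2l; first by rewrite lee_fin ltW.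
rewrite ge0_integralD//; first last.
- exact/measurable_EFinP.
- by move=> x _; rewrite lee_fin powR_ge0.
rewrite integral_cst// mul1e; exact: leeD.
Qed.

Lemma modular_integrable l u : 0 < l -> measurable_fun Omega u -> (modular l u <= 1)%E ->
  (leb R N).-integrable Omega (EFin \o u).
Proof.
move=> l0 mu ul; apply/integrableP; split; first exact/measurable_EFinP.
apply: le_lt_trans (modular_integral l0 mu ul) _.
have /fineK <- : leb R N Omega \is a fin_num by rewrite ge0_fin_numE.
by rewrite -EFinD -EFinM ltry.
Qed.

(** Convergence to [0] in the Luxemburg norm, stated with modulars in order to
    avoid the infimum. *)
Definition Lpx_null (u : nat -> E -> R) :=
  forall l, 0 < l -> \forall k \near \oo, (modular l (u k) <= 1)%E.
Definition L1_null (u : nat -> E -> R) :=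
  forall e, 0 < e -> \forall k \near \oo,
    (\int[leb R N]_(x in Omega) (`|u k x|)%:E <= e%:E)%E.

Lemma Lpx_null_L1 (u_ : nat -> E -> R) : (forall k, measurable_fun Omega (u_ k)) ->
  Lpx_null u_ -> L1_null u_.
Proof.
move=> mu nu e e0.
have L0 : (0 <= leb R N Omega)%E by [].
have Lf : leb R N Omega \is a fin_num by rewrite ge0_fin_numE.
pose L := fine (leb R N Omega) + 1.
have Lp : 0 < L by rewrite ltr_wpDl// fine_ge0.
apply: filterS (nu (e / L) (divr_gt0 e0 Lp)) => k hk.
apply: le_trans (modular_integral (divr_gt0 e0 Lp) (mu k) hk) _.
by rewrite -(fineK Lf) -EFinD -EFinM lee_fin divfK// gt_eqF.
Qed.

Lemma Lpx_null_add (u_ v_ w_ : nat -> E -> R) : (forall k, measurable_fun Omega (u_ k)) ->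
  (forall k, measurable_fun Omega (v_ k)) ->
  (forall k x, Omega x -> `|w_ k x| <= `|u_ k x| + `|v_ k x|) ->
  Lpx_null u_ -> Lpx_null v_ -> Lpx_null w_.
Proof.
move=> mu mv wuv nu nv l l0.
have l40 : 0 < l / 4 by rewrite divr_gt0.
have e : l = 4 * (l / 4) by rewrite mulrC divfK.
apply: filterS2 (nu _ l40) (nv _ l40) => k h1 h2; rewrite e.
by apply: (@modular_add _ (u_ k) (v_ k)) => //; apply: aeW => x; exact: wuv.
Qed.

Lemma Lpx_null_scale (u_ w_ : nat -> E -> R) C : 0 < C ->
  (forall k x, Omega x -> `|w_ k x| <= C * `|u_ k x|) ->
  Lpx_null u_ -> Lpx_null w_.
Proof.
move=> C0 wu nu l l0; have lC0 : 0 < l / C by rewrite divr_gt0.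
have e : l = C * (l / C) by rewrite mulrC divfK// gt_eqF.
apply: filterS (nu _ lC0) => k h; rewrite e.
by apply: modular_scale h => //; apply: aeW => x; exact: wu.
Qed.

(** Bounded factors that converge to [0] in [L^1] carry a fixed element of
    [L^p(x)] to [0]: where [|G| <= k] the product is dominated by the factor,
    and the part of [G] where [|G| > k] is small for [k] large. *)
Lemma Lpx_null_mul (m_ : nat -> E -> R) (G : E -> R) (K l0 : R) :
  (forall k, measurable_fun Omega (m_ k)) -> (forall k x, Omega x -> `|m_ k x| <= K) ->
  L1_null m_ -> measurable_fun Omega G -> 0 < l0 -> (modular l0 G <= 1)%E ->
  Lpx_null (fun k x => m_ k x * G x).
Proof.
rewrite modularE => mm mK nm mG l00 Gl l l_gt0.
have [K1 [K1_ge1 mK1]] : exists K1, 1 <= K1 /\ forall k x, Omega x -> `|m_ k x| <= K1.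
  exists (Num.max 1 K); split; first by rewrite le_max lexx.
  by move=> k x Ox; rewrite le_max (mK k x Ox) orbT.
have K10 : 0 < K1 by exact: lt_le_trans K1_ge1.
pose H x := (`|G x| / l0) `^ p x.
have mH : measurable_fun Omega H by exact: measurable_modular.
have H0 x : 0 <= H x by exact: powR_ge0.
have iH : (leb R N).-integrable Omega (EFin \o H).
  apply/integrableP; split; first exact/measurable_EFinP.
  rewrite (eq_integral (EFin \o H)); first by apply: le_lt_trans Gl _; rewrite ltry.
  by move=> x _ /=; rewrite ger0_norm.
pose B := (Num.max 1 (K1 * l0 / l)) `^ P.
have B0 : 0 < B by rewrite powR_gt0// lt_max ltr01.
pose tail k x := H x * \1_(`]k%:R, +oo[%classic) `|G x|.
have mabsG : measurable_fun Omega (fun x => `|G x|).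
  exact: (measurableT_comp (@normr_measurable R setT) mG).
have mtail k : measurable_fun Omega (tail k).
  by apply: measurable_funM => //; exact: (measurableT_comp (measurable_indic _) mabsG).
have tail0 k x : 0 <= tail k x by rewrite mulr_ge0// indicE.
have tailH k x : tail k x <= H x by rewrite ler_piMr// indicE; case: (_ \in _).
have [|||||_ ctail] := @dominated_cvg_Rintegral _ _ _ (leb R N) Omega tail (cst 0) H mO.
- exact: mtail.
- exact: measurable_cst.
- exact: iH.
- by apply: aeW => x _ k; rewrite ger0_norm.
- apply: aeW => x _; apply: cvg_near_cst.
  have : \forall k \near \oo, `|G x| <= (k%:R : R) by exact: nbhs_infty_ger.
  apply: filterS => k hk; rewrite /tail indicE memNset ?mulr0//= in_itv/= andbT.
  by rewrite ltNge hk.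
have eB : 0 < (2 * B)^-1 by rewrite invr_gt0 mulr_gt0.
have [k hk] : exists k, (\int[leb R N]_(x in Omega) (tail k x)%:E <= ((2 * B)^-1)%:E)%E.
  move/cvgrPdist_le : ctail => /(_ _ eB)[k _ /(_ _ (leqnn k))].
  have -> : \int[leb R N]_(x in Omega) (cst 0 x : R) = 0.
    by rewrite /Rintegral integral0.
  rewrite sub0r normrN => h; exists k.
  have it : (leb R N).-integrable Omega (EFin \o tail k).
    apply: le_integrable iH => //; first exact/measurable_EFinP.
    by move=> x _; rewrite lee_fin !ger0_norm.
  rewrite -(fineK (integrable_fin_num mO it)) lee_fin.
  exact: le_trans (ler_norm _) h.
pose A := K1 `^ P * (Num.max 1 (k%:R / l)) `^ P.
have A0 : 0 < A by rewrite mulr_gt0// powR_gt0// lt_max ltr01.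
have eA : 0 < (2 * A)^-1 by rewrite invr_gt0 mulr_gt0.
apply: filterS (nm _ eA) => j hj; rewrite modularE.
have mabsm : measurable_fun Omega (fun x => `|m_ j x|).
  exact: (measurableT_comp (@normr_measurable R setT) (mm j)).
apply: (@le_trans _ _ (\int[leb R N]_(x in Omega) (A%:E * (`|m_ j x|)%:E + B%:E * (tail k x)%:E))%E).
  apply: ge0_le_integral_ae.
  - by move=> x _; rewrite lee_fin powR_ge0.
  - by move=> x _; rewrite adde_ge0// mule_ge0// lee_fin// ltW.
  apply: aeW => x Ox; rewrite -!EFinM -EFinD lee_fin normrM.
  have [p1x pPx] := andP (p1 Ox); have p0x := ltW (p0 Ox).
  have mj := mK1 j x Ox.
  have [Gk|Gk] := leP `|G x| k%:R.
    apply: ler_wpDr; first by rewrite mulr_ge0// ltW.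
    have -> : `|m_ j x| * `|G x| / l = `|m_ j x| * (`|G x| / l) by rewrite mulrA.
    rewrite powRM//; last by rewrite divr_ge0// ltW.
    have h1 : (`|G x| / l) `^ p x <= (Num.max 1 (k%:R / l)) `^ P.
      apply: powR_bound => //.
      - by rewrite divr_ge0// ltW.
      - by rewrite le_max ler_wpM2r ?orbT// invr_ge0 ltW.
      - by rewrite le_max lexx.
    have h2 : `|m_ j x| `^ p x <= `|m_ j x| * K1 `^ P.
      have [->|m0] := eqVneq (`|m_ j x|) 0.
        by rewrite powR0 ?mul0r// gt_eqF// p0.
      rewrite -mulr_powRB1// ?p0// ler_wpM2l//.
      apply: powR_bound => //; first by rewrite subr_ge0.
      by rewrite lerBlDr (le_trans pPx)// lerDl.
    have -> : A * `|m_ j x| = (`|m_ j x| * K1 `^ P) * Num.max 1 (k%:R / l) `^ P.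
      by rewrite /A; ring.
    by apply: ler_pM => //; rewrite ?powR_ge0.
  apply: ler_wpDl; first by rewrite mulr_ge0// ltW.
  rewrite /tail indicE mem_set ?mulr1; last by rewrite /= in_itv/= Gk.
  apply: (@le_trans _ _ ((K1 * l0 / l * (`|G x| / l0)) `^ p x)).
    apply: ge0_ler_powR => //.
    - by rewrite nnegrE divr_ge0 ?mulr_ge0// ltW.
    - by rewrite nnegrE mulr_ge0// divr_ge0// ?mulr_ge0// ltW.
    rewrite (_ : K1 * l0 / l * (`|G x| / l0) = K1 * `|G x| / l); last first.
      by field; rewrite !gt_eqF.
    by apply: ler_wpM2r; [rewrite invr_ge0 ltW|exact: ler_wpM2r].
  have B1 : 0 <= K1 * l0 / l by rewrite divr_ge0// ?mulr_ge0// ltW.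
  rewrite powRM//; last by rewrite divr_ge0// ltW.
  apply: ler_wpM2r; first exact: powR_ge0.
  by apply: powR_bound => //; rewrite le_max lexx// orbT.
rewrite ge0_integralD//; first last.
- by apply: measurable_funeM; exact/measurable_EFinP.
- by move=> x _; rewrite mule_ge0// lee_fin// ltW.
- by apply: measurable_funeM; exact/measurable_EFinP.
- by move=> x _; rewrite mule_ge0// lee_fin// ltW.
have Z1 : (\int[leb R N]_(x in Omega) (A%:E * (`|m_ j x|)%:E) = A%:E * \int[leb R N]_(x in Omega) (`|m_ j x|)%:E)%E.
  by apply: ge0_integralZl_EFin => //; [exact/measurable_EFinP|exact: ltW].
have Z2 : (\int[leb R N]_(x in Omega) (B%:E * (tail k x)%:E) = B%:E * \int[leb R N]_(x in Omega) (tail k x)%:E)%E.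
  by apply: ge0_integralZl_EFin => //; [by move=> x _; rewrite lee_fin|exact/measurable_EFinP|exact: ltW].
rewrite Z1 Z2.
have e : (1%:E = A%:E * ((2 * A)^-1)%:E + B%:E * ((2 * B)^-1)%:E :> \bar R)%E.
  by rewrite -!EFinM -EFinD; congr EFin; field; rewrite !gt_eqF.
have A0' : (0 <= A%:E)%E by rewrite lee_fin ltW.
have B0' : (0 <= B%:E)%E by rewrite lee_fin ltW.
by rewrite [leRHS]e; apply: leeD; [exact: (lee_wpmul2l A0' hj)|exact: (lee_wpmul2l B0' hk)].
Qed.

End modular.

(** * Weak gradients and W0 *)

Section weak_gradients.
Variables (R : realType) (N : nat).
Local Notation E := 'rV[R]_N.
Variables (Omega : set E).
Hypotheses (oO : open Omega).
Let mO : measurable Omega := open_measurable_rV oO.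

Definition locally_integrable (u : E -> R) :=
  forall K, compact K -> K `<=` Omega -> (leb R N).-integrable K (EFin \o u).

Lemma loc_test_integrable (u psi : E -> R) : measurable_fun Omega u ->
  locally_integrable u -> test_function Omega psi ->
  (leb R N).-integrable Omega (EFin \o (fun x => u x * psi x)).
Proof.
move=> mu iu tpsi; have [C C0 psiC] := test_function_bounded tpsi.
have mpsi := test_function_measurable tpsi.
move: tpsi => [_ [K [cK KO psi0]]]; have [mK fK] := compact_leb cK.
have iK : (leb R N).-integrable K (EFin \o (fun x => u x * psi x)).
  have iC := integrableZl mK C (integrable_norm (iu K cK KO)).
  apply: le_integrable iC => //.
    apply/measurable_EFinP; apply: measurable_funM; last exact: measurable_funTS.
    exact: measurable_funS mu.
  move=> x Kx /=; rewrite lee_fin normrM (ger0_norm (mulr_ge0 C0 _))//.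
  by rewrite mulrC ler_wpM2r.
apply/(integrable_mkcond _ mO).
move/(integrable_mkcond _ mK) : iK; apply: eq_integrable => // x _.
rewrite /patch /=; case: (boolP (x \in K)) => [/set_mem/KO/mem_set->//|/negP nK].
case: ifP => // _; rewrite psi0 ?mulr0// => Kx.
by apply: nK; exact/mem_set.
Qed.

Lemma weak_gradient_test (u : E -> R) g : weak_gradient Omega u g ->
  forall i psi, test_function Omega psi ->
  (leb R N).-integrable Omega (EFin \o (fun x => u x * partial i psi x)) /\
  (leb R N).-integrable Omega (EFin \o (fun x => g x ord0 i * psi x)).
Proof.
move=> [mu mg loc ibp] i psi tpsi; split.
  apply: loc_test_integrable => //; last exact: test_function_derive.
  by move=> K cK KO; have [] := loc K cK KO.
apply: loc_test_integrable => //.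
  exact: (measurableT_comp (@measurable_coord R N i) mg).
by move=> K cK KO; have [_] := loc K cK KO; apply.
Qed.

Lemma measurable_rVD d (T : measurableType d) (D : set T) (f g : T -> E) :
  measurable_fun D f -> measurable_fun D g -> measurable_fun D (fun x => f x + g x).
Proof.
move=> mf mg; apply: measurable_fun_rV => i.
rewrite (_ : (fun _ => _) = (fun t => f t ord0 i + g t ord0 i)).
  apply: measurable_funD; first exact: (measurableT_comp (@measurable_coord R N i) mf).
  exact: (measurableT_comp (@measurable_coord R N i) mg).
by apply/funext => t; rewrite mxE.
Qed.

Lemma measurable_rVZ d (T : measurableType d) (D : set T) (a : T -> R) (f : T -> E) :
  measurable_fun D a -> measurable_fun D f -> measurable_fun D (fun x => a x *: f x).
Proof.
move=> ma mf; apply: measurable_fun_rV => i.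
rewrite (_ : (fun _ => _) = (fun t => a t * f t ord0 i)).
  by apply: measurable_funM => //; exact: (measurableT_comp (@measurable_coord R N i) mf).
by apply/funext => t; rewrite mxE.
Qed.

Lemma weak_gradientD u v g h : weak_gradient Omega u g -> weak_gradient Omega v h ->
  weak_gradient Omega (fun x => u x + v x) (fun x => g x + h x).
Proof.
move=> ug vh; have tu := weak_gradient_test ug; have tv := weak_gradient_test vh.
move: ug vh => [mu mg lu pu] [mv mh lv pv]; split.
- exact: measurable_funD.
- exact: measurable_rVD.
- move=> K cK KO; have [mK fK] := compact_leb cK.
  have [iu ig] := lu K cK KO; have [iv ih] := lv K cK KO; split.
    exact: (integrableD mK iu iv).
  move=> i; apply: eq_integrable (integrableD mK (ig i) (ih i)) => //.
  by move=> x _ /=; rewrite mxE EFinD.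
- move=> i psi tpsi; have [i1 i2] := tu i psi tpsi; have [i3 i4] := tv i psi tpsi.
  rewrite (@eq_Rintegral _ _ _ _ _ (fun x => u x * partial i psi x + v x * partial i psi x)); last first.
    by move=> x _; rewrite mulrDl.
  rewrite [in RHS](@eq_Rintegral _ _ _ _ _ (fun x => g x ord0 i * psi x + h x ord0 i * psi x)); last first.
    by move=> x _; rewrite mxE mulrDl.
  by rewrite !RintegralD// pu// pv// opprD.
Qed.

Lemma weak_gradientN u g : weak_gradient Omega u g ->
  weak_gradient Omega (fun x => - u x) (fun x => - g x).
Proof.
move=> ug; have tu := weak_gradient_test ug.
move: ug => [mu mg lu pu]; split.
- exact: measurable_funN.
- rewrite (_ : (fun _ => _) = (fun x => (-1) *: g x)).
    by apply: measurable_rVZ.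
  by apply/funext => x; rewrite scaleN1r.
- move=> K cK KO; have [mK fK] := compact_leb cK.
  have [iu ig] := lu K cK KO; split; first exact: (integrableN iu).
  move=> i; apply: eq_integrable (integrableN (ig i)) => //.
  by move=> x _ /=; rewrite mxE EFinN.
- move=> i psi tpsi; have [i1 i2] := tu i psi tpsi.
  rewrite (@eq_Rintegral _ _ _ _ _ (fun x => (-1) * (u x * partial i psi x))); last first.
    by move=> x _; rewrite mulN1r mulNr.
  rewrite [in RHS](@eq_Rintegral _ _ _ _ _ (fun x => (-1) * (g x ord0 i * psi x))); last first.
    by move=> x _; rewrite mxE mulN1r mulNr.
  by rewrite !RintegralZl// pu// mulrN.
Qed.

Lemma weak_gradientB u v g h : weak_gradient Omega u g -> weak_gradient Omega v h ->
  weak_gradient Omega (fun x => u x - v x) (fun x => g x - h x).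
Proof. by move=> ug /weak_gradientN vh; exact: weak_gradientD. Qed.

(** The difference of two gradients has integral zero against every test
    function. *)
Lemma weak_gradient_unique u g h : weak_gradient Omega u g -> weak_gradient Omega u h ->
  {ae leb R N, forall x, Omega x -> g x = h x}.
Proof.
move=> ug uh; have tg := weak_gradient_test ug; have th := weak_gradient_test uh.
move: ug uh => [mu mg lg pg] [_ mh lh ph].
have coord i : {ae leb R N, forall x, Omega x -> g x ord0 i - h x ord0 i = 0}.
  apply: ae_eq0_of_test_functions => //.
  - apply: measurable_funB; first exact: (measurableT_comp (@measurable_coord R N i) mg).
    exact: (measurableT_comp (@measurable_coord R N i) mh).
  - move=> K cK KO; have [mK fK] := compact_leb cK.
    have [_ ig] := lg K cK KO; have [_ ih] := lh K cK KO.
    exact: (integrableB mK (ig i) (ih i)).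
  - move=> psi tpsi; have [i1 i2] := tg i psi tpsi; have [i3 i4] := th i psi tpsi.
    rewrite (@eq_Rintegral _ _ _ _ _ (fun x => g x ord0 i * psi x - h x ord0 i * psi x)); last first.
      by move=> x _; rewrite mulrBl.
    rewrite RintegralB//; have := pg i psi tpsi; rewrite (ph i psi tpsi) => /oppr_inj ->.
    by rewrite subrr.
have : {ae leb R N, forall x, forall i, Omega x -> g x ord0 i - h x ord0 i = 0}.
  by apply: filter_forall => i; exact: coord.
apply: filterS => x hx Ox; apply/rowP => i; apply/eqP.
by rewrite -subr_eq0 hx.
Qed.

Lemma L1_null_cvg (u_ : nat -> E -> R) (u m : E -> R) C :
  (forall k, (leb R N).-integrable Omega (EFin \o u_ k)) ->
  (leb R N).-integrable Omega (EFin \o u) ->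
  measurable_fun Omega m -> (forall x, Omega x -> `|m x| <= C) ->
  L1_null Omega (fun k x => u_ k x - u x) ->
  (fun k => \int[leb R N]_(x in Omega) (u_ k x * m x)) @ \oo -->
  \int[leb R N]_(x in Omega) (u x * m x).
Proof.
move=> iu_ iu mm mC nu.
pose C1 := `|C| + 1; have C10 : 0 < C1 by rewrite ltr_wpDl.
have mC1 x : Omega x -> `|m x| <= C1.
  by move=> /mC /le_trans; apply; rewrite (le_trans (ler_norm _))// lerDl.
have ium (v : E -> R) : (leb R N).-integrable Omega (EFin \o v) ->
    (leb R N).-integrable Omega (EFin \o (fun x => v x * m x)).
  move=> iv; have mv : measurable_fun Omega v.
    by apply/measurable_EFinP; exact: measurable_int iv.
  apply: le_integrable (integrableZl mO C1 (integrable_norm iv)) => //.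
    by apply/measurable_EFinP; exact: measurable_funM.
  move=> x Ox /=; rewrite lee_fin normrM (ger0_norm (mulr_ge0 (ltW C10) _))//.
  by rewrite mulrC ler_wpM2r// mC1.
apply/cvgrPdist_le => e e0.
apply: filterS (nu (e / C1) (divr_gt0 e0 C10)) => k hk.
rewrite -RintegralB//; try exact: ium.
have iB : (leb R N).-integrable Omega (EFin \o (fun x => u_ k x - u x)).
  exact: (integrableB mO (iu_ k) iu).
apply: le_trans (le_normr_Rintegral mO _) _.
  exact: (integrableB mO (ium _ iu) (ium _ (iu_ k))).
apply: (@le_trans _ _ (C1 * \int[leb R N]_(x in Omega) `|u_ k x - u x|)).
  rewrite -RintegralZl//; last exact: integrable_norm iB.
  apply: le_Rintegral => //.
  - apply: integrable_norm; exact: (integrableB mO (ium _ iu) (ium _ (iu_ k))).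
  - exact: (integrableZl mO C1 (integrable_norm iB)).
  - by move=> x Ox; rewrite -mulrBl normrM mulrC distrC ler_wpM2r// mC1.
rewrite mulrC -ler_pdivlMr// -lee_fin fineK//.
apply: integrable_fin_num => //; exact: integrable_norm iB.
Qed.

(** Both sides of the integration by parts formula are continuous in [L^1]. *)
Lemma weak_gradient_lim (u_ : nat -> E -> R) (g_ : nat -> E -> E) (u : E -> R) (g : E -> E) :
  (forall k, weak_gradient Omega (u_ k) (g_ k)) ->
  (forall k, (leb R N).-integrable Omega (EFin \o u_ k)) ->
  (forall k i, (leb R N).-integrable Omega (fun x => (g_ k x ord0 i)%:E)) ->
  measurable_fun Omega g ->
  (leb R N).-integrable Omega (EFin \o u) ->
  (forall i, (leb R N).-integrable Omega (fun x => (g x ord0 i)%:E)) ->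
  L1_null Omega (fun k x => u_ k x - u x) ->
  (forall i, L1_null Omega (fun k x => g_ k x ord0 i - g x ord0 i)) ->
  weak_gradient Omega u g.
Proof.
move=> ug iu_ ig_ mg iu ig nu ng; split => //.
- by apply/measurable_EFinP; exact: measurable_int iu.
- move=> K cK KO; have [mK fK] := compact_leb cK.
  by split=> [|i]; apply: (integrableS mO) => //; exact: ig.
- move=> i psi tpsi.
  have tpsi' := test_function_derive (basis_vec R i) tpsi.
  have [C C0 hC] := test_function_bounded tpsi.
  have [C' C0' hC'] := test_function_bounded tpsi'.
  have m1 := measurable_funTS (D := Omega) (test_function_measurable tpsi).
  have m2 := measurable_funTS (D := Omega) (test_function_measurable tpsi').
  have c1 := L1_null_cvg iu_ iu m2 (fun x _ => hC' x) nu.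
  have c2 := L1_null_cvg (fun k => ig_ k i) (ig i) m1 (fun x _ => hC x) (ng i).
  apply: (cvg_unique (@Rhausdorff R) c1).
  rewrite (_ : (fun k => _) = (fun k => - \int[leb R N]_(x in Omega) (g_ k x ord0 i * psi x))).
    exact: cvgN c2.
  by apply/funext => k; have [_ _ _ ->] := ug k.
Qed.

End weak_gradients.

Section variable_exponent_W0.
Variables (R : realType) (N : nat).
Local Notation E := 'rV[R]_N.
Variables (Omega : set E) (p : E -> R) (P : R).
Hypotheses (oO : open Omega) (fO : (leb R N Omega < +oo)%E).
Hypotheses (mp : measurable_fun Omega p) (p1 : forall x, Omega x -> 1 <= p x <= P).
Let mO : measurable Omega := open_measurable_rV oO.
Local Notation modular := (modular Omega p).
Local Notation Lpx_null := (Lpx_null Omega p).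

Lemma sobolev_norm_ge0 u : (0 <= sobolev_norm Omega p u)%E.
Proof.
by apply: le_ereal_inf_tmp => _ [g _ <-]; rewrite adde_ge0// luxemburg_ge0.
Qed.

Lemma sobolev_norm_lt l u : (sobolev_norm Omega p u < l%:E)%E ->
  exists g, [/\ 0 < l, weak_gradient Omega u g, (modular l u <= 1)%E &
   (modular l (fun x => enorm (g x)) <= 1)%E].
Proof.
move=> /ereal_inf_lt[_ [g ug <-]] h.
have h1 : (luxemburg Omega p u < l%:E)%E.
  by apply: le_lt_trans h; rewrite leeDl// luxemburg_ge0.
have h2 : (luxemburg Omega p (fun x => enorm (g x)) < l%:E)%E.
  by apply: le_lt_trans h; rewrite leeDr// luxemburg_ge0.
have [l0 hu] := luxemburg_lt p1 h1; have [_ hg] := luxemburg_lt p1 h2.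
by exists g; split.
Qed.

Lemma sobolev_norm_le l u g : 0 < l -> weak_gradient Omega u g ->
  (modular l u <= 1)%E -> (modular l (fun x => enorm (g x)) <= 1)%E ->
  (sobolev_norm Omega p u <= (2 * l)%:E)%E.
Proof.
move=> l0 ug ul gl; apply: ge_ereal_inf.
exists (luxemburg Omega p u + luxemburg Omega p (fun x => enorm (g x)))%E; first by exists g.
have -> : ((2 * l)%:E = l%:E + l%:E)%E by rewrite -EFinD; congr EFin; ring.
by apply: leeD; exact: luxemburg_le.
Qed.

Lemma sobolev_norm_cvg0 (u_ : nat -> E -> R) (g_ : nat -> E -> E) :
  (forall k, weak_gradient Omega (u_ k) (g_ k)) ->
  (fun k => sobolev_norm Omega p (u_ k)) @ \oo --> 0%E <->
  Lpx_null u_ /\ Lpx_null (fun k x => enorm (g_ k x)).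
Proof.
move=> ug; rewrite ge0_cvg0P; last by move=> k; exact: sobolev_norm_ge0.
split=> [h|[nu ng] e e0].
  have key l : 0 < l -> \forall k \near \oo, (modular l (u_ k) <= 1)%E /\
      (modular l (fun x => enorm (g_ k x)) <= 1)%E.
    move=> l0; have l20 : 0 < l / 2 by rewrite divr_gt0.
    apply: filterS (h _ l20) => k hk.
    have /sobolev_norm_lt[g [_ ukg hu hg]] : (sobolev_norm Omega p (u_ k) < l%:E)%E.
      by apply: le_lt_trans hk _; rewrite lte_fin ltr_pdivrMr// ltr_pMr// ltr1n.
    split; first exact: hu.
    apply: (le_trans _ hg); apply: (modular_le p1) => //.
    apply: filterS (weak_gradient_unique oO (ug k) ukg) => x hx Ox.
    by rewrite hx.
  by split => l l0; apply: filterS (key l l0) => k [].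
have e20 : 0 < e / 2 by rewrite divr_gt0.
apply: filterS2 (nu _ e20) (ng _ e20) => k h1 h2.
apply: le_trans (sobolev_norm_le e20 (ug k) h1 h2) _.
by rewrite lee_fin mulrC divfK.
Qed.

(** Membership in [W0] with the gradient as a parameter and modulars in place of
    norms, the form in which compositions are handled. *)
Definition W0_with (u : E -> R) (g : E -> E) : Prop :=
  [/\ weak_gradient Omega u g,
      exists l, [/\ 0 < l, (modular l u <= 1)%E & (modular l (fun x => enorm (g x)) <= 1)%E] &
      exists psi : nat -> E -> R, [/\ forall k, test_function Omega (psi k),
        Lpx_null (fun k x => u x - psi k x) &
        Lpx_null (fun k x => enorm (g x - gradient (psi k) x))]].

Lemma W0_withP u g : weak_gradient Omega u g -> W0 Omega p u <-> W0_with u g.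
Proof.
move=> ug; split.
  move=> [fu [psi [tpsi cpsi]]]; split; first exact: ug.
    have unum : sobolev_norm Omega p u \is a fin_num.
      by rewrite ge0_fin_numE// sobolev_norm_ge0.
    have : (sobolev_norm Omega p u < (fine (sobolev_norm Omega p u) + 1)%:E)%E.
      by rewrite -{1}(fineK unum) lte_fin ltrDl.
    move=> /sobolev_norm_lt[h [l0 uh mu mh]].
    exists (fine (sobolev_norm Omega p u) + 1); split; [exact: l0|exact: mu|].
    apply: (le_trans _ mh); apply: (modular_le p1) => //.
    apply: filterS (weak_gradient_unique oO ug uh) => x hx Ox.
    by rewrite hx.
  exists psi.
  have up k : weak_gradient Omega (u \- psi k) (fun x => g x - gradient (psi k) x).
    by apply: weak_gradientB => //; exact: test_function_weak_gradient.
  have [h _] := sobolev_norm_cvg0 up.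
  by have [nu ng] := h cpsi; split; [exact: tpsi|exact: nu|exact: ng].
move=> [_ [l [l0 hu hg]] [psi [tpsi nu ng]]]; split.
  by apply: le_lt_trans (sobolev_norm_le l0 ug hu hg) _; rewrite ltry.
exists psi; split; first exact: tpsi.
have up k : weak_gradient Omega (u \- psi k) (fun x => g x - gradient (psi k) x).
  by apply: weak_gradientB => //; exact: test_function_weak_gradient.
apply/(sobolev_norm_cvg0 up); split; [exact: nu|exact: ng].
Qed.

Lemma W0_ex u : W0 Omega p u -> exists g, W0_with u g.
Proof.
move=> Wu; have [fu _] := Wu.
have [g ug] : exists g, weak_gradient Omega u g.
  have /ereal_inf_lt[_ [g ug _] _] := fu.
  by exists g.
by exists g; apply/(W0_withP ug).
Qed.

Lemma W0_with_W0 u g : W0_with u g -> W0 Omega p u.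
Proof. by move=> h; have [ug _ _] := h; apply/(W0_withP ug). Qed.

Lemma W0_with_integrable u g : W0_with u g ->
  (leb R N).-integrable Omega (EFin \o u) /\
  forall i, (leb R N).-integrable Omega (fun x => (g x ord0 i)%:E).
Proof.
move=> [[mu mg _ _] [l [l0 hu hg]] _]; split.
  exact: (modular_integrable mO fO mp p1 l0 mu hu).
move=> i; have me := measurable_enorm mg.
have ie := modular_integrable mO fO mp p1 l0 me hg.
apply: le_integrable ie => //.
  apply/measurable_EFinP; exact: (measurableT_comp (@measurable_coord R N i) mg).
by move=> x Ox /=; rewrite lee_fin (ger0_norm (enorm_ge0 _)) entry_le_enorm.
Qed.

End variable_exponent_W0.

(** * The chain rule in W0 *)

Section chain_rule.
Variables (R : realType) (N : nat).
Local Notation E := 'rV[R]_N.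

Definition lipschitz2 (C : R) (F : R -> R -> R) :=
  forall a b a' b', `|F a b - F a' b'| <= C * (`|a - a'| + `|b - b'|).

Lemma lipschitz2_measurable C F d (T : measurableType d) (D : set T) (u w : T -> R) :
  lipschitz2 C F -> measurable D -> measurable_fun D u -> measurable_fun D w ->
  measurable_fun D (fun x => F (u x) (w x)).
Proof.
move=> lF mD mu mw.
apply: (@measurable_comp_continuous R _ T (R * R)%type _ _ D (fun x => (u x, w x)) (fun z => F z.1 z.2)
  (prod_base (@rat_itv_base R) (@rat_itv_base R))) => //.
- move=> [i j] /=.
  rewrite (_ : _ `&` _ = (D `&` u @^-1` rat_itv i) `&` (D `&` w @^-1` rat_itv j)).
    by apply: measurableI; [apply: mu|apply: mw] => //; exact: measurable_rat_itv.
  by apply/seteqP; split => x; rewrite /setX/=; [move=> [? []]|move=> [[? ?] []]].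
- move=> x _; apply/cvgrPdist_le => e e0.
  pose C1 := `|C| + 1; have C10 : 0 < C1 by rewrite ltr_wpDl.
  have eC : 0 < e / (C1 + C1) by rewrite divr_gt0// addr_gt0.
  have : \forall z \near (u x, w x), ball (u x, w x) (e / (C1 + C1)) z by exact: nbhsx_ballx.
  apply: filterS => -[a b] [] /=; rewrite /ball/= => h1 h2.
  apply: (le_trans (lF _ _ _ _)).
  apply: (@le_trans _ _ (C1 * (`|u x - a| + `|w x - b|))).
    by apply: ler_wpM2r; rewrite ?addr_ge0// (le_trans (ler_norm _))// lerDl.
  apply: (@le_trans _ _ (C1 * (e / (C1 + C1) + e / (C1 + C1)))).
    by apply: ler_wpM2l; [exact: ltW|apply: lerD; exact: ltW].
  rewrite le_eqVlt; apply/orP; left; apply/eqP; field.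
  by rewrite -mulr2n mulrn_eq0/= gt_eqF.
Qed.

Variables (Omega : set E) (p : E -> R) (P : R).
Hypotheses (oO : open Omega) (fO : (leb R N Omega < +oo)%E).
Hypotheses (mp : measurable_fun Omega p) (p1 : forall x, Omega x -> 1 <= p x <= P).
Let mO : measurable Omega := open_measurable_rV oO.
Local Notation modular := (modular Omega p).
Local Notation Lpx_null := (Lpx_null Omega p).
Local Notation W0_with := (W0_with Omega p).

(** The gradient formula is required on test functions only, where it is
    elementary; the Lipschitz bounds extend it to [W0]. *)
Record chain_map (F F1 F2 : R -> R -> R) (C : R) : Prop := ChainMap {
  chain_gt0 : 0 < C;
  chain_at0 : F 0 0 = 0;
  chain_lip : lipschitz2 C F;
  chain_lip1 : lipschitz2 C F1;
  chain_lip2 : lipschitz2 C F2;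
  chain_bound1 : forall a b, `|F1 a b| <= C;
  chain_bound2 : forall a b, `|F2 a b| <= C;
  chain_test : forall psi chi, test_function Omega psi -> test_function Omega chi ->
    test_function Omega (fun x => F (psi x) (chi x)) /\
    forall x, gradient (fun x => F (psi x) (chi x)) x =
      F1 (psi x) (chi x) *: gradient psi x + F2 (psi x) (chi x) *: gradient chi x
}.

Definition chain_grad (F1 F2 : R -> R -> R) (u w : E -> R) (gu gw : E -> E) x :=
  F1 (u x) (w x) *: gu x + F2 (u x) (w x) *: gw x.

Lemma enorm_chain_grad F F1 F2 C u w gu gw x : chain_map F F1 F2 C ->
  enorm (chain_grad F1 F2 u w gu gw x) <= C * (enorm (gu x) + enorm (gw x)).
Proof.
move=> cm; apply: le_trans (enorm_triangle _ _) _; rewrite !enormZ mulrDr.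
by apply: lerD; apply: ler_wpM2r; rewrite ?enorm_ge0 ?(chain_bound1 cm) ?(chain_bound2 cm).
Qed.

Lemma norm_chain F F1 F2 C a b : chain_map F F1 F2 C ->
  `|F a b| <= C * (`|a| + `|b|).
Proof.
by move=> cm; have := chain_lip cm a b 0 0; rewrite (chain_at0 cm) !subr0.
Qed.

Lemma modular_mono l l' (u : E -> R) : 0 < l -> l <= l' ->
  (modular l u <= 1)%E -> (modular l' u <= 1)%E.
Proof.
move=> l0 ll' h; have l'0 := lt_le_trans l0 ll'.
apply: (le_trans _ h); apply: (modular_le p1 l'0 l0); apply: aeW => x _.
by apply: ler_wpM2l => //; rewrite lef_pV2// ?posrE.
Qed.

Lemma modular_lin l C (u v w : E -> R) : 0 < l -> 0 < C ->
  measurable_fun Omega u -> measurable_fun Omega v ->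
  (forall x, Omega x -> `|w x| <= C * (`|u x| + `|v x|)) ->
  (modular l u <= 1)%E -> (modular l v <= 1)%E -> (modular (4 * (C * l)) w <= 1)%E.
Proof.
move=> l0 C0 mu mv wuv ul vl; have Cl0 : 0 < C * l by rewrite mulr_gt0.
apply: (@modular_add _ _ _ _ P mO mp p1 (C * l) (fun x => C * u x) (fun x => C * v x)) => //.
- exact: measurable_funM.
- exact: measurable_funM.
- apply: aeW => x Ox; rewrite !normrM (gtr0_norm C0) -mulrDr; exact: wuv.
- apply: (modular_scale p1 l0 C0 _ ul); apply: aeW => x Ox.
  by rewrite normrM (gtr0_norm C0).
- apply: (modular_scale p1 l0 C0 _ vl); apply: aeW => x Ox.
  by rewrite normrM (gtr0_norm C0).
Qed.

Section continuity.
Variables (u w : E -> R) (gu gw : E -> E).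
Variables (u_ w_ : nat -> E -> R) (gu_ gw_ : nat -> E -> E).
Hypotheses (mu : measurable_fun Omega u) (mw : measurable_fun Omega w).
Hypotheses (mgu : measurable_fun Omega gu) (mgw : measurable_fun Omega gw).
Hypotheses (mu_ : forall k, measurable_fun Omega (u_ k)) (mw_ : forall k, measurable_fun Omega (w_ k)).
Hypotheses (mgu_ : forall k, measurable_fun Omega (gu_ k)) (mgw_ : forall k, measurable_fun Omega (gw_ k)).
Hypotheses (nu : Lpx_null (fun k x => u x - u_ k x)) (nw : Lpx_null (fun k x => w x - w_ k x)).
Hypotheses (ngu : Lpx_null (fun k x => enorm (gu x - gu_ k x))).
Hypotheses (ngw : Lpx_null (fun k x => enorm (gw x - gw_ k x))).

Lemma lipschitz2_null C F : 0 < C -> lipschitz2 C F ->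
  Lpx_null (fun k x => F (u x) (w x) - F (u_ k x) (w_ k x)).
Proof.
move=> C0 lF.
apply: (@Lpx_null_add _ _ _ _ _ mO mp p1 (fun k x => C * (u x - u_ k x)) (fun k x => C * (w x - w_ k x))).
- by move=> k; apply: measurable_funM => //; exact: measurable_funB.
- by move=> k; apply: measurable_funM => //; exact: measurable_funB.
- by move=> k x Ox; rewrite !normrM (gtr0_norm C0) -mulrDr; exact: lF.
- apply: (Lpx_null_scale p1 C0 _ nu) => k x _.
  by rewrite normrM (gtr0_norm C0).
- apply: (Lpx_null_scale p1 C0 _ nw) => k x _.
  by rewrite normrM (gtr0_norm C0).
Qed.

Lemma lipschitz2_null_mul C F (G : E -> E) l0 : 0 < C -> lipschitz2 C F ->
  (forall a b, `|F a b| <= C) -> measurable_fun Omega G -> 0 < l0 ->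
  (modular l0 (fun x => enorm (G x)) <= 1)%E ->
  Lpx_null (fun k x => (F (u x) (w x) - F (u_ k x) (w_ k x)) * enorm (G x)).
Proof.
move=> C0 lF bF mG l00 hG.
have mF k : measurable_fun Omega (fun x => F (u x) (w x) - F (u_ k x) (w_ k x)).
  by apply: measurable_funB; exact: (lipschitz2_measurable lF).
have mE := measurable_enorm mG.
apply: (@Lpx_null_mul _ _ _ _ _ mO mp p1 (fun k x => F (u x) (w x) - F (u_ k x) (w_ k x)) _ (C + C) l0) => //.
  by move=> k x _; rewrite (le_trans (ler_normB _ _))// lerD.
by apply: (Lpx_null_L1 mO fO mp p1) => //; exact: (lipschitz2_null C0).
Qed.

Lemma chain_grad_null F F1 F2 C l1 l2 : chain_map F F1 F2 C ->
  0 < l1 -> (modular l1 (fun x => enorm (gu x)) <= 1)%E ->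
  0 < l2 -> (modular l2 (fun x => enorm (gw x)) <= 1)%E ->
  Lpx_null (fun k x => enorm (chain_grad F1 F2 u w gu gw x -
     chain_grad F1 F2 (u_ k) (w_ k) (gu_ k) (gw_ k) x)).
Proof.
move=> cm l10 h1 l20 h2; have C0 := chain_gt0 cm.
have n1 := lipschitz2_null_mul C0 (chain_lip1 cm) (chain_bound1 cm) mgu l10 h1.
have n2 := lipschitz2_null_mul C0 (chain_lip2 cm) (chain_bound2 cm) mgw l20 h2.
have mF1 k : measurable_fun Omega (fun x => F1 (u x) (w x) - F1 (u_ k x) (w_ k x)).
  by apply: measurable_funB; exact: (lipschitz2_measurable (chain_lip1 cm)).
have mF2 k : measurable_fun Omega (fun x => F2 (u x) (w x) - F2 (u_ k x) (w_ k x)).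
  by apply: measurable_funB; exact: (lipschitz2_measurable (chain_lip2 cm)).
have md (g : E -> E) (g_ : nat -> E -> E) : measurable_fun Omega g ->
   (forall k, measurable_fun Omega (g_ k)) ->
   forall k, measurable_fun Omega (fun x => enorm (g x - g_ k x)).
  move=> mg mg_ k; apply: measurable_enorm; apply: measurable_rVD => //.
  rewrite (_ : (fun _ => _) = (fun x => (-1) *: g_ k x)).
    by apply: measurable_rVZ.
  by apply/funext => x; rewrite scaleN1r.
have part (Fi : R -> R -> R) (g : E -> E) (g_ : nat -> E -> E) :
   lipschitz2 C Fi -> (forall a b, `|Fi a b| <= C) ->
   measurable_fun Omega g -> (forall k, measurable_fun Omega (g_ k)) ->
   Lpx_null (fun k x => enorm (g x - g_ k x)) ->
   Lpx_null (fun k x => (Fi (u x) (w x) - Fi (u_ k x) (w_ k x)) * enorm (g x)) ->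
   Lpx_null (fun k x => enorm (Fi (u x) (w x) *: g x - Fi (u_ k x) (w_ k x) *: g_ k x)).
  move=> lFi bFi mg mg_ ng nFg.
  apply: (@Lpx_null_add _ _ _ _ _ mO mp p1
     (fun k x => (Fi (u x) (w x) - Fi (u_ k x) (w_ k x)) * enorm (g x))
     (fun k x => C * enorm (g x - g_ k x))) => //.
  - move=> k; apply: measurable_funM; last exact: measurable_enorm.
    by apply: measurable_funB; exact: (lipschitz2_measurable lFi).
  - by move=> k; apply: measurable_funM => //; exact: md.
  - move=> k x Ox; rewrite (ger0_norm (enorm_ge0 _)).
    rewrite (_ : Fi (u x) (w x) *: g x - Fi (u_ k x) (w_ k x) *: g_ k x =
      (Fi (u x) (w x) - Fi (u_ k x) (w_ k x)) *: g x + Fi (u_ k x) (w_ k x) *: (g x - g_ k x)); last first.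
      by rewrite scalerBl scalerBr addrA subrK.
    apply: le_trans (enorm_triangle _ _) _; rewrite !enormZ !normrM.
    rewrite !(ger0_norm (enorm_ge0 _)) (gtr0_norm C0) lerD2l.
    by apply: ler_wpM2r; rewrite ?enorm_ge0.
  - apply: (Lpx_null_scale p1 C0 _ ng) => k x Ox.
    by rewrite normrM (gtr0_norm C0).
have m1 := part _ _ _ (chain_lip1 cm) (chain_bound1 cm) mgu mgu_ ngu n1.
have m2 := part _ _ _ (chain_lip2 cm) (chain_bound2 cm) mgw mgw_ ngw n2.
have mm (Fi : R -> R -> R) (g : E -> E) (g_ : nat -> E -> E) :
   lipschitz2 C Fi -> measurable_fun Omega g -> (forall k, measurable_fun Omega (g_ k)) ->
   forall k, measurable_fun Omega (fun x => enorm (Fi (u x) (w x) *: g x - Fi (u_ k x) (w_ k x) *: g_ k x)).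
  move=> lFi mg mg_; apply: md => [|k]; apply: measurable_rVZ => //;
    exact: (lipschitz2_measurable lFi).
apply: (Lpx_null_add mO mp p1 _ _ _ m1 m2).
- exact: mm (chain_lip1 cm) mgu mgu_.
- exact: mm (chain_lip2 cm) mgw mgw_.
- move=> k x Ox; rewrite !(ger0_norm (enorm_ge0 _)) /chain_grad.
  by rewrite opprD addrACA; exact: enorm_triangle.
Qed.

End continuity.

Lemma measurable_chain_grad d (T : measurableType d) (D : set T) F F1 F2 C (u w : T -> R) (gu gw : T -> E) :
  chain_map F F1 F2 C -> measurable D ->
  measurable_fun D u -> measurable_fun D w ->
  measurable_fun D gu -> measurable_fun D gw ->
  measurable_fun D (fun x => F1 (u x) (w x) *: gu x + F2 (u x) (w x) *: gw x).
Proof.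
move=> cm mD mu mw mgu mgw.
by apply: measurable_rVD; apply: measurable_rVZ => //;
  [exact: lipschitz2_measurable (chain_lip1 cm) _ _ _|exact: lipschitz2_measurable (chain_lip2 cm) _ _ _].
Qed.

Lemma measurable_gradient_test psi : test_function Omega psi ->
  measurable_fun Omega (gradient psi).
Proof. by move=> tpsi; have [_ ? _ _] := test_function_weak_gradient tpsi. Qed.

(** Test functions approximate both arguments. Their compositions converge
    because [F] is Lipschitz, and the gradients of the compositions converge by
    [chain_grad_null]. *)
Lemma W0_with_chain F F1 F2 C u w gu gw : chain_map F F1 F2 C ->
  W0_with u gu -> W0_with w gw ->
  W0_with (fun x => F (u x) (w x)) (chain_grad F1 F2 u w gu gw).
Proof.
move=> cm Wu Ww; have C0 := chain_gt0 cm.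
have [iu igu] := W0_with_integrable oO fO mp p1 Wu.
have [iw igw] := W0_with_integrable oO fO mp p1 Ww.
move: Wu Ww => [[mu mgu _ _] [l1 [l10 hu hgu]] [psi [tpsi npsi ngpsi]]].
move=> [[mw mgw _ _] [l2 [l20 hw hgw]] [chi [tchi nchi ngchi]]].
have mpsi k : measurable_fun Omega (psi k) by apply: measurable_funTS; exact: test_function_measurable (tpsi k).
have mchi k : measurable_fun Omega (chi k) by apply: measurable_funTS; exact: test_function_measurable (tchi k).
have mgpsi k := measurable_gradient_test (tpsi k).
have mgchi k := measurable_gradient_test (tchi k).
have tF k := (chain_test cm (tpsi k) (tchi k)).1.
have gF k x := (chain_test cm (tpsi k) (tchi k)).2 x.
have nF := lipschitz2_null mu mw mpsi mchi npsi nchi C0 (chain_lip cm).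
have ngF := chain_grad_null mu mw mgu mgw mpsi mchi mgpsi mgchi npsi nchi ngpsi ngchi cm l10 hgu l20 hgw.
have mF : measurable_fun Omega (fun x => F (u x) (w x)) by exact: lipschitz2_measurable (chain_lip cm) _ _ _.
have mgF : measurable_fun Omega (chain_grad F1 F2 u w gu gw).
  exact: (measurable_chain_grad cm).
have mgFk k : measurable_fun Omega (gradient (fun x => F (psi k x) (chi k x))).
  exact: measurable_gradient_test.
have ngF' : Lpx_null (fun k x => enorm (chain_grad F1 F2 u w gu gw x - gradient (fun x => F (psi k x) (chi k x)) x)).
  rewrite (_ : (fun _ _ => _) = (fun k x => enorm (chain_grad F1 F2 u w gu gw x -
    chain_grad F1 F2 (psi k) (chi k) (gradient (psi k)) (gradient (chi k)) x))).
    exact: ngF.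
  by apply/funext => k; apply/funext => x; rewrite gF.
split.
- have wF k := test_function_weak_gradient (tF k).
  apply: (weak_gradient_lim oO wF) => //.
  + by move=> k; apply: (integrableS measurableT) => //; exact: test_function_integrable (tF k).
  + move=> k i.
    rewrite (_ : (fun _ => _) = EFin \o partial i (fun x => F (psi k x) (chi k x))).
      apply: (integrableS measurableT) => //.
      exact: test_function_integrable (test_function_derive (basis_vec R i) (tF k)).
    by apply/funext => x; rewrite mxE.
  + apply: le_integrable (integrableZl mO C (integrableD mO (integrable_norm iu) (integrable_norm iw))) => //.
      exact/measurable_EFinP.
    move=> x Ox /=; rewrite lee_fin.
    by rewrite (ger0_norm (mulr_ge0 (ltW C0) _)) ?addr_ge0// (norm_chain _ _ cm).
  + move=> i.
    apply: le_integrable (integrableZl mO C (integrableD mO (integrable_norm (igu i)) (integrable_norm (igw i)))) => //.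
      apply/measurable_EFinP; exact: (measurableT_comp (@measurable_coord R N i) mgF).
    move=> x Ox /=; rewrite lee_fin.
    rewrite (ger0_norm (mulr_ge0 (ltW C0) _)) ?addr_ge0//.
    rewrite /chain_grad !mxE (le_trans (ler_normD _ _))// !normrM mulrDr.
    by apply: lerD; apply: ler_wpM2r; rewrite ?(chain_bound1 cm) ?(chain_bound2 cm).
  + apply: (Lpx_null_L1 mO fO mp p1).
      move=> k; apply: measurable_funB => //; apply: measurable_funTS; exact: test_function_measurable (tF k).
    by apply: (Lpx_null_scale p1 ltr01 _ nF) => k x Ox; rewrite mul1r distrC.
  + move=> i; apply: (Lpx_null_L1 mO fO mp p1).
      move=> k; apply: measurable_funB.
        exact: (measurableT_comp (@measurable_coord R N i) (mgFk k)).
      exact: (measurableT_comp (@measurable_coord R N i) mgF).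
    apply: (Lpx_null_scale p1 ltr01 _ ngF') => k x Ox.
    rewrite mul1r distrC (ger0_norm (enorm_ge0 _)).
    apply: le_trans (entry_le_enorm _ i); rewrite !mxE//.
- pose l := Num.max l1 l2.
  have l0 : 0 < l by rewrite lt_max l10.
  have l1l : l1 <= l by rewrite le_max lexx.
  have l2l : l2 <= l by rewrite le_max lexx orbT.
  exists (4 * (C * l)); split; first by rewrite !mulr_gt0.
    apply: (modular_lin l0 C0 mu mw).
    + by move=> x _; exact: (norm_chain _ _ cm).
    + exact: (modular_mono l10 l1l hu).
    + exact: (modular_mono l20 l2l hw).
  apply: (modular_lin l0 C0 (measurable_enorm mgu) (measurable_enorm mgw)).
  + by move=> x _; rewrite !(ger0_norm (enorm_ge0 _)); exact: (enorm_chain_grad _ _ _ _ _ cm).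
  + exact: (modular_mono l10 l1l hgu).
  + exact: (modular_mono l20 l2l hgw).
- by exists (fun k x => F (psi k x) (chi k x)); split; [exact: tF|exact: nF|exact: ngF'].
Qed.

(** With this instance the sums in [W0] need no separate treatment. *)
Lemma chain_map_add : chain_map (fun a b => a + b) (fun _ _ => 1) (fun _ _ => 1) 1.
Proof.
split => //.
- by rewrite addr0.
- by move=> a b a' b'; rewrite mul1r opprD addrACA ler_normD.
- by move=> a b a' b'; rewrite subrr normr0 mul1r addr_ge0.
- by move=> a b a' b'; rewrite subrr normr0 mul1r addr_ge0.
- by move=> a b; rewrite normr1.
- by move=> a b; rewrite normr1.
- move=> psi chi tpsi tchi; split; first exact: test_functionD.
  move=> x; apply/rowP => i; rewrite !mxE !mul1r /partial deriveD//.
    exact: smooth_derivable tpsi.1.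
  exact: smooth_derivable tchi.1.
Qed.

Lemma W0_add u w : W0 Omega p u -> W0 Omega p w -> W0 Omega p (fun x => u x + w x).
Proof.
move=> /(W0_ex oO p1)[gu Wu] /(W0_ex oO p1)[gw Ww].
apply: (W0_with_W0 oO p1); exact: W0_with_chain chain_map_add Wu Ww.
Qed.

Lemma W0_chain F F1 F2 C u w : chain_map F F1 F2 C ->
  W0 Omega p u -> W0 Omega p w -> W0 Omega p (fun x => F (u x) (w x)).
Proof.
move=> cm /(W0_ex oO p1)[gu Wu] /(W0_ex oO p1)[gw Ww].
apply: (W0_with_W0 oO p1); exact: W0_with_chain cm Wu Ww.
Qed.

Lemma W0_cst0 : W0 Omega p (fun=> 0).
Proof.
have t0 := @test_function_cst0 R E Omega.
have g0 := test_function_weak_gradient t0.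
apply/(W0_withP oO p1 g0).
have z : gradient (fun=> 0 : R) = (fun=> 0) :> (E -> E).
  by apply/funext => x; apply/rowP => i; rewrite !mxE /partial derive_cst.
have e0 : enorm (0 : E) = 0.
  by rewrite /enorm /dotp big1 ?sqrtr0// => i _; rewrite mxE mul0r.
have m0 l : 0 < l -> (modular l (fun=> 0%R) <= 1)%E.
  move=> l0; rewrite (_ : modular l _ = 0%E)//.
  rewrite modularE; apply: integral0_eq => x Ox; rewrite normr0 mul0r powR0//.
  by have /andP[h _] := p1 Ox; rewrite gt_eqF// (lt_le_trans ltr01).
split => //.
- exists 1; split => //; first exact: m0.
  by rewrite z (_ : (fun _ => _) = (fun=> 0 : R)); [exact: m0|apply/funext => x; rewrite e0].
- exists (fun _ _ => 0); split => //.
  + move=> l l0; apply: nearW => k.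
    by rewrite (_ : (fun _ => _) = (fun=> 0 : R)); [exact: m0|apply/funext => x; rewrite subr0].
  + move=> l l0; apply: nearW => k.
    by rewrite (_ : (fun _ => _) = (fun=> 0 : R)); [exact: m0|apply/funext => x; rewrite subrr e0].
Qed.

Lemma W0_sum (I : Type) (s : seq I) (Q : pred I) (u : I -> E -> R) :
  (forall i, W0 Omega p (u i)) -> W0 Omega p (fun x => \sum_(i <- s | Q i) u i x).
Proof.
move=> Wu; elim: s => [|i s IH].
  rewrite (_ : (fun _ => _) = fun=> 0); first exact: W0_cst0.
  by apply/funext => x; rewrite big_nil.
have [Qi|nQi] := boolP (Q i).
  rewrite (_ : (fun _ => _) = fun x => u i x + \sum_(i <- s | Q i) u i x).
    exact: (W0_add (Wu i) IH).
  by apply/funext => x; rewrite big_cons Qi.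
rewrite (_ : (fun _ => _) = fun x => \sum_(i <- s | Q i) u i x)//.
by apply/funext => x; rewrite big_cons (negbTE nQi).
Qed.

(** Continuity of composition on [W0], through which approximations of two paths
    become approximations of the composed path. *)
Lemma sobolev_norm_chain_cvg0 F F1 F2 C u w u_ w_ : chain_map F F1 F2 C ->
  W0 Omega p u -> W0 Omega p w -> (forall k, W0 Omega p (u_ k)) -> (forall k, W0 Omega p (w_ k)) ->
  (fun k : nat => sobolev_norm Omega p (u \- u_ k)) @ \oo --> 0%E ->
  (fun k : nat => sobolev_norm Omega p (w \- w_ k)) @ \oo --> 0%E ->
  (fun k : nat => sobolev_norm Omega p (fun x => F (u x) (w x) - F (u_ k x) (w_ k x))) @ \oo --> 0%E.
Proof.
move=> cm /(W0_ex oO p1)[gu Wu] /(W0_ex oO p1)[gw Ww] W_u W_w.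
have /choice[gu_ Wu_] k : exists g, W0_with (u_ k) g by exact: (W0_ex oO p1).
have /choice[gw_ Ww_] k : exists g, W0_with (w_ k) g by exact: (W0_ex oO p1).
have WF := W0_with_chain cm Wu Ww.
have WF_ k := W0_with_chain cm (Wu_ k) (Ww_ k).
have wg u' g' : W0_with u' g' -> weak_gradient Omega u' g' by case.
have du k := weak_gradientB oO (wg _ _ Wu) (wg _ _ (Wu_ k)).
have dw k := weak_gradientB oO (wg _ _ Ww) (wg _ _ (Ww_ k)).
have dF k := weak_gradientB oO (wg _ _ WF) (wg _ _ (WF_ k)).
move=> /(sobolev_norm_cvg0 oO p1 du)[nu ngu] /(sobolev_norm_cvg0 oO p1 dw)[nw ngw].
apply/(sobolev_norm_cvg0 oO p1 dF).
have mm u' g' : W0_with u' g' -> measurable_fun Omega u' /\ measurable_fun Omega g'.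
  by move=> [[? ? _ _] _ _].
have [mu mgu] := mm _ _ Wu; have [mw mgw] := mm _ _ Ww.
have mu_ k := (mm _ _ (Wu_ k)).1; have mgu_ k := (mm _ _ (Wu_ k)).2.
have mw_ k := (mm _ _ (Ww_ k)).1; have mgw_ k := (mm _ _ (Ww_ k)).2.
have [_ [l1 [l10 _ h1]] _] := Wu; have [_ [l2 [l20 _ h2]] _] := Ww.
split.
  exact: (lipschitz2_null mu mw mu_ mw_ nu nw (chain_gt0 cm) (chain_lip cm)).
exact: (chain_grad_null mu mw mgu mgw mu_ mw_ mgu_ mgw_ nu nw ngu ngw cm l10 h1 l20 h2).
Qed.

End chain_rule.

(** * The regularized quotient *)

Section bounded_lipschitz.
Variable R : realType.

Definition bounded_lipschitz (f : R -> R -> R) :=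
  exists C, [/\ 0 < C, lipschitz2 C f & forall a b, `|f a b| <= C].

Lemma bounded_lipschitz_cst (c : R) : bounded_lipschitz (fun _ _ => c).
Proof.
exists (`|c| + 1); split; first by rewrite ltr_wpDl.
  by move=> a b a' b'; rewrite subrr normr0 mulr_ge0// addr_ge0.
by move=> _ _; rewrite lerDl.
Qed.

Lemma bounded_lipschitzD f g : bounded_lipschitz f -> bounded_lipschitz g ->
  bounded_lipschitz (fun a b => f a b + g a b).
Proof.
move=> [C [C0 lf bf]] [D [D0 lg bg]]; exists (C + D); split; first exact: addr_gt0.
  move=> a b a' b'; rewrite opprD addrACA mulrDl (le_trans (ler_normD _ _))//.
  by apply: lerD; [exact: lf|exact: lg].
by move=> a b; rewrite (le_trans (ler_normD _ _))// lerD.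
Qed.

Lemma bounded_lipschitzM f g : bounded_lipschitz f -> bounded_lipschitz g ->
  bounded_lipschitz (fun a b => f a b * g a b).
Proof.
move=> [C [C0 lf bf]] [D [D0 lg bg]]; exists (C * D + C * D); split.
- by rewrite addr_gt0// mulr_gt0.
- move=> a b a' b'.
  rewrite (_ : f a b * g a b - _ = f a b * (g a b - g a' b') + (f a b - f a' b') * g a' b'); last by ring.
  rewrite (le_trans (ler_normD _ _))// !normrM mulrDl; apply: lerD.
    by rewrite -mulrA ler_pM.
  by rewrite -mulrA [D * _]mulrC mulrA ler_pM.
- move=> a b; rewrite normrM (@le_trans _ _ (C * D))//; first exact: ler_pM.
  by rewrite lerDl mulr_ge0// ltW.
Qed.

Lemma bounded_lipschitz_l (k : R -> R) C : 0 < C -> (forall a, `|k a| <= C) ->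
  (forall a b, `|k a - k b| <= C * `|a - b|) -> bounded_lipschitz (fun a _ => k a).
Proof.
move=> C0 bk lk; exists C; split => // a b a' b'.
by rewrite (le_trans (lk _ _))// ler_wpM2l ?lerDl// ltW.
Qed.

Lemma bounded_lipschitz_r (k : R -> R) C : 0 < C -> (forall a, `|k a| <= C) ->
  (forall a b, `|k a - k b| <= C * `|a - b|) -> bounded_lipschitz (fun _ b => k b).
Proof.
move=> C0 bk lk; exists C; split => // a b a' b'.
by rewrite (le_trans (lk _ _))// ler_wpM2l ?lerDr// ltW.
Qed.

Lemma mean_value_lipschitz (k : R -> R) C : (forall x, derivable k x 1) ->
  (forall x, `|'D_1 k x| <= C) -> forall a b, `|k a - k b| <= C * `|a - b|.
Proof.
move=> dk bk.
have main a b : a <= b -> `|k a - k b| <= C * `|a - b|.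
  move=> ab.
  have [||c _ kE] := @MVT_segment R k (fun x => 'D_1 k x) a b ab.
  - by move=> x _; apply: DeriveDef => //.
  - apply: continuous_subspaceT => x.
    by apply: differentiable_continuous; exact/derivable1_diffP.
  - by rewrite distrC kE normrM [in leRHS]distrC ler_wpM2r.
move=> a b; have [ab|/ltW ba] := leP a b; first exact: main.
by rewrite distrC [`|a - b|]distrC; exact: main.
Qed.

(** The factors of [quot] belong to this class, which is stable under
    differentiation and consists of bounded Lipschitz functions. *)
Definition eventually_cst (k : R -> R) := exists c, test_function setT (fun x => k x - c).

Lemma eventually_cst_smooth k : eventually_cst k -> smooth_on setT k.
Proof.
move=> [c [sk _]] m; rewrite (_ : k = fun x => (k x - c) + c).
  by apply: CkD; [exact: sk|exact: Ck_cst].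
by apply/funext => x; rewrite subrK.
Qed.

Lemma eventually_cst_derive k : eventually_cst k -> eventually_cst (fun x => 'D_1 k x).
Proof.
move=> ek; have sk := eventually_cst_smooth ek; move: ek => [c tk]; exists 0.
rewrite (_ : (fun x => _) = (fun x => 'D_1 (fun x => k x - c) x)).
  exact: test_function_derive.
apply/funext => x; rewrite subr0 deriveB//; first by rewrite derive_cst subr0.
exact: smooth_derivable.
Qed.

Lemma eventually_cst_bound k : eventually_cst k ->
  exists C, [/\ 0 < C, forall a, `|k a| <= C & forall a b, `|k a - k b| <= C * `|a - b|].
Proof.
move=> ek; have sk := eventually_cst_smooth ek; have [c tk] := ek.
have [C C0 bC] := test_function_bounded tk.
have [c' tk'] := eventually_cst_derive ek.
have [D D0 bD] := test_function_bounded tk'.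
pose K := (C + `|c|) + (D + `|c'|) + 1.
have K0 : 0 < K by rewrite ltr_wpDl// !addr_ge0.
exists K; split => //.
- move=> a; rewrite -[k a](subrK c) (le_trans (ler_normD _ _))//.
  apply: (@le_trans _ _ (C + `|c|)); first by rewrite lerD2r.
  by rewrite /K -addrA lerDl !addr_ge0.
- apply: mean_value_lipschitz; first by move=> x; exact: smooth_derivable.
  move=> x; rewrite -['D_1 k x](subrK c') (le_trans (ler_normD _ _))//.
  apply: (@le_trans _ _ (D + `|c'|)); first by rewrite lerD2r.
  by rewrite /K -addrA [D + _ + 1]addrC addrA lerDr !addr_ge0.
Qed.

Lemma eventually_cst_l k : eventually_cst k -> bounded_lipschitz (fun a _ => k a).
Proof. by move=> /eventually_cst_bound[C [h1 h2 h3]]; exact: bounded_lipschitz_l h1 h2 h3. Qed.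

Lemma eventually_cst_r k : eventually_cst k -> bounded_lipschitz (fun _ b => k b).
Proof. by move=> /eventually_cst_bound[C [h1 h2 h3]]; exact: bounded_lipschitz_r h1 h2 h3. Qed.

Lemma segment_compact_support (k : R -> R) a b c : smooth_on setT k ->
  (forall x, (x <= a) || (b <= x) -> k x = c) -> eventually_cst k.
Proof.
move=> sk kc; exists c; split.
  by move=> m; apply: CkD; [exact: sk|exact: Ck_cst].
exists `[a, b]%classic; split => //; first exact: segment_compact.
move=> x /= /negP; rewrite in_itv/= negb_and -!ltNge => h.
rewrite kc ?subrr//; move: h => /orP[/ltW->//|/ltW->]; by rewrite orbT.
Qed.

End bounded_lipschitz.

Section regularized_quotient.
Variables (R : realType) (q c M : R).
Hypotheses (c0 : 0 < c) (M0 : 0 <= M).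

Local Notation sig := (cutoff c M).
Let sig_pow s x := sig x `^ s.

Lemma cutoff_gt0 x : 0 < sig x.
Proof. by have /andP[h _] := cutoff_bounds x c0 M0; exact: lt_le_trans h. Qed.

Let smooth_sig : smooth_on setT sig.
Proof. by move=> k; exact: Ck_cutoff. Qed.

Let smooth_sig_pow s : smooth_on setT (sig_pow s).
Proof. by move=> k; apply: Ck_powR; [exact: cutoff_gt0|exact: Ck_cutoff]. Qed.

Lemma eventually_cst_cutoff : eventually_cst sig.
Proof.
by apply: (@segment_compact_support _ _ (- c) (M + 1) (c + c)) => // x;
  exact: cutoff_out.
Qed.

Lemma eventually_cst_cutoff_pow s : eventually_cst (sig_pow s).
Proof.
apply: (@segment_compact_support _ _ (- c) (M + 1) ((c + c) `^ s)) => // x h.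
by rewrite /sig_pow cutoff_out.
Qed.

Lemma derive_cutoff_pow s x : 'D_1 (sig_pow s) x = s * sig_pow (s - 1) x * 'D_1 sig x.
Proof.
have [d1 d2] := derive_powR_gt0 s (cutoff_gt0 x).
have ds := smooth_differentiable x smooth_sig.
have [_] := @derive_comp_real R R (fun y => y `^ s) sig x 1 d1 ds.
by rewrite d2.
Qed.

(** With [e = 2 c], and for [a], [b] in [[0, M]], this is
    [(a + e) - (b + e)^q / (a + e)^(q - 1)]; the cut-off makes it smooth with
    bounded derivatives on the whole plane. *)
Definition quot (a b : R) : R := sig a - sig b `^ q * sig a `^ (1 - q).
Definition quot1 (a b : R) : R :=
  'D_1 sig a * (1 + (q - 1) * (sig b `^ q * sig a `^ (- q))).
Definition quot2 (a b : R) : R :=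
  - q * (sig b `^ (q - 1) * 'D_1 sig b * sig a `^ (1 - q)).

Lemma quot_00 : quot 0 0 = 0.
Proof.
rewrite /quot -powRD; last by rewrite (gt_eqF (cutoff_gt0 _)) implybT.
have -> : q + (1 - q) = 1 by ring.
by rewrite powRr1 ?subrr// ltW// cutoff_gt0.
Qed.

Lemma bounded_lipschitz_quot : bounded_lipschitz quot.
Proof.
rewrite (_ : quot = fun a b => sig a + (- 1) * (sig_pow q b * sig_pow (1 - q) a)).
  apply: bounded_lipschitzD; first exact/eventually_cst_l/eventually_cst_cutoff.
  apply: bounded_lipschitzM; first exact: bounded_lipschitz_cst.
  apply: bounded_lipschitzM.
    exact/eventually_cst_r/eventually_cst_cutoff_pow.
  exact/eventually_cst_l/eventually_cst_cutoff_pow.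
by apply/funext => a; apply/funext => b; rewrite mulN1r.
Qed.

Lemma bounded_lipschitz_quot1 : bounded_lipschitz quot1.
Proof.
apply: bounded_lipschitzM.
  exact/(@eventually_cst_l _ (fun x => 'D_1 sig x))/eventually_cst_derive/eventually_cst_cutoff.
apply: bounded_lipschitzD; first exact: bounded_lipschitz_cst.
apply: bounded_lipschitzM; first exact: bounded_lipschitz_cst.
apply: bounded_lipschitzM.
  exact/eventually_cst_r/(eventually_cst_cutoff_pow q).
exact/eventually_cst_l/(eventually_cst_cutoff_pow (- q)).
Qed.

Lemma bounded_lipschitz_quot2 : bounded_lipschitz quot2.
Proof.
apply: bounded_lipschitzM; first exact: bounded_lipschitz_cst.
apply: bounded_lipschitzM; last exact/eventually_cst_l/(eventually_cst_cutoff_pow (1 - q)).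
apply: bounded_lipschitzM; first exact/eventually_cst_r/(eventually_cst_cutoff_pow (q - 1)).
exact/(@eventually_cst_r _ (fun x => 'D_1 sig x))/eventually_cst_derive/eventually_cst_cutoff.
Qed.

Variables (N : nat) (Omega : set 'rV[R]_N).

Lemma quot_test psi chi : test_function Omega psi -> test_function Omega chi ->
  test_function Omega (fun x => quot (psi x) (chi x)) /\
  forall x, gradient (fun x => quot (psi x) (chi x)) x =
    quot1 (psi x) (chi x) *: gradient psi x + quot2 (psi x) (chi x) *: gradient chi x.
Proof.
move=> [spsi [K [cK KO psi0]]] [schi [L [cL LO chi0]]]; split.
  split.
    move=> k; apply: CkD.
      by apply: Ck_comp_real; [exact: smooth_sig|exact: spsi].
    apply: CkN; apply: CkM.
      by apply: (Ck_comp_real (kap := sig_pow q)); [exact: smooth_sig_pow|exact: schi].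
    by apply: (Ck_comp_real (kap := sig_pow (1 - q))); [exact: smooth_sig_pow|exact: spsi].
  exists (K `|` L); split; [exact: compactU|by move=> x [/KO|/LO]|].
  by move=> x /not_orP[/psi0 -> /chi0 ->]; exact: quot_00.
move=> x; apply/rowP => i; rewrite !mxE /partial.
set h := basis_vec R i.
have dpsi := smooth_differentiable x spsi.
have dchi := smooth_differentiable x schi.
have [d1 e1] := derive_comp_real h (smooth_differentiable (psi x) smooth_sig) dpsi.
have [d2 e2] := derive_comp_real h (smooth_differentiable (chi x) (smooth_sig_pow q)) dchi.
have [d3 e3] := derive_comp_real h (smooth_differentiable (psi x) (smooth_sig_pow (1 - q))) dpsi.
have e2' := etrans e2 (congr1 (fun z => z * 'D_h chi x) (derive_cutoff_pow q (chi x))).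
have e3' := etrans e3 (congr1 (fun z => z * 'D_h psi x) (derive_cutoff_pow (1 - q) (psi x))).
have dd1 : derivable (sig \o psi) x h by apply: diff_derivable; exact: d1.
have dd2 : derivable (sig_pow q \o chi) x h by apply: diff_derivable; exact: d2.
have dd3 : derivable (sig_pow (1 - q) \o psi) x h by apply: diff_derivable; exact: d3.
have -> : 'D_h (fun x => quot (psi x) (chi x)) x =
    'D_1 sig (psi x) * 'D_h psi x -
    (sig_pow q (chi x) * ((1 - q) * sig_pow (1 - q - 1) (psi x) * 'D_1 sig (psi x) * 'D_h psi x) +
     sig_pow (1 - q) (psi x) * (q * sig_pow (q - 1) (chi x) * 'D_1 sig (chi x) * 'D_h chi x)).
  have ddm := derivableM dd2 dd3.
  apply: (etrans (deriveB dd1 ddm)); congr (_ - _); first exact: e1.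
  apply: (etrans (deriveM dd2 dd3)); congr (_ *: _ + _ *: _); [exact: e3'|exact: e2'].
have -> : 1 - q - 1 = - q by ring.
have alg (da db dp dc Sq Sm Sp Sq1 : R) :
    da * dp - (Sq * ((1 - q) * Sm * da * dp) + Sp * (q * Sq1 * db * dc)) =
    da * (1 + (q - 1) * (Sq * Sm)) * dp + (- q * (Sq1 * db * Sp)) * dc by ring.
exact: alg.
Qed.

(** Composition with the quotient thus preserves [W0], which makes the quotients
    admissible test functions. *)
Lemma chain_map_quot : exists C, chain_map Omega quot quot1 quot2 C.
Proof.
have [C0 [C0p l0 _]] := bounded_lipschitz_quot.
have [C1 [C1p l1 b1]] := bounded_lipschitz_quot1.
have [C2 [C2p l2 b2]] := bounded_lipschitz_quot2.
have w C C' F : 0 < C -> 0 < C' -> C <= C' -> lipschitz2 C F -> lipschitz2 C' F.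
  move=> Cp C'p CC' lF a b a' b'; rewrite (le_trans (lF _ _ _ _))//.
  by rewrite ler_wpM2r// addr_ge0.
have Sp : 0 < C0 + C1 + C2 by rewrite !addr_gt0.
have h0 : C0 <= C0 + C1 + C2 by lra.
have h1 : C1 <= C0 + C1 + C2 by lra.
have h2 : C2 <= C0 + C1 + C2 by lra.
exists (C0 + C1 + C2); split => //.
- exact: quot_00.
- exact: w l0.
- exact: w l1.
- exact: w l2.
- by move=> a b; exact: le_trans (b1 _ _) h1.
- by move=> a b; exact: le_trans (b2 _ _) h2.
- exact: quot_test.
Qed.

End regularized_quotient.

(** * Composition in Bochner spaces *)

Section ae_tools.
Context d (X : measurableType d) (R : realType).
Variable mu : {measure set X -> \bar R}.

Lemma aeS (A B : X -> Prop) : {ae mu, forall x, A x} ->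
  (forall x, A x -> B x) -> {ae mu, forall x, B x}.
Proof. by move=> hA AB; apply: filterS hA. Qed.

Lemma aeS2 (A B C : X -> Prop) : {ae mu, forall x, A x} -> {ae mu, forall x, B x} ->
  (forall x, A x -> B x -> C x) -> {ae mu, forall x, C x}.
Proof. by move=> hA hB ABC; apply: filterS2 hA hB. Qed.

End ae_tools.

Section bochner.
Variables (R : realType) (N : nat).
Local Notation E := 'rV[R]_N.
Variables (Omega : set E) (p : E -> R) (P : R).
Hypotheses (oO : open Omega) (fO : (leb R N Omega < +oo)%E).
Hypotheses (mp : measurable_fun Omega p) (p1 : forall x, Omega x -> 1 <= p x <= P).

Let atom k (B : 'I_k -> set R) (S : {set 'I_k}) : set R :=
  [set t | forall i, B i t <-> i \in S].

Let measurable_atom k (B : 'I_k -> set R) S : (forall i, measurable (B i)) ->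
  measurable (atom B S).
Proof.
move=> mB.
rewrite (_ : atom B S = \bigcap_(i in [set: 'I_k]) (if i \in S then B i else ~` B i)).
  apply: fin_bigcap_measurable => // i _; case: ifP => _; first exact: mB.
  by apply: measurableC; exact: mB.
apply/seteqP; split => t h i.
  by move=> _; case: ifPn => [/h//|/negP nS] /h.
have := h i I; case: ifPn => [iS Bi|/negP nS nB]; first by split.
by split.
Qed.

Let simple_atom k (B : 'I_k -> set R) (u : 'I_k -> E -> R) t x :
  \sum_(i < k) \1_(B i) t * u i x = \sum_(i in [set i | t \in B i]%SET) u i x.
Proof.
rewrite [RHS]big_mkcond; apply: eq_bigr => i _; rewrite inE indicE.
by case: (_ \in _); rewrite ?mul1r ?mul0r.
Qed.

Let atomE k (B : 'I_k -> set R) S t : atom B S t <-> S = [set i | t \in B i]%SET.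
Proof.
split=> [h|->]; last by move=> i; rewrite inE; split => [/mem_set|/set_mem].
apply/setP => i; rewrite inE; apply/idP/idP.
  by move=> /h/mem_set.
by move=> /set_mem/h.
Qed.

(** The sets that carry a simple function may overlap; on the atoms that they
    generate both functions are constant in time. *)
Lemma simple_W0_chain F F1 F2 C s r : chain_map Omega F F1 F2 C ->
  simple_W0 Omega p s -> simple_W0 Omega p r ->
  simple_W0 Omega p (fun t x => F (s t x) (r t x)).
Proof.
move=> cm [k [B [u [mB Wu ->]]]] [m [D [w [mD Ww ->]]]].
pose I : finType := ({set 'I_k} * {set 'I_m})%type.
pose e1 (j : 'I_#|I|) : {set 'I_k} := (enum_val j).1.
pose e2 (j : 'I_#|I|) : {set 'I_m} := (enum_val j).2.
exists #|I|, (fun j => atom B (e1 j) `&` atom D (e2 j)),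
  (fun j x => F (\sum_(i in e1 j) u i x) (\sum_(i in e2 j) w i x)).
split.
- by move=> j; apply: measurableI; exact: measurable_atom.
- move=> j; by apply: (W0_chain oO fO mp p1 cm); apply: (W0_sum oO fO mp p1).
- apply/funext => t; apply/funext => x; rewrite !simple_atom.
  set S := [set i | t \in B i]%SET; set S' := [set i | t \in D i]%SET.
  rewrite (bigD1 (enum_rank ((S, S') : I)))//= /e1 /e2 enum_rankK/= indicE mem_set; last first.
    by split; apply/atomE.
  rewrite mul1r [X in _ + X]big1 ?addr0// => j jS.
  rewrite indicE memNset ?mul0r// => -[/atomE h1 /atomE h2].
  move/eqP: jS; apply; rewrite -[j]enum_valK; congr enum_rank.
  by rewrite [LHS]surjective_pairing h1 h2.
Qed.

Lemma Lnorm_oo_bound d (T : measurableType d) (mu : {measure set T -> \bar R})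
    (D : set T) (u : T -> \bar R) :
  (Lnorm_on mu D +oo u < +oo)%E -> exists2 M : R, 0 <= M &
    {ae mu, forall x, D x -> (`|u x| <= M%:E)%E}.
Proof.
rewrite /Lnorm_on unlock; case: ifPn => [mu0 h|]; last first.
  rewrite -leNgt => mu0 _; exists 0 => //.
  exists setT; split => //; apply/eqP; rewrite eq_le mu0; exact: measure_ge0.
set s := ess_sup mu _ in h.
have s0 : (0 <= s)%E by apply: ess_sup_gee => //; apply: aeW => x /=.
have sf : s \is a fin_num by rewrite ge0_fin_numE.
exists (fine s); first exact: fine_ge0.
rewrite fineK//; apply: filterS (ess_sup_ge mu (abse \o (u \_ D))) => x /= hx Dx.
by move: hx; rewrite patchE mem_set.
Qed.

Variables (T : R) (T0 : 0 < T).

Lemma in_LrW_oo_bound v : in_LrW Omega p T +oo%E v -> exists2 M, 0 < M &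
  {ae @lebesgue_measure R, forall t : R, 0 < t < T ->
     W0 Omega p (v t) /\ (sobolev_norm Omega p (v t) < M%:E)%E}.
Proof.
move=> [W _ /Lnorm_oo_bound[M M0 hM]]; exists (M + 1); first by rewrite ltr_wpDl.
apply: (aeS2 W hM) => t Wt ht tT; split; first exact: Wt.
have {}ht : (`|sobolev_norm Omega p (v t)| <= M%:E)%E by apply: ht; rewrite /= in_itv.
rewrite gee0_abs ?sobolev_norm_ge0// in ht.
by rewrite (le_lt_trans ht)// lte_fin ltrDl.
Qed.

(** The simple approximations are composed too and converge by
    [sobolev_norm_chain_cvg0]; the norm of the composition is bounded uniformly
    in time because [F] vanishes at the origin and has bounded derivatives. *)
Lemma in_L1W_chain F F1 F2 C v w : chain_map Omega F F1 F2 C ->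
  in_LrW Omega p T +oo%E v -> in_LrW Omega p T +oo%E w ->
  in_LrW Omega p T 1%E (fun t x => F (v t x) (w t x)).
Proof.
move=> cm Lv Lw.
have [Mv Mv0 hMv] := in_LrW_oo_bound Lv.
have [Mw Mw0 hMw] := in_LrW_oo_bound Lw.
move: Lv Lw => [Wv [s [ss cs]] _] [Ww [r [rs cr]] _].
have simple_in t z : simple_W0 Omega p z -> W0 Omega p (z t).
  move=> [k [B [u [mB Wu ->]]]].
  rewrite (_ : (fun x => _) = (fun x => \sum_(i in [set i | t \in B i]%SET) u i x)).
    exact: (W0_sum oO fO mp p1).
  by apply/funext => x; exact: simple_atom.
split.
- apply: (aeS2 Wv Ww) => t hv hw tT.
  exact: (W0_chain oO fO mp p1 cm (hv tT) (hw tT)).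
- exists (fun k t x => F (s k t x) (r k t x)); split.
    by move=> k; exact: (simple_W0_chain cm (ss k) (rs k)).
  have : {ae @lebesgue_measure R, forall t : R, 0 < t < T -> W0 Omega p (v t) /\ W0 Omega p (w t)}.
    by apply: (aeS2 Wv Ww) => t hv hw tT; split; [exact: hv|exact: hw].
  move=> WW; have cc : {ae @lebesgue_measure R, forall t : R, 0 < t < T ->
       (fun n => sobolev_norm Omega p (v t \- s n t)) @ \oo --> 0%E /\
       (fun n => sobolev_norm Omega p (w t \- r n t)) @ \oo --> 0%E}.
    by apply: (aeS2 cs cr) => t hv hw tT; split; [exact: hv|exact: hw].
  apply: (aeS2 WW cc) => t hW hc tT.
  have [W1 W2] := hW tT; have [c1 c2] := hc tT.
  apply: (sobolev_norm_chain_cvg0 oO fO mp p1 cm W1 W2 _ _ c1 c2).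
    by move=> k; exact: simple_in.
  by move=> k; exact: simple_in.
- pose M := Num.max Mv Mw; have M0 : 0 < M by rewrite lt_max Mv0.
  have C0 := chain_gt0 cm.
  pose K := 2 * (4 * (C * M)).
  have K0 : 0 <= K by rewrite !mulr_ge0// ltW.
  have bound : {ae @lebesgue_measure R, forall t : R, 0 < t < T ->
      (sobolev_norm Omega p (fun x => F (v t x) (w t x)) <= K%:E)%E}.
    apply: (aeS2 hMv hMw) => t hv hw tT.
    have [/(W0_ex oO p1)[gv Wvt] /(sobolev_norm_lt p1)[gv' [l10 wv' hv1 hgv1]]] := hv tT.
    have [/(W0_ex oO p1)[gw Wwt] /(sobolev_norm_lt p1)[gw' [l20 ww' hw1 hgw1]]] := hw tT.
    have [wF _ _] := W0_with_chain oO fO mp p1 cm Wvt Wwt.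
    have [wv _ _] := Wvt; have [ww _ _] := Wwt.
    have [mv mgv _ _] := wv; have [mw mgw _ _] := ww.
    have MvM : Mv <= M by rewrite le_max lexx.
    have MwM : Mw <= M by rewrite le_max lexx orbT.
    have hgv : (modular Omega p M (fun x => enorm (gv x)) <= 1)%E.
      apply: (modular_mono p1 Mv0 MvM); apply: (le_trans _ hgv1).
      apply: (modular_le p1 Mv0 Mv0).
      by apply: filterS (weak_gradient_unique oO wv wv') => x hx Ox; rewrite hx.
    have hgw : (modular Omega p M (fun x => enorm (gw x)) <= 1)%E.
      apply: (modular_mono p1 Mw0 MwM); apply: (le_trans _ hgw1).
      apply: (modular_le p1 Mw0 Mw0).
      by apply: filterS (weak_gradient_unique oO ww ww') => x hx Ox; rewrite hx.
    have CM0 : 0 < 4 * (C * M) by rewrite !mulr_gt0.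
    apply: (sobolev_norm_le CM0 wF).
      apply: (modular_lin oO mp p1 M0 C0 mv mw).
      + by move=> x _; exact: (norm_chain _ _ cm).
      + exact: (modular_mono p1 Mv0 MvM hv1).
      + exact: (modular_mono p1 Mw0 MwM hw1).
    apply: (modular_lin oO mp p1 M0 C0 (measurable_enorm mgv) (measurable_enorm mgw) _ hgv hgw).
    by move=> x _; rewrite !(ger0_norm (enorm_ge0 _)); exact: (enorm_chain_grad _ _ _ _ _ cm).
  rewrite /Lnorm_on Lnorm1.
  apply: (@le_lt_trans _ _ (\int[@lebesgue_measure R]_(t in `]0%R, T[%classic) K%:E)%E); last first.
    rewrite integral_cst//= lebesgue_measure_itv/= lte_fin T0 -EFinD -EFinM.
    exact: ltry.
  rewrite [leRHS]integral_mkcond.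
  apply: ge0_le_integral_ae.
  + by move=> t _.
  + by move=> t _; rewrite patchE; case: ifP => // _; rewrite lee_fin.
  apply: (aeS bound) => t ht _; rewrite !patchE.
  case: ifPn => [/set_mem tT|_]; last by rewrite abse0.
  rewrite gee0_abs ?sobolev_norm_ge0//; apply: ht.
  by move: tT; rewrite /= in_itv.
Qed.

End bochner.

(** * The Picone inequality *)

Section calculus_along_lines.
Variables (R : realType).

(** The exceptional point is the one where a line meets the origin, at which the
    flux need not be differentiable. *)
Lemma nondecreasing_except1 (f f' : R -> R) (t0 : R) : continuous f ->
  (forall t, t != t0 -> is_derive t 1 f (f' t) /\ 0 <= f' t) ->
  forall a b, a <= b -> f a <= f b.
Proof.
move=> cf df.
have main a b : a <= b -> (b <= t0 \/ t0 <= a) -> f a <= f b.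
  rewrite le_eqVlt => /predU1P[->//|ab] h.
  have ne x : a < x < b -> x != t0.
    by move=> /andP[ax xb]; apply/eqP => xt; move: h; rewrite -xt => -[];
      rewrite leNgt ?ax ?xb.
  have [||c cab fab] := @MVT R f f' a b ab.
  - move=> x; rewrite in_itv/= => /ne xt; have [h1 h2] := df x xt; exact: h1.
  - exact: continuous_subspaceT.
  rewrite -subr_ge0 fab; apply: mulr_ge0; last by rewrite subr_ge0 ltW.
  by move: cab; rewrite in_itv/= => /ne xt; exact: (df c xt).2.
move=> a b ab; have [h|h] := leP b t0; first by apply: main => //; left.
have [h'|h'] := leP t0 a; first by apply: main => //; right.
by apply: (@le_trans _ _ (f t0)); apply: main; do ?[exact: ltW|by left|by right].
Qed.

Lemma continuous_sum (I : Type) (r : seq I) (f : I -> R -> R) :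
  (forall i, continuous (f i)) -> continuous (fun t => \sum_(i <- r) f i t).
Proof.
move=> cf; elim: r => [|i r IH] t.
  rewrite (_ : (fun t => _) = (fun=> 0)); first exact: cvg_cst.
  by apply/funext => s; rewrite big_nil.
rewrite (_ : (fun t => _) = (fun t => f i t + \sum_(i <- r) f i t)).
  by apply: cvgD; [exact: cf|exact: IH].
by apply/funext => s; rewrite big_cons.
Qed.

Variable N : nat.
Local Notation E := 'rV[R]_N.

Lemma dotp0r (x : E) : dotp x 0 = 0.
Proof. by rewrite /dotp big1// => i _; rewrite [X in _ * X]mxE mulr0. Qed.

Lemma enorm0 : enorm (0 : E) = 0.
Proof. by rewrite /enorm dotp0r sqrtr0. Qed.

Lemma derive_gradient (u : E -> R) (x d : E) : differentiable u x ->
  'D_d u x = dotp (gradient u x) d.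
Proof.
move=> du; rewrite deriveE// /dotp {1}(row_sum_delta d) linear_sum.
apply: eq_bigr => i _; rewrite linearZ/= mxE /partial -deriveE// mulrC.
by rewrite /basis_vec.
Qed.

Lemma is_derive_line (u : E -> R) (x d : E) (t : R) : differentiable u (x + t *: d) ->
  is_derive t 1 (fun s : R => u (x + s *: d)) (dotp (gradient u (x + t *: d)) d).
Proof.
move=> du.
have aff (h : R) : x + (h *: 1 + t) *: d = h *: d + (x + t *: d).
  by rewrite [h *: 1]mulr1 scalerDl addrCA.
have [h1 h2] := @derive_affine R E R (fun s : R => x + s *: d) u 1 t d aff.
apply: DeriveDef; first by apply: h1; exact: diff_derivable.
by rewrite [LHS]h2 derive_gradient.
Qed.

End calculus_along_lines.

Section picone.
Variables (R : realType) (N : nat).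
Local Notation E := 'rV[R]_N.
Variables (Omega : set E) (p : E -> R) (A : E -> E -> R).
Hypotheses (oO : open Omega) (cp : {in Omega, continuous p}) (p1 : forall x, Omega x -> 1 < p x).
Hypotheses (HA : operator_potential Omega A) (HA0 : condA0 Omega p A) (HA1 : condA1 Omega p A).
Local Notation flux := (flux p A).

Let p0 x : Omega x -> 0 < p x.
Proof. by move=> /p1; exact: lt_trans. Qed.

Let openX : open (Omega `*` [set: E]).
Proof.
rewrite openE => -[x xi] [Ox _]; exists (Omega, setT); last by move=> [y eta].
by split; [exact: open_nbhs_nbhs|exact: filterT].
Qed.

Lemma within_continuous_slice (g : E * E -> R) :
  {within Omega `*` setT, continuous g} ->
  (forall xi, {in Omega, continuous (fun x => g (x, xi))}) /\
  (forall x, Omega x -> continuous (fun xi => g (x, xi))).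
Proof.
rewrite continuous_open_subspace// => cg; split.
- move=> xi x /set_mem Ox.
  have cgx : {for (x, xi), continuous g} by apply: cg; apply/mem_set; split.
  change {for x, continuous (g \o (fun x => (x, xi)))}.
  apply: continuous_comp; last exact: cgx.
  move=> U [[U1 U2] /= [h1 h2] sU]; apply: (filterS _ h1) => y U1y.
  by apply: sU; split => //=; exact: nbhs_singleton.
- move=> x Ox xi.
  have cgx : {for (x, xi), continuous g} by apply: cg; apply/mem_set; split.
  change {for xi, continuous (g \o (fun xi => (x, xi)))}.
  apply: continuous_comp; last exact: cgx.
  move=> U [[U1 U2] /= [h1 h2] sU]; apply: (filterS _ h2) => y U2y.
  by apply: sU; split => //=; exact: nbhs_singleton.
Qed.

(** By continuity in [x], homogeneity holds everywhere and not just almost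
    everywhere. *)
Lemma potential_homogeneous x t xi : Omega x -> 0 < t -> A x (t *: xi) = t `^ p x * A x xi.
Proof.
move=> Ox t0; have [_ cA _] := HA.
have [cAx _] := within_continuous_slice cA.
apply: (@ae_eq_continuous R N Omega (fun x => A x (t *: xi)) (fun x => t `^ p x * A x xi)) => //.
- exact: cAx.
- move=> y Oy.
  apply: (@continuousM _ _ (fun x => t `^ p x) (fun x => A x xi)); last exact: (cAx xi).
  rewrite /powR gt_eqF//.
  change {for y, continuous (expR \o (fun x => p x * ln t))}.
  apply: continuous_comp; last exact: continuous_expR.
  by apply: continuousM; [exact: cp|exact: cst_continuous].
- exact: HA0 (ltW t0).
Qed.

Lemma potential_at0 x : Omega x -> A x 0 = 0.
Proof.
move=> Ox; have := @potential_homogeneous x 2 0 Ox (ltr0n R 2).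
rewrite scaler0 => h; apply/eqP.
have : (2 `^ p x - 1) * A x 0 = 0 by rewrite mulrBl mul1r -h subrr.
move/eqP; rewrite mulf_eq0 => /orP[|//].
have p2 : 1 < (2 : R) `^ p x.
  apply: (@lt_le_trans _ _ ((2 : R) `^ 1)); first by rewrite powRr1// ltr1n.
  by apply: ler_powR; [rewrite ler1n|exact/ltW/p1].
by rewrite subr_eq0 gt_eqF.
Qed.

Let dA x xi : Omega x -> differentiable (A x) xi.
Proof. by have [_ _ h] := HA; exact: h. Qed.

Lemma gradient_flux x xi : Omega x -> gradient (A x) xi = p x *: flux x xi.
Proof. by move=> Ox; rewrite /flux scalerA mulfV ?scale1r// gt_eqF// p0. Qed.

Lemma is_derive_powR1 (s : R) : is_derive (1 : R) 1 (fun t : R => t `^ s) s.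
Proof.
have := is_derive1_powR s (@ltr01 R).
by rewrite powR1 mulr1.
Qed.

(** Euler's identity, from the derivative of [A x (t *: xi)] at [t = 1]. *)
Lemma dotp_flux x xi : Omega x -> dotp (flux x xi) xi = A x xi.
Proof.
move=> Ox; have px0 := p0 Ox.
have h1 : is_derive (1 : R) 1 (fun t : R => A x (0 + t *: xi)) (dotp (gradient (A x) xi) xi).
  by have := @is_derive_line R N (A x) 0 xi 1; rewrite add0r scale1r; apply; exact: dA.
have h2 : is_derive (1 : R) 1 (fun t : R => t `^ p x * A x xi) (p x * A x xi).
  have h3 := is_derive_powR1 (p x).
  have : is_derive (1 : R) 1 (fun t : R => A x xi *: (t `^ p x : R^o)) (A x xi *: (p x : R^o)).
    exact: is_deriveZ.
  by rewrite /GRing.scale/= mulrC; under eq_fun do rewrite mulrC.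
have : dotp (gradient (A x) xi) xi = p x * A x xi.
  rewrite -(@derive_val _ _ _ _ _ _ _ h1) -(@derive_val _ _ _ _ _ _ _ h2).
  apply: near_eq_derive; near=> t.
  have t0 : 0 < t by near: t; exact: lt_nbhsr.
  by rewrite add0r potential_homogeneous.
rewrite gradient_flux// dotpZl => /(mulfI _); apply.
by rewrite gt_eqF.
Unshelve. all: by end_near. Qed.

Lemma flux_homogeneous x t xi : Omega x -> 0 < t ->
  flux x (t *: xi) = t `^ (p x - 1) *: flux x xi.
Proof.
move=> Ox t0; rewrite /flux scalerA mulrC -scalerA; congr (_ *: _).
apply/rowP => i; rewrite !mxE /partial.
have aff (h : R) : t *: (h *: basis_vec R i + xi) = h *: (t *: basis_vec R i) + t *: xi.
  by rewrite scalerDr !scalerA mulrC.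
have [_ h] := @derive_affine R E E (fun y => t *: y) (A x) (basis_vec R i) xi (t *: basis_vec R i) aff.
have h1 : 'D_(t *: basis_vec R i) (A x) (t *: xi) = t * 'D_(basis_vec R i) (A x) (t *: xi).
  by rewrite !deriveE ?linearZ//; exact: dA.
have h2 : 'D_(basis_vec R i) (A x \o (fun y => t *: y)) xi = t `^ p x * 'D_(basis_vec R i) (A x) xi.
  have -> : A x \o (fun y => t *: y) = (fun y => t `^ p x *: (A x y : R^o)).
    by apply/funext => y /=; rewrite potential_homogeneous.
  by rewrite deriveZ//; apply: diff_derivable; exact: dA.
apply: (mulfI (x := t)); first by rewrite gt_eqF.
rewrite -h1 -h h2 mulrA mulr_powRB1// ?ltW// p0//.
Qed.

Let dflux j x xi : Omega x -> xi != 0 -> differentiable (fun xi' => flux x xi' ord0 j) xi.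
Proof.
move=> Ox xi0; have [_ /(_ j)[h _] _ _] := HA1.
have d1 : differentiable (fun z : E * E => flux z.1 z.2 ord0 j) (x, xi) by exact: h.
have d2 : differentiable (fun xi' : E => (x, xi')) xi.
  by apply: differentiable_pair; [exact: differentiable_cst|exact: ex_diff].
exact: (@differentiable_comp _ _ _ _ (fun xi' : E => (x, xi')) (fun z : E * E => flux z.1 z.2 ord0 j)).
Qed.

Lemma is_derive_flux_line x (xi d : E) (t : R) : Omega x -> xi + t *: d != 0 ->
  is_derive t 1 (fun s : R => dotp (flux x (xi + s *: d)) d)
    (\sum_(i < N) \sum_(j < N) dflux_xi p A i j x (xi + t *: d) * d ord0 i * d ord0 j).
Proof.
move=> Ox xd.
have h j : is_derive t 1 (fun s : R => flux x (xi + s *: d) ord0 j * d ord0 j)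
   ((\sum_(i < N) dflux_xi p A i j x (xi + t *: d) * d ord0 i) * d ord0 j).
  have h1 := is_derive_line (dflux j Ox xd).
  have : is_derive t 1 (fun s : R => d ord0 j *: (flux x (xi + s *: d) ord0 j : R^o))
    (d ord0 j *: (dotp (gradient (fun xi' => flux x xi' ord0 j) (xi + t *: d)) d : R^o)).
    exact: is_deriveZ.
  rewrite /GRing.scale/= mulrC; under eq_fun do rewrite mulrC.
  by congr is_derive; congr (_ * _); apply: eq_bigr => i _; rewrite mxE.
have := is_derive_sum h.
rewrite (_ : \sum_(j < N) _ = (fun s : R => dotp (flux x (xi + s *: d)) d)); last first.
  by apply/funext => s; rewrite fct_sumE.
congr is_derive; rewrite exchange_big; apply: eq_bigr => j _.
by rewrite mulr_suml.
Qed.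

Lemma flux_continuous x : Omega x -> forall j, continuous (fun xi => flux x xi ord0 j).
Proof.
move=> Ox j; have [_ _ /(_ j) cf _] := HA1.
by have [_ h] := within_continuous_slice cf; exact: h.
Qed.

Lemma flux_line_nondecreasing x (xi d : E) : Omega x ->
  forall a b, a <= b -> dotp (flux x (xi + a *: d)) d <= dotp (flux x (xi + b *: d)) d.
Proof.
move=> Ox a b ab; have [->|d0] := eqVneq d 0.
  by rewrite !dotp0r.
have [t0 ht0] : exists t0, forall t, t != t0 -> xi + t *: d != 0.
  have [[t0 h0]|h] := pselect (exists t, xi + t *: d = 0); last first.
    by exists 0 => t _; apply/eqP => ht; apply: h; exists t.
  exists t0 => t; apply: contra => /eqP ht.
  have : (t - t0) *: d = 0.
    rewrite scalerBl; apply/eqP; rewrite subr_eq0; apply/eqP.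
    by apply: (@addrI _ xi); rewrite ht h0.
  by move/eqP; rewrite scaler_eq0 (negbTE d0) orbF subr_eq0.
have [gam [Gam [g0 G0 hG]]] : exists gamma Gamma : R, [/\ 0 < gamma, 0 < Gamma &
        forall x xi, Omega x -> xi != 0 ->
        (forall eta : E,
          gamma * enorm xi `^ (p x - 2) * enorm eta ^+ 2 <=
          \sum_(i < N) \sum_(j < N)
             dflux_xi p A i j x xi * eta ord0 i * eta ord0 j) /\
        \sum_(i < N) \sum_(j < N) `|dflux_xi p A i j x xi| <=
          Gamma * enorm xi `^ (p x - 2)] by have [_ _ _] := HA1.
apply: (@nondecreasing_except1 R (fun s => dotp (flux x (xi + s *: d)) d)
  (fun t => \sum_(i < N) \sum_(j < N) dflux_xi p A i j x (xi + t *: d) * d ord0 i * d ord0 j) t0) => //.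
- apply: continuous_sum => j t.
  apply: cvgM; last exact: cvg_cst.
  change {for t, continuous ((fun xi => flux x xi ord0 j) \o (fun s => xi + s *: d))}.
  apply: continuous_comp; last exact: flux_continuous.
  by apply: cvgD; [exact: cvg_cst|apply: cvgZl; exact: cvg_id].
- move=> t tt0; have xd := ht0 t tt0; split; first exact: is_derive_flux_line.
  have [h _] := hG x _ Ox xd; apply: le_trans (h d).
  rewrite mulr_ge0 ?sqr_ge0// mulr_ge0 ?powR_ge0//; exact: ltW.
Qed.

(** By the mean value theorem, convexity of the potential follows from the
    monotonicity of the flux along lines. *)
Lemma potential_convex x xi eta : Omega x ->
  A x xi + p x * dotp (flux x xi) (eta - xi) <= A x eta.
Proof.
move=> Ox; set d := eta - xi.
have [||c cab h] := @MVT_segment R (fun t : R => A x (xi + t *: d))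
   (fun t => dotp (gradient (A x) (xi + t *: d)) d) 0 1 ler01.
- by move=> t _; apply: is_derive_line; exact: dA.
- apply: continuous_subspaceT => t.
  apply: differentiable_continuous; apply/derivable1_diffP.
  by have := @is_derive_line R N (A x) xi d t (dA _ Ox) => hd; exact: ex_derive.
move: h; rewrite scale1r scale0r addr0 subr0 mulr1 gradient_flux// dotpZl.
rewrite {1}/d subrKC => h; rewrite -lerBrDl h ler_pM2l ?p0//.
have := @flux_line_nondecreasing x xi d Ox 0 c.
rewrite scale0r addr0; apply.
by move: cab; rewrite in_itv/= => /andP[].
Qed.

Lemma euler_flux x xi : Omega x -> xi != 0 ->
  (forall j, \sum_(i < N) dflux_xi p A i j x xi * xi ord0 i = (p x - 1) * flux x xi ord0 j).
Proof.
move=> Ox xi0 j.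
have dj : differentiable (fun xi' => flux x xi' ord0 j) (0 + 1 *: xi).
  by rewrite add0r scale1r; exact: dflux.
have h1 := is_derive_line dj.
have h2 : is_derive (1 : R) 1 (fun t : R => t `^ (p x - 1) * flux x xi ord0 j) ((p x - 1) * flux x xi ord0 j).
  have h3 := is_derive_powR1 (p x - 1).
  have : is_derive (1 : R) 1 (fun t : R => flux x xi ord0 j *: (t `^ (p x - 1) : R^o)) (flux x xi ord0 j *: (p x - 1 : R^o)).
    exact: is_deriveZ.
  by rewrite /GRing.scale/= mulrC; under eq_fun do rewrite mulrC.
rewrite -(@derive_val _ _ _ _ _ _ _ h2).
rewrite (_ : \sum_(i < N) _ = dotp (gradient (fun xi' => flux x xi' ord0 j) (0 + 1 *: xi)) xi); last first.
  by apply: eq_bigr => i _; rewrite add0r scale1r mxE.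
rewrite -(@derive_val _ _ _ _ _ _ _ h1).
apply: near_eq_derive; near=> t.
have t0 : 0 < t by near: t; exact: lt_nbhsr.
by rewrite add0r flux_homogeneous// mxE.
Unshelve. all: by end_near. Qed.

(** Euler's identity for the flux turns the bounds on its derivative into a
    bound on the flux and into the positivity of the potential. *)
Lemma flux_bounds : exists C, 0 < C /\ forall x xi, Omega x ->
   enorm (flux x xi) * (p x - 1) <= C * enorm xi `^ (p x - 1) /\
   (xi != 0 -> 0 < A x xi).
Proof.
have [f00 _ _ [gam [Gam [g0 G0 hG]]]] := HA1.
exists Gam; split => // x xi Ox; have px1 : 0 < p x - 1 by rewrite subr_gt0 p1.
have [->|xi0] := eqVneq xi 0.
  split => //; rewrite (_ : flux x 0 = 0); last by apply/rowP => j; rewrite f00// mxE.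
  rewrite enorm0.
  by rewrite mul0r mulr_ge0 ?powR_ge0// ltW.
have n0 : 0 < enorm xi.
  rewrite lt_def enorm_ge0 andbT; apply: contra xi0 => /eqP h.
  by apply/eqP; exact: enorm0_eq0.
have eu := euler_flux Ox xi0.
have [h1 h2] := hG x xi Ox xi0; split.
  have e1 : enorm xi `^ (p x - 1) = enorm xi * enorm xi `^ (p x - 2).
    have -> : p x - 1 = 1 + (p x - 2) by ring.
    rewrite [LHS]powRD; last by rewrite (gt_eqF n0) implybT.
    by rewrite powRr1// ltW.
  rewrite e1 [leRHS]mulrCA.
  apply: (@le_trans _ _ (enorm xi * (\sum_(i < N) \sum_(j < N) `|dflux_xi p A i j x xi|))); last first.
    by rewrite ler_pM2l.
  have nle (y : E) : enorm y <= \sum_j `|y ord0 j|.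
    have s0 : 0 <= \sum_j `|y ord0 j| by apply: sumr_ge0.
    rewrite -(@ler_pXn2r _ 2)// ?nnegrE ?enorm_ge0// sqr_enorm expr2 mulr_suml.
    apply: ler_sum => j _; rewrite (le_trans (ler_norm _))// normrM ler_wpM2l//.
    by rewrite (bigD1 j)//= lerDl sumr_ge0.
  apply: (@le_trans _ _ ((\sum_j `|flux x xi ord0 j|) * (p x - 1))).
    by rewrite ler_pM2r.
  rewrite exchange_big/= mulr_suml mulr_sumr; apply: ler_sum => j _.
  rewrite -{1}(gtr0_norm px1) -normrM mulrC -eu.
  rewrite (le_trans (ler_norm_sum _ _ _))// mulr_sumr; apply: ler_sum => i _.
  by rewrite normrM mulrC ler_wpM2r// entry_le_enorm.
move=> _.
have h3 : (p x - 1) * A x xi = \sum_(i < N) \sum_(j < N) dflux_xi p A i j x xi * xi ord0 i * xi ord0 j.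
  rewrite exchange_big/= -(dotp_flux xi Ox) /dotp mulr_sumr; apply: eq_bigr => j _.
  by rewrite mulrA -eu mulr_suml.
rewrite -(pmulr_rgt0 _ px1) h3; apply: lt_le_trans (h1 xi).
by rewrite !mulr_gt0// ?powR_gt0// exprn_gt0.
Qed.

(** Young's inequality attached to the potential: the convexity inequality at
    [t *: eta], with the best [t]. *)
Lemma flux_young x xi eta z : Omega x -> 0 < z -> A x eta = z `^ p x * A x xi ->
  dotp (flux x xi) eta <= z * A x xi.
Proof.
move=> Ox z0 hz; have px0 := p0 Ox.
have zi0 : 0 < z^-1 by rewrite invr_gt0.
have := potential_convex xi (z^-1 *: eta) Ox.
have e : z^-1 `^ p x * (z `^ p x * A x xi) = A x xi.
  rewrite mulrA -powRM; [|exact: ltW|exact: ltW].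
  by rewrite mulVf ?powR1 ?mul1r// gt_eqF.
rewrite potential_homogeneous// hz e -scaleN1r dotpDr !dotpZr dotp_flux// => h.
have : p x * (z^-1 * dotp (flux x xi) eta) <= p x * A x xi by lra.
by rewrite ler_pM2l// ler_pdivrMl// mulrC.
Qed.

(** Young's inequality with the conjugate exponents [q] and [q / (q - 1)]. *)
Lemma young_power (q k z : R) : 1 < q -> 0 < k -> 0 < z ->
  q * (k `^ (q - 1) * z) <= (q - 1) * k `^ q + z `^ q.
Proof.
move=> q1 k0 z0; have q0 : 0 < q by exact: lt_trans q1.
have q10 : 0 < q - 1 by rewrite subr_gt0.
have qne : q != 0 by rewrite gt_eqF.
have q1ne : q - 1 != 0 by rewrite gt_eqF.
have := @conjugate_powR R z (k `^ (q - 1)) q (q / (q - 1)) (ltW z0) (powR_ge0 _ _) q0 (divr_gt0 q0 q10).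
rewrite -powRrM (_ : (q - 1) * (q / (q - 1)) = q); last by field.
move=> h; have {}h : z * k `^ (q - 1) <= z `^ q / q + k `^ q / (q / (q - 1)).
  by apply: h; field; rewrite qne q1ne.
rewrite [_ `^ _ * z]mulrC -ler_pdivlMl//.
apply: (le_trans h); rewrite le_eqVlt; apply/orP; left; apply/eqP; field.
by rewrite qne q1ne.
Qed.

(** The Picone inequality in the symmetric form of Diaz and Saa. Write [A x eta
    = z ^ p A x xi]. The mixed terms are estimated by [flux_young] and
    [young_power]; what remains is [A x xi (1 - z ^ q) (1 - z ^ (p - q))], which
    is nonnegative since [q < p]. *)
Lemma picone x (q V W : R) xi eta : Omega x -> 1 < q -> q < p x -> 0 < V -> 0 < W ->
  0 <= dotp (flux x xi) ((1 + (q - 1) * (W `^ q * V `^ (- q))) *: xi +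
         (- q * (W `^ (q - 1) * V `^ (1 - q))) *: eta) +
       dotp (flux x eta) ((1 + (q - 1) * (V `^ q * W `^ (- q))) *: eta +
         (- q * (V `^ (q - 1) * W `^ (1 - q))) *: xi).
Proof.
move=> Ox q1 qp V0 W0; rewrite !dotpDr !dotpZr !dotp_flux//.
have [C [_ hC]] := flux_bounds.
have q0 : 0 < q by exact: lt_trans q1.
pose k := W / V; have k0 : 0 < k by rewrite divr_gt0.
have ratio (a b s : R) : 0 < a -> 0 < b -> a `^ s * b `^ (- s) = (a / b) `^ s.
  move=> a0 b0; rewrite powRM; [|exact: ltW|by rewrite invr_ge0 ltW].
  by rewrite -(powR_inv1 (ltW b0)) -powRrM mulN1r.
have kV : V / W = k^-1 by rewrite /k invf_div.
have -> : 1 - q = - (q - 1) by ring.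
rewrite !ratio// kV -/k.
have c0 : forall a, 0 < a -> 0 <= 1 + (q - 1) * a `^ q.
  by move=> a a0; rewrite addr_ge0// mulr_ge0 ?powR_ge0// subr_ge0 ltW.
have k'0 : 0 < k^-1 by rewrite invr_gt0.
have [->|xi0] := eqVneq xi 0.
  rewrite potential_at0// mulr0 add0r.
  have [->|eta0] := eqVneq eta 0.
    by rewrite potential_at0// !dotp0r !mulr0 !addr0.
  have [f00 _ _ _] := HA1.
  have -> : dotp (flux x 0) eta = 0.
    by rewrite /dotp big1// => i _; rewrite f00// mul0r.
  rewrite dotp0r !mulr0 add0r addr0 mulr_ge0// ?c0// ltW//.
  by have [_ h] := hC x eta Ox; exact: h.
have [->|eta0] := eqVneq eta 0.
  rewrite potential_at0// mulr0 add0r.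
  have [f00 _ _ _] := HA1.
  have -> : dotp (flux x 0) xi = 0.
    by rewrite /dotp big1// => i _; rewrite f00// mul0r.
  rewrite dotp0r !mulr0 !addr0 mulr_ge0// ?c0// ltW//.
  by have [_ h] := hC x xi Ox; exact: h.
have X0 : 0 < A x xi by have [_ h] := hC x xi Ox; exact: h.
have Y0 : 0 < A x eta by have [_ h] := hC x eta Ox; exact: h.
have px0 := p0 Ox.
set X := A x xi in X0 *; set Y := A x eta in Y0 *.
pose z := (Y / X) `^ (p x)^-1.
have z0 : 0 < z by rewrite powR_gt0// divr_gt0.
have z'0 : 0 < z^-1 by rewrite invr_gt0.
have zY : Y = z `^ p x * X.
  rewrite /z -powRrM mulVf ?gt_eqF// powRr1; last by rewrite divr_ge0// ltW.
  by rewrite divfK// gt_eqF.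
have zX : X = z^-1 `^ p x * Y.
  rewrite zY mulrA -powRM; [|exact: ltW|exact: ltW].
  by rewrite mulVf ?powR1 ?mul1r// gt_eqF.
have y1 := flux_young Ox z0 zY.
have y2 := flux_young Ox z'0 zX.
have u1 := young_power q1 k0 z0.
have u2 := young_power q1 k'0 z'0.
rewrite -/X in y1; rewrite -/Y in y2.
set a := k `^ q in u1 *; set a' := k^-1 `^ q in u2 *.
set b := k `^ (q - 1) in u1 *; set b' := k^-1 `^ (q - 1) in u2 *.
have b0 : 0 < b by exact: powR_gt0.
have b'0 : 0 < b' by exact: powR_gt0.
(* after Young's inequality only the terms in z are left *)
have key : 0 <= X * (1 - z `^ q) + Y * (1 - z^-1 `^ q).
  have -> : Y * (1 - z^-1 `^ q) = X * (z `^ p x - z `^ (p x - q)).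
    rewrite zY mulrBr mulr1 mulrBr [X * _]mulrC; congr (_ - _).
    have -> : z^-1 `^ q = z `^ (- q).
      by rewrite -(powR_inv1 (ltW z0)) -powRrM mulN1r.
    rewrite mulrAC -powRD; first by rewrite mulrC.
    by rewrite (gt_eqF z0) implybT.
  rewrite -mulrDr mulr_ge0//; first exact: ltW.
  have zz : z `^ p x = z `^ q * z `^ (p x - q).
    rewrite -powRD; first by rewrite addrC subrK.
    by rewrite (gt_eqF z0) implybT.
  rewrite zz.
  have -> : 1 - z `^ q + (z `^ q * z `^ (p x - q) - z `^ (p x - q)) =
     (1 - z `^ q) * (1 - z `^ (p x - q)) by ring.
  have qpx : 0 < p x - q by rewrite subr_gt0.
  have le0 r : 0 < r -> (z <= 1 -> z `^ r <= 1) /\ (1 <= z -> 1 <= z `^ r).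
    move=> r0; rewrite -{2 4}(powRr0 z); split=> h.
      by apply: ger_powR; [rewrite z0 h|exact: (ltW r0)].
    by apply: ler_powR; [exact: h|exact: (ltW r0)].
  have [h1 h2] := le0 q q0; have [h3 h4] := le0 _ qpx.
  have [z1|z1] := leP z 1.
    by apply: mulr_ge0; rewrite subr_ge0; [exact: h1|exact: h3].
  apply: mulr_le0; rewrite subr_le0; [apply: h2|apply: h4]; exact: (ltW z1).
have e1 : q * b * dotp (flux x xi) eta <= q * b * (z * X).
  by rewrite ler_pM2l// mulr_gt0.
have e2 : q * b' * dotp (flux x eta) xi <= q * b' * (z^-1 * Y).
  by rewrite ler_pM2l// mulr_gt0.
have e3 : X * (q * (b * z)) <= X * ((q - 1) * a + z `^ q) by rewrite ler_pM2l.
have e4 : Y * (q * (b' * z^-1)) <= Y * ((q - 1) * a' + z^-1 `^ q) by rewrite ler_pM2l.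
move: e1 e2 e3 e4 key; move: (dotp (flux x xi) eta) (dotp (flux x eta) xi) => D1 D2.
move: (z `^ q) (z^-1 `^ q) => Z1 Z2 e1 e2 e3 e4 key.
nra.
Qed.

End picone.

(** * Square-integrable functions *)

Section square_integrable.
Context d (T : measurableType d) (R : realType).
Variables (mu : {measure set T -> \bar R}) (D : set T).
Hypothesis mD : measurable D.
Implicit Types u v : T -> R.

Lemma Lnorm_2E u : Lnorm_on mu D 2%:E (EFin \o u) =
  ((\int[mu]_(x in D) ((u x) ^+ 2)%:E) `^ 2^-1)%E.
Proof.
rewrite /Lnorm_on unlock; congr (_ `^ _)%E.
rewrite [RHS]integral_mkcond; apply: eq_integral => x _.
rewrite !patchE; case: ifPn => _ /=.
  by rewrite powR_mulrn// real_normK// num_real.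
by rewrite normr0 powR0// pnatr_eq0.
Qed.

Lemma Lnorm_2_Rintegral u : measurable_fun D u ->
  mu.-integrable D (fun x => ((u x) ^+ 2)%:E) ->
  Lnorm_on mu D 2%:E (EFin \o u) = (Num.sqrt (\int[mu]_(x in D) (u x ^+ 2)))%:E.
Proof.
move=> mu_ iu; rewrite Lnorm_2E poweR12_sqrt; last first.
  by apply: integral_ge0 => x _; rewrite lee_fin sqr_ge0.
by rewrite -(fineK (integrable_fin_num mD iu)).
Qed.

Lemma in_L2P u : in_Lp mu D 2%:E u <->
  measurable_fun D u /\ mu.-integrable D (fun x => ((u x) ^+ 2)%:E).
Proof.
split=> -[mu_ h]; split=> //; last first.
  rewrite Lnorm_2_Rintegral//; exact: ltry.
have mu2 : measurable_fun D (fun x => u x ^+ 2) by exact: measurable_funX.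
apply/integrableP; split; first exact/measurable_EFinP.
have -> : (\int[mu]_(x in D) `|((u x) ^+ 2)%:E| = \int[mu]_(x in D) ((u x) ^+ 2)%:E)%E.
  by apply: eq_integral => x _; rewrite gee0_abs// lee_fin sqr_ge0.
move: h; rewrite Lnorm_2E.
have : (0 <= \int[mu]_(x in D) ((u x) ^+ 2)%:E)%E.
  by apply: integral_ge0 => x _; rewrite lee_fin sqr_ge0.
case: (\int[mu]_(x in D) _)%E => [r _ _|_|].
- exact: ltry.
- by rewrite poweRyr// invr_eq0 pnatr_eq0.
- by rewrite leNgt ltNy0.
Qed.

Section two_functions.
Variables (u v : T -> R).
Hypotheses (mu_ : measurable_fun D u) (mv_ : measurable_fun D v).
Hypotheses (iu : mu.-integrable D (fun x => ((u x) ^+ 2)%:E))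
  (iv : mu.-integrable D (fun x => ((v x) ^+ 2)%:E)).

Let iuv2 : mu.-integrable D (fun x => (u x ^+ 2 + v x ^+ 2)%:E).
Proof. by apply: eq_integrable (integrableD mD iu iv) => // x _. Qed.

Lemma integrable_mul_L2 : mu.-integrable D (fun x => (u x * v x)%:E).
Proof.
apply: (le_integrable mD _ _ iuv2).
  by apply/measurable_EFinP; exact: measurable_funM.
move=> x _; rewrite /= lee_fin normrM [leRHS]ger0_norm ?addr_ge0 ?sqr_ge0//.
rewrite -(real_normK (num_real (u x))) -(real_normK (num_real (v x))).
have := sqr_ge0 (`|u x| - `|v x|); have := mulr_ge0 (normr_ge0 (u x)) (normr_ge0 (v x)).
move: `|u x| `|v x| => a b. nra.
Qed.

Lemma integrable_sqrB_L2 : mu.-integrable D (fun x => ((u x - v x) ^+ 2)%:E).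
Proof.
have i2 := integrableZl mD 2 iuv2.
apply: (le_integrable mD _ _ i2).
  by apply/measurable_EFinP; apply: measurable_funX; exact: measurable_funB.
move=> x _; rewrite /= lee_fin ger0_norm ?sqr_ge0// [leRHS]ger0_norm; last first.
  by rewrite mulr_ge0// addr_ge0 ?sqr_ge0.
by have := sqr_ge0 (u x + v x); nra.
Qed.

(** Young's inequality is integrated with the optimal weight, the two norms
    being increased by a small [s] so that the weight makes sense when they
    vanish. *)
Lemma cauchy_schwarz_L2 : `|\int[mu]_(x in D) (u x * v x)| <=
  Num.sqrt (\int[mu]_(x in D) (u x ^+ 2)) * Num.sqrt (\int[mu]_(x in D) (v x ^+ 2)).
Proof.
have iuv := integrable_mul_L2.
apply: (le_trans (le_normr_Rintegral mD iuv)).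
set a := \int[mu]_(x in D) (u x ^+ 2); set b := \int[mu]_(x in D) (v x ^+ 2).
have a0 : 0 <= a by apply: Rintegral_ge0 => x _; exact: sqr_ge0.
have b0 : 0 <= b by apply: Rintegral_ge0 => x _; exact: sqr_ge0.
set c := \int[mu]_(x in D) _.
set al := Num.sqrt a; set be := Num.sqrt b.
have al0 : 0 <= al by exact: sqrtr_ge0.
have be0 : 0 <= be by exact: sqrtr_ge0.
have Ea : a = al ^+ 2 by rewrite sqr_sqrtr.
have Eb : b = be ^+ 2 by rewrite sqr_sqrtr.
have young l : 0 < l -> 2 * c <= l * a + l^-1 * b.
  move=> l0; rewrite /a /b /c -!RintegralZl//; last first.
    by apply: eq_integrable (integrable_abse iuv) => // x _.
  rewrite -RintegralD//; last 2 first.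
    by apply: eq_integrable (integrableZl mD l iu) => // x _.
    by apply: eq_integrable (integrableZl mD l^-1 iv) => // x _.
  apply: le_Rintegral => //.
  - by apply: eq_integrable (integrableZl mD 2 (integrable_abse iuv)) => // x _.
  - apply: eq_integrable (integrableD mD (integrableZl mD l iu)
      (integrableZl mD l^-1 iv)) => // x _ //.
  - move=> x _ /=; rewrite normrM.
    rewrite -(real_normK (num_real (u x))) -(real_normK (num_real (v x))).
    set U := `|u x|; set V := `|v x|; rewrite -subr_ge0.
    have -> : l * U ^+ 2 + l^-1 * V ^+ 2 - 2 * (U * V) = l * (U - l^-1 * V) ^+ 2.
      by field; rewrite gt_eqF.
    by rewrite mulr_ge0 ?sqr_ge0 ?ltW.
apply/ler_addgt0Pr => e e0.
pose s := e / (al + be + 1).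
have s0 : 0 < s by rewrite divr_gt0// ltr_wpDl// addr_ge0.
have se : s * (al + be) <= e.
  rewrite /s mulrAC ler_pdivrMr; last by rewrite ltr_wpDl// addr_ge0.
  by rewrite ler_pM2l// lerDl.
have := young ((be + s) / (al + s)).
have als : 0 < al + s by rewrite ltr_wpDl.
have bes : 0 < be + s by rewrite ltr_wpDl.
rewrite divr_gt0// invf_div => /(_ isT).
have h1 : (be + s) / (al + s) * a <= (be + s) * al.
  rewrite -mulrA ler_pM2l// mulrC ler_pdivrMr// Ea expr2 ler_wpM2l//.
  by rewrite lerDl ltW.
have h2 : (al + s) / (be + s) * b <= (al + s) * be.
  rewrite -mulrA ler_pM2l// mulrC ler_pdivrMr// Eb expr2 ler_wpM2l//.
  by rewrite lerDl ltW.
nra.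
Qed.

End two_functions.

End square_integrable.

(** * Weak derivatives on an interval *)

Lemma Rintegral_support d (X : measurableType d) (R : realType)
    (mu : {measure set X -> \bar R}) (B D : set X) (f : X -> R) :
  B `<=` D -> (forall x, D x -> ~ B x -> f x = 0) ->
  \int[mu]_(x in D) f x = \int[mu]_(x in B) f x.
Proof.
move=> BD f0; rewrite Rintegral_mkcond [RHS]Rintegral_mkcond; congr (Rintegral _ _ _).
apply/funext => x; rewrite /patch.
case: ifPn => [/set_mem Dx|nD]; case: ifPn => [/set_mem Bx|nB] //.
  by apply: f0 => // Bx; move: nB; rewrite mem_set.
by exfalso; move: nD; rewrite mem_set//; exact: BD.
Qed.

Section ramps.
Variable R : realType.
Local Notation lambda := (@lebesgue_measure R).

(** The derivative of a function that rises from [0] at [a] to [1] at [b] has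
    integral one and concentrates near [a]. *)
Lemma ramp_delta (s m : R -> R) (a b c C e : R) (D : set R) : a < b ->
  smooth_on setT s -> (forall x, x <= a -> s x = 0) -> (forall x, b <= x -> s x = 1) ->
  (forall x, `|'D_1 s x| <= C) -> continuous m ->
  (forall x, a <= x <= b -> `|m x - c| <= e) -> `[a, b]%classic `<=` D ->
  `|\int[lambda]_(x in D) (m x * 'D_1 s x) - c| <= C * e * (b - a).
Proof.
move=> ab ss sa sb sC cm me abD.
have cDs : continuous (fun x => 'D_1 s x) by exact/smooth_continuous/smooth_derive.
have D0 x : ~ `[a, b]%classic x -> 'D_1 s x = 0.
  move=> /= /negP; rewrite in_itv/= negb_and -!ltNge => /orP[xa|bx].
    rewrite (_ : 'D_1 s x = 'D_1 (fun=> 0 : R) x); first exact: derive_cst.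
    apply: near_eq_derive; apply: filterS (lt_nbhsl xa) => y ya.
    by rewrite sa// ltW.
  rewrite (_ : 'D_1 s x = 'D_1 (fun=> 1 : R) x); first exact: derive_cst.
  apply: near_eq_derive; apply: filterS (lt_nbhsr bx) => y ya.
  by rewrite sb// ltW.
have -> : \int[lambda]_(x in D) (m x * 'D_1 s x) =
    \int[lambda]_(x in `[a, b]) (m x * 'D_1 s x).
  by apply: Rintegral_support => // x _ nx; rewrite D0// mulr0.
have int1 : \int[lambda]_(x in `[a, b]) ('D_1 s x) = 1.
  rewrite /Rintegral (@continuous_FTC2 R _ s)//.
  - by rewrite (sa a)// (sb b)// sube0.
  - exact: continuous_subspaceT.
  - have cs := smooth_continuous ss.
    split; first by move=> x _; exact: smooth_derivable.
    + by apply: cvg_at_right_filter; exact: cs.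
    + by apply: cvg_at_left_filter; exact: cs.
  - by move=> x _; rewrite derive1E.
have integ (g : R -> R) : continuous g -> lambda.-integrable `[a, b] (EFin \o g).
  move=> cg; apply: continuous_compact_integrable; first exact: segment_compact.
  exact: continuous_subspaceT.
have cmDs : continuous (fun x => m x * 'D_1 s x).
  by move=> x; apply: cvgM; [exact: cm|exact: cDs].
have mab : measurable (`[a, b]%classic : set (measurableTypeR R)) by exact: measurable_itv.
have ccDs : continuous (fun x => c * 'D_1 s x).
  by move=> x; apply: cvgM; [exact: cvg_cst|exact: cDs].
have E1 := RintegralZl c mab (integ _ cDs).
have E2 := RintegralB mab (integ _ cmDs) (integ _ ccDs).
rewrite int1 mulr1 in E1; rewrite E1 in E2.
rewrite -E2.
have -> : \int[lambda]_(x in `[a, b]) (m x * 'D_1 s x - c * 'D_1 s x) =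
    \int[lambda]_(x in `[a, b]) ((m x - c) * 'D_1 s x).
  by apply: eq_Rintegral => x _; rewrite mulrBl.
have cd : continuous (fun x => (m x - c) * 'D_1 s x).
  by move=> x; apply: cvgM; [apply: cvgB; [exact: cm|exact: cvg_cst]|exact: cDs].
apply: (le_trans (le_normr_Rintegral mab (integ _ cd))).
have -> : C * e * (b - a) = \int[lambda]_(x in `[a, b]) (C * e).
  by rewrite Rintegral_cst//= lebesgue_measure_itv/= lte_fin ab.
apply: le_Rintegral => //.
- by apply: integ => x; apply: cvg_norm; exact: cd.
- by apply: integ => x; exact: cvg_cst.
- move=> x /= xab; rewrite normrM mulrC; apply: ler_pM => //.
  by apply: me; move: xab; rewrite in_itv.
Qed.

Definition ramp (k b x : R) : R := step (k * (x - b)).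

Lemma smooth_ramp k b : smooth_on setT (ramp k b).
Proof.
move=> j; apply: Ck_comp_real; first exact: Ck_step.
by apply: CkM; [exact: Ck_cst|apply: CkD; [exact: Ck_id|exact: Ck_cst]].
Qed.

Lemma ramp_eq0 k b x : 0 < k -> x <= b -> ramp k b x = 0.
Proof. by move=> k0 xb; apply: step_le0; rewrite pmulr_rle0// subr_le0. Qed.

Lemma ramp_eq1 k b x : 0 < k -> b + k^-1 <= x -> ramp k b x = 1.
Proof.
move=> k0 xb; apply: step_ge1; rewrite -(mulfV (lt0r_neq0 k0)) ler_pM2l//.
by rewrite lerBrDl.
Qed.

Lemma derive_ramp : exists2 C : R, 0 < C & forall k b x, 0 < k ->
  `|'D_1 (ramp k b) x| <= k * C.
Proof.
have ss : smooth_on setT (@step R) by move=> j; exact: Ck_step.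
have tD : test_function setT (fun x => 'D_1 (@step R) x).
  split; first exact: smooth_derive.
  exists `[0, 1]%classic; split => //; first exact: segment_compact.
  move=> x /= /negP; rewrite in_itv/= negb_and -!ltNge => /orP[xa|bx].
    rewrite (_ : 'D_1 _ x = 'D_1 (fun=> 0 : R) x); first exact: derive_cst.
    apply: near_eq_derive; apply: filterS (lt_nbhsl xa) => y ya.
    by rewrite step_le0// ltW.
  rewrite (_ : 'D_1 _ x = 'D_1 (fun=> 1 : R) x); first exact: derive_cst.
  apply: near_eq_derive; apply: filterS (lt_nbhsr bx) => y ya.
  by rewrite step_ge1// ltW.
have [C C0 bC] := test_function_bounded tD.
exists (C + 1); first by rewrite ltr_wpDl.
move=> k b x k0.
have sl : smooth_on setT (fun x : R => k * (x - b)).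
  by move=> j; apply: CkM; [exact: Ck_cst|apply: CkD; [exact: Ck_id|exact: Ck_cst]].
have [_ ->] := @derive_comp_real R R (@step R) (fun x => k * (x - b)) x 1
  (smooth_differentiable _ ss) (smooth_differentiable _ sl).
have -> : 'D_1 (fun x : R => k * (x - b)) x = k.
  rewrite deriveM//= derive_cst deriveB//= derive_cst derive_id.
  by rewrite subr0 !scaler0 addr0 /GRing.scale/= mulr1.
rewrite normrM mulrC (gtr0_norm k0) ler_wpM2l//; first exact: ltW.
by rewrite (le_trans (bC _))// lerDl.
Qed.

(** The identity is tested with the difference of two ramps, which converges to
    the indicator of []0, t[]. The ramps rise strictly inside this interval,
    which is why the end points [0] and [T] are included. *)
Lemma primitive_of_weak_derivative (T : R) (m n : R -> R) : continuous m ->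
  lambda.-integrable (`]0, T[%classic : set (measurableTypeR R)) (EFin \o n) ->
  (forall eta : R -> R, test_function (`]0, T[%classic : set R) eta ->
    \int[lambda]_(x in `]0, T[) (m x * 'D_1 eta x) =
    - \int[lambda]_(x in `]0, T[) (n x * eta x)) ->
  forall t, 0 <= t <= T -> m t - m 0 = \int[lambda]_(x in `]0, t[) n x.
Proof.
move=> cm in_ weak t /andP[]; rewrite le_eqVlt => /orP[/eqP<- _|t0 tT].
  by rewrite subrr set_itv_ge ?bnd_simp ?ltxx// Rintegral_set0.
have mT : measurable (`]0, T[%classic : set (measurableTypeR R)) by exact: measurable_itv.
pose K j : R := j%:R + 3 / t.
have K0 j : 0 < K j by rewrite ltr_wpDl// divr_gt0.
have Kt j : 3 * (K j)^-1 <= t.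
  rewrite ler_pdivrMr//.
  have -> : t * K j = t * j%:R + 3 by rewrite /K; field; rewrite gt_eqF.
  by rewrite lerDr mulr_ge0// ltW.
have Ki0 j : 0 < (K j)^-1 by rewrite invr_gt0.
pose s1 j := ramp (K j) (K j)^-1; pose s2 j := ramp (K j) (t - 2 * (K j)^-1).
pose eta j x := s1 j x - s2 j x.
have tst j : test_function (`]0, T[%classic : set R) (eta j).
  have [ki kt] := (Ki0 j, Kt j); split.
    move=> i; apply: CkD; first exact: smooth_ramp.
    by apply: CkN; exact: smooth_ramp.
  exists `[(K j)^-1, t - (K j)^-1]%classic; split; first exact: segment_compact.
    by move=> x /=; rewrite !in_itv/=; move: tT ki kt; move: (K j)^-1 => y; lra.
  move=> x /= /negP; rewrite in_itv/= negb_and -!ltNge => /orP[xa|bx].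
    rewrite /eta /s1 /s2 !ramp_eq0 ?subrr//; last exact: ltW.
    by move: xa kt; move: (K j)^-1 => y; lra.
  rewrite /eta /s1 /s2 !ramp_eq1 ?subrr//.
    by move: bx; move: (K j)^-1 => y; lra.
  by move: bx kt; move: (K j)^-1 => y; lra.
have [C C0 bC] := derive_ramp.
have Kcvg : (fun j => (K j)^-1) @ \oo --> (0 : R).
  apply/gtr0_cvgV0; first by apply: nearW => j; exact: K0.
  apply: ger_cvgy (@cvgr_idn R); apply: nearW => j /=.
  by rewrite lerDl divr_ge0// ltW.
(* the derivative of a ramp that rises near a concentrates at a *)
have delta (r : nat -> R) (a : R) : (forall j, 0 < r j) -> (forall j, r j + (K j)^-1 < T) ->
    (forall j, `|r j - a| <= 2 * (K j)^-1) ->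
    (fun j => \int[lambda]_(x in `]0, T[) (m x * 'D_1 (ramp (K j) (r j)) x)) @ \oo --> m a.
  move=> r0 rT ra; apply/cvgrPdist_le => e e0.
  have eC : 0 < e / C by rewrite divr_gt0.
  have /cvgrPdist_le/(_ _ eC)/nbhs_ballP[d /= d0 hd] := cm a.
  have [J _ hJ] : \forall j \near \oo, (K j)^-1 < d / 4.
    have /cvgrPdist_lt/(_ (d / 4)) := Kcvg; rewrite divr_gt0// => /(_ isT).
    by apply: filterS => j; rewrite sub0r normrN gtr0_norm.
  exists J => // j /= Jj; rewrite distrC.
  have := @ramp_delta (ramp (K j) (r j)) m (r j) (r j + (K j)^-1) (m a) (K j * C) (e / C)
    `]0, T[%classic.
  rewrite ltrDl Ki0 => /(_ isT (@smooth_ramp _ _)) h.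
  apply: (le_trans (h _ _ _ _ _ _)).
  - by move=> x; exact: ramp_eq0.
  - by move=> x; exact: ramp_eq1.
  - by move=> x; exact: bC.
  - exact: cm.
  - move=> x xr; rewrite distrC; apply: hd; rewrite /ball/=.
    have := hJ _ Jj; have := ra j; have := xr; rewrite ler_norml ltr_norml.
    by move: (K j)^-1 => y; lra.
  - move=> x /=; rewrite !in_itv/= => xr.
    by have := r0 j; have := rT j; move: xr; move: (K j)^-1 => y; lra.
  - have -> : K j * C * (e / C) * (r j + (K j)^-1 - r j) = e by
      field; rewrite !gt_eqF.
    exact: lexx.
have d1 := delta (fun j => (K j)^-1) 0.
have d2 := delta (fun j => t - 2 * (K j)^-1) t.
have {}d1 : (fun j => \int[lambda]_(x in `]0, T[) (m x * 'D_1 (s1 j) x)) @ \oo --> m 0.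
  apply: d1 => j; first exact: Ki0.
    by have := Ki0 j; have := Kt j; move: tT; move: (K j)^-1 => y; lra.
  rewrite subr0 gtr0_norm// ler_pMl//; lra.
have {}d2 : (fun j => \int[lambda]_(x in `]0, T[) (m x * 'D_1 (s2 j) x)) @ \oo --> m t.
  apply: d2 => j.
  - by have := Ki0 j; have := Kt j; move: tT; move: (K j)^-1 => y; lra.
  - by have := Ki0 j; have := Kt j; move: tT; move: (K j)^-1 => y; lra.
  - have k0 := Ki0 j; rewrite addrAC subrr add0r normrN ger0_norm//.
    by rewrite mulr_ge0// ltW.
have lhs : (fun j => \int[lambda]_(x in `]0, T[) (m x * 'D_1 (eta j) x)) @ \oo --> m 0 - m t.
  suff -> : (fun j => \int[lambda]_(x in `]0, T[) (m x * 'D_1 (eta j) x)) =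
    (fun j => \int[lambda]_(x in `]0, T[) (m x * 'D_1 (s1 j) x) -
              \int[lambda]_(x in `]0, T[) (m x * 'D_1 (s2 j) x)) by exact: cvgB.
  apply/funext => j.
  have ig r : lambda.-integrable (`]0, T[%classic : set (measurableTypeR R))
      (EFin \o (fun x => m x * 'D_1 (ramp (K j) r) x)).
    have cD : continuous (fun x => 'D_1 (ramp (K j) r) x).
      exact/smooth_continuous/smooth_derive/smooth_ramp.
    have cg : continuous (fun x => m x * 'D_1 (ramp (K j) r) x).
      by move=> x; apply: cvgM; [exact: cm|exact: cD].
    have ic : lambda.-integrable `[0, T] (EFin \o (fun x => m x * 'D_1 (ramp (K j) r) x)).
      apply: continuous_compact_integrable; first exact: segment_compact.
      exact: continuous_subspaceT.
    apply: integrableS ic => //.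
    by apply: subset_itv_oo_cc.
  have E := RintegralB mT (ig (K j)^-1) (ig (t - 2 * (K j)^-1)).
  rewrite -E; apply: eq_Rintegral => x _; rewrite /= -mulrBr; congr (_ * _).
  by rewrite /eta deriveB//; exact/smooth_derivable/smooth_ramp.
have rhs : (fun j => \int[lambda]_(x in `]0, T[) (n x * eta j x)) @ \oo -->
    \int[lambda]_(x in `]0, T[) (n x * \1_(`]0, t[%classic : set R) x).
  have mn : measurable_fun (`]0, T[%classic : set (measurableTypeR R)) n.
    by have /integrableP[/measurable_EFinP] := in_.
  apply: (proj2 (@dominated_cvg_Rintegral _ _ _ lambda _ _ _ (fun x => `|n x|) mT _ _ _ _ _)).
  - move=> j; apply: measurable_funM; first exact: mn.
    have [sj _] := tst j.
    apply: measurable_funTS; apply: continuous_measurable_fun.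
    exact: smooth_continuous.
  - apply: measurable_funM; first exact: mn.
    by apply: measurable_indic; exact: measurable_itv.
  - exact: integrable_abse in_.
  - apply: aeW => x _ j; rewrite normrM ler_piMr//.
    rewrite /eta ler_norml.
    have := step_ge0 (K j * (x - (K j)^-1)); have := step_le1 (K j * (x - (K j)^-1)).
    have := step_ge0 (K j * (x - (t - 2 * (K j)^-1))).
    have := step_le1 (K j * (x - (t - 2 * (K j)^-1))); rewrite /s1 /s2 /ramp.
    move: (step _) (step _) => y z; clear; lra.
  - apply: aeW => x /=; rewrite in_itv/= => /andP[x0 xT].
    apply: cvgM; first exact: cvg_cst.
    apply: cvg_near_cst; rewrite indicE.
    have nearK (d : R) : 0 < d -> \forall j \near \oo, (K j)^-1 < d.
      move=> d0; have /cvgrPdist_lt/(_ _ d0) := Kcvg.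
      by apply: filterS => j; rewrite sub0r normrN gtr0_norm.
    have x20 : 0 < x / 2 by rewrite divr_gt0.
    have h1 := nearK _ x20.
    have [xt|tx] := ltP x t.
      have tx0 : 0 < (t - x) / 2 by rewrite divr_gt0// subr_gt0.
      apply: filterS2 h1 (nearK _ tx0) => j.
      rewrite mem_set/=; last by rewrite in_itv/= x0 xt.
      move=> a1 a2; rewrite /eta /s1 /s2 ramp_eq1//; last first.
        by move: a1; move: (K j)^-1 => y; lra.
      rewrite ramp_eq0 ?subr0//.
      by move: a2; move: (K j)^-1 => y; lra.
    apply: filterS h1 => j a1.
    rewrite memNset/=; last by rewrite in_itv/= => /andP[_]; rewrite ltNge tx.
    have ki := Ki0 j.
    rewrite /eta /s1 /s2 !ramp_eq1 ?subrr//.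
      by move: tx ki; move: (K j)^-1 => y; lra.
    by move: a1; move: (K j)^-1 => y; lra.
have : m 0 - m t = - \int[lambda]_(x in `]0, T[) (n x * \1_(`]0, t[%classic : set R) x).
  apply: (cvg_unique _ lhs) => //.
  have -> : (fun j => \int[lambda]_(x in `]0, T[) (m x * 'D_1 (eta j) x)) =
      (fun j => - \int[lambda]_(x in `]0, T[) (n x * eta j x)).
    by apply/funext => j; rewrite -(weak _ (tst j)).
  exact: cvgN rhs.
have -> : \int[lambda]_(x in `]0, T[) (n x * \1_(`]0, t[%classic : set R) x) =
    \int[lambda]_(x in `]0, t[) n x.
  have -> : \int[lambda]_(x in `]0, T[) (n x * \1_(`]0, t[%classic : set R) x) =
      \int[lambda]_(x in `]0, t[) (n x * \1_(`]0, t[%classic : set R) x).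
    apply: Rintegral_support => x /=.
      by rewrite !in_itv/= => /andP[-> xt]; exact: lt_le_trans tT.
    by move=> _ nx; rewrite indicE memNset ?mulr0.
  by apply: eq_Rintegral => x xt; rewrite indicE xt mulr1.
lra.
Unshelve. all: by end_near. Qed.

End ramps.

(** * The weak time derivative *)

Section integration_tools.
Context d (X : measurableType d) (R : realType).
Variable (mu : {measure set X -> \bar R}).

Lemma integrable_mul_bounded (D : set X) (f g : X -> R) (C : R) : measurable D ->
  mu.-integrable D (EFin \o f) -> measurable_fun D g ->
  (forall x, D x -> `|g x| <= C) -> mu.-integrable D (fun x => (f x * g x)%:E).
Proof.
move=> mD if_ mg gC.
have mf : measurable_fun D f by have /integrableP[/measurable_EFinP] := if_.
apply: (le_integrable mD _ _ (integrableZl mD C (integrable_abse if_))).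
  by apply/measurable_EFinP; exact: measurable_funM.
move=> x Dx /=; rewrite lee_fin normrM mulrC (le_trans _ (ler_norm _))//.
by rewrite ler_wpM2r// gC.
Qed.

Lemma integrable_fine (D : set X) (f : X -> \bar R) : measurable D ->
  mu.-integrable D f -> mu.-integrable D (EFin \o (fine \o f)) /\
  \int[mu]_(x in D) fine (f x) = fine (\int[mu]_(x in D) f x)%E.
Proof.
move=> mD if_.
have h := integrable_ae mD if_.
have /integrableP[mf _] := if_.
split.
  apply: (le_integrable mD _ _ if_).
    apply/measurable_EFinP; apply: measurableT_comp => //; exact: fine_measurable.
  move=> x _ /=; case: (f x) => [r| |] //=; by rewrite normr0 leey.
rewrite /Rintegral; congr fine; apply: ae_eq_integral_nomeas.
by apply: filterS h => x hx Dx /=; rewrite fineK// hx.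
Qed.

End integration_tools.

Section Rfubini.
Context d1 d2 (T1 : measurableType d1) (T2 : measurableType d2) (R : realType).
Variables (m1 : {sigma_finite_measure set T1 -> \bar R})
  (m2 : {sigma_finite_measure set T2 -> \bar R}) (D1 : set T1) (D2 : set T2).
Hypotheses (mD1 : measurable D1) (mD2 : measurable D2).

Lemma Rfubini (f : T1 * T2 -> R) :
  (m1 \x m2)%E.-integrable (D1 `*` D2) (EFin \o f) ->
  m1.-integrable D1 (fun x => (\int[m2]_(y in D2) f (x, y))%:E) /\
  \int[(m1 \x m2)%E]_(z in D1 `*` D2) f z =
  \int[m1]_(x in D1) \int[m2]_(y in D2) f (x, y).
Proof.
move=> /(fubini_rect mD1 mD2)[_ i1 e]; have [i2 e2] := integrable_fine mD1 i1.
by split; [exact: i2|rewrite {1}/Rintegral e -e2].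
Qed.

Lemma Rfubini' (f : T1 * T2 -> R) :
  (m1 \x m2)%E.-integrable (D1 `*` D2) (EFin \o f) ->
  m2.-integrable D2 (fun y => (\int[m1]_(x in D1) f (x, y))%:E) /\
  \int[(m1 \x m2)%E]_(z in D1 `*` D2) f z =
  \int[m2]_(y in D2) \int[m1]_(x in D1) f (x, y).
Proof.
move=> /(fubini_rect' mD1 mD2)[_ i1 e]; have [i2 e2] := integrable_fine mD2 i1.
by split; [exact: i2|rewrite {1}/Rintegral e -e2].
Qed.

End Rfubini.

Section time_regularity.
Variables (R : realType) (N : nat).
Local Notation E := 'rV[R]_N.
Local Notation lambda := (@lebesgue_measure R).
Variables (Omega : set E) (T : R).
Hypotheses (oO : open Omega) (fO : (leb R N Omega < +oo)%E).

Let mO : measurable Omega. Proof. exact: open_measurable_rV. Qed.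

Let clamp (t : R) := Num.max 0 (Num.min t T).

Let clamp_in t : 0 <= T -> 0 <= clamp t <= T.
Proof.
move=> T0; rewrite /clamp le_max lexx/= ge_max T0/=.
by rewrite ge_min lexx orbT.
Qed.

Let clampE t : 0 <= t <= T -> clamp t = t.
Proof. by move=> /andP[t0 tT]; rewrite /clamp min_l// max_r. Qed.

(** Clamping the time to [[0, T]] makes the pairing continuous on the whole
    line. *)
Lemma pairing_continuous (U : R -> E -> R) (phi : E -> R) : 0 <= T ->
  (forall t, 0 <= t <= T -> in_Lp (leb R N) Omega 2%:E (U t)) ->
  (forall t, 0 <= t <= T ->
    L2norm Omega (U s \- U t) @[s --> within `[0, T]%classic (nbhs t)] --> 0%E) ->
  measurable_fun Omega phi ->
  (leb R N).-integrable Omega (fun x => ((phi x) ^+ 2)%:E) ->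
  continuous (fun t => \int[leb R N]_(x in Omega) (U (clamp t) x * phi x)).
Proof.
move=> T0 U2 cU mphi iphi t.
pose B := Num.sqrt (\int[leb R N]_(x in Omega) (phi x ^+ 2)).
have B0 : 0 <= B by exact: sqrtr_ge0.
apply/cvgrPdist_le => e e0.
have eB : 0 < e / (B + 1) by rewrite divr_gt0// ltr_wpDl.
have ct := clamp_in t T0.
have [mt it] := (proj1 (in_L2P (leb R N) mO (U (clamp t)))) (U2 _ ct).
have := cU _ ct; rewrite ge0_cvg0P; last by move=> s; exact: poweR_ge0 || exact: Lnorm_ge0.
move=> /(_ _ eB); rewrite near_withinE => near1.
have c1 : {for t, continuous (fun _ : R => (0 : R))} by exact: cvg_cst.
have c2 : {for t, continuous (fun _ : R => T)} by exact: cvg_cst.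
have c3 : {for t, continuous (fun x : R => x)} by exact: cvg_id.
have cc := continuous_max c1 (continuous_min c3 c2).
have near2 : \forall s \near t, `[0, T]%classic (clamp s) ->
    (L2norm Omega (U (clamp s) \- U (clamp t))%R <= (e / (B + 1))%:E)%E.
  exact: (cc _ near1).
apply: filterS near2 => s /=.
have cs := clamp_in s T0.
rewrite in_itv/= => /(_ cs) h.
have [ms is_] := (proj1 (in_L2P (leb R N) mO (U (clamp s)))) (U2 _ cs).
have msB : measurable_fun Omega (fun x => U (clamp s) x - U (clamp t) x).
  exact: measurable_funB.
have isB := integrable_sqrB_L2 mO ms mt is_ it.
have L2 : L2norm Omega (U (clamp s) \- U (clamp t))%R =
  (Num.sqrt (\int[leb R N]_(x in Omega) ((U (clamp s) x - U (clamp t) x) ^+ 2)))%:E.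
  exact: (Lnorm_2_Rintegral mO msB isB).
rewrite L2 lee_fin in h.
have E := RintegralB mO (integrable_mul_L2 mO ms mphi is_ iphi)
  (integrable_mul_L2 mO mt mphi it iphi).
rewrite distrC -E.
have -> : \int[leb R N]_(x in Omega) (U (clamp s) x * phi x - U (clamp t) x * phi x) =
  \int[leb R N]_(x in Omega) ((U (clamp s) x - U (clamp t) x) * phi x).
  by apply: eq_Rintegral => x _; rewrite mulrBl.
apply: (le_trans (cauchy_schwarz_L2 mO msB mphi isB iphi)).
apply: (@le_trans _ _ (e / (B + 1) * B)); first by rewrite ler_wpM2r.
rewrite mulrAC ler_pdivrMr; last by rewrite ltr_wpDl.
by rewrite ler_pM2l// lerDl.
Qed.

Let fst_cont : continuous (@fst R E). Proof. by move=> z; exact: cvg_fst. Qed.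
Let snd_cont : continuous (@snd R E). Proof. by move=> z; exact: cvg_snd. Qed.

Let tensor (eta : R -> R) (phi : E -> R) : R * E -> R := fun z => eta z.1 * phi z.2.

Let tensor_test eta phi : test_function (`]0, T[%classic : set R) eta ->
  test_function Omega phi -> test_function (QT Omega T : set (R * E)%type) (tensor eta phi).
Proof.
move=> [se [K [cK KT e0]]] [sp [L [cL LO p0]]]; split.
  move=> k; apply: CkM.
    by apply: (@Ck_comp_linear R R _ k fst eta); [exact: fst_cont|exact: se].
  by apply: (@Ck_comp_linear R E _ k snd phi); [exact: snd_cont|exact: sp].
exists (K `*` L); split; first exact: compact_setX.
  by move=> [t x] [/= Kt Lx]; split; [exact: KT|exact: LO].
move=> [t x] /= nKL; rewrite /tensor/=.
have [Kt|/e0->] := pselect (K t); last by rewrite mul0r.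
by rewrite p0 ?mulr0// => Lx; apply: nKL.
Qed.

Let derive_tensor eta phi z : smooth_on setT eta -> smooth_on setT phi ->
  'D_((1, 0) : R * E) (tensor eta phi) z = 'D_1 eta z.1 * phi z.2.
Proof.
move=> se sp.
have [d1 e1] := @derive_comp_linear R R (R * E)%type fst eta z (1, 0) fst_cont
  (smooth_differentiable z.1 se).
have [d2 e2] := @derive_comp_linear R E (R * E)%type snd phi z (1, 0) snd_cont
  (smooth_differentiable z.2 sp).
have -> : tensor eta phi = (eta \o fst) * (phi \o snd) by [].
rewrite deriveM; [|exact/diff_derivable|exact/diff_derivable].
by rewrite e1 e2 derive0 scaler0 add0r /GRing.scale/= mulrC.
Qed.

Variables (u Z U : R -> E -> R).
Hypotheses (iu : (tleb R N).-integrable (QT Omega T) (EFin \o joint u))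
  (iZ : (tleb R N).-integrable (QT Omega T) (EFin \o joint Z)).
Hypotheses (uZ : weak_dt Omega T u Z) (uU : C_L2_representative Omega T u U).

Let mI t : measurable (`]0, t[%classic : set (measurableTypeR R)).
Proof. exact: measurable_itv. Qed.

Let measurable_tensor (eta : R -> R) (phi : E -> R) D : continuous eta ->
  measurable_fun setT phi ->
  measurable_fun D (fun z : measurableTypeR R * E => eta z.1 * phi z.2).
Proof.
move=> ce mp; apply: measurable_funTS; apply: measurable_funM.
  apply: measurableT_comp; last exact: measurable_fst.
  exact: continuous_measurable_fun.
by apply: measurableT_comp; [exact: mp|exact: measurable_snd].
Qed.

(** Products of a function of time and a function of space are tested: for each
    function of space the pairing with [u] has a weak derivative on []0, T[],
    hence is a primitive, and the fundamental lemma removes the function of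
    space. *)
Lemma weak_dt_primitive t : 0 <= t <= T -> {ae leb R N, forall x, Omega x ->
  U t x = U 0 x + \int[lambda]_(s in `]0%R, t[) Z s x}.
Proof.
move=> tT; have T0 : 0 <= T by have /andP[h1 h2] := tT; exact: le_trans h2.
have T00 : 0 <= (0 : R) <= T by rewrite lexx.
have [U2 cU UE] := uU.
have U2' s : 0 <= s <= T -> measurable_fun Omega (U s) /\
    (leb R N).-integrable Omega (fun x => ((U s x) ^+ 2)%:E).
  by move=> hs; exact: (proj1 (in_L2P (leb R N) mO (U s)) (U2 _ hs)).
have mcst : measurable_fun Omega (fun _ : E => 1 : R) by exact: measurable_cst.
have icst : (leb R N).-integrable Omega (fun x : E => ((1 : R) ^+ 2)%:E).
  apply: (@bounded_integrable _ _ _ (fun=> 1 ^+ 2) (1 ^+ 2) mO fO) => [|x _].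
    exact: measurable_cst.
  by rewrite expr1n normr1.
have U1 s : 0 <= s <= T -> (leb R N).-integrable Omega (EFin \o U s).
  move=> hs; have [m2 i2] := U2' _ hs.
  have := integrable_mul_L2 mO m2 mcst i2 icst.
  by apply: eq_integrable => // x _ /=; rewrite mulr1.
have mU := fun s hs => (U2' s hs).1.
have QtT : QT Omega t `<=` QT Omega T.
  move=> [s x] [/= + Ox]; rewrite in_itv/= => /andP[s0 st]; split => //=.
  by rewrite in_itv/= s0 (lt_le_trans st)//; have /andP[] := tT.
have mQ s : measurable (QT Omega s) by apply: measurableX.
have iZt : (tleb R N).-integrable (QT Omega t) (EFin \o joint Z).
  exact: integrableS (mQ T) (mQ t) QtT iZ.
have [iS _] := Rfubini' (mI t) mO iZt.
rewrite /joint /= in iS.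
pose S x := \int[lambda]_(s in `]0%R, t[) Z s x.
pose g x := U t x - U 0 x - S x.
have mS : measurable_fun Omega S by have /integrableP[/measurable_EFinP] := iS.
have mg : measurable_fun Omega g.
  by apply: measurable_funB => //; apply: measurable_funB; exact: mU.
have ig : (leb R N).-integrable Omega (EFin \o g).
  exact: (integrableB mO (integrableB mO (U1 _ tT) (U1 _ T00)) iS).
suff h : {ae leb R N, forall x, Omega x -> g x = 0}.
  apply: filterS h => x hx Ox; have /eqP := hx Ox; rewrite /g subr_eq0 subr_eq => /eqP ->.
  by rewrite addrC.
apply: (ae_eq0_of_test_functions oO mg).
  move=> K cK KO; apply: integrableS ig => //.
  by have [] := compact_leb cK.
move=> phi tphi.
have [C C0 bC] := test_function_bounded tphi.
have mphi : measurable_fun Omega phi.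
  by apply: measurable_funTS; exact: test_function_measurable tphi.
have iphi : (leb R N).-integrable Omega (fun x => ((phi x) ^+ 2)%:E).
  have iph : (leb R N).-integrable Omega (EFin \o phi).
    by apply: integrableS (test_function_integrable tphi).
  have := integrable_mul_bounded mO iph mphi (fun x _ => bC x).
  by apply: eq_integrable => // x _ /=; rewrite expr2.
pose m s := \int[leb R N]_(x in Omega) (U (clamp s) x * phi x).
pose n s := \int[leb R N]_(x in Omega) (Z s x * phi x).
have cm : continuous m by exact: pairing_continuous.
have iZphi s : 0 <= s <= T -> (tleb R N).-integrable (QT Omega s)
    (EFin \o (fun z => joint Z z * (1 * phi z.2))).
  move=> /andP[s0 sT].
  have iZs : (tleb R N).-integrable (QT Omega s) (EFin \o joint Z).
    apply: integrableS (mQ T) (mQ s) _ iZ.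
    move=> [r x] [/= + Ox]; rewrite in_itv/= => /andP[r0 rs]; split => //=.
    by rewrite in_itv/= r0 (lt_le_trans rs).
  apply: (@integrable_mul_bounded _ _ _ _ _ _ _ C (mQ s) iZs).
    apply: (@measurable_tensor (fun=> 1)); first by move=> ?; exact: cvg_cst.
    exact: test_function_measurable tphi.
  by move=> z _; rewrite mul1r.
have TT : 0 <= T <= T by rewrite T0/=.
have [in_ _] := Rfubini (mI T) mO (iZphi T TT).
have in' : lambda.-integrable (`]0, T[%classic : set (measurableTypeR R)) (EFin \o n).
  apply: eq_integrable in_ => // s _ /=; congr EFin; apply: eq_Rintegral => x _.
  by rewrite /joint/= mul1r.
have weak eta : test_function (`]0, T[%classic : set R) eta ->
    \int[lambda]_(x in `]0, T[) (m x * 'D_1 eta x) =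
    - \int[lambda]_(x in `]0, T[) (n x * eta x).
  move=> teta; have [seta _] := teta; have [sphi _] := tphi.
  have [_ /(_ _ (tensor_test teta tphi)) W] := uZ.
  have [C1 C10 bC1] := test_function_bounded teta.
  have ceta : continuous eta by exact: smooth_continuous.
  have mphi0 : measurable_fun setT phi by exact: test_function_measurable tphi.
  have tDeta : test_function (`]0, T[%classic : set R) (fun x => 'D_1 eta x).
    exact: test_function_derive.
  have cDeta : continuous (fun x => 'D_1 eta x).
    exact/smooth_continuous/(proj1 tDeta).
  have [C2 C20 bC2] := test_function_bounded tDeta.
  have b1 z : QT Omega T z -> `|eta z.1 * phi z.2| <= C1 * C.
    by move=> _; rewrite normrM ler_pM.
  have b2 z : QT Omega T z -> `|'D_1 eta z.1 * phi z.2| <= C2 * C.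
    by move=> _; rewrite normrM ler_pM.
  have i1 := integrable_mul_bounded (mQ T) iZ
    (measurable_tensor (D := QT Omega T) ceta mphi0) b1.
  have i2 := integrable_mul_bounded (mQ T) iu
    (measurable_tensor (D := QT Omega T) cDeta mphi0) b2.
  have [_ e1] := Rfubini (mI T) mO i1.
  have [_ e2] := Rfubini (mI T) mO i2.
  have E1 : \int[tleb R N]_(z in QT Omega T) (joint Z z * tensor eta phi z) =
      \int[lambda]_(x in `]0, T[) (n x * eta x).
    rewrite [LHS]e1; have /integrableP[/measurable_EFinP mn _] := in'.
    apply: ae_eq_Rintegral; have [ae1 _ _] := fubini_rect (mI T) mO (iZphi T TT).
    apply: filterS ae1 => s hs /hs is_; rewrite mulrC /n -RintegralZl//; last first.
      by apply: eq_integrable is_ => // x _ /=; rewrite mul1r.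
    by apply: eq_Rintegral => x _; rewrite /joint/= mulrCA.
  have E2 : \int[tleb R N]_(z in QT Omega T)
      (joint u z * 'D_((1, 0) : R * E) (tensor eta phi) z) =
      \int[lambda]_(x in `]0, T[) (m x * 'D_1 eta x).
    transitivity (\int[tleb R N]_(z in QT Omega T) (joint u z * ('D_1 eta z.1 * phi z.2))).
      by apply: eq_Rintegral => z _; rewrite derive_tensor.
    rewrite [LHS]e2; apply: ae_eq_Rintegral.
    refine (aeS UE _) => s hs /=; rewrite in_itv/= => sT; have {}hs := hs sT.
    have sT' : 0 <= s <= T by have /andP[s0 s1] := sT; rewrite !ltW.
    rewrite /m clampE// mulrC -RintegralZl//; last first.
      by have [ms is_] := U2' _ sT'; exact: (integrable_mul_L2 mO ms mphi is_ iphi).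
    apply: ae_eq_Rintegral; apply: filterS hs => x hx Ox; rewrite /joint/= hx//.
    by rewrite mulrCA.
  by rewrite -E1 -E2.
have key := primitive_of_weak_derivative cm in' weak tT.
have iUphi s : 0 <= s <= T ->
    (leb R N).-integrable Omega (fun x => (U s x * phi x)%:E).
  by move=> hs; have [ms is_] := U2' _ hs; exact: (integrable_mul_L2 mO ms mphi is_ iphi).
have iSphi : (leb R N).-integrable Omega (fun x => (S x * phi x)%:E).
  by apply: (@integrable_mul_bounded _ _ _ _ _ _ _ C mO iS mphi).
have -> : \int[leb R N]_(x in Omega) (g x * phi x) =
    \int[leb R N]_(x in Omega) (U t x * phi x - U 0 x * phi x - S x * phi x).
  by apply: eq_Rintegral => x _; rewrite /g !mulrBl.
have r1 := RintegralB mO (iUphi _ tT) (iUphi _ T00).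
have r2 := RintegralB mO (integrableB mO (iUphi _ tT) (iUphi _ T00)) iSphi.
rewrite [LHS]r2 r1.
move: key; rewrite /m !clampE// => ->.
have [_ f1] := Rfubini (mI t) mO (iZphi t tT).
have [_ f2] := Rfubini' (mI t) mO (iZphi t tT).
have -> : \int[lambda]_(x in `]0, t[) n x =
    \int[lambda]_(x in `]0, t[) \int[leb R N]_(y in Omega) (joint Z (x, y) * (1 * phi y)).
  by apply: eq_Rintegral => s _; apply: eq_Rintegral => x _; rewrite mul1r.
rewrite -[X in X - _]f1 f2; apply/eqP; rewrite subr_eq0; apply/eqP.
have [ae2 _ _] := fubini_rect' (mI t) mO iZt.
apply: ae_eq_Rintegral; apply: filterS ae2 => x hx /hx ix.
rewrite mulrC -RintegralZl//; apply: eq_Rintegral => s _.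
by rewrite /joint/= mul1r mulrC.
Qed.

End time_regularity.

(** * The half-square formula and a Gronwall inequality *)

Section half_square.
Variable R : realType.
Local Notation lambda := (@lebesgue_measure R).
Local Notation M := (measurableTypeR R).
Local Notation I t := (`]0, t[%classic : set M).

Let mI t : measurable (I t). Proof. exact: measurable_itv. Qed.

Lemma integrable_tensor (t : R) (k : R -> R) : lambda.-integrable (I t) (EFin \o k) ->
  (lambda \x lambda)%E.-integrable (I t `*` I t) (EFin \o (fun z : M * M => k z.1 * k z.2)).
Proof.
move=> ik; have /integrableP[/measurable_EFinP mk fk] := ik.
have mk1 : measurable_fun (I t `*` I t) (fun z : M * M => k z.1).
  apply: (@measurable_comp _ _ _ _ _ _ (I t)) => //; last exact: measurable_funTS measurable_fst.
  by move=> _ [z [? ?] <-].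
have mk2 : measurable_fun (I t `*` I t) (fun z : M * M => k z.2).
  apply: (@measurable_comp _ _ _ _ _ _ (I t)) => //; last exact: measurable_funTS measurable_snd.
  by move=> _ [z [? ?] <-].
have mkk := measurable_funM mk1 mk2.
apply/integrableP; split; first exact/measurable_EFinP.
have mabs : measurable_fun (I t `*` I t)
    (fun z : M * M => (`|(k z.1 * k z.2)%R%:E|)%E).
  by apply: measurableT_comp => //; exact/measurable_EFinP.
have [_ ->] := ge0_fubini_rect lambda lambda (mI t) (mI t) mabs (fun z _ => abse_ge0 _).
rewrite /=; under eq_integral => x _.
  under eq_integral do rewrite normrM EFinM.
  rewrite ge0_integralZl//=; last first.
    by apply/measurable_EFinP; exact: measurableT_comp.
  over.
rewrite /= ge0_integralZr//=.
- by apply: lte_mul_pinfty; [exact: integral_ge0|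
    rewrite ge0_fin_numE//; exact: integral_ge0|].
- by apply/measurable_EFinP; exact: measurableT_comp.
- exact: integral_ge0.
Qed.

(** The square of side t is cut along its diagonal into two halves exchanged
    by the symmetry of the integrand. *)
Lemma half_square (t : R) (k : R -> R) : lambda.-integrable (I t) (EFin \o k) ->
  lambda.-integrable (I t) (fun s => (k s * \int[lambda]_(r in `]0, s[) k r)%:E) /\
  \int[lambda]_(s in `]0, t[) (k s * \int[lambda]_(r in `]0, s[) k r) =
  2^-1 * (\int[lambda]_(s in `]0, t[) k s) ^+ 2.
Proof.
move=> ik; have iG := integrable_tensor ik.
have mII : measurable (I t `*` I t) by exact: measurableX.
pose A : set (M * M) := [set z | z.2 < z.1].
have mA : measurable A.
  rewrite (_ : A = (fun z : M * M => z.1 - z.2) @^-1` `]0, +oo[%classic); last first.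
    by apply/seteqP; split=> z; rewrite /A/= in_itv/= andbT subr_gt0.
  rewrite -[X in measurable X]setTI.
  have : measurable_fun setT (fun z : M * M => z.1 - z.2 : R).
    by apply: measurable_funB; [exact: measurable_fst|exact: measurable_snd].
  by apply => //; exact: measurable_itv.
have bd (B : set (M * M)) z : (I t `*` I t) z -> `|\1_B z| <= 1 :> R.
  by move=> _; rewrite indicE; case: (_ \in _); rewrite ?normr1 ?normr0.
have m1A : measurable_fun (I t `*` I t) (\1_A : M * M -> R) by exact: measurable_indic.
have iA := integrable_mul_bounded mII iG m1A (bd A).
have mcA : measurable (~` A) by exact: measurableC.
have m1B : measurable_fun (I t `*` I t) (\1_(~` A) : M * M -> R) by exact: measurable_indic.
have iB := integrable_mul_bounded mII iG m1B (bd (~` A)).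
have [jA eA] := Rfubini (mI t) (mI t) iA.
have [jB eB] := Rfubini' (mI t) (mI t) iB.
have [_ eG] := Rfubini (mI t) (mI t) iG.
have sub s : 0 < s < t -> I s `<=` I t.
  move=> /andP[_ st] r /=; rewrite !in_itv/= => /andP[-> rs]; exact: lt_trans st.
have iks s : 0 < s < t -> lambda.-integrable (I s) (EFin \o k).
  by move=> st; apply: integrableS ik => //; exact: sub.
have secA s : 0 < s < t -> \int[lambda]_(r in `]0, t[) (k s * k r * \1_A (s, r)) =
    k s * \int[lambda]_(r in `]0, s[) k r.
  move=> st; rewrite -(RintegralZl _ (mI s) (iks _ st)).
  transitivity (\int[lambda]_(r in `]0, s[) (k s * k r * \1_A (s, r))).
    apply: Rintegral_support; first exact: sub.
    move=> r /= + nr; rewrite in_itv/= => /andP[r0 rt].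
    rewrite indicE memNset ?mulr0//= => rs; apply: nr.
    by rewrite /A/= in_itv/= r0 rs.
  apply: eq_Rintegral => r /set_mem/=; rewrite in_itv/= => /andP[_ rs].
  by rewrite indicE mem_set ?mulr1.
have secB s : 0 < s < t -> \int[lambda]_(r in `]0, t[) (k r * k s * \1_(~` A) (r, s)) =
    k s * \int[lambda]_(r in `]0, s[) k r.
  move=> st; have /andP[s0 s1] := st.
  have <- : \int[lambda]_(r in `]0, s]) k r = \int[lambda]_(r in `]0, s[) k r.
    apply/esym/Rintegral_itv_bndo_bndc.
    exact: (iks _ st).
  rewrite -RintegralZl//; last first.
    apply: integrableS ik => //.
    move=> r /=; rewrite !in_itv/= => /andP[-> rs]; exact: (le_lt_trans rs s1).
  transitivity (\int[lambda]_(r in `]0, s]) (k r * k s * \1_(~` A) (r, s))).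
    apply: Rintegral_support.
      move=> r /=; rewrite !in_itv/= => /andP[-> rs]; exact: (le_lt_trans rs s1).
    move=> r /= + nr; rewrite in_itv/= => /andP[r0 rt].
    rewrite indicE memNset ?mulr0//= => /negP; rewrite -leNgt => rs; apply: nr.
    by rewrite in_itv/= r0 rs.
  apply: eq_Rintegral => r /set_mem/=; rewrite in_itv/= => /andP[_ rs].
  by rewrite indicE mem_set ?mulr1 1?mulrC//= /A/=; apply/negP; rewrite -leNgt.
split.
  apply: eq_integrable jA => // s /set_mem/=; rewrite in_itv/= => st.
  by congr EFin; rewrite -(secA _ st).
set J := \int[lambda]_(s in `]0, t[) (k s * _).
have EA : \int[(lambda \x lambda)%E]_(z in I t `*` I t) (k z.1 * k z.2 * \1_A z) = J.
  rewrite [LHS]eA; apply: eq_Rintegral => s /set_mem/=; rewrite in_itv/= => st.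
  by rewrite -(secA _ st).
have EB : \int[(lambda \x lambda)%E]_(z in I t `*` I t) (k z.1 * k z.2 * \1_(~` A) z) = J.
  rewrite [LHS]eB; apply: eq_Rintegral => s /set_mem/=; rewrite in_itv/= => st.
  by rewrite -(secB _ st).
have EG : \int[(lambda \x lambda)%E]_(z in I t `*` I t) (k z.1 * k z.2) =
    (\int[lambda]_(s in `]0, t[) k s) ^+ 2.
  rewrite [LHS]eG expr2 -(RintegralZl _ (mI t) ik); apply: eq_Rintegral => s _ /=.
  by rewrite (RintegralZl _ (mI t) ik) mulrC.
have ES : \int[(lambda \x lambda)%E]_(z in I t `*` I t) (k z.1 * k z.2) = J + J.
  rewrite -{1}EA -EB; have r := RintegralD mII iA iB.
  rewrite -[RHS]r; apply: eq_Rintegral => z _ /=.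
  rewrite -mulrDr !indicE in_setC; case: (_ \in _) => /=.
    by rewrite addr0 mulr1.
  by rewrite add0r mulr1.
have -> := etrans (esym EG) ES; by rewrite -mulr2n -[J *+ 2]mulr_natl mulKf ?pnatr_eq0.
Qed.

End half_square.

Section gronwall.
Variable R : realType.
Local Notation lambda := (@lebesgue_measure R).
Local Notation I t := (`]0, t[%classic : set (measurableTypeR R)).

Let mI t : measurable (I t). Proof. exact: measurable_itv. Qed.

(** A bound y <= y0 + (1 + d) K, with K the primitive of k, inserted into the
    integral inequality gives y ^ 2 <= y0 ^ 2 + 2 y0 K + (1 + d) K ^ 2, by the
    half-square formula, hence y <= y0 + (1 + d / 2) K; the defect d tends to 0. *)
Lemma gronwall_sqr (y k : R -> R) (y0 B t : R) : 0 <= t -> 0 <= y0 ->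
  lambda.-integrable (I t) (EFin \o k) -> (forall s, 0 < s < t -> 0 <= k s) ->
  (forall s, 0 <= s <= t -> 0 <= y s <= B) ->
  (forall s, 0 <= s <= t -> ((y s ^+ 2)%:E <= (y0 ^+ 2)%:E +
     2%:E * \int[lambda]_(r in `]0%R, s[) (k r * y r)%:E)%E) ->
  y t <= y0 + \int[lambda]_(r in `]0, t[) k r.
Proof.
move=> t0 y00 ik k0 yB ineq.
pose K s := \int[lambda]_(r in `]0, s[) k r.
have sub s : s <= t -> I s `<=` I t.
  by move=> st r /=; rewrite !in_itv/= => /andP[-> rs]; exact: (lt_le_trans rs st).
have iks s : s <= t -> lambda.-integrable (I s) (EFin \o k).
  by move=> st; apply: integrableS ik => //; exact: sub.
have k0s s r : s <= t -> I s r -> 0 <= k r.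
  by move=> st /(sub _ st); rewrite /= in_itv/=; exact: k0.
have K0 s : s <= t -> 0 <= K s.
  by move=> st; apply: Rintegral_ge0 => r; exact: k0s.
have step (c : R -> R) s : 0 <= s <= t -> (forall r, 0 <= r <= s -> y r <= c r) ->
    lambda.-integrable (I s) (fun r => (k r * c r)%:E) ->
    y s ^+ 2 <= y0 ^+ 2 + 2 * \int[lambda]_(r in `]0, s[) (k r * c r).
  move=> /andP[s0 st] yc ikc; have := ineq s; rewrite s0 st => /(_ isT) h.
  rewrite -lee_fin; apply: (le_trans h).
  set J := \int[lambda]_(r in _) (k r * c r).
  have -> : (y0 ^+ 2 + 2 * J)%:E = ((y0 ^+ 2)%:E + 2%:E * J%:E)%E by [].
  apply: leeD2l; apply: lee_wpmul2l; first by rewrite lee_fin.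
  rewrite /J /Rintegral fineK; last exact: integrable_fin_num ikc.
  have in1 r : I s r -> 0 <= r <= s.
    by rewrite /= in_itv/= => /andP[/ltW-> /ltW->].
  have in2 r : I s r -> 0 <= r <= t.
    by move=> /in1/andP[-> h1]; exact: (le_trans h1 st).
  apply: ge0_le_integral_ae.
  - move=> r Ir; rewrite lee_fin mulr_ge0//; first exact: k0s Ir.
    by have /andP[] := yB _ (in2 _ Ir).
  - move=> r Ir; rewrite lee_fin mulr_ge0//; first exact: k0s Ir.
    have /andP[y0r _] := yB _ (in2 _ Ir).
    by apply: (le_trans y0r); apply: yc; exact: in1.
  - apply: aeW => r Ir; rewrite lee_fin ler_wpM2l//; first exact: k0s Ir.
    by apply: yc; exact: in1.
have base s : 0 <= s <= t -> y s <= y0 + (1 + 1) * K s.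
  move=> /andP[s0 st]; pose S := sup [set y r | r in `[0, s]%classic].
  have in1 r : 0 <= r <= s -> 0 <= r <= t.
    by move=> /andP[-> h]; exact: (le_trans h st).
  have hs : has_sup [set y r | r in `[0, s]%classic].
    split; first by exists (y 0), 0 => //=; rewrite in_itv/= ?lexx ?s0.
    exists B => _ [r /= + <-]; rewrite in_itv/= => rs.
    by have /andP[] := yB _ (in1 _ rs).
  have yS r : 0 <= r <= s -> y r <= S.
    by move=> rs; apply: ub_le_sup; [exact: (proj2 hs)|exists r => //=; rewrite in_itv].
  have S0 : 0 <= S.
    have h0 : 0 <= (0 : R) <= s by rewrite lexx s0.
    by apply: (le_trans _ (yS 0 h0)); have /andP[] := yB _ (in1 _ h0).
  have KK r : 0 <= r <= s -> K r <= K s.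
    move=> /andP[r0 rs]; rewrite /K -lee_fin.
    have f1 := integrable_fin_num (mI _) (iks _ (le_trans rs st)).
    have f2 := integrable_fin_num (mI _) (iks _ st).
    rewrite /Rintegral (fineK f1) (fineK f2).
    apply: ge0_subset_integral => //.
    - by have /integrableP[] := iks _ st.
    - by move=> z Iz; rewrite lee_fin; exact: k0s Iz.
    - by move=> z /=; rewrite !in_itv/= => /andP[-> zr]; exact: (lt_le_trans zr rs).
  have iS r : r <= t -> lambda.-integrable (I r) (fun z => (k z * S)%:E).
    move=> rt; have := integrableZr (mI r) S (iks _ rt).
    by apply: eq_integrable => //.
  have bnd r : 0 <= r <= s -> y r ^+ 2 <= y0 ^+ 2 + 2 * S * K s.
    move=> rs; have /andP[r0 r1] := rs; have rt := le_trans r1 st.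
    have rt' : 0 <= r <= t by rewrite r0.
    have yc z : 0 <= z <= r -> y z <= S.
      by move=> /andP[z0 zr]; apply: yS; rewrite z0 (le_trans zr).
    apply: (le_trans (step (fun=> S) r rt' yc (iS _ rt))).
    rewrite lerD2l -mulrA ler_pM2l// (RintegralZr _ (mI r) (iks _ rt)) mulrC.
    by rewrite ler_wpM2l//; exact: KK.
  have SS : S <= Num.sqrt (y0 ^+ 2 + 2 * S * K s).
    apply: ge_sup; first by have [] := hs.
    move=> _ [r /= + <-]; rewrite in_itv/= => rs.
    have y0r : 0 <= y r by have /andP[] := yB _ (in1 _ rs).
    by rewrite -[leLHS]ger0_norm// -sqrtr_sqr ler_wsqrtr// bnd.
  have pos : 0 <= y0 ^+ 2 + 2 * S * K s.
    by rewrite addr_ge0 ?sqr_ge0// !mulr_ge0// K0.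
  have S2 : S ^+ 2 <= y0 ^+ 2 + 2 * S * K s.
    by rewrite -(sqr_sqrtr pos) ler_sqr ?nnegrE ?sqrtr_ge0.
  apply: (@le_trans _ _ S); first by apply: yS; rewrite s0 lexx.
  rewrite leNgt; apply/negP => h.
  have ks := K0 _ st; move: S2 h ks S0 y00; move: (K s) => z; clear; nra.
have iter n s : 0 <= s <= t -> y s <= y0 + (1 + 2^-1 ^+ n) * K s.
  elim: n s => [s /base|n IH s st]; first by rewrite expr0.
  set d := 2^-1 ^+ n in IH; have d0 : 0 <= d by rewrite exprn_ge0// invr_ge0.
  have /andP[s0 s1] := st.
  have yc r : 0 <= r <= s -> y r <= y0 + (1 + d) * K r.
    by move=> /andP[r0 rs]; apply: IH; rewrite r0 (le_trans rs).
  have [iH eH] := half_square (iks _ s1).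
  have i1 := integrableZr (mI s) y0 (iks _ s1).
  have i2 := integrableZl (mI s) (1 + d) iH.
  have ic : lambda.-integrable (I s) (fun r => (k r * (y0 + (1 + d) * K r))%:E).
    apply: eq_integrable (integrableD (mI s) i1 i2) => //.
    by move=> r _; rewrite /= -!EFinM -EFinD mulrDr (mulrCA (k r)).
  have := step _ _ st yc ic.
  have -> : \int[lambda]_(r in `]0, s[) (k r * (y0 + (1 + d) * K r)) =
      K s * y0 + (1 + d) * (2^-1 * K s ^+ 2).
    rewrite -eH -(RintegralZr _ (mI s) (iks _ s1)) -(RintegralZl _ (mI s) iH).
    rewrite -(RintegralD (mI s) i1 i2).
    by apply: eq_Rintegral => r _; rewrite /= mulrDr (mulrCA (k r)).
  have -> : 2^-1 ^+ n.+1 = d / 2 by rewrite exprSr.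
  have ys0 : 0 <= y s by have /andP[] := yB _ st.
  have ks := K0 _ s1; have dk : 0 <= d * K s by rewrite mulr_ge0.
  have rhs0 : 0 <= y0 + (1 + d / 2) * K s.
    by rewrite addr_ge0// mulr_ge0// addr_ge0// divr_ge0.
  move=> h; rewrite -ler_sqr ?nnegrE//; apply: (le_trans h).
  have e : (y0 + (1 + d / 2) * K s) ^+ 2 -
    (y0 ^+ 2 + 2 * (K s * y0 + (1 + d) * (2^-1 * K s ^+ 2))) =
    y0 * (d * K s) + 4^-1 * (d * K s) ^+ 2 by field.
  by rewrite -subr_ge0 e addr_ge0 ?mulr_ge0 ?sqr_ge0.
apply/ler_addgt0Pr => e e0.
have tt : 0 <= t <= t by rewrite t0 lexx.
have Kt := K0 _ (lexx t).
have [n hn] : exists n, 2^-1 ^+ n * K t <= e.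
  have h : (fun n => 2^-1 ^+ n * K t) @ \oo --> 0 * K t.
    apply: cvgMl; apply: cvg_expr; rewrite gtr0_norm ?invr_gt0// invf_lt1//.
    by rewrite ltr1n.
  rewrite mul0r in h; have /cvgrPdist_le/(_ _ e0)[n _ hn] := h.
  exists n; have := hn n (leqnn n); rewrite sub0r normrN.
  exact: le_trans (ler_norm _).
apply: (le_trans (iter n t tt)).
by rewrite -/(K t) mulrDl mul1r addrA lerD2l.
Qed.

End gronwall.

(** * The energy identity *)

Lemma integrable_mul_ae_bounded d (X : measurableType d) (R : realType)
    (mu : {measure set X -> \bar R}) (D : set X) (f g : X -> R) (C : R) :
  measurable D -> mu.-integrable D (EFin \o f) -> measurable_fun D g -> 0 <= C ->
  {ae mu, forall x, D x -> `|g x| <= C} -> mu.-integrable D (fun x => (f x * g x)%:E).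
Proof.
move=> mD if_ mg C0 gC.
have /integrableP[/measurable_EFinP mf _] := if_.
have iC := integrableZl mD C (integrable_abse if_).
apply/integrableP; split; first by apply/measurable_EFinP; exact: measurable_funM.
apply: (@le_lt_trans _ _ (\int[mu]_(x in D) (C%:E * `|(f x)%:E|))%E).
  apply: ge0_le_integral_ae.
  - by move=> x _; exact: abse_ge0.
  - by move=> x _; rewrite mule_ge0// lee_fin.
  - refine (aeS gC _) => x hx Dx; rewrite /= lee_fin normrM mulrC.
    by rewrite ler_wpM2r// hx.
rewrite -ge0_fin_numE; first exact: integrable_fin_num iC.
by apply: integral_ge0 => x _; rewrite mule_ge0// lee_fin.
Qed.

Section sections.
Context d1 d2 (T1 : measurableType d1) (T2 : measurableType d2) (R : realType).
Variables (m1 : {sigma_finite_measure set T1 -> \bar R})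
  (m2 : {sigma_finite_measure set T2 -> \bar R}) (D1 : set T1) (D2 : set T2).
Hypotheses (mD1 : measurable D1) (mD2 : measurable D2).

(** Tonelli's theorem, which needs the joint measurability of both functions, is
    applied to the absolute value of the difference. *)
Lemma ae_eq_prod_of_sections (f g : T1 * T2 -> R) :
  measurable_fun (D1 `*` D2) f -> measurable_fun (D1 `*` D2) g ->
  {ae m1, forall x, D1 x -> {ae m2, forall y, D2 y -> f (x, y) = g (x, y)}} ->
  {ae (m1 \x m2)%E, forall z, (D1 `*` D2) z -> f z = g z}.
Proof.
move=> mf mg fg.
have mDD : measurable (D1 `*` D2) by exact: measurableX.
have mh : measurable_fun (D1 `*` D2) (EFin \o (fun z => f z - g z)).
  by apply/measurable_EFinP; exact: measurable_funB.
suff : ae_eq (m1 \x m2)%E (D1 `*` D2) (EFin \o (fun z => f z - g z)) (cst 0%E).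
  by apply: filterS => z h Dz; have [h'] := h Dz; apply/eqP; rewrite -subr_eq0 h'.
apply/(ae_eq_integral_abs _ mDD mh).
have mah : measurable_fun (D1 `*` D2)
    (fun z => (`|(f z - g z)%R%:E|)%E).
  exact: measurableT_comp.
have [_ ->] := ge0_fubini_rect m1 m2 mD1 mD2 mah (fun z _ => abse_ge0 _).
rewrite -(integral0 m1 D1); apply: ge0_ae_eq_integral_nomeas => //.
  by move=> x _; apply: integral_ge0 => y _; exact: abse_ge0.
apply: filterS fg => x h D1x; rewrite -(integral0 m2 D2).
apply: ge0_ae_eq_integral_nomeas; [by move=> y _; exact: abse_ge0|by move=> y _; exact: lexx|].
by apply: filterS (h D1x) => y hy D2y; rewrite /= hy// subrr normr0.
Qed.

End sections.

Section energy.
Variables (R : realType) (N : nat).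
Local Notation E := 'rV[R]_N.
Local Notation lambda := (@lebesgue_measure R).
Local Notation M := (measurableTypeR R).
Variables (Omega : set E) (T : R).
Hypotheses (mO : measurable Omega).

Let mI t : measurable (`]0, t[%classic : set M).
Proof. exact: measurable_itv. Qed.

Let mQ t : measurable (QT Omega t). Proof. exact: measurableX. Qed.

Let QTs t : t <= T -> QT Omega t `<=` QT Omega T.
Proof.
move=> tT [s x] [/= + Ox]; rewrite in_itv/= => /andP[s0 st]; split => //=.
by rewrite in_itv/= s0 (lt_le_trans st).
Qed.

(** The primitive is the integral in [s] of a jointly measurable function of
    [t], [x] and [s]. *)
Lemma measurable_primitive (Z : R -> E -> R) : measurable_fun (QT Omega T) (joint Z) ->
  measurable_fun (QT Omega T)
    (fun z : M * E => \int[lambda]_(s in `]0, z.1[) Z s z.2).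
Proof.
move=> mZ.
pose Z' := joint Z \_ (QT Omega T).
have mZ' : measurable_fun setT Z' by exact/(measurable_restrictT _ (mQ T)).
pose A : set ((M * E) * M) := [set z | 0 < z.2 /\ z.2 < z.1.1].
have mA : measurable A.
  have m2 : measurable_fun setT (fun z : (M * E) * M => z.2 : R) by exact: measurable_snd.
  have m1 : measurable_fun setT (fun z : (M * E) * M => z.1.1 - z.2 : R).
    apply: measurable_funB => //; apply: measurableT_comp; last exact: measurable_fst.
    exact: measurable_fst.
  rewrite (_ : A = ((fun z => z.2) @^-1` `]0, +oo[%classic) `&`
      ((fun z => z.1.1 - z.2) @^-1` `]0, +oo[%classic)); last first.
    by apply/seteqP; split=> z; rewrite /A/= !in_itv/= !andbT subr_gt0.
  apply: measurableI; rewrite -[X in measurable X]setTI.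
    by apply: m2 => //; exact: measurable_itv.
  by apply: m1 => //; exact: measurable_itv.
pose F (z : (M * E) * M) : \bar R := (Z' (z.2, z.1.2) * \1_A z)%:E.
have mF : measurable_fun setT F.
  apply/measurable_EFinP; apply: measurable_funM; last exact: measurable_indic.
  have m12 : measurable_fun setT (fun z : (M * E) * M => z.1.2).
    apply: (@measurableT_comp _ _ _ _ _ _ (fun z : M * E => z.2)).
      exact: measurable_snd.
    exact: measurable_fst.
  have m2 : measurable_fun setT (fun z : (M * E) * M => z.2) by exact: measurable_snd.
  exact: (measurableT_comp mZ' (measurable_fun_pair m2 m12)).
have mP := @measurable_fun_fubini_tonelli_F _ _ _ _ _ lambda _ (measurable_funepos mF)
  (fun z => funepos_ge0 F z).
have mN := @measurable_fun_fubini_tonelli_F _ _ _ _ _ lambda _ (measurable_funeneg mF)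
  (fun z => funeneg_ge0 F z).
have mI0 : measurable_fun setT (fun z : M * E => (\int[lambda]_s F (z, s))%E).
  apply: eq_measurable_fun (emeasurable_funB mP mN) => z _.
  rewrite [RHS]integralE; congr (_ - _)%E; apply: eq_integral => s _.
    by rewrite !funeposE.
  by rewrite !funenegE.
have mPN : measurable_fun (QT Omega T)
    (fun z : M * E => fine ((\int[lambda]_s F (z, s))%E)).
  by apply: measurable_funTS; apply: measurableT_comp mI0; exact: fine_measurable.
apply: eq_measurable_fun mPN => -[t x] /set_mem[/= + Ox]; rewrite in_itv/= => /andP[t0 tT].
rewrite /Rintegral; congr fine; rewrite [RHS]integral_mkcond; apply: eq_integral => s _.
rewrite /F patchE indicE /Z' /A /=.
case: ifPn => [/set_mem/=|/negP]; rewrite ?in_itv/=.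
  move=> /andP[s0 st]; rewrite mem_set// mulr1 patchE mem_set//.
  by split => //=; rewrite in_itv/= s0 (lt_trans st).
move=> h; rewrite memNset ?mulr0// => -[/= s0 st]; apply: h.
by apply/mem_set; rewrite /= in_itv/= s0 st.
Qed.

Variables (Z P W : R -> E -> R) (B : R).
Hypotheses (iZ : (tleb R N).-integrable (QT Omega T) (EFin \o joint Z)) (B0 : 0 <= B).
Hypotheses (mW : measurable_fun (QT Omega T) (joint W))
  (WB : {ae tleb R N, forall z, QT Omega T z -> `|joint W z| <= B}).
Hypothesis P2 : forall t, 0 <= t <= T -> measurable_fun Omega (P t) /\
  (leb R N).-integrable Omega (fun x => ((P t x) ^+ 2)%:E).
Hypothesis PZ : forall t, 0 <= t <= T -> {ae leb R N, forall x, Omega x ->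
  P t x = P 0 x + \int[lambda]_(s in `]0, t[) Z s x}.
Hypothesis PW : {ae lambda, forall t : R, 0 < t < T ->
  {ae leb R N, forall x, Omega x -> P t x = W t x}}.

(** With P = P 0 + K and K the primitive of Z in time, the product Z P
    integrates in time to (P t ^ 2 - P 0 ^ 2) / 2. *)
Lemma energy_identity t : 0 <= t <= T ->
  \int[tleb R N]_(z in QT Omega t) (joint Z z * joint W z) =
  2^-1 * (\int[leb R N]_(x in Omega) (P t x ^+ 2) -
          \int[leb R N]_(x in Omega) (P 0 x ^+ 2)).
Proof.
move=> /andP[t0 tT]; have T0 : 0 <= T by exact: le_trans tT.
have mZ : measurable_fun (QT Omega T) (joint Z).
  by have /integrableP[/measurable_EFinP] := iZ.
have [mP0 iP0] := P2 (t := 0) (introT andP (conj (lexx 0) T0)).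
have [mPt iPt] := P2 (t := t) (introT andP (conj t0 tT)).
pose Q (z : M * E) : R := P 0 z.2 + \int[lambda]_(s in `]0, z.1[) Z s z.2.
have mQQ : measurable_fun (QT Omega T) Q.
  apply: measurable_funD; last exact: measurable_primitive.
  apply: (@measurable_comp _ _ _ _ _ _ Omega) => //; last exact: measurable_funTS measurable_snd.
  by move=> _ [z [? ?] <-].
have QW : {ae tleb R N, forall z, QT Omega T z -> Q z = joint W z}.
  apply: (ae_eq_prod_of_sections (mI T) mO mQQ mW).
  refine (aeS PW _) => s hs /=; rewrite in_itv/= => sT; have {}hs := hs sT.
  have sT' : 0 <= s <= T by have /andP[h1 h2] := sT; rewrite !ltW.
  apply: filterS2 (PZ sT') hs => x h1 h2 Ox.
  by rewrite /Q/= -h1// h2.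
have QWt : {ae tleb R N, forall z, QT Omega t z -> Q z = joint W z}.
  by apply: filterS QW => z h /(QTs tT)/h.
have QB : {ae tleb R N, forall z, QT Omega t z -> `|Q z| <= B}.
  by apply: filterS2 WB QW => z h1 h2 /(QTs tT) Qz; rewrite h2// h1.
have -> : \int[tleb R N]_(z in QT Omega t) (joint Z z * joint W z) =
    \int[tleb R N]_(z in QT Omega t) (joint Z z * Q z).
  by apply: ae_eq_Rintegral; apply: filterS QWt => z h Qz; rewrite h.
have iZt : (tleb R N).-integrable (QT Omega t) (EFin \o joint Z).
  exact: integrableS (mQ T) (mQ t) (QTs tT) iZ.
have mQt : measurable_fun (QT Omega t) Q.
  exact: measurable_funS (mQ T) (QTs tT) mQQ.
have iZQ := integrable_mul_ae_bounded (mQ t) iZt mQt B0 QB.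
have [_ e] := Rfubini' (mI t) mO iZQ.
rewrite [LHS]e -(RintegralB mO iPt iP0) -RintegralZl//; last first.
  exact: (integrableB mO iPt iP0).
have [aeZ _ _] := fubini_rect' (mI t) mO iZt.
apply: ae_eq_Rintegral.
apply: filterS2 aeZ (PZ (t := t) (introT andP (conj t0 tT))) => x h1 h2 Ox.
have {h1} ik := h1 Ox; have {h2} hP := h2 Ox; rewrite /joint /= in ik.
have [iH eH] := half_square (k := fun s => Z s x) ik.
rewrite /Q /joint /=.
have i1 := integrableZr (mI t) (P 0 x) ik.
transitivity (\int[lambda]_(s in `]0, t[) (Z s x * P 0 x +
    Z s x * \int[lambda]_(r in `]0, s[) Z r x)).
  by apply: eq_Rintegral => s _; rewrite mulrDr.
have e1 := RintegralD (mI t) i1 iH.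
rewrite [LHS]e1 eH (RintegralZr _ (mI t) ik) hP.
by move: (\int[lambda]_(s in _) Z s x) => K; field.
Qed.

End energy.

(** * Limits of the regularized quotients *)

Section quotient_limits.
Variables (R : realType) (q M : R).
Hypothesis q1 : 1 < q.
Local Notation qt := (fun c => quot q c M).

Let q0 : 0 < q. Proof. exact: lt_trans q1. Qed.

Section fixed.
Variables (c a b : R).
Hypotheses (c0 : 0 < c) (a0 : 0 < a < M) (b0 : 0 < b < M).

Let Ea : cutoff c M a = a + (c + c).
Proof. by apply: cutoffE => //; have /andP[h1 h2] := a0; rewrite !ltW. Qed.

Let Eb : cutoff c M b = b + (c + c).
Proof. by apply: cutoffE => //; have /andP[h1 h2] := b0; rewrite !ltW. Qed.

Let A0 : 0 < a + (c + c). Proof. by have /andP[h1 h2] := a0; rewrite !addr_gt0. Qed.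
Let B0 : 0 < b + (c + c). Proof. by have /andP[h1 h2] := b0; rewrite !addr_gt0. Qed.

Lemma quotE : quot q c M a b =
  (a + (c + c)) - (b + (c + c)) `^ q * (a + (c + c)) `^ (1 - q).
Proof. by rewrite /quot Ea Eb. Qed.

Lemma quot_le : quot q c M a b <= M + (c + c).
Proof.
rewrite quotE lerBlDr (le_trans (y := M + (c + c)))//.
  by rewrite lerD2r; have /andP[_ /ltW] := a0.
by rewrite lerDl mulr_ge0 ?powR_ge0.
Qed.

(** With [a'] and [b'] the translates of [a] and [b] by [2 c], the left-hand
    side is the absolute value of [(a / a') ^ (q - 1) (a' ^ q - b' ^ q)]. *)
Lemma quot_bound : `|a `^ (q - 1) * quot q c M a b| <= (M + (c + c)) `^ q.
Proof.
have /andP[ap aM] := a0; have /andP[bp bM] := b0.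
set A := a + (c + c); set B := b + (c + c); set S := M + (c + c).
have q10 : 0 <= q - 1 by rewrite subr_ge0 ltW.
have AS : A <= S by rewrite lerD2r ltW.
have BS : B <= S by rewrite lerD2r ltW.
have e : a `^ (q - 1) * quot q c M a b =
    (a `^ (q - 1) * A `^ (1 - q)) * (A `^ q - B `^ q).
  rewrite quotE -/A -/B -mulrA; congr (_ * _); rewrite mulrBr -powRD; last first.
    by rewrite (gt_eqF A0) implybT.
  rewrite (_ : 1 - q + q = 1); last by ring.
  by rewrite powRr1 ?(ltW A0)// [X in _ = _ - X]mulrC.
have r0 : 0 <= a `^ (q - 1) * A `^ (1 - q) by rewrite mulr_ge0 ?powR_ge0.
have r1 : a `^ (q - 1) * A `^ (1 - q) <= 1.
  apply: (@le_trans _ _ (A `^ (q - 1) * A `^ (1 - q))).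
    rewrite ler_wpM2r ?powR_ge0//; apply: ge0_ler_powR => //.
    - by rewrite nnegrE ltW.
    - by rewrite nnegrE ltW// A0.
    - by rewrite /A lerDl addr_ge0// ltW.
  rewrite -powRD; last by rewrite (gt_eqF A0) implybT.
  by rewrite (_ : q - 1 + (1 - q) = 0) ?powRr0//; ring.
rewrite e normrM (ger0_norm r0).
apply: (@le_trans _ _ (1 * `|A `^ q - B `^ q|)); first by rewrite ler_wpM2r.
rewrite mul1r ler_norml.
have hA : A `^ q <= S `^ q.
  by apply: ge0_ler_powR; rewrite ?nnegrE ?(ltW q0) ?(ltW A0) ?(le_trans (ltW A0) AS).
have hB : B `^ q <= S `^ q.
  by apply: ge0_ler_powR; rewrite ?nnegrE ?(ltW q0) ?(ltW B0) ?(le_trans (ltW B0) BS).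
have := powR_ge0 A q; have := powR_ge0 B q; lra.
Qed.

Lemma derive_cutoff : 'D_1 (cutoff c M) a = 1.
Proof.
have /andP[ap aM] := a0.
rewrite (_ : 'D_1 _ a = 'D_1 (fun x : R => x + (c + c)) a).
  by rewrite deriveD// derive_cst derive_id addr0.
apply: near_eq_derive.
have h1 : \forall x \near a, 0 < x by exact: lt_nbhsr.
have h2 : \forall x \near a, x < M by exact: lt_nbhsl.
by apply: filterS2 h1 h2 => x x0 xM; rewrite cutoffE// !ltW.
Qed.

End fixed.

Lemma quot_picone N (Omega : set 'rV[R]_N) (p : 'rV[R]_N -> R) A c a b x xi eta :
  open Omega -> {in Omega, continuous p} -> (forall x, Omega x -> 1 < p x) ->
  operator_potential Omega A -> condA0 Omega p A -> condA1 Omega p A ->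
  0 < c -> 0 < a < M -> 0 < b < M -> Omega x -> q < p x ->
  0 <= dotp (flux p A x xi) (quot1 q c M a b *: xi + quot2 q c M a b *: eta) +
       dotp (flux p A x eta) (quot1 q c M b a *: eta + quot2 q c M b a *: xi).
Proof.
move=> oO cp p1 HA HA0 HA1 c0 a0 b0 Ox qp.
have /andP[ap aM] := a0; have /andP[bp bM] := b0.
have da := derive_cutoff c0 a0; have db := derive_cutoff c0 b0.
have ca := cutoffE c0 (introT andP (conj (ltW ap) (ltW aM))).
have cb := cutoffE c0 (introT andP (conj (ltW bp) (ltW bM))).
have A0 : 0 < a + (c + c) by rewrite !addr_gt0.
have B0 : 0 < b + (c + c) by rewrite !addr_gt0.
have e1 : quot1 q c M a b = 1 + (q - 1) * ((b + (c + c)) `^ q * (a + (c + c)) `^ (- q)).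
  by rewrite /quot1 da mul1r ca cb.
have e2 : quot1 q c M b a = 1 + (q - 1) * ((a + (c + c)) `^ q * (b + (c + c)) `^ (- q)).
  by rewrite /quot1 db mul1r ca cb.
have e3 : quot2 q c M a b = - q * ((b + (c + c)) `^ (q - 1) * (a + (c + c)) `^ (1 - q)).
  by rewrite /quot2 db mulr1 ca cb.
have e4 : quot2 q c M b a = - q * ((a + (c + c)) `^ (q - 1) * (b + (c + c)) `^ (1 - q)).
  by rewrite /quot2 da mulr1 ca cb.
rewrite e1 e2 e3 e4.
exact: (picone oO cp p1 HA HA0 HA1 xi eta Ox q1 qp A0 B0).
Qed.

Lemma cvg_invS : (fun n : nat => (n.+1%:R : R)^-1) @ \oo --> (0 : R).
Proof. exact: cvg_harmonic. Qed.

Variables (a b : R).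
Hypotheses (a0 : 0 < a < M) (b0 : 0 < b < M).
Local Notation cn := (fun n : nat => (n.+1%:R : R)^-1).

Lemma quot_cvg : (fun n => quot q (cn n) M a b) @ \oo --> a - b `^ q * a `^ (1 - q).
Proof.
have /andP[ap aM] := a0; have /andP[bp bM] := b0.
have -> : (fun n => quot q (cn n) M a b) = (fun n => (a + (cn n + cn n)) -
    (b + (cn n + cn n)) `^ q * (a + (cn n + cn n)) `^ (1 - q)).
  by apply/funext => n; rewrite quotE.
have sh (x : R) : (fun n => x + (cn n + cn n)) @ \oo --> x.
  rewrite -[X in _ --> X]addr0; apply: cvgD; first exact: cvg_cst.
  by rewrite -[X in _ --> X]addr0; apply: cvgD; exact: cvg_invS.
have pw (x s : R) : 0 < x -> (fun n => (x + (cn n + cn n)) `^ s) @ \oo --> x `^ s.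
  move=> x0.
  have cpw : {for x, continuous (fun y : R => y `^ s)}.
    by apply: differentiable_continuous; have [] := derive_powR_gt0 s x0.
  exact: (cvg_comp _ _ (sh x) cpw).
by apply: cvgB; [exact: sh|apply: cvgM; exact: pw].
Qed.

Lemma quot_weighted_cvg : (fun n => a `^ (q - 1) * quot q (cn n) M a b) @ \oo -->
  a `^ q - b `^ q.
Proof.
have /andP[ap aM] := a0.
have -> : a `^ q - b `^ q = a `^ (q - 1) * (a - b `^ q * a `^ (1 - q)).
  rewrite mulrBr mulrCA -[X in _ = _ * X - _](powRr1 (ltW ap)) -!powRD ?(gt_eqF ap) ?implybT//.
  rewrite (_ : q - 1 + 1 = q); last by ring.
  by rewrite (_ : q - 1 + (1 - q) = 0) ?powRr0 ?mulr1//; ring.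
by apply: cvgM; [exact: cvg_cst|exact: quot_cvg].
Qed.

End quotient_limits.

Section source_sign.
Variables (R : realType) (q M : R).
Hypothesis q1 : 1 < q.
Variables (a b fa fb : R).
Hypotheses (a0 : 0 < a < M) (b0 : 0 < b < M).
Local Notation cn := (fun n : nat => (n.+1%:R : R)^-1).

Let q0 : 0 < q. Proof. exact: lt_trans q1. Qed.

(** The sum factors as [(a ^ q - b ^ q) (fa / a ^ (q - 1) - fb / b ^ (q - 1))],
    whose factors have opposite signs. *)
Lemma source_limit_le0 : (a <= b -> fb / b `^ (q - 1) <= fa / a `^ (q - 1)) ->
  (b <= a -> fa / a `^ (q - 1) <= fb / b `^ (q - 1)) ->
  fa * (a - b `^ q * a `^ (1 - q)) + fb * (b - a `^ q * b `^ (1 - q)) <= 0.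
Proof.
have /andP[ap aM] := a0; have /andP[bp bM] := b0.
have inv (x : R) : 0 < x -> (x `^ (q - 1))^-1 = x `^ (1 - q).
  by move=> x0; rewrite -powRN; congr (_ `^ _); ring.
have one (x : R) : 0 < x -> x = x `^ q * x `^ (1 - q).
  move=> x0; rewrite -powRD ?(gt_eqF x0) ?implybT// (_ : q + (1 - q) = 1); last by ring.
  by rewrite powRr1// ltW.
rewrite !inv// => h1 h2.
have -> : fa * (a - b `^ q * a `^ (1 - q)) + fb * (b - a `^ q * b `^ (1 - q)) =
    (a `^ q - b `^ q) * (fa * a `^ (1 - q) - fb * b `^ (1 - q)).
  rewrite [X in fa * (X - _)](one a)// [X in fb * (X - _)](one b)//; ring.
have mono (x y : R) : 0 < x -> x <= y -> x `^ q <= y `^ q.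
  move=> x0 xy; apply: ge0_ler_powR => //; rewrite ?nnegrE ?(ltW q0) ?(ltW x0)//.
  by rewrite (le_trans (ltW x0)).
have [ab|ba] := leP a b.
  by apply: mulr_le0_ge0; rewrite ?subr_le0 ?subr_ge0; [exact: mono|exact: h1].
apply: mulr_ge0_le0; rewrite ?subr_le0 ?subr_ge0.
  by apply: mono => //; exact: ltW.
by apply: h2; exact: ltW.
Qed.

Lemma source_positive_part_cvg0 : 
  (a <= b -> fb / b `^ (q - 1) <= fa / a `^ (q - 1)) ->
  (b <= a -> fa / a `^ (q - 1) <= fb / b `^ (q - 1)) ->
  (fun n => Num.max 0 (fa * quot q (cn n) M a b + fb * quot q (cn n) M b a)) @ \oo --> (0 : R).
Proof.
move=> h1 h2; have L0 := source_limit_le0 h1 h2.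
set L := _ + _ in L0.
have eL : Num.max 0 L = 0 by rewrite max_l.
rewrite -[X in _ --> X]eL.
have hL : (fun n => fa * quot q (cn n) M a b + fb * quot q (cn n) M b a) @ \oo --> L.
  by apply: cvgD; apply: cvgM;
    [exact: cvg_cst|exact: quot_cvg|exact: cvg_cst|exact: quot_cvg].
have c1 : {for L, continuous (fun _ : R => (0 : R))} by exact: cvg_cst.
have c2 : {for L, continuous (fun x : R => x)} by exact: cvg_id.
exact: (cvg_comp _ _ hL (continuous_max c1 c2)).
Qed.

End source_sign.

(** * Passage to the limit in the tested equations *)

Lemma ae_bounded_integrable d (X : measurableType d) (R : realType)
    (mu : {measure set X -> \bar R}) (D : set X) (g : X -> R) (C : R) :
  measurable D -> (mu D < +oo)%E -> measurable_fun D g -> 0 <= C ->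
  {ae mu, forall x, D x -> `|g x| <= C} -> mu.-integrable D (EFin \o g).
Proof.
move=> mD fD mg C0 gC.
have i1 : mu.-integrable D (EFin \o (fun=> 1 : R)).
  apply/integrableP; split; first by apply/measurable_EFinP; exact: measurable_cst.
  under eq_integral do rewrite /= normr1.
  by rewrite integral_cst// mul1e.
have := integrable_mul_ae_bounded mD i1 mg C0 gC.
by apply: eq_integrable => // x _; rewrite /= mul1r.
Qed.

Section comparison_limit.
Context d (X : measurableType d) (R : realType).
Variables (mu : {measure set X -> \bar R}) (D : set X) (q M : R).
Hypotheses (mD : measurable D) (fD : (mu D < +oo)%E) (q1 : 1 < q) (M0 : 0 < M).
Local Notation cn n := ((n.+1%:R : R)^-1).

Let cn0 n : 0 < cn n. Proof. by rewrite invr_gt0 ltr0n. Qed.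
Let cn1 n : cn n <= 1. Proof. by rewrite invf_le1 ?ler1n ?ltr0n. Qed.
Let q0 : 0 < q. Proof. exact: lt_trans q1. Qed.

Lemma quot_weighted_le n a b : 0 < a < M -> 0 < b < M ->
  `|a `^ (q - 1) * quot q (cn n) M a b| <= (M + 2) `^ q.
Proof.
move=> a0 b0; apply: (le_trans (quot_bound q1 (cn0 n) a0 b0)).
have h1 : 0 <= M + (cn n + cn n) by rewrite !addr_ge0// ltW.
have h2 : 0 <= M + 2 by rewrite addr_ge0// ltW.
apply: ge0_ler_powR; rewrite ?nnegrE ?(ltW q0)//.
by rewrite lerD2l; have := cn1 n; move: (cn n) => y; lra.
Qed.

Let mpow s (u : X -> R) : measurable_fun D u -> measurable_fun D (fun x => u x `^ s).
Proof.
move=> mu_; apply: (@measurableT_comp _ _ _ _ _ _ (fun y : R => y `^ s)) mu_.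
exact: measurable_powR.
Qed.

Section weighted.
Variables (v w : X -> R).
Hypotheses (mv : measurable_fun D v) (mw : measurable_fun D w).
Hypotheses (v0 : {ae mu, forall x, D x -> 0 < v x < M})
  (w0 : {ae mu, forall x, D x -> 0 < w x < M}).

Lemma measurable_quot c : 0 < c -> measurable_fun D (fun x => quot q c M (v x) (w x)).
Proof.
move=> c0; have [C [_ lF _]] := bounded_lipschitz_quot q c0 (ltW M0).
exact: lipschitz2_measurable lF mD mv mw.
Qed.

Let mvq n : measurable_fun D (fun x => v x `^ (q - 1) * quot q (cn n) M (v x) (w x)).
Proof.
apply: measurable_funM; last exact: measurable_quot.
exact: mpow.
Qed.

Let bnd n : {ae mu, forall x, D x ->
  `|v x `^ (q - 1) * quot q (cn n) M (v x) (w x)| <= (M + 2) `^ q}.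
Proof.
by refine (aeS2 v0 w0 _) => x h1 h2 Dx; apply: quot_weighted_le; [exact: h1|exact: h2].
Qed.

Lemma quot_weighted_integrable (g : X -> R) n : mu.-integrable D (EFin \o g) ->
  mu.-integrable D (fun x => (g x * (v x `^ (q - 1) * quot q (cn n) M (v x) (w x)))%:E).
Proof.
by move=> ig; exact: (integrable_mul_ae_bounded mD ig (mvq n) (powR_ge0 _ _) (bnd n)).
Qed.

Lemma quot_weighted_integral_cvg (g : X -> R) : mu.-integrable D (EFin \o g) ->
  mu.-integrable D (fun x => (g x * (v x `^ q - w x `^ q))%:E) /\
  (fun n => \int[mu]_(x in D) (g x * (v x `^ (q - 1) * quot q (cn n) M (v x) (w x)))) @ \oo -->
  \int[mu]_(x in D) (g x * (v x `^ q - w x `^ q)).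
Proof.
move=> ig; have mg : measurable_fun D g by have /integrableP[/measurable_EFinP] := ig.
have igC : mu.-integrable D (EFin \o (fun x => `|g x| * (M + 2) `^ q)).
  by apply: eq_integrable (integrableZr mD ((M + 2) `^ q) (integrable_abse ig)) => // x _.
apply: (dominated_cvg_Rintegral (g := fun x => `|g x| * (M + 2) `^ q) mD).
- by move=> n; exact: measurable_funM.
- apply: measurable_funM => //; apply: measurable_funB.
    exact: mpow.
  exact: mpow.
- exact: igC.
- refine (aeS2 v0 w0 _) => x h1 h2 Dx n; rewrite normrM ler_wpM2l//.
  by apply: quot_weighted_le; [exact: h1|exact: h2].
- refine (aeS2 v0 w0 _) => x h1 h2 Dx; apply: cvgM; first exact: cvg_cst.
  by apply: quot_weighted_cvg; [exact: h1|exact: h2].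
Qed.

End weighted.

Variables (v w dv dw hv hw fv fw : X -> R) (F : R) (a b : nat -> R).
Hypotheses (mv : measurable_fun D v) (mw : measurable_fun D w).
Hypotheses (v0 : {ae mu, forall x, D x -> 0 < v x < M})
  (w0 : {ae mu, forall x, D x -> 0 < w x < M}).
Hypotheses (idv : mu.-integrable D (EFin \o dv)) (idw : mu.-integrable D (EFin \o dw)).
Hypotheses (ihv : mu.-integrable D (EFin \o hv)) (ihw : mu.-integrable D (EFin \o hw)).
Hypotheses (mfv : measurable_fun D fv) (mfw : measurable_fun D fw).
Hypotheses (fv0 : {ae mu, forall x, D x -> 0 <= fv x <= F})
  (fw0 : {ae mu, forall x, D x -> 0 <= fw x <= F}).
Hypothesis fmono : {ae mu, forall x, D x ->
  (v x <= w x -> fw x / w x `^ (q - 1) <= fv x / v x `^ (q - 1)) /\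
  (w x <= v x -> fv x / v x `^ (q - 1) <= fw x / w x `^ (q - 1))}.
Local Notation Phi n x := (quot q (cn n) M (v x) (w x)).
Local Notation Psi n x := (quot q (cn n) M (w x) (v x)).
Hypothesis eqv : forall n,
  \int[mu]_(x in D) (dv x * (v x `^ (q - 1) * Phi n x)) + a n =
  \int[mu]_(x in D) (hv x * (v x `^ (q - 1) * Phi n x)) + \int[mu]_(x in D) (fv x * Phi n x).
Hypothesis eqw : forall n,
  \int[mu]_(x in D) (dw x * (w x `^ (q - 1) * Psi n x)) + b n =
  \int[mu]_(x in D) (hw x * (w x `^ (q - 1) * Psi n x)) + \int[mu]_(x in D) (fw x * Psi n x).
Hypothesis ab0 : forall n, 0 <= a n + b n.

Let combine (s1 s2 s3 s4 s5 s6 s7 s8 x y : R) : s5 + x = s7 + s3 -> s6 + y = s8 + s4 ->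
  0 <= x + y -> s1 = s3 + s4 -> s1 <= s2 -> s5 + s6 <= s7 + s8 + s2.
Proof. lra. Qed.

(** Only the positive part of the source terms survives in the inequality: it
    is dominated, although the source terms divided by the regularized
    solutions need not be. *)
Lemma comparison_limit :
  \int[mu]_(x in D) ((dv x - dw x) * (v x `^ q - w x `^ q)) <=
  \int[mu]_(x in D) ((hv x - hw x) * (v x `^ q - w x `^ q)).
Proof.
have [i1 c1] := quot_weighted_integral_cvg mv mw v0 w0 idv.
have [i2 c2] := quot_weighted_integral_cvg mw mv w0 v0 idw.
have [i3 c3] := quot_weighted_integral_cvg mv mw v0 w0 ihv.
have [i4 c4] := quot_weighted_integral_cvg mw mv w0 v0 ihw.
pose S n x := fv x * Phi n x + fw x * Psi n x.
have mS n : measurable_fun D (S n).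
  by apply: measurable_funD; apply: measurable_funM => //; exact: measurable_quot.
have mF (g u u' : X -> R) (c : R) : measurable_fun D g -> measurable_fun D u -> measurable_fun D u' ->
    {ae mu, forall x, D x -> 0 <= g x <= F} -> 0 < c ->
    mu.-integrable D (EFin \o (fun x => g x * quot q c M (u x) (u' x))).
  move=> mg mu_ mu' gF c0; have [C [C0 _ bC]] := bounded_lipschitz_quot q c0 (ltW M0).
  have ig : mu.-integrable D (EFin \o g).
    apply: (ae_bounded_integrable (C := `|F|) mD fD mg) => //.
    refine (aeS gF _) => x h Dx; have /andP[g0 gF'] := h Dx.
    by rewrite ger0_norm// (le_trans gF' (ler_norm _)).
  by apply: (integrable_mul_bounded mD ig (measurable_quot mu_ mu' c0)).
have iv n := mF _ _ _ _ mfv mv mw fv0 (cn0 n).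
have iw n := mF _ _ _ _ mfw mw mv fw0 (cn0 n).
have SC : {ae mu, forall x, D x -> forall n, Num.max 0 (S n x) <= 2 * `|F| * (M + 2)}.
  refine (aeS2 (aeS2 v0 w0 (fun x h1 h2 => conj h1 h2))
    (aeS2 fv0 fw0 (fun x h1 h2 => conj h1 h2)) _) => x [h1 h2] [h3 h4] Dx n.
  have vx := h1 Dx; have wx := h2 Dx; have /andP[g0 gF] := h3 Dx; have /andP[k0 kF] := h4 Dx.
  have M2 : 0 <= M + 2 by rewrite addr_ge0// ltW.
  rewrite ge_max; apply/andP; split; first by rewrite !mulr_ge0.
  have cb : M + (cn n + cn n) <= M + 2.
    by rewrite lerD2l; have := cn1 n; move: (cn n) => y; lra.
  have hq y z : 0 < y < M -> 0 < z < M -> quot q (cn n) M y z <= M + 2.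
    by move=> hy hz; exact: (le_trans (quot_le q (cn0 n) hy hz)).
  have hf g y z : 0 <= g -> g <= F -> 0 < y < M -> 0 < z < M ->
      g * quot q (cn n) M y z <= `|F| * (M + 2).
    move=> g0' gF' hy hz; apply: (@le_trans _ _ (g * (M + 2))).
      by rewrite ler_wpM2l// hq.
    by rewrite ler_wpM2r// (le_trans gF' (ler_norm _)).
  apply: (le_trans (lerD (hf _ _ _ g0 gF vx wx) (hf _ _ _ k0 kF wx vx))).
  by rewrite -[2 * _ * _]mulrA mulr_natl mulr2n.
have mmax n : measurable_fun D (fun x => Num.max 0 (S n x)).
  by apply: measurable_maxr => //; exact: measurable_cst.
have c5 : (fun n => \int[mu]_(x in D) Num.max 0 (S n x)) @ \oo -->
    \int[mu]_(x in D) (fun=> 0 : R) x.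
  apply: (proj2 (dominated_cvg_Rintegral (g := fun=> 2 * `|F| * (M + 2)) mD mmax _ _ _ _)).
  - exact: measurable_cst.
  - apply: (ae_bounded_integrable (C := `|2 * `|F| * (M + 2)|) mD fD) => //.
    by apply: aeW.
  - refine (aeS SC _) => x h Dx n; rewrite ger0_norm ?h//.
    by rewrite le_max lexx.
  - refine (aeS2 (aeS2 v0 w0 (fun x h1 h2 => conj h1 h2)) fmono _) => x [h1 h2] h3 Dx.
    have [f1 f2] := h3 Dx.
    by apply: source_positive_part_cvg0; [exact: q1|exact: h1|exact: h2|exact: f1|exact: f2].
have e5 : \int[mu]_(x in D) (fun=> 0 : R) x = 0 by rewrite Rintegral_cst// mul0r.
rewrite e5 in c5.
have iS n : mu.-integrable D (EFin \o S n).
  by apply: eq_integrable (integrableD mD (iv n) (iw n)) => // x _.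
have key n :
    \int[mu]_(x in D) (dv x * (v x `^ (q - 1) * Phi n x)) +
    \int[mu]_(x in D) (dw x * (w x `^ (q - 1) * Psi n x)) <=
    \int[mu]_(x in D) (hv x * (v x `^ (q - 1) * Phi n x)) +
    \int[mu]_(x in D) (hw x * (w x `^ (q - 1) * Psi n x)) +
    \int[mu]_(x in D) Num.max 0 (S n x).
  have h1 : \int[mu]_(x in D) S n x <= \int[mu]_(x in D) Num.max 0 (S n x).
    have iM : mu.-integrable D (EFin \o (fun x => Num.max 0 (S n x))).
      apply: (ae_bounded_integrable (C := `|2 * `|F| * (M + 2)|) mD fD) => //.
      refine (aeS SC _) => x h Dx; rewrite ger0_norm ?le_max ?lexx//.
      exact: (le_trans (h Dx n) (ler_norm _)).
    apply: (le_Rintegral mD (iS n) iM).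
    by move=> x _; rewrite le_max lexx orbT.
  have h2 := RintegralD mD (iv n) (iw n).
  exact: (combine (eqv n) (eqw n) (ab0 n) h2 h1).
have lim : \int[mu]_(x in D) (dv x * (v x `^ q - w x `^ q)) +
    \int[mu]_(x in D) (dw x * (w x `^ q - v x `^ q)) <=
    \int[mu]_(x in D) (hv x * (v x `^ q - w x `^ q)) +
    \int[mu]_(x in D) (hw x * (w x `^ q - v x `^ q)) + 0.
  have L := cvgD c1 c2; have Rr := cvgD (cvgD c3 c4) c5.
  by refine (ler_cvg_to (L _) (Rr _ _) _); apply: nearW => n; exact: key.
have comb g k : mu.-integrable D (fun x => (g x * (v x `^ q - w x `^ q))%:E) ->
    mu.-integrable D (fun x => (k x * (w x `^ q - v x `^ q))%:E) ->
    \int[mu]_(x in D) ((g x - k x) * (v x `^ q - w x `^ q)) =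
    \int[mu]_(x in D) (g x * (v x `^ q - w x `^ q)) +
    \int[mu]_(x in D) (k x * (w x `^ q - v x `^ q)).
  move=> ig ik; have e := RintegralD mD ig ik.
  rewrite -[RHS]e; apply: eq_Rintegral => x _ /=; ring.
rewrite (comb dv dw)// (comb hv hw)//.
by rewrite addr0 in lim.
Qed.

End comparison_limit.

(** * Flux and source terms on the cylinder *)

Lemma compact_closure_bounded (R : realType) (N : nat) (Omega : set 'rV[R]_N) :
  bounded_set Omega -> compact (closure Omega).
Proof.
move=> [B [Br hB]]; apply: bounded_closed_compact; last exact: closed_closure.
exists B; split => // m' Bm' x cx.
have : closure Omega `<=` closed_ball_ Num.norm 0 m'.
  rewrite [X in _ `<=` X](closure_id _).1; last exact: closed_closed_ball_.
  by apply: closureS => y Oy; rewrite /closed_ball_/= sub0r normrN; exact: hB Oy.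
by move=> /(_ _ cx); rewrite /closed_ball_/= sub0r normrN.
Qed.

Section operator_terms.
Variables (R : realType) (N : nat).
Local Notation E := 'rV[R]_N.
Local Notation M := (measurableTypeR R).
Local Notation lambda := (@lebesgue_measure R).
Variables (Omega : set E) (p : E -> R) (A : E -> E -> R) (T q P : R).
Hypotheses (oO : open Omega) (fO : (leb R N Omega < +oo)%E).
Hypotheses (cp : {in Omega, continuous p}) (pq : forall x, Omega x -> q < p x <= P).
Hypotheses (q1 : 1 < q) (T0 : 0 < T).
Hypotheses (HA : operator_potential Omega A) (HA0 : condA0 Omega p A) (HA1 : condA1 Omega p A).

Let mO : measurable Omega. Proof. exact: open_measurable_rV. Qed.
Let mI t : measurable (`]0, t[%classic : set M). Proof. exact: measurable_itv. Qed.

Lemma measurable_QT t : measurable (QT Omega t). Proof. exact: measurableX. Qed.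
Let mQ := measurable_QT.

Lemma QT_subset t : t <= T -> QT Omega t `<=` QT Omega T.
Proof.
move=> tT [s x] [/= + Ox]; rewrite in_itv/= => /andP[s0 st]; split => //=.
by rewrite in_itv/= s0 (lt_le_trans st).
Qed.

Lemma QT_lty : (tleb R N (QT Omega T) < +oo)%E.
Proof.
have -> : tleb R N (QT Omega T) = (lambda (`]0%R, T[%classic : set M) * leb R N Omega)%E.
  exact: (product_measure1E lambda (leb R N) (mI T) mO).
apply: lte_mul_pinfty.
- exact: measure_ge0.
- by rewrite /= lebesgue_measure_itv/= lte_fin T0.
- exact: fO.
Qed.

Let p1 x : Omega x -> 1 < p x.
Proof. by move=> /pq/andP[h _]; exact: lt_trans h. Qed.

Let p1P x : Omega x -> 1 <= p x <= P.
Proof. by move=> Ox; have /andP[_ ->] := pq Ox; rewrite ltW ?p1. Qed.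

Let mp : measurable_fun Omega p.
Proof. by apply: measurable_continuous_rV => // x Ox; apply: cp; exact/mem_set. Qed.

Let openX : open (Omega `*` [set: E]).
Proof.
rewrite openE => -[x xi] [/= Ox _]; exists (Omega, setT) => //=; split.
  exact: open_nbhs_nbhs.
exact: filterT.
Qed.

Let measurable_snd_box (Y : topologicalType) (I : countType) (B : I -> set Y)
    (G : M * E -> Y) t i :
  (forall j, measurable (QT Omega t `&` G @^-1` B j)) ->
  measurable (QT Omega t `&`
    (fun z => (z.2, G z)) @^-1` (rat_box i.1 `*` B i.2)).
Proof.
move=> mG; rewrite (_ : _ `&` _ = (QT Omega t `&` snd @^-1` rat_box i.1) `&`
    (QT Omega t `&` G @^-1` B i.2)).
  apply: measurableI; last exact: mG.
  have ms : measurable_fun (QT Omega t) (snd : M * E -> E).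
    exact: measurable_funTS measurable_snd.
  exact: (ms (mQ t) _ (measurable_rat_box i.1)).
by apply/seteqP; split => z /=; [move=> [? [? ?]]|move=> [[? ?] [? ?]]].
Qed.

Lemma measurable_flux t (G : M * E -> E) : measurable_fun (QT Omega t) G ->
  measurable_fun (QT Omega t) (fun z => flux p A z.2 (G z)).
Proof.
move=> mG; apply: measurable_fun_rV => j.
apply: (@measurable_comp_continuous R _ (M * E)%type (E * E)%type _ _ (QT Omega t)
  (fun z => (z.2, G z)) (fun y => flux p A y.1 y.2 ord0 j)
  (prod_base (@rat_box_base R N) (@rat_box_base R N))).
- exact: mQ.
- move=> i; apply: measurable_snd_box => k; exact: (mG (mQ t) _ (measurable_rat_box k)).
- move=> z [_ Oz]; have [_ _ /(_ j) cf _] := HA1.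
  move: cf; rewrite continuous_open_subspace// => cf.
  by apply: cf; apply/mem_set; split.
Qed.

Section source.
Variable f : E -> R -> R.
Hypothesis Hf : {within closure Omega `*` [set s : R | 0 <= s],
  continuous (fun z : E * R => f z.1 z.2)}.

(** The positive part extends [f], which is continuous only up to [s = 0], to a
    function that is continuous at all points above [Omega]. *)
Lemma measurable_source t (v : M * E -> R) : measurable_fun (QT Omega t) v ->
  measurable_fun (QT Omega t) (fun z => f z.2 (Num.max 0 (v z))).
Proof.
move=> mv.
apply: (@measurable_comp_continuous R _ (M * E)%type (E * R)%type _ _ (QT Omega t)
  (fun z => (z.2, v z)) (fun y => f y.1 (Num.max 0 y.2))
  (prod_base (@rat_box_base R N) (@rat_itv_base R))).
- exact: mQ.
- move=> i; apply: measurable_snd_box => k; exact: (mv (mQ t) _ (measurable_rat_itv k)).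
move=> [s x] [_ /= Ox]; set y := v (s, x).
pose S := closure Omega `*` [set s : R | 0 <= s].
pose kap (z : E * R) : E * R := (z.1, Num.max 0 z.2).
have Skap : S (kap (x, y)).
  by split => /=; [exact: subset_closure|rewrite le_max lexx].
have ckap : {for (x, y), continuous kap}.
  have c1 : {for (x, y), continuous (fun _ : E * R => (0 : R))} by exact: cvg_cst.
  have c2 : {for (x, y), continuous (fun z : E * R => z.2)} by exact: cvg_snd.
  have c3 : {for (x, y), continuous (fun z : E * R => z.1)} by exact: cvg_fst.
  exact: (cvg_pair c3 (continuous_max c1 c2)).
move=> U nU.
have /subspace_continuousP hS := Hf.
have hU := hS _ Skap _ nU.
have nO : \forall z \near (x, y), Omega z.1.
  by apply: (cvg_fst (G := nbhs y)); exact: open_nbhs_nbhs.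
have nS : \forall z \near (x, y), S (kap z) -> U (f (kap z).1 (kap z).2).
  exact: (ckap _ hU).
apply: filterS2 nO nS => z Oz h; apply: h.
by split => /=; [exact: subset_closure|rewrite le_max lexx].
Qed.

Lemma source_bounded (m : R) : bounded_set Omega -> exists2 F, 0 <= F &
  forall x s, Omega x -> 0 <= s <= m -> `|f x s| <= F.
Proof.
move=> bO.
have cK : compact (closure Omega `*` `[0, m]%classic).
  apply: compact_setX; last exact: segment_compact.
  exact: compact_closure_bounded.
have cf : {within closure Omega `*` `[0, m]%classic,
    continuous (fun z : E * R => f z.1 z.2)}.
  apply: continuous_subspaceW Hf => -[x s] [/= cx]; rewrite in_itv/= => /andP[s0 _].
  by split.
have := compact_bounded (continuous_compact cf cK).
move=> [B [_ hB]]; exists (`|B| + 1); first by rewrite addr_ge0.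
move=> x s Ox sm; apply: (hB (`|B| + 1)); first by rewrite (le_lt_trans (ler_norm B))// ltrDl.
by exists (x, s) => //=; split => /=; [exact: subset_closure|rewrite in_itv/=].
Qed.

End source.

Section pairing.
Variables (K : R) (G1 G2 G : R -> E -> E) (C : R).
Hypotheses (K1 : 1 <= K) (C0 : 0 <= C).
Hypotheses (mG1 : measurable_fun (QT Omega T) (joint G1))
  (mG2 : measurable_fun (QT Omega T) (joint G2)) (mG : measurable_fun (QT Omega T) (joint G)).

(** The Luxemburg norms are bounded uniformly in time, hence the modulars are at
    most one at almost every time. *)
Lemma gradient_power_integrable (H : R -> E -> E) :
  measurable_fun (QT Omega T) (joint H) ->
  {ae lambda, forall t : R, 0 < t < T ->
    (modular Omega p K (fun x => enorm (H t x)) <= 1)%E} ->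
  (tleb R N).-integrable (QT Omega T) (fun z => (enorm (joint H z) `^ p z.2)%:E).
Proof.
move=> mH hH; have K0 : 0 < K by exact: lt_le_trans K1.
have mpz : measurable_fun (QT Omega T) (fun z : M * E => p z.2).
  apply: (@measurable_comp _ _ _ _ _ _ Omega) => //; last exact: measurable_funTS measurable_snd.
  by move=> _ [z [? ?] <-].
have p0 z : QT Omega T z -> 0 < p z.2.
  by move=> [_ /p1]; exact: lt_trans.
have mN := measurable_enorm mH.
have mu1 : measurable_fun (QT Omega T) (fun z => (`|enorm (joint H z)| / K) `^ p z.2).
  apply: measurable_powR2 => //.
    apply: measurable_funM; last exact: measurable_cst.
    exact: measurableT_comp mN.
  by move=> z _; rewrite divr_ge0// ltW.
have i1 : (tleb R N).-integrable (QT Omega T)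
    (fun z => ((`|enorm (joint H z)| / K) `^ p z.2)%:E).
  apply/integrableP; split; first exact/measurable_EFinP.
  under eq_integral do rewrite gee0_abs ?lee_fin ?powR_ge0//.
  have mE1 : measurable_fun (`]0, T[%classic `*` Omega : set (M * E))
      (fun z => ((`|enorm (joint H z)| / K) `^ p z.2)%:E) by exact/measurable_EFinP.
  have [_ e] := ge0_fubini_rect lambda (leb R N) (mI T) mO mE1
    (fun z _ => (powR_ge0 _ _ : (0 <= _%:E)%E)).
  apply: (@le_lt_trans _ _ (\int[lambda]_(t in `]0%R, T[) 1)%E).
    rewrite [leLHS]e; apply: ge0_le_integral_ae.
    - by move=> t _; apply: integral_ge0 => x _; rewrite lee_fin powR_ge0.
    - by move=> t _; exact: lee01.
    - refine (aeS hH _) => t h /=; rewrite in_itv/= => tT.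
      by have := h tT; rewrite modularE.
  rewrite integral_cst//; apply: lte_mul_pinfty => //.
  by rewrite /= lebesgue_measure_itv/= lte_fin T0 ltry.
have iK := integrableZl (mQ T) (K `^ P) i1.
apply: (le_integrable (mQ T) _ _ iK).
  apply/measurable_EFinP; apply: measurable_powR2 => //.
  by move=> z _; exact: enorm_ge0.
move=> z Qz; have [_ Oz] := Qz.
rewrite /= lee_fin ger0_norm ?powR_ge0// ger0_norm; last by rewrite mulr_ge0 ?powR_ge0.
have n0 := enorm_ge0 (joint H z); rewrite (ger0_norm n0).
have -> : enorm (joint H z) `^ p z.2 = K `^ p z.2 * (enorm (joint H z) / K) `^ p z.2.
  rewrite -powRM; [|exact: ltW|by rewrite divr_ge0// ltW].
  by rewrite mulrC divfK// gt_eqF.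
rewrite ler_wpM2r ?powR_ge0//; apply: ler_powR => //.
by have /andP[] := pq Oz.
Qed.

Hypotheses (h1 : {ae lambda, forall t : R, 0 < t < T ->
    (modular Omega p K (fun x => enorm (G1 t x)) <= 1)%E})
  (h2 : {ae lambda, forall t : R, 0 < t < T ->
    (modular Omega p K (fun x => enorm (G2 t x)) <= 1)%E}).
Hypothesis GC : forall z, enorm (joint G z) <= C * (enorm (joint G1 z) + enorm (joint G2 z)).

(** The flux grows like the power [p - 1] of the gradient, and [r ^ (p - 1) s <=
    r ^ p + s ^ p]. *)
Lemma flux_pairing_integrable : (tleb R N).-integrable (QT Omega T)
  (fun z => (dotp (flux p A z.2 (joint G1 z)) (joint G z))%:E).
Proof.
have [D [D0 hD]] := flux_bounds oO cp p1 HA HA0 HA1.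
have i1 := gradient_power_integrable mG1 h1.
have i2 := gradient_power_integrable mG2 h2.
have q10 : 0 < q - 1 by rewrite subr_gt0.
pose B := D / (q - 1) * C.
have B0 : 0 <= B by rewrite mulr_ge0// divr_ge0// ltW.
have iB := integrableZl (mQ T) B (integrableD (mQ T) (integrableZl (mQ T) 2 i1) i2).
apply: (le_integrable (mQ T) _ _ iB).
  apply/measurable_EFinP; apply: measurable_dotp => //; exact: measurable_flux.
move=> z [_ Oz] /=; set g1 := joint G1 z; set g2 := joint G2 z; set g := joint G z.
rewrite lee_fin; apply: (le_trans (norm_dotp_le _ _)).
apply: (le_trans _ (ler_norm _)).
have [hz _] := hD z.2 g1 Oz.
have /andP[qp _] := pq Oz.
have fb : enorm (flux p A z.2 g1) <= D / (q - 1) * enorm g1 `^ (p z.2 - 1).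
  rewrite mulrAC ler_pdivlMr//; apply: (le_trans _ hz).
  by rewrite ler_wpM2l ?enorm_ge0// lerD2r ltW.
apply: (@le_trans _ _ (D / (q - 1) * enorm g1 `^ (p z.2 - 1) * (C * (enorm g1 + enorm g2)))).
  by apply: ler_pM; rewrite ?enorm_ge0// GC.
rewrite mulrACA -/B ler_wpM2l// mulrDr.
have px := p1 Oz.
have pw (a b : R) : 0 <= a -> 0 <= b -> a <= b -> a `^ (p z.2 - 1) * b <= b `^ p z.2.
  move=> a0 b0 ab; have -> : b `^ p z.2 = b `^ (p z.2 - 1) * b.
    have [->|bn] := eqVneq b 0; first by rewrite mulr0 powR0// gt_eqF// (lt_trans _ px).
    rewrite -[X in _ = _ * X](powRr1 b0) -powRD ?(negPf bn) ?implybT//.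
    by rewrite subrK.
  rewrite ler_wpM2r//; apply: ge0_ler_powR; rewrite ?nnegrE//.
  by rewrite subr_ge0 ltW.
have n1 := enorm_ge0 g1; have n2 := enorm_ge0 g2.
have k1 := pw _ _ n1 n1 (lexx _).
have k2 : enorm g1 `^ (p z.2 - 1) * enorm g2 <= enorm g1 `^ p z.2 + enorm g2 `^ p z.2.
  have [le12|/ltW le21] := leP (enorm g1) (enorm g2).
    by rewrite (le_trans (pw _ _ n1 n2 le12))// lerDr powR_ge0.
  apply: (@le_trans _ _ (enorm g1 `^ (p z.2 - 1) * enorm g1)).
    by rewrite ler_wpM2l ?powR_ge0.
  by rewrite (le_trans k1)// lerDl powR_ge0.
by apply: (le_trans (lerD k1 k2)); rewrite addrA -mulr2n mulr_natl.
Qed.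

End pairing.

End operator_terms.

(** * Comparison of two tested equations *)

Lemma exponent_bounds (R : realType) (N : nat) (Omega : set 'rV[R]_N) p (q : R) :
  open Omega -> bounded_set Omega -> variable_exponent Omega p -> q < p_minus Omega p ->
  {in Omega, continuous p} /\ exists P : R, forall x, Omega x -> q < p x <= P.
Proof.
move=> oO bO [[[dp _] cp _] _] qp; split.
  by move=> x /set_mem Ox; apply: differentiable_continuous; exact: dp.
have := compact_bounded (continuous_compact cp (compact_closure_bounded bO)).
move=> [B [_ hB]]; exists (`|B| + 1) => x Ox.
have hb y : closure Omega y -> `|p y| <= `|B| + 1.
  move=> cy; apply: (hB (`|B| + 1)); last by exists y.
  by rewrite (le_lt_trans (ler_norm B))// ltrDl.
have cx : closure Omega x by exact: subset_closure.
rewrite (le_trans (ler_norm _) (hb _ cx)) andbT; apply: (lt_le_trans qp).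
apply: ge_inf; last by exists x.
exists (- (`|B| + 1)) => _ [y cy <-].
by have := hb y cy; rewrite ler_norml => /andP[].
Qed.

Section tested.
Variables (R : realType) (N : nat).
Local Notation E := 'rV[R]_N.
Local Notation M := (measurableTypeR R).
Local Notation lambda := (@lebesgue_measure R).
Variables (Omega : set E) (p : E -> R) (A : E -> E -> R) (T q P m K : R).
Hypotheses (oO : open Omega) (fO : (leb R N Omega < +oo)%E).
Hypotheses (cp : {in Omega, continuous p}) (pq : forall x, Omega x -> q < p x <= P).
Hypotheses (q1 : 1 < q) (T0 : 0 < T) (m0 : 0 < m) (K1 : 1 <= K).
Hypotheses (HA : operator_potential Omega A) (HA0 : condA0 Omega p A) (HA1 : condA1 Omega p A).

Let mO : measurable Omega. Proof. exact: open_measurable_rV. Qed.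
Let mQ t : measurable (QT Omega t). Proof. exact: measurable_QT. Qed.
Let mI t : measurable (`]0, t[%classic : set M). Proof. exact: measurable_itv. Qed.

Let p1 x : Omega x -> 1 < p x.
Proof. by move=> /pq/andP[h _]; exact: lt_trans h. Qed.

Let p1P x : Omega x -> 1 <= p x <= P.
Proof. by move=> Ox; have /andP[_ ->] := pq Ox; rewrite ltW ?p1. Qed.

Let mp : measurable_fun Omega p.
Proof. by apply: measurable_continuous_rV => // x Ox; apply: cp; exact/mem_set. Qed.

(** What the comparison uses of a weak solution besides its equation. *)
Record bounded_path (v : R -> E -> R) (Dv : R -> E -> E) : Prop := BoundedPath {
  path_meas : measurable_fun (QT Omega T) (joint v);
  path_gmeas : measurable_fun (QT Omega T) (joint Dv);
  path_range : {ae tleb R N, forall z, QT Omega T z -> 0 < joint v z < m};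
  path_LW : in_LrW Omega p T +oo%E v;
  path_W0 : {ae lambda, forall t : R, 0 < t < T -> W0_with Omega p (v t) (Dv t)};
  path_modular : {ae lambda, forall t : R, 0 < t < T ->
    (modular Omega p K (fun x => enorm (Dv t x)) <= 1)%E} }.

Definition quot_path c (v w : R -> E -> R) t x := quot q c m (v t x) (w t x).
Definition quot_grad c (v w : R -> E -> R) (Dv Dw : R -> E -> E) t :=
  chain_grad (quot1 q c m) (quot2 q c m) (v t) (w t) (Dv t) (Dw t).

Section pair.
Variables (c : R) (v w : R -> E -> R) (Dv Dw : R -> E -> E).
Hypotheses (c0 : 0 < c) (bv : bounded_path v Dv) (bw : bounded_path w Dw).

Lemma quot_admissible : [/\ in_LpQ Omega T 2%:E (quot_path c v w),
  in_LrW Omega p T 1%E (quot_path c v w) &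
  spatial_gradient Omega T (quot_path c v w) (quot_grad c v w Dv Dw)].
Proof.
have [mv mDv _ Lv Wv _] := bv; have [mw mDw _ Lw Ww _] := bw.
have [C cm] := chain_map_quot q c0 (ltW m0) Omega.
have [B [B0 lF bF]] := bounded_lipschitz_quot q c0 (ltW m0).
have mphi : measurable_fun (QT Omega T) (joint (quot_path c v w)).
  exact: (lipschitz2_measurable lF (mQ T) mv mw).
split.
- apply/(in_L2P _ (mQ T)); split; first exact: mphi.
  have m2 : measurable_fun (QT Omega T) (fun z => joint (quot_path c v w) z ^+ 2).
    exact: measurable_funX.
  apply: (ae_bounded_integrable (C := B ^+ 2) (mQ T) (QT_lty oO fO T0) m2).
    exact: sqr_ge0.
  apply: aeW => z _; rewrite normrX ler_sqr ?nnegrE ?normr_ge0 ?(ltW B0)//.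
  exact: bF.
- exact: (in_L1W_chain oO fO mp p1P T0 cm Lv Lw).
- split; first exact: (measurable_chain_grad cm (mQ T) mv mw mDv mDw).
  refine (aeS2 Wv Ww _) => t h1 h2 tT.
  by have [] := W0_with_chain oO fO mp p1P cm (h1 tT) (h2 tT).
Qed.

Lemma quot_pairing_integrable (G1 G2 : R -> E -> E) (u1 u2 : R -> E -> R) :
  bounded_path u1 G1 -> bounded_path u2 G2 ->
  (tleb R N).-integrable (QT Omega T)
  (fun z => (dotp (flux p A z.2 (joint G1 z)) (joint (quot_grad c u1 u2 G1 G2) z))%:E).
Proof.
move=> [mu1 mG1 _ _ _ h1] [mu2 mG2 _ _ _ h2].
have [C cm] := chain_map_quot q c0 (ltW m0) Omega.
apply: (@flux_pairing_integrable R N Omega p A T q P oO cp pq q1 T0 HA HA0 HA1 K G1 G2 _ C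
  K1 (ltW (chain_gt0 cm)) mG1 mG2 _ h1 h2).
- exact: (measurable_chain_grad cm (mQ T) mu1 mu2 mG1 mG2).
- by move=> z; exact: (enorm_chain_grad _ _ _ _ _ cm).
Qed.

(** The Picone inequality holds pointwise, since the paths take their values
    where the cut-off is a translation. *)
Lemma quot_operator_ge0 t : t <= T ->
  0 <= \int[tleb R N]_(z in QT Omega t)
         dotp (flux p A z.2 (joint Dv z)) (joint (quot_grad c v w Dv Dw) z) +
       \int[tleb R N]_(z in QT Omega t)
         dotp (flux p A z.2 (joint Dw z)) (joint (quot_grad c w v Dw Dv) z).
Proof.
move=> tT; have sub := QT_subset (Omega := Omega) tT.
have i1 := integrableS (mQ T) (mQ t) sub (quot_pairing_integrable bv bw).
have i2 := integrableS (mQ T) (mQ t) sub (quot_pairing_integrable bw bv).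
have e := RintegralD (mQ t) i1 i2; rewrite -e.
set g := fun z => _ + _.
have -> : \int[tleb R N]_(z in QT Omega t) g z = \int[tleb R N]_(z in QT Omega t) `|g z|.
  apply: ae_eq_Rintegral.
  refine (aeS2 (path_range bv) (path_range bw) _) => z h1 h2 Qz.
  have Qz' := sub _ Qz; have [_ Oz] := Qz'; have /andP[qpz _] := pq Oz.
  rewrite ger0_norm//.
  exact: (quot_picone q1 _ _ oO cp p1 HA HA0 HA1 c0 (h1 Qz') (h2 Qz') Oz qpz).
by apply: Rintegral_ge0 => z _; exact: normr_ge0.
Qed.

End pair.

Variables (f : E -> R -> R) (F : R).
Hypotheses (Hf0 : condf0 Omega f) (Hf1 : condf1 Omega f q).
Hypothesis fF : forall x s, Omega x -> 0 <= s <= m -> `|f x s| <= F.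

(** The equation of a weak solution, separated from the regularity that
    [bounded_path] records. *)
Definition tested_equation (h v : R -> E -> R) (dvq : R -> E -> R) (Dv : R -> E -> E) : Prop :=
  forall (phi : R -> E -> R) (Dphi : R -> E -> E),
    in_LpQ Omega T 2%:E phi -> in_LrW Omega p T 1%E phi ->
    spatial_gradient Omega T phi Dphi ->
    forall t, 0 < t <= T ->
    \int[tleb R N]_(z in QT Omega t)
      (joint dvq z * joint v z `^ (q - 1) * joint phi z) +
    \int[tleb R N]_(z in QT Omega t)
      dotp (flux p A z.2 (joint Dv z)) (joint Dphi z) =
    \int[tleb R N]_(z in QT Omega t)
      ((joint h z * joint v z `^ (q - 1) + f z.2 (joint v z)) * joint phi z).

Let source v z : R := f z.2 (Num.max 0 (joint v z)).

Let source_meas v Dv t : t <= T -> bounded_path v Dv ->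
  measurable_fun (QT Omega t) (source v).
Proof.
move=> tT [mv _ _ _ _ _]; have [_ cf _ _] := Hf0.
apply: (measurable_source oO cf).
exact: measurable_funS (mQ T) (QT_subset tT) mv.
Qed.

Let source_range v Dv t : t <= T -> bounded_path v Dv ->
  {ae tleb R N, forall z, QT Omega t z -> 0 <= source v z <= F}.
Proof.
move=> tT [_ _ rv _ _ _]; have [f0 _ _ _] := Hf0.
refine (aeS rv _) => z h Qz; have [_ Oz] := Qz.
have /andP[v0 vm] := h (QT_subset tT Qz).
rewrite /source max_r ?(ltW v0)//; apply/andP; split.
  by apply: f0; [exact: subset_closure|exact: ltW].
by apply: (le_trans (ler_norm _)); apply: fF => //; rewrite !ltW.
Qed.

Let equation_split h v dvq w Dv Dw c t : 0 < c -> 0 < t <= T ->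
  bounded_path v Dv -> bounded_path w Dw ->
  (tleb R N).-integrable (QT Omega t)
    (fun z => (joint h z * (joint v z `^ (q - 1) * quot q c m (joint v z) (joint w z)))%:E) ->
  tested_equation h v dvq Dv ->
  \int[tleb R N]_(z in QT Omega t)
    (joint dvq z * (joint v z `^ (q - 1) * quot q c m (joint v z) (joint w z))) +
  \int[tleb R N]_(z in QT Omega t)
    dotp (flux p A z.2 (joint Dv z)) (joint (quot_grad c v w Dv Dw) z) =
  \int[tleb R N]_(z in QT Omega t)
    (joint h z * (joint v z `^ (q - 1) * quot q c m (joint v z) (joint w z))) +
  \int[tleb R N]_(z in QT Omega t) (source v z * quot q c m (joint v z) (joint w z)).
Proof.
move=> c0 tT bv bw ih eqv; have /andP[t0 tT'] := tT.
have [a1 a2 a3] := quot_admissible c0 bv bw.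
have E0 := eqv _ _ a1 a2 a3 t tT.
have -> : \int[tleb R N]_(z in QT Omega t)
    (joint dvq z * (joint v z `^ (q - 1) * quot q c m (joint v z) (joint w z))) =
  \int[tleb R N]_(z in QT Omega t)
    (joint dvq z * joint v z `^ (q - 1) * joint (quot_path c v w) z).
  by apply: eq_Rintegral => z _; rewrite mulrA.
rewrite [LHS]E0.
have [B [B0 lF bF]] := bounded_lipschitz_quot q c0 (ltW m0).
have mquot : measurable_fun (QT Omega t) (fun z => quot q c m (joint v z) (joint w z)).
  apply: (lipschitz2_measurable lF (mQ t)).
    exact: measurable_funS (mQ T) (QT_subset tT') (path_meas bv).
  exact: measurable_funS (mQ T) (QT_subset tT') (path_meas bw).
have ftt : (tleb R N (QT Omega t) < +oo)%E by exact: QT_lty.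
have is_ : (tleb R N).-integrable (QT Omega t) (EFin \o source v).
  apply: (ae_bounded_integrable (C := `|F|) (mQ t) ftt (source_meas tT' bv)) => //.
  refine (aeS (source_range tT' bv) _) => z h' Qz; have /andP[g0 gF] := h' Qz.
  by rewrite ger0_norm// (le_trans gF (ler_norm _)).
have isq := integrable_mul_bounded (mQ t) is_ mquot (fun z _ => bF _ _).
have e := RintegralD (mQ t) ih isq.
rewrite -[RHS]e; apply: ae_eq_Rintegral.
refine (aeS (path_range bv) _) => z h' Qz; have /andP[v0 _] := h' (QT_subset tT' Qz).
by rewrite /source max_r ?(ltW v0)// mulrDl mulrA.
Qed.

Lemma energy_comparison h ht v w dvq dwq Dv Dw t : 0 < t <= T ->
  bounded_path v Dv -> bounded_path w Dw ->
  tested_equation h v dvq Dv -> tested_equation ht w dwq Dw ->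
  (tleb R N).-integrable (QT Omega T) (EFin \o joint dvq) ->
  (tleb R N).-integrable (QT Omega T) (EFin \o joint dwq) ->
  (tleb R N).-integrable (QT Omega T) (EFin \o joint h) ->
  (tleb R N).-integrable (QT Omega T) (EFin \o joint ht) ->
  \int[tleb R N]_(z in QT Omega t)
    ((joint dvq z - joint dwq z) * (joint v z `^ q - joint w z `^ q)) <=
  \int[tleb R N]_(z in QT Omega t)
    ((joint h z - joint ht z) * (joint v z `^ q - joint w z `^ q)).
Proof.
move=> tT bv bw eqv eqw idv idw ih iht; have /andP[t0 tT'] := tT.
have sub := QT_subset (Omega := Omega) tT'.
have rs g : (tleb R N).-integrable (QT Omega T) (EFin \o g) ->
    (tleb R N).-integrable (QT Omega t) (EFin \o g).
  exact: integrableS (mQ T) (mQ t) sub.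
have mv : measurable_fun (QT Omega t) (joint v).
  exact: measurable_funS (mQ T) sub (path_meas bv).
have mw : measurable_fun (QT Omega t) (joint w).
  exact: measurable_funS (mQ T) sub (path_meas bw).
have rv : {ae tleb R N, forall z, QT Omega t z -> 0 < joint v z < m}.
  by refine (aeS (path_range bv) _) => z hz /sub; exact: hz.
have rw : {ae tleb R N, forall z, QT Omega t z -> 0 < joint w z < m}.
  by refine (aeS (path_range bw) _) => z hz /sub; exact: hz.
have ftt : (tleb R N (QT Omega t) < +oo)%E by exact: QT_lty.
have cn0 n : 0 < (n.+1%:R : R)^-1 by rewrite invr_gt0 ltr0n.
apply: (comparison_limit (mQ t) ftt q1 m0 mv mw rv rw (rs _ idv) (rs _ idw) (rs _ ih)
  (rs _ iht) (source_meas tT' bv) (source_meas tT' bw) (source_range tT' bv)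
  (source_range tT' bw)
  (a := fun n => \int[tleb R N]_(z in QT Omega t) dotp (flux p A z.2 (joint Dv z))
      (joint (quot_grad (n.+1%:R)^-1 v w Dv Dw) z))
  (b := fun n => \int[tleb R N]_(z in QT Omega t) dotp (flux p A z.2 (joint Dw z))
      (joint (quot_grad (n.+1%:R)^-1 w v Dw Dv) z))).
- refine (aeS2 rv rw _) => z h1 h2 Qz; have [_ Oz] := Qz.
  have /andP[v0 _] := h1 Qz; have /andP[w0 _] := h2 Qz.
  rewrite /source !max_r ?(ltW v0) ?(ltW w0)//.
  by split=> le; exact: Hf1.
- move=> n; apply: (equation_split (cn0 n) tT bv bw _ eqv).
  exact: (quot_weighted_integrable (mQ t) q1 m0 mv mw rv rw n (rs _ ih)).
- move=> n; apply: (equation_split (cn0 n) tT bw bv _ eqw).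
  exact: (quot_weighted_integrable (mQ t) q1 m0 mw mv rw rv n (rs _ iht)).
- by move=> n; exact: quot_operator_ge0.
Qed.

End tested.

(** * Weak solutions as bounded paths *)

Lemma le_add1_sqr (R : realType) (y : R) : y <= 1 + y ^+ 2.
Proof. by have := sqr_ge0 (2 * y - 1); nra. Qed.

Section solutions.
Variables (R : realType) (N : nat).
Local Notation E := 'rV[R]_N.
Local Notation M := (measurableTypeR R).
Local Notation lambda := (@lebesgue_measure R).
Variables (Omega : set E) (p : E -> R) (T q P : R).
Hypotheses (oO : open Omega) (fO : (leb R N Omega < +oo)%E).
Hypotheses (cp : {in Omega, continuous p}) (pq : forall x, Omega x -> q < p x <= P).
Hypotheses (q1 : 1 < q) (T0 : 0 < T).

Let mO : measurable Omega. Proof. exact: open_measurable_rV. Qed.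
Let mQ t : measurable (QT Omega t). Proof. exact: measurable_QT. Qed.
Let mI t : measurable (`]0, t[%classic : set M). Proof. exact: measurable_itv. Qed.

Let p1P x : Omega x -> 1 <= p x <= P.
Proof.
by move=> /pq/andP[h ->]; rewrite andbT; exact: (le_trans (ltW q1) (ltW h)).
Qed.

(** By uniqueness of weak gradients, the bound on the Sobolev norm is a bound on
    the given gradient. *)
Lemma bounded_path_ex v Dv : {ae tleb R N, forall z, QT Omega T z -> 0 < joint v z} ->
  in_LrW Omega p T +oo%E v -> in_LpQ Omega T +oo%E v -> spatial_gradient Omega T v Dv ->
  exists m K, [/\ 0 < m, 1 <= K & forall m' K', m <= m' -> K <= K' ->
    bounded_path Omega p T m' K' v Dv].
Proof.
move=> v0 Lv [mv /Lnorm_oo_bound[B B0 hB]] [mDv wDv].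
have [K K0 hK] := in_LrW_oo_bound Lv.
exists (B + 1), (K + 1); split; first by rewrite ltr_wpDl.
  by rewrite lerDr ltW.
move=> m' K' mm KK; split => //.
- refine (aeS2 v0 hB _) => z h1 h2 Qz; rewrite h1//=.
  have := h2 Qz; rewrite /= lee_fin => h.
  apply: (lt_le_trans _ mm); apply: (le_lt_trans (le_trans (ler_norm _) h)).
  by rewrite ltrDl.
- refine (aeS2 wDv hK _) => t h1 h2 tT; have [W _] := h2 tT.
  by apply/(W0_withP oO p1P (h1 tT)).
- refine (aeS2 wDv hK _) => t h1 h2 tT; have [_ /sobolev_norm_lt h] := h2 tT.
  have [g [_ wg _ mg]] := h _ p1P.
  have KK' : K <= K' by apply: (le_trans _ KK); rewrite lerDl.
  apply: (modular_mono p1P K0 KK').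
  apply: (le_trans _ mg); apply: (modular_le p1P K0 K0).
  apply: filterS (weak_gradient_unique oO (h1 tT) wg) => x hx Ox.
  by rewrite hx.
Qed.

Lemma ae_itv_ex (Q : R -> Prop) : {ae lambda, forall t : R, 0 < t < T -> Q t} ->
  exists2 t, 0 < t < T & Q t.
Proof.
move=> [B [mB B0 hB]]; apply: contrapT => h.
have sub : (`]0, T[%classic : set M) `<=` B.
  move=> t /=; rewrite in_itv/= => tT; apply: hB => /= hQ.
  by apply: h; exists t => //; exact: hQ.
have := le_measure lambda (mem_set (mI T)) (mem_set mB) sub.
by rewrite [leRHS]B0 [leLHS]lebesgue_measure_itv/= lte_fin T0 sube0 lee_fin leNgt T0.
Qed.

(** The two representatives differ from the same primitive by their values at
    time [0], and they coincide at some time. *)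
Lemma L2_representative_unique u Z U V :
  (tleb R N).-integrable (QT Omega T) (EFin \o joint u) ->
  (tleb R N).-integrable (QT Omega T) (EFin \o joint Z) -> weak_dt Omega T u Z ->
  C_L2_representative Omega T u U -> C_L2_representative Omega T u V ->
  {ae leb R N, forall x, Omega x -> U 0 x = V 0 x}.
Proof.
move=> iu iZ uZ hU hV.
have [_ _ aU] := hU; have [_ _ aV] := hV.
have [t tT [eU eV]] : exists2 t, 0 < t < T &
    {ae leb R N, forall x, Omega x -> U t x = u t x} /\
    {ae leb R N, forall x, Omega x -> V t x = u t x}.
  by apply: ae_itv_ex; refine (aeS2 aU aV _) => t h1 h2 tT; split; [exact: h1|exact: h2].
have tT' : 0 <= t <= T by have /andP[h1 h2] := tT; rewrite !ltW.
have hU0 := weak_dt_primitive oO fO iu iZ uZ hU tT'.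
have hV0 := weak_dt_primitive oO fO iu iZ uZ hV tT'.
apply: filterS2 (aeS2 eU eV (fun x h1 h2 => conj h1 h2))
  (aeS2 hU0 hV0 (fun x h1 h2 => conj h1 h2)) => x [h1 h2] [h3 h4] Ox.
by move: (h3 Ox) (h4 Ox); rewrite h1// h2// => -> /addIr.
Qed.

Lemma in_L2Q_integrable g : in_LpQ Omega T 2%:E g ->
  (tleb R N).-integrable (QT Omega T) (EFin \o joint g).
Proof.
move=> /(in_L2P (tleb R N) (mQ T))[mg ig].
have m1 : measurable_fun (QT Omega T) (fun _ : M * E => 1 : R) by exact: measurable_cst.
have i1 : (tleb R N).-integrable (QT Omega T) (fun _ : M * E => ((1 : R) ^+ 2)%:E).
  apply: (ae_bounded_integrable (C := 1) (g := fun _ : M * E => (1 : R) ^+ 2) (mQ T)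
    (QT_lty oO fO T0)) => //.
  by apply: aeW => z _; rewrite expr1n normr1.
by apply: eq_integrable (integrable_mul_L2 (mQ T) mg m1 ig i1) => // z _; rewrite /= mulr1.
Qed.

Lemma pow_q_integrable m K v Dv : bounded_path Omega p T m K v Dv ->
  (tleb R N).-integrable (QT Omega T) (EFin \o joint (pow_q q v)).
Proof.
move=> [mv _ rv _ _ _].
have mpow : measurable_fun (QT Omega T) (joint (pow_q q v)).
  apply: (@measurableT_comp _ _ _ _ _ _ (fun y : R => y `^ q)) mv; exact: measurable_powR.
apply: (ae_bounded_integrable (C := m `^ q) (mQ T) (QT_lty oO fO T0) mpow).
  exact: powR_ge0.
refine (aeS rv _) => z h Qz; have /andP[v0 vm] := h Qz.
rewrite ger0_norm ?powR_ge0//; apply: ge0_ler_powR; rewrite ?nnegrE ?(ltW v0) ?(ltW vm)//.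
  exact: le_trans (ltW q1).
by rewrite (le_trans (ltW v0) (ltW vm)).
Qed.

(** The norm is at most one plus its square, which is integrable in time by
    Fubini. *)
Lemma spatial_norm_integrable (H : R -> E -> R) t : t <= T -> in_LpQ Omega T 2%:E H ->
  let k := fun s => Num.sqrt (\int[leb R N]_(x in Omega) (H s x ^+ 2)) in
  [/\ lambda.-integrable (`]0, t[%classic : set M) (EFin \o k),
   {ae lambda, forall s : R, 0 < s < T -> measurable_fun Omega (H s) /\
      (leb R N).-integrable Omega (fun x => ((H s x) ^+ 2)%:E)} &
   {ae lambda, forall s : R, 0 < s < T -> L2norm Omega (H s) = (k s)%:E}].
Proof.
move=> tT hH k; have iH := in_L2Q_integrable hH.
have [mH iH2] := (in_L2P (tleb R N) (mQ T) (joint H)).1 hH.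
have [i1 _] := Rfubini (mI T) mO (f := fun z => joint H z ^+ 2) iH2.
have [ae2 _ _] := fubini_rect (mI T) mO iH2.
have [ae1 _ _] := fubini_rect (mI T) mO iH.
have sections : {ae lambda, forall s : R, 0 < s < T -> measurable_fun Omega (H s) /\
      (leb R N).-integrable Omega (fun x => ((H s x) ^+ 2)%:E)}.
  refine (aeS2 ae1 ae2 _) => s h1 h2 sT.
  have Is : (`]0, T[%classic : set M) s by rewrite /= in_itv.
  split; last exact: h2.
  by have /integrableP[/measurable_EFinP] := h1 Is.
have it : lambda.-integrable (`]0, t[%classic : set M)
    (fun s => (\int[leb R N]_(x in Omega) (H s x ^+ 2))%:E).
  apply: integrableS i1 => //.
  by move=> s /=; rewrite !in_itv/= => /andP[-> h]; exact: (lt_le_trans h tT).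
split; [|exact: sections|].
- have /integrableP[/measurable_EFinP mk _] := it.
  have mk' : measurable_fun (`]0, t[%classic : set M) k.
    apply: (@measurableT_comp _ _ _ _ _ _ (@Num.sqrt R)) mk.
    by apply: continuous_measurable_fun; exact: sqrt_continuous.
  have i1' : lambda.-integrable (`]0, t[%classic : set M) (EFin \o (fun=> 1 : R)).
    apply: (ae_bounded_integrable (C := 1)) => //.
    + rewrite [ltLHS]lebesgue_measure_itv/=; case: ifPn => _; exact: ltry.
    + by apply: aeW => s _; rewrite normr1.
  apply: (le_integrable (mI t) _ _ (integrableD (mI t) i1' it)).
    exact/measurable_EFinP.
  move=> s _; rewrite /= lee_fin ger0_norm ?sqrtr_ge0//; apply: (le_trans _ (ler_norm _)).
  have J0 : 0 <= \int[leb R N]_(x in Omega) (H s x ^+ 2).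
    by apply: Rintegral_ge0 => x _; exact: sqr_ge0.
  rewrite -[X in _ <= 1 + X]sqr_sqrtr// -/(k s).
  exact: le_add1_sqr.
- refine (aeS sections _) => s h sT; have [h1 h2] := h sT.
  exact: (Lnorm_2_Rintegral mO h1 h2).
Qed.

End solutions.

(** * The contraction estimate *)

Theorem theorem1p2 (R : realType) (N : nat) (Omega : set 'rV[R]_N)
  (p : 'rV[R]_N -> R) (A : 'rV[R]_N -> 'rV[R]_N -> R)
  (f : 'rV[R]_N -> R -> R) (T q : R)
  (v0 w0 : 'rV[R]_N -> R) (h ht : R -> 'rV[R]_N -> R)
  (v w : R -> 'rV[R]_N -> R)
  (HN : (0 < N)%N)
  (HOmega : smooth_bounded_domain Omega)
  (Hp : variable_exponent Omega p)
  (HT : 0 < T)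
  (Hq : 1 < q < p_minus Omega p)
  (HA : operator_potential Omega A)
  (HA0 : condA0 Omega p A)
  (HA1 : condA1 Omega p A)
  (HA2 : condA2 Omega p A)
  (Hf0 : condf0 Omega f)
  (Hf1 : condf1 Omega f q)
  (Hv0 : in_Lp (leb R N) Omega (2 * q)%:E v0)
  (Hw0 : in_Lp (leb R N) Omega (2 * q)%:E w0)
  (Hv0_ge0 : {ae leb R N, forall x, Omega x -> 0 <= v0 x})
  (Hw0_ge0 : {ae leb R N, forall x, Omega x -> 0 <= w0 x})
  (Hh : in_LpQ Omega T 2%:E h)
  (Hht : in_LpQ Omega T 2%:E ht)
  (Hv : weak_solution Omega T p A f q h v0 v)
  (Hw : weak_solution Omega T p A f q ht w0 w)
  (Vq Wq : R -> 'rV[R]_N -> R)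
  (HVq : C_L2_representative Omega T (pow_q q v) Vq)
  (HWq : C_L2_representative Omega T (pow_q q w) Wq) :
  forall t : R, 0 <= t <= T ->
  (L2norm Omega (Vq t \- Wq t)%R <=
   L2norm Omega (fun x => v0 x `^ q - w0 x `^ q)%R +
   \int[@lebesgue_measure R]_(s in `]0%R, t[)
      L2norm Omega (h s \- ht s)%R)%E.
Proof.
have [oO _ _ bO _] := HOmega.
have /andP[q1 qp] := Hq.
have [cp [P pq]] := exponent_bounds oO bO Hp qp.
have mO : measurable Omega by exact: open_measurable_rV.
have fO := bounded_leb_lty mO bO.
have mQ s : measurable (QT Omega s) by exact: measurable_QT.
have mI s : measurable (`]0, s[%classic : set (measurableTypeR R)) by exact: measurable_itv.
have [pv Lv bv [V [hV V0]] [dvq [Dv [dtv dv2 sv eqv]]]] := Hv.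
have [pw Lw bw [W [hW W0]] [dwq [Dw [dtw dw2 sw eqw]]]] := Hw.
have [m1 [K1 [m10 K11 path_v]]] := bounded_path_ex oO pq q1 pv Lv bv sv.
have [m2 [K2 [m20 K21 path_w]]] := bounded_path_ex oO pq q1 pw Lw bw sw.
pose m := m1 + m2; pose K := K1 + K2.
have m0 : 0 < m by exact: addr_gt0.
have K0 : 1 <= K by rewrite (le_trans K11)// lerDl (le_trans _ K21).
have {path_v}bpv : bounded_path Omega p T m K v Dv.
  by apply: path_v; rewrite lerDl; [exact: ltW|exact: (le_trans ler01)].
have {path_w}bpw : bounded_path Omega p T m K w Dw.
  by apply: path_w; rewrite lerDr; [exact: ltW|exact: (le_trans ler01)].
have idv := in_L2Q_integrable oO fO HT dv2.
have idw := in_L2Q_integrable oO fO HT dw2.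
have ih := in_L2Q_integrable oO fO HT Hh.
have iht := in_L2Q_integrable oO fO HT Hht.
have ivq := pow_q_integrable oO fO q1 HT bpv.
have iwq := pow_q_integrable oO fO q1 HT bpw.
have Vq0 := L2_representative_unique oO fO HT ivq idv dtv HVq hV.
have Wq0 := L2_representative_unique oO fO HT iwq idw dtw HWq hW.
have [_ cf _ _] := Hf0.
have [F F0 fF] := source_bounded cf m bO.
pose D s x := Vq s x - Wq s x.
pose y s := Num.sqrt (\int[leb R N]_(x in Omega) (D s x ^+ 2)).
have D2 s : 0 <= s <= T -> measurable_fun Omega (D s) /\
    (leb R N).-integrable Omega (fun x => ((D s x) ^+ 2)%:E).
  move=> sT; have [hv2 _ _] := HVq; have [hw2 _ _] := HWq.
  have [mv iv] := (in_L2P (leb R N) mO (Vq s)).1 (hv2 _ sT).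
  have [mw iw] := (in_L2P (leb R N) mO (Wq s)).1 (hw2 _ sT).
  by split; [exact: measurable_funB|exact: integrable_sqrB_L2].
have yE s : 0 <= s <= T -> L2norm Omega (Vq s \- Wq s) = (y s)%:E.
  by move=> sT; have [h1 h2] := D2 s sT; exact: (Lnorm_2_Rintegral mO h1 h2).
have T00 : 0 <= (0 : R) <= T by rewrite lexx ltW.
(* the initial data enter only through the continuous representatives *)
have init : L2norm Omega (fun x => v0 x `^ q - w0 x `^ q) = (y 0)%:E.
  rewrite -(yE 0 T00) /L2norm !Lnorm_2E; congr (_ `^ _)%E.
  apply: ae_eq_integral_nomeas.
  apply: filterS2 (aeS2 Vq0 Wq0 (fun x h1 h2 => conj h1 h2))
    (aeS2 V0 W0 (fun x h1 h2 => conj h1 h2)) => x [h1 h2] [h3 h4] Ox.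
  by rewrite /= h1// h2// h3// h4.
pose H s x := h s x - ht s x.
pose k s := Num.sqrt (\int[leb R N]_(x in Omega) (H s x ^+ 2)).
have H2 : in_LpQ Omega T 2%:E H.
  have [mh ih2] := (in_L2P (tleb R N) (mQ T) (joint h)).1 Hh.
  have [mht iht2] := (in_L2P (tleb R N) (mQ T) (joint ht)).1 Hht.
  apply/(in_L2P (tleb R N) (mQ T)); split; first exact: measurable_funB.
  exact: (integrable_sqrB_L2 (mQ T) mh mht ih2 iht2).
move=> t /andP[t0 tT].
have [ik secH kE] := spatial_norm_integrable oO fO HT tT H2.
rewrite init yE ?t0//.
have -> : (\int[@lebesgue_measure R]_(s in `]0%R, t[) L2norm Omega (h s \- ht s)%R =
    (\int[@lebesgue_measure R]_(s in `]0%R, t[) k s)%:E)%E.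
  rewrite /Rintegral fineK; last exact: (integrable_fin_num (mI t) ik).
  apply: ae_eq_integral_nomeas; refine (aeS kE _) => s hs /=; rewrite in_itv/= => /andP[s0 st].
  by apply: hs; rewrite s0 (lt_le_trans st).
rewrite -EFinD lee_fin.
have sub s : s <= T -> QT Omega s `<=` QT Omega T by exact: QT_subset.
pose Z s x := dvq s x - dwq s x.
pose u s x := v s x `^ q - w s x `^ q.
have iZ : (tleb R N).-integrable (QT Omega T) (EFin \o joint Z).
  exact: (integrableB (mQ T) idv idw).
have iu : (tleb R N).-integrable (QT Omega T) (EFin \o joint u).
  exact: (integrableB (mQ T) ivq iwq).
have mu : measurable_fun (QT Omega T) (joint u).
  by have /integrableP[/measurable_EFinP] := iu.
have uB : {ae tleb R N, forall z, QT Omega T z -> `|joint u z| <= m `^ q}.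
  refine (aeS2 (path_range bpv) (path_range bpw) _) => z h1 h2 Qz.
  have mono b : 0 < b < m -> 0 <= b `^ q <= m `^ q.
    move=> /andP[b0 bm]; rewrite powR_ge0/=; apply: ge0_ler_powR;
      rewrite ?nnegrE ?(ltW b0) ?(ltW bm) ?(ltW m0)//; exact: (le_trans ler01 (ltW q1)).
  have /andP[a1 a2] := mono _ (h1 Qz); have /andP[b1 b2] := mono _ (h2 Qz).
  rewrite /joint/= /u ler_norml; move: a1 a2 b1 b2; rewrite /joint/=.
  move: (v _ _ `^ q) (w _ _ `^ q) (m `^ q) => b1 b2 b3; lra.
have DZ s : 0 <= s <= T -> {ae leb R N, forall x, Omega x ->
    D s x = D 0 x + \int[@lebesgue_measure R]_(r in `]0, s[) Z r x}.
  move=> sT; have /andP[s0 sT'] := sT.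
  have h1 := weak_dt_primitive oO fO ivq idv dtv HVq sT.
  have h2 := weak_dt_primitive oO fO iwq idw dtw HWq sT.
  have [h3 _ _] := fubini_rect' (mI s) mO (integrableS (mQ T) (mQ s) (sub _ sT') idv).
  have [h4 _ _] := fubini_rect' (mI s) mO (integrableS (mQ T) (mQ s) (sub _ sT') idw).
  apply: filterS2 (aeS2 h1 h2 (fun x k1 k2 => conj k1 k2))
    (aeS2 h3 h4 (fun x k1 k2 => conj k1 k2)) => x [k1 k2] [k3 k4] Ox.
  have e := RintegralB (mI s) (k3 Ox) (k4 Ox).
  rewrite /D k1// k2// /Z [X in _ = _ + X]e /joint/=; ring.
have Du : {ae @lebesgue_measure R, forall s : R, 0 < s < T ->
    {ae leb R N, forall x, Omega x -> D s x = u s x}}.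
  have [_ _ a1] := HVq; have [_ _ a2] := HWq.
  refine (aeS2 a1 a2 _) => s h1 h2 sT.
  by apply: filterS2 (h1 sT) (h2 sT) => x k1 k2 Ox; rewrite /D k1// k2.
have iHu : (tleb R N).-integrable (QT Omega T) (fun z => (joint H z * joint u z)%:E).
  have iH := in_L2Q_integrable oO fO HT H2.
  exact: (integrable_mul_ae_bounded (mQ T) iH mu (powR_ge0 _ _) uB).
pose J s := \int[tleb R N]_(z in QT Omega s) (joint H z * joint u z).
have y2 s : y s ^+ 2 = \int[leb R N]_(x in Omega) (D s x ^+ 2).
  by rewrite sqr_sqrtr//; apply: Rintegral_ge0 => x _; exact: sqr_ge0.
(* the inequality between the time derivatives, rewritten with norms *)
have energy s : 0 < s <= T -> y s ^+ 2 <= y 0 ^+ 2 + 2 * J s.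
  move=> sT; have sT' : 0 <= s <= T by have /andP[h1 ->] := sT; rewrite ltW.
  have e := energy_identity mO iZ (powR_ge0 _ _) mu uB D2 DZ Du sT'.
  have c := energy_comparison oO fO cp pq q1 HT m0 K0 HA HA0 HA1 Hf0 Hf1 fF sT bpv bpw
    eqv eqw idv idw ih iht.
  have {}c : 2^-1 * (\int[leb R N]_(x in Omega) (D s x ^+ 2) -
      \int[leb R N]_(x in Omega) (D 0 x ^+ 2)) <= J s by rewrite -e; exact: c.
  rewrite !y2 -lerBlDl -ler_pdivrMl//; exact: c.
have Jle s : 0 < s <= T -> (`|J s|%:E <=
    \int[@lebesgue_measure R]_(r in `]0%R, s[) (k r * y r)%:E)%E.
  move=> /andP[s0 sT]; have iHs := integrableS (mQ T) (mQ s) (sub _ sT) iHu.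
  have [jI jE] := Rfubini (mI s) mO iHs.
  have -> : J s = \int[@lebesgue_measure R]_(r in `]0, s[)
      \int[leb R N]_(x in Omega) (H r x * u r x) by exact: jE.
  apply: (@le_trans _ _ (\int[@lebesgue_measure R]_(r in `]0%R, s[)
    `|(\int[leb R N]_(x in Omega) (H r x * u r x))%:E|)%E).
    have f1 := integrable_fin_num (mI s) jI.
    have -> : (`|\int[@lebesgue_measure R]_(r in `]0, s[)
      \int[leb R N]_(x in Omega) (H r x * u r x)|%:E =
      `|\int[@lebesgue_measure R]_(r in `]0%R, s[)
        (\int[leb R N]_(x in Omega) (H r x * u r x))%:E|)%E.
      by rewrite [X in (`|X|%:E)%E]/Rintegral -abse_EFin fineK.
    have /integrableP[mj _] := jI.
    exact: (le_abse_integral _ (mI s) mj).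
  apply: ge0_le_integral_ae.
  - by move=> r _; exact: abse_ge0.
  - by move=> r _; rewrite lee_fin mulr_ge0 ?sqrtr_ge0.
  - refine (aeS2 secH Du _) => r h1 h2 /=; rewrite in_itv/= => /andP[r0 rs].
    have rT : 0 < r < T by rewrite r0 (lt_le_trans rs).
    have rT' : 0 <= r <= T by rewrite !ltW// (lt_le_trans rs).
    have [mH iH] := h1 rT; have [mD iD] := D2 r rT'.
    have -> : \int[leb R N]_(x in Omega) (H r x * u r x) =
        \int[leb R N]_(x in Omega) (H r x * D r x).
      by apply: ae_eq_Rintegral; apply: filterS (h2 rT) => x hx Ox; rewrite hx.
    by rewrite lee_fin; exact: (cauchy_schwarz_L2 mO mH mD iH iD).
(* the a priori bound that starts the Gronwall argument *)
pose B := \int[tleb R N]_(z in QT Omega T) `|joint H z * joint u z|.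
have B0 : 0 <= B by apply: Rintegral_ge0 => z _; exact: normr_ge0.
have JB s : 0 < s <= T -> `|J s| <= B.
  move=> /andP[s0 sT]; have iHs := integrableS (mQ T) (mQ s) (sub _ sT) iHu.
  apply: (le_trans (le_normr_Rintegral (mQ s) iHs)).
  have ia := integrable_abse iHu; have ias := integrable_abse iHs.
  rewrite -lee_fin /B /Rintegral.
  rewrite (fineK (integrable_fin_num (mQ s) ias)) (fineK (integrable_fin_num (mQ T) ia)).
  apply: ge0_subset_integral => //.
  - by have /integrableP[] := ia.
  - by move=> z _; exact: abse_ge0.
  - exact: sub.
apply: (gronwall_sqr (B := Num.sqrt (y 0 ^+ 2 + 2 * B)) t0 (sqrtr_ge0 _) ik).
- by move=> s _; exact: sqrtr_ge0.
- move=> s /andP[s0 st]; rewrite sqrtr_ge0/=.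
  have pos : 0 <= y 0 ^+ 2 + 2 * B by rewrite addr_ge0 ?sqr_ge0// mulr_ge0.
  rewrite -ler_sqr ?nnegrE ?sqrtr_ge0// (sqr_sqrtr pos).
  move: s0; rewrite le_eqVlt => /orP[/eqP<-|s0]; first by rewrite lerDl mulr_ge0.
  have sT : 0 < s <= T by rewrite s0 (le_trans st).
  apply: (le_trans (energy _ sT)); rewrite lerD2l ler_pM2l//.
  by rewrite (le_trans (ler_norm _))// JB.
- move=> s /andP[]; rewrite le_eqVlt => /orP[/eqP<- _|s0 st].
    by rewrite set_itv_ge ?bnd_simp ?ltxx// integral_set0 mule0 adde0.
  have sT : 0 < s <= T by rewrite s0 (le_trans st).
  apply: (@le_trans _ _ ((y 0 ^+ 2)%:E + 2%:E * (`|J s|)%:E)%E).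
    rewrite -EFinM -EFinD lee_fin (le_trans (energy _ sT))// lerD2l ler_pM2l//.
    exact: ler_norm.
  apply: leeD2l; apply: lee_wpmul2l; first by rewrite lee_fin.
  exact: Jle.
Qed.
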